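(* Let $\tau \in i\mathbb{R}_{>0}$ (i.e. $E_\tau$ is a rectangular torus). Then for every integer $n\geq 1$ the equation $$\Delta u+e^{u}=8\pi n\,\delta_{0}\quad\text{on } E_{\tau}$$ has no solutions.
   Context: For $\tau\in\mathbb{H}=\{\tau\mid \operatorname{Im}\tau>0\}$, $\Lambda_\tau=\mathbb{Z}+\mathbb{Z}\tau$ and $E_\tau=\mathbb{C}/\Lambda_\tau$ is the flat torus with the flat metric induced from $\mathbb{C}$; $\Delta=\partial_x^2+\partial_y^2$ with $z=x+iy$; $\delta_0$ is the Dirac measure at $0\in E_\tau$ (the lattice points). A solution is a real-valued function $u$ on $E_\tau$ satisfying the equation in the sense of distributions; it is smooth away from $0$ and satisfies $u(z)=4n\log|z|+O(1)$ near $0$. *)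

(* Defs.v *)
From HB Require Import structures.
From mathcomp Require Import all_boot all_order all_algebra.
From mathcomp Require Import complex.
From mathcomp Require Import all_classical all_reals all_analysis.
Set Implicit Arguments.
Unset Strict Implicit.
Unset Printing Implicit Defensive.
Import Order.TTheory GRing.Theory Num.Theory.
Import numFieldNormedType.Exports.
Export numFieldNormedType.Exports.
Local Open Scope classical_set_scope.
Local Open Scope complex_scope.
Local Open Scope ring_scope.

Section MeanFieldEquation.
Context {R : realType}.

(* Differentiation and integration take place in the plane R * R, which is
   identified with C = R[i] by z = x + i y. *)
Definition to_complex (p : R * R) : R[i] := p.1 +i* p.2.
Definition in_plane (f : R[i] -> R) : R * R -> R := f \o to_complex.

Definition dx (f : R * R -> R) : R * R -> R := 'D_((1, 0) : R * R) f.
Definition dy (f : R * R -> R) : R * R -> R := 'D_((0, 1) : R * R) f.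
Definition laplacian (f : R * R -> R) : R * R -> R := dx (dx f) \+ dy (dy f).

(* For U open, the existence and continuity of all partial derivatives of order
   k + 1 implies the continuity of those of order at most k. *)
Fixpoint Ck_on (k : nat) (U : set (R * R)) (f : R * R -> R) : Prop :=
  if k is k'.+1 then
    [/\ forall p, U p -> derivable f p ((1, 0) : R * R),
        forall p, U p -> derivable f p ((0, 1) : R * R),
        Ck_on k' U (dx f) & Ck_on k' U (dy f)]
  else forall p, U p -> {for p, continuous f}.

Definition smooth_on (U : set (R * R)) (f : R * R -> R) : Prop :=
  forall k, Ck_on k U f.

Context (tau : R[i]).

Definition lattice : set R[i] :=
  [set w | exists m n : int, w = m%:~R + n%:~R * tau].

(* Functions on the torus E_tau = C / lattice are represented by
   lattice-periodic functions on C. *)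
Definition on_torus (f : R[i] -> R) : Prop :=
  forall z w, lattice w -> f (z + w) = f z.

(* Half-open, so that each point of E_tau has exactly one representative. *)
Definition fundamental_domain : set (R * R) :=
  [set p | exists s t : R, [/\ 0 <= s < 1, 0 <= t < 1 &
    to_complex p = s%:C + t%:C * tau]].

(* Lebesgue measure on the plane, that is the area measure dx dy. *)
Definition area := (@lebesgue_measure R \x @lebesgue_measure R)%E.

Definition test_function (phi : R[i] -> R) : Prop :=
  on_torus phi /\ smooth_on setT (in_plane phi).

(* Delta u + e^u = rho delta_0 on E_tau in the sense of distributions; u and
   e^u define distributions as they are integrable over E_tau. *)
Definition distributional_solution (rho : R) (u : R[i] -> R) : Prop :=
  [/\ area.-integrable fundamental_domain (EFin \o in_plane u),
      area.-integrable fundamental_domain (EFin \o (expR \o in_plane u)) &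
      forall phi, test_function phi ->
        \int[area]_(p in fundamental_domain)
            (in_plane u p * laplacian (in_plane phi) p)
        + \int[area]_(p in fundamental_domain)
            (expR (in_plane u p) * in_plane phi p)
        = rho * \int[\d_((0, 0) : R * R)]_(p in fundamental_domain) in_plane phi p].

(* A solution is singular at the lattice points: its values there are arbitrary
   and the last three conditions do not depend on them. The norm of R * R is the
   maximum norm, hence the explicit modulus of p as a complex number. *)
Record solution (n : nat) (u : R[i] -> R) : Prop := Solution {
  solution_on_torus : on_torus u;
  solution_smooth :
    smooth_on [set p | ~ lattice (to_complex p)] (in_plane u);
  solution_at_0 :
    (fun p : R * R => in_plane u p - 4 * n%:R * ln (Normc.normc (to_complex p)))
      =O_ ((0 : R * R)^') (fun _ : R * R => 1 : R);
  solution_equation : distributional_solution (8 * pi * n%:R) u }.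

End MeanFieldEquation.

(* Main.v *)
Require Import Defs.
From HB Require Import structures.
From mathcomp Require Import all_boot all_order all_algebra.
From mathcomp Require Import complex ring lra zify.
From mathcomp Require Import all_classical all_reals all_analysis.
Set Implicit Arguments.
Unset Strict Implicit.
Unset Printing Implicit Defensive.
Import Order.TTheory GRing.Theory Num.Theory.
Import numFieldNormedType.Exports.
Local Open Scope classical_set_scope.
Local Open Scope ring_scope.

(*@@@ 1*)
Section SmoothCalculus.
Context {R : realType}.
Implicit Types (U V : set (R * R)) (f g : R * R -> R) (p v : R * R).

Definition e_x : R * R := (1, 0).
Definition e_y : R * R := (0, 1).

Lemma open_near U p : open U -> U p -> \near p, U p.
Proof. by move=> oU Up; apply: open_nbhs_nbhs. Qed.

Lemma Ck_on_ext k U f g : open U -> (forall p, U p -> f p = g p) ->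
  Ck_on k U f -> Ck_on k U g.
Proof.
move=> oU; elim: k f g => [|k IH] f g fg /=.
  move=> Cf p Up; have near_fg : \near p, f p = g p.
    by apply: filterS (open_near oU Up) => q /fg.
  rewrite /prop_for /continuous_at -(fg p Up).
  apply: cvg_trans (Cf p Up); apply: near_eq_cvg.
  by apply: filterS near_fg => q ->.
have near_fg p : U p -> \near p, f p = g p.
  by move=> Up; apply: filterS (open_near oU Up) => q /fg.
move=> [dfx dfy Cx Cy]; split.
- by move=> p Up; apply: near_eq_derivable (dfx p Up); exact: near_fg.
- by move=> p Up; apply: near_eq_derivable (dfy p Up); exact: near_fg.
- apply: IH Cx => p Up; apply: near_eq_derive; exact: near_fg.
- apply: IH Cy => p Up; apply: near_eq_derive; exact: near_fg.
Qed.

Lemma smooth_on_ext U f g : open U -> (forall p, U p -> f p = g p) ->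
  smooth_on U f -> smooth_on U g.
Proof. by move=> oU fg Sf k; apply: Ck_on_ext fg (Sf k). Qed.

Lemma smooth_on_sub U V f : V `<=` U -> smooth_on U f -> smooth_on V f.
Proof.
move=> VU Sf k; elim: k f {Sf}(Sf k) => [|k IH] f /= => [Cf p /VU|]; first exact: Cf.
by case=> dx_ dy_ Cx Cy; split; [move=> p /VU; exact: dx_|move=> p /VU; exact: dy_|exact: IH|exact: IH].
Qed.

Lemma smooth_onU U V f : smooth_on U f -> smooth_on V f -> smooth_on (U `|` V) f.
Proof.
move=> SU SV k; elim: k f {SU}(SU k) {SV}(SV k) => [|k IH] f /= => [CU CV p [/CU|/CV] //|].
case=> x1 y1 Cx1 Cy1 [x2 y2 Cx2 Cy2].
by split; [move=> p [/x1|/x2]|move=> p [/y1|/y2]|apply: IH|apply: IH].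
Qed.

Lemma smooth_continuous U f p : smooth_on U f -> U p -> {for p, continuous f}.
Proof. by move=> /(_ 0) /=; exact. Qed.

Lemma smooth_derivable_x U f p : smooth_on U f -> U p -> derivable f p e_x.
Proof. by move=> /(_ 1) [+ _ _ _]; exact. Qed.

Lemma smooth_derivable_y U f p : smooth_on U f -> U p -> derivable f p e_y.
Proof. by move=> /(_ 1) [_ + _ _]; exact. Qed.

Lemma smooth_dx U f : smooth_on U f -> smooth_on U (dx f).
Proof. by move=> Sf k; have [] := Sf k.+1. Qed.

Lemma smooth_dy U f : smooth_on U f -> smooth_on U (dy f).
Proof. by move=> Sf k; have [] := Sf k.+1. Qed.

(* sums of members of a family *)
Inductive span (P : set (R * R -> R)) : set (R * R -> R) :=
| span_in f : P f -> span P f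
| span_add f g : span P f -> span P g -> span P (f + g).

Lemma smooth_coind U (P : set (R * R -> R)) : open U ->
  (forall f, P f -> forall p, U p -> {for p, continuous f}) ->
  (forall f v, P f -> v = e_x \/ v = e_y -> exists2 g, span P g &
     forall p, U p -> is_derive p v f (g p)) ->
  forall f, P f -> smooth_on U f.
Proof.
move=> oU PC PD.
have SC f : span P f -> forall p, U p -> {for p, continuous f}.
  elim=> [{}f /PC //|{}f g _ Cf _ Cg p Up].
  by apply: continuousD; [exact: Cf|exact: Cg].
have SD f : span P f -> forall v, v = e_x \/ v = e_y -> exists2 g, span P g &
     forall p, U p -> is_derive p v f (g p).
  elim=> [{}f Pf v /(PD _ _ Pf) //|{}f1 f2 _ IH1 _ IH2 v ev].
  have [g1 S1 D1] := IH1 v ev; have [g2 S2 D2] := IH2 v ev.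
  exists (g1 + g2); first exact: span_add.
  by move=> p Up; have := D1 p Up; have := D2 p Up => ? ?; apply: is_deriveD.
have SS : forall k f, span P f -> Ck_on k U f.
  elim=> [f /SC //|k IH f Sf] /=.
  have [gx Sx Dx] := SD f Sf e_x (or_introl erefl).
  have [gy Sy Dy] := SD f Sf e_y (or_intror erefl).
  split.
  - by move=> p /Dx [].
  - by move=> p /Dy [].
  - apply: (Ck_on_ext oU) (IH _ Sx) => p /Dx [_ <- //].
  - apply: (Ck_on_ext oU) (IH _ Sy) => p /Dy [_ <- //].
by move=> f Pf k; apply: SS; apply: span_in.
Qed.

Lemma smoothI U f gx gy : open U -> (forall p, U p -> {for p, continuous f}) ->
  (forall p, U p -> is_derive p e_x f (gx p)) ->
  (forall p, U p -> is_derive p e_y f (gy p)) ->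
  smooth_on U gx -> smooth_on U gy -> smooth_on U f.
Proof.
move=> oU Cf Dx Dy Sx Sy [//|k] /=; split.
- by move=> p /Dx [].
- by move=> p /Dy [].
- apply: (Ck_on_ext oU) (Sx k) => p /Dx [_ <- //].
- apply: (Ck_on_ext oU) (Sy k) => p /Dy [_ <- //].
Qed.

Definition dv v f : R * R -> R := 'D_v f.

Lemma smooth_dv U v f : v = e_x \/ v = e_y -> smooth_on U f -> smooth_on U (dv v f).
Proof. by case=> ->; [exact: smooth_dx|exact: smooth_dy]. Qed.

Lemma smooth_is_derive U f p v : smooth_on U f -> U p -> v = e_x \/ v = e_y ->
  is_derive p v f (dv v f p).
Proof.
move=> Sf Up ev; apply: DeriveDef => //.
by case: ev => ->; [exact: smooth_derivable_x Sf Up|exact: smooth_derivable_y Sf Up].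
Qed.

Lemma smooth_is_dx U f p : smooth_on U f -> U p -> is_derive p e_x f (dx f p).
Proof. by move=> Sf Up; apply: (smooth_is_derive Sf Up); left. Qed.

Lemma smooth_is_dy U f p : smooth_on U f -> U p -> is_derive p e_y f (dy f p).
Proof. by move=> Sf Up; apply: (smooth_is_derive Sf Up); right. Qed.

Lemma smooth_cst U (c : R) : open U -> smooth_on U (fun=> c).
Proof.
move=> oU; apply: (@smooth_coind U [set f | exists c, f = fun=> c]) => //=; last by exists c.
- by move=> f [d ->] p _; exact: cvg_cst.
- move=> f v [d ->] _; exists (fun=> 0); first by apply: span_in; exists 0.
  by move=> p _; exact: is_derive_cst.
Qed.

Lemma is_derive_line f p v a :
  is_derive p v f a <-> is_derive (0 : R) 1 (fun h : R => f (h *: v + p)) a.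
Proof.
have E : 'D_v f p = 'D_1 (fun h : R => f (h *: v + p)) 0.
  have E0 : (fun h : R => h^-1 *: ((f \o shift p) (h *: v) - f p)) =
     (fun h : R => h^-1 *: (((fun k : R => f (k *: v + p)) \o shift 0) (h *: 1) -
        (fun k : R => f (k *: v + p)) 0)).
    by apply/funext => h; rewrite /= addr0 scale0r add0r [h *: 1]mulr1.
  by rewrite /derive E0.
split=> -[d e].
  exact: (DeriveDef ((derivable1P f p v).1 d) (etrans (esym E) e)).
exact: (DeriveDef ((derivable1P f p v).2 d) (etrans E e)).
Qed.

Lemma smooth_fst U : open U -> smooth_on U (fun p => p.1).
Proof.
move=> oU; apply: (smoothI oU _ _ _ (smooth_cst 1 oU) (smooth_cst 0 oU)).
- by move=> p _; exact: cvg_fst.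
- move=> p _; apply/is_derive_line.
  rewrite (_ : (fun h : R => _) = (fun h : R => h + p.1)).
    have D1 := @is_derive_id R R 0 1; have D2 := @is_derive_cst R R R p.1 0 1.
    by have := is_deriveD D1 D2; rewrite addr0.
  by apply/funext => h /=; rewrite [h *: _]mulr1.
- move=> p _; apply/is_derive_line.
  rewrite (_ : (fun h : R => _) = (fun h : R => p.1)); first exact: is_derive_cst.
  by apply/funext => h /=; rewrite [h *: _]mulr0 add0r.
Qed.

Lemma smooth_snd U : open U -> smooth_on U (fun p => p.2).
Proof.
move=> oU; apply: (smoothI oU _ _ _ (smooth_cst 0 oU) (smooth_cst 1 oU)).
- by move=> p _; exact: cvg_snd.
- move=> p _; apply/is_derive_line.
  rewrite (_ : (fun h : R => _) = (fun h : R => p.2)); first exact: is_derive_cst.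
  by apply/funext => h /=; rewrite [h *: _]mulr0 add0r.
- move=> p _; apply/is_derive_line.
  rewrite (_ : (fun h : R => _) = (fun h : R => h + p.2)).
    have D1 := @is_derive_id R R 0 1; have D2 := @is_derive_cst R R R p.2 0 1.
    by have := is_deriveD D1 D2; rewrite addr0.
  by apply/funext => h /=; rewrite [h *: _]mulr1.
Qed.

Lemma smoothD U f g : open U -> smooth_on U f -> smooth_on U g ->
  smooth_on U (fun p => f p + g p).
Proof.
move=> oU Sf Sg.
apply: (@smooth_coind U [set h | exists f g, [/\ smooth_on U f, smooth_on U g &
   h = (fun p => f p + g p)]]) => //=; last by exists f, g.
- move=> h [{Sf}f [{Sg}g [Sf Sg ->]]] p Up.
  by apply: continuousD; [exact: smooth_continuous Sf Up|exact: smooth_continuous Sg Up].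
- move=> h v [{Sf}f [{Sg}g [Sf Sg ->]]] ev; exists (fun p => dv v f p + dv v g p).
    by apply: span_in; exists (dv v f), (dv v g); split=> //; exact: smooth_dv.
  move=> p Up; have ? := smooth_is_derive Sf Up ev; have ? := smooth_is_derive Sg Up ev.
  exact: is_deriveD.
Qed.

Lemma smoothM U f g : open U -> smooth_on U f -> smooth_on U g ->
  smooth_on U (fun p => f p * g p).
Proof.
move=> oU Sf Sg.
pose P := [set h | exists f g, [/\ smooth_on U f, smooth_on U g &
   h = (fun p => f p * g p)]].
apply: (@smooth_coind U P) => //=; last by exists f, g.
- move=> h [{Sf}f [{Sg}g [Sf Sg ->]]] p Up.
  by apply: continuousM; [exact: smooth_continuous Sf Up|exact: smooth_continuous Sg Up].
- move=> h v [{Sf}f [{Sg}g [Sf Sg ->]]] ev.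
  exists ((fun p => f p * dv v g p) + (fun p => g p * dv v f p)).
    by apply: span_add; apply: span_in; [exists f, (dv v g)|exists g, (dv v f)];
       split=> //; exact: smooth_dv.
  move=> p Up; have ? := smooth_is_derive Sf Up ev; have ? := smooth_is_derive Sg Up ev.
  exact: is_deriveM.
Qed.

(* chain rule along a direction *)
Lemma is_derive_comp1 (phi : R -> R) f p v a b :
  is_derive (f p) 1 phi a -> is_derive p v f b ->
  is_derive p v (phi \o f) (a * b).
Proof.
move=> Dphi Df.
have D1 : is_derive (0 : R) 1 (fun h : R => f (h *: v + p)) b by move/is_derive_line : Df.
have D2 : is_derive (f ((0 : R) *: v + p)) 1 phi a by rewrite scale0r add0r.
exact: ((is_derive_line (phi \o f) p v (a * b)).2 (is_derive1_comp D2 D1)).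
Qed.

Lemma continuous_comp1 (phi : R -> R) f p :
  {for f p, continuous phi} -> {for p, continuous f} -> {for p, continuous (phi \o f)}.
Proof. by move=> Cp Cf; apply: continuous_comp. Qed.

Lemma is_derive_continuous (phi : R -> R) (x a : R) : is_derive x 1 phi a -> {for x, continuous phi}.
Proof. by case=> d _; apply: differentiable_continuous; apply/derivable1_diffP. Qed.

(* composition with an element of a family of one-variable functions closed
   under derivation *)
Lemma smooth_comp (I : Type) (H : I -> R -> R) (dH : I -> seq (R * I)) (A : set R) U f i :
  open U -> smooth_on U f -> (forall p, U p -> A (f p)) ->
  (forall j x, A x -> is_derive x 1 (H j) (\sum_(c <- dH j) c.1 * H c.2 x)) ->
  smooth_on U (H i \o f).
Proof.
move=> oU Sf Af DH.
pose P := [set h | exists g j, smooth_on U g /\ h = (fun p => g p * H j (f p))].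
have P0 : P (fun=> 0).
  exists (fun=> 0), i; split; first exact: smooth_cst.
  by apply/funext => p; rewrite mul0r.
apply: (@smooth_on_ext _ (fun p => 1 * H i (f p))) => //.
  by move=> p _ /=; rewrite mul1r.
apply: (@smooth_coind U P) => //=; last by exists (fun=> 1), i; split => //; exact: smooth_cst.
- move=> h [g [j [Sg ->]]] p Up.
  apply: continuousM; first exact: smooth_continuous Sg Up.
  apply: (@continuous_comp1 (H j)); last exact: smooth_continuous Sf Up.
  exact: is_derive_continuous (DH j (f p) (Af p Up)).
- move=> h v [g [j [Sg ->]]] ev.
  exists ((fun p => dv v g p * H j (f p)) +
     \sum_(c <- dH j) (fun p => (g p * dv v f p * c.1) * H c.2 (f p))).
    apply: span_add.
      by apply: span_in; exists (dv v g), j; split => //; exact: smooth_dv.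
    elim: (dH j) => [|c s IH]; first by rewrite big_nil; apply: span_in.
    rewrite big_cons; apply: span_add => //; apply: span_in.
    exists (fun p => g p * dv v f p * c.1), c.2; split => //.
    apply: smoothM => //; last exact: smooth_cst.
    by apply: smoothM => //; exact: smooth_dv.
  move=> p Up; have Dg := smooth_is_derive Sg Up ev; have Df := smooth_is_derive Sf Up ev.
  have Dc := is_derive_comp1 (DH j (f p) (Af p Up)) Df.
  have := @is_deriveM _ _ _ _ _ _ _ _ Dg Dc.
  set a := (X in is_derive _ _ _ X) => D; set b := (X in is_derive _ _ _ X).
  suff -> : b = a by [].
  rewrite /a /b /= !/(_ + _) /= addrC; congr (_ + _); last exact: mulrC.
  rewrite fct_sumE -[_ *: _]/(_ * _) mulr_suml mulr_sumr; apply: eq_bigr => c _.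
  by rewrite !mulrA; ring.
Qed.

Lemma smooth_expR U f : open U -> smooth_on U f -> smooth_on U (fun p => expR (f p)).
Proof.
move=> oU Sf; apply: (@smooth_comp unit (fun=> expR) (fun=> [:: (1, tt)]) setT _ _ tt) => //.
by move=> _ x _; rewrite big_seq1 mul1r; exact: is_derive_expR.
Qed.

Lemma smooth_cos U f : open U -> smooth_on U f -> smooth_on U (fun p => cos (f p)).
Proof.
move=> oU Sf; apply: (@smooth_comp bool (fun b => if b then cos else sin)
  (fun b => if b then [:: (-1, false)] else [:: (1, true)]) setT _ _ true) => //.
case=> x _; rewrite big_seq1 /= ?mulN1r ?mul1r; first exact: is_derive_cos.
exact: is_derive_sin.
Qed.

Lemma smooth_inv U f : open U -> smooth_on U f -> (forall p, U p -> f p != 0) ->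
  smooth_on U (fun p => (f p)^-1).
Proof.
move=> oU Sf f0; have := (@smooth_comp nat (fun k x => x^-1 ^+ k)
  (fun k => [:: (- k%:R, k.+1)]) [set x | x != 0] U f 1 oU Sf f0).
move=> H; apply: (smooth_on_ext oU _ (H _)) => [p _|k x /= x0]; first by rewrite /= expr1.
rewrite big_seq1 /=.
have Dx : is_derive (x : R) 1 (fun y => y^-1) (- x ^- 2 *: 1) by apply: is_deriveV.
have := @is_deriveX _ _ (fun y : R => y^-1) k x 1 _ Dx.
set a := (X in is_derive _ _ _ X) => D; set b := (X in is_derive _ _ _ X).
suff -> : b = a by rewrite (_ : (fun _ => _) = (fun y : R => y^-1) ^+ k)//; apply/funext=> y; rewrite exprfctE.
rewrite /a /b -[_ *: 1]/(_ * 1) mulr1 -[_ *: _]/(_ * _).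
case: k {D a b} => [|k]; first by rewrite !mul0r oppr0 mul0r.
rewrite /= -exprVn mulrN mulNr; congr (- _).
by rewrite -mulr_natl -!mulrA -exprD addn2.
Qed.

Lemma smooth_ln U f : open U -> smooth_on U f -> (forall p, U p -> 0 < f p) ->
  smooth_on U (fun p => ln (f p)).
Proof.
move=> oU Sf f0.
have Si : smooth_on U (fun p => (f p)^-1).
  by apply: smooth_inv => // p /f0; rewrite lt0r => /andP[].
apply: (@smoothI _ _ (fun p => (f p)^-1 * dx f p) (fun p => (f p)^-1 * dy f p) oU).
- move=> p Up; have Dl := is_derive1_ln (f0 _ Up).
  exact: (@continuous_comp1 (@ln R) f p (is_derive_continuous Dl) (smooth_continuous Sf Up)).
- move=> p Up; exact: (is_derive_comp1 (is_derive1_ln (f0 _ Up)) (smooth_is_dx Sf Up)).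
- move=> p Up; exact: (is_derive_comp1 (is_derive1_ln (f0 _ Up)) (smooth_is_dy Sf Up)).
- by apply: smoothM => //; exact: smooth_dx.
- by apply: smoothM => //; exact: smooth_dy.
Qed.

Lemma smoothN U f : open U -> smooth_on U f -> smooth_on U (fun p => - f p).
Proof.
move=> oU Sf; apply: (@smooth_on_ext _ (fun p => (-1) * f p)) => //.
  by move=> p _; rewrite mulN1r.
by apply: smoothM => //; exact: smooth_cst.
Qed.

Lemma smoothB U f g : open U -> smooth_on U f -> smooth_on U g ->
  smooth_on U (fun p => f p - g p).
Proof. by move=> oU Sf Sg; apply: smoothD => //; exact: smoothN. Qed.

Lemma smoothZ U (c : R) f : open U -> smooth_on U f -> smooth_on U (fun p => c * f p).
Proof. by move=> oU Sf; apply: smoothM => //; exact: smooth_cst. Qed.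

Lemma smoothX U n f : open U -> smooth_on U f -> smooth_on U (fun p => f p ^+ n).
Proof.
move=> oU Sf; elim: n => [|n IH]; first exact: smooth_cst.
apply: (@smooth_on_ext _ (fun p => f p * f p ^+ n)) => //; first by move=> p _; rewrite exprS.
exact: smoothM.
Qed.

End SmoothCalculus.

(*@@@ 2*)
Section Deriv.
Context {R : realType}.
Implicit Types (U V : set (R * R)) (f g : R * R -> R) (p v : R * R).

Lemma dx_val f p a : is_derive p e_x f a -> dx f p = a.
Proof. by case. Qed.
Lemma dy_val f p a : is_derive p e_y f a -> dy f p = a.
Proof. by case. Qed.

Lemma dx_near U f g p : open U -> U p -> (forall q, U q -> f q = g q) -> dx f p = dx g p.
Proof.
move=> oU Up fg; have near_fg : \near p, f p = g p by apply: filterS (open_near oU Up) => q /fg.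
exact: near_eq_derive.
Qed.
Lemma dy_near U f g p : open U -> U p -> (forall q, U q -> f q = g q) -> dy f p = dy g p.
Proof.
move=> oU Up fg; have near_fg : \near p, f p = g p by apply: filterS (open_near oU Up) => q /fg.
exact: near_eq_derive.
Qed.

Section rules.
Variables (U : set (R * R)) (f g : R * R -> R) (p : R * R).
Hypotheses (Sf : smooth_on U f) (Sg : smooth_on U g) (Up : U p).

Lemma dxD : dx (fun q => f q + g q) p = dx f p + dx g p.
Proof. exact: dx_val (is_deriveD (smooth_is_dx Sf Up) (smooth_is_dx Sg Up)). Qed.
Lemma dyD : dy (fun q => f q + g q) p = dy f p + dy g p.
Proof. exact: dy_val (is_deriveD (smooth_is_dy Sf Up) (smooth_is_dy Sg Up)). Qed.
Lemma dxM : dx (fun q => f q * g q) p = dx f p * g p + f p * dx g p.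
Proof.
have := is_deriveM (smooth_is_dx Sf Up) (smooth_is_dx Sg Up).
by move/dx_val => ->; rewrite addrC -[_ *: _]/(_ * _) mulrC.
Qed.
Lemma dyM : dy (fun q => f q * g q) p = dy f p * g p + f p * dy g p.
Proof.
have := is_deriveM (smooth_is_dy Sf Up) (smooth_is_dy Sg Up).
by move/dy_val => ->; rewrite addrC -[_ *: _]/(_ * _) mulrC.
Qed.
Lemma dxN : dx (fun q => - f q) p = - dx f p.
Proof. exact: dx_val (is_deriveN (smooth_is_dx Sf Up)). Qed.
Lemma dyN : dy (fun q => - f q) p = - dy f p.
Proof. exact: dy_val (is_deriveN (smooth_is_dy Sf Up)). Qed.
Lemma dxB : dx (fun q => f q - g q) p = dx f p - dx g p.
Proof. exact: dx_val (is_deriveB (smooth_is_dx Sf Up) (smooth_is_dx Sg Up)). Qed.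
Lemma dyB : dy (fun q => f q - g q) p = dy f p - dy g p.
Proof. exact: dy_val (is_deriveB (smooth_is_dy Sf Up) (smooth_is_dy Sg Up)). Qed.
Lemma dxZ c : dx (fun q => c * f q) p = c * dx f p.
Proof. exact: dx_val (is_deriveZ c (smooth_is_dx Sf Up)). Qed.
Lemma dyZ c : dy (fun q => c * f q) p = c * dy f p.
Proof. exact: dy_val (is_deriveZ c (smooth_is_dy Sf Up)). Qed.

Lemma dx_comp (phi : R -> R) a : is_derive (f p) 1 phi a ->
  dx (fun q => phi (f q)) p = a * dx f p.
Proof. by move=> D; exact: dx_val (is_derive_comp1 D (smooth_is_dx Sf Up)). Qed.
Lemma dy_comp (phi : R -> R) a : is_derive (f p) 1 phi a ->
  dy (fun q => phi (f q)) p = a * dy f p.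
Proof. by move=> D; exact: dy_val (is_derive_comp1 D (smooth_is_dy Sf Up)). Qed.

Lemma dxV : f p != 0 -> dx (fun q => (f q)^-1) p = - dx f p / f p ^+ 2.
Proof.
move=> f0; have D : is_derive (f p : R) 1 (fun y : R => y^-1) (- (f p) ^- 2 *: 1).
  by apply: is_deriveV.
by rewrite (dx_comp D) -[_ *: _]/(_ * _) mulr1 mulrC mulrN mulNr.
Qed.
Lemma dyV : f p != 0 -> dy (fun q => (f q)^-1) p = - dy f p / f p ^+ 2.
Proof.
move=> f0; have D : is_derive (f p : R) 1 (fun y : R => y^-1) (- (f p) ^- 2 *: 1).
  by apply: is_deriveV.
by rewrite (dy_comp D) -[_ *: _]/(_ * _) mulr1 mulrC mulrN mulNr.
Qed.

Lemma is_derive_slice_x : is_derive p.1 1 (fun t : R => f (t, p.2)) (dx f p).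
Proof.
have /is_derive_line D := smooth_is_dx Sf Up.
have D2 : is_derive p.1 1 (fun t : R => t - p.1) 1.
  by have := is_deriveB (@is_derive_id R R p.1 1) (@is_derive_cst R R R p.1 p.1 1); rewrite subr0.
have D1 : is_derive (p.1 - p.1) 1 (fun h : R => f (h *: e_x + p)) (dx f p) by rewrite subrr.
have := @is_derive1_comp R (fun h => f (h *: e_x + p)) (fun t => t - p.1) p.1 _ _ D1 D2.
rewrite mulr1; congr (is_derive _ _ _ _).
apply/funext => t /=; congr f; apply: injective_projections => /=.
  by rewrite [_ *: 1]mulr1 subrK.
by rewrite [_ *: 0]mulr0 add0r.
Qed.

Lemma is_derive_slice_y : is_derive p.2 1 (fun t : R => f (p.1, t)) (dy f p).
Proof.
have /is_derive_line D := smooth_is_dy Sf Up.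
have D2 : is_derive p.2 1 (fun t : R => t - p.2) 1.
  by have := is_deriveB (@is_derive_id R R p.2 1) (@is_derive_cst R R R p.2 p.2 1); rewrite subr0.
have D1 : is_derive (p.2 - p.2) 1 (fun h : R => f (h *: e_y + p)) (dy f p) by rewrite subrr.
have := @is_derive1_comp R (fun h => f (h *: e_y + p)) (fun t => t - p.2) p.2 _ _ D1 D2.
rewrite mulr1; congr (is_derive _ _ _ _).
apply/funext => t /=; congr f; apply: injective_projections => /=.
  by rewrite [_ *: 0]mulr0 add0r.
by rewrite [_ *: 1]mulr1 subrK.
Qed.
End rules.

Lemma dx_cst c p : dx (fun=> c) p = 0.
Proof. exact: dx_val (@is_derive_cst _ _ _ _ _ _). Qed.
Lemma dy_cst c p : dy (fun=> c) p = 0.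
Proof. exact: dy_val (@is_derive_cst _ _ _ _ _ _). Qed.

Lemma near_box p (P : set (R * R)) : (\near p, P p) ->
  exists2 e : R, 0 < e & forall x y, `|x - p.1| <= e -> `|y - p.2| <= e -> P (x, y).
Proof.
move=> /nbhs_ballP [e /= e0 eP]; exists (e / 2); first by rewrite divr_gt0.
move=> x y hx hy; apply: eP; split => /=; rewrite /ball /= distrC.
  by apply: le_lt_trans hx _; rewrite ltr_pdivrMr // ltr_pMr // ltr1n.
by apply: le_lt_trans hy _; rewrite ltr_pdivrMr // ltr_pMr // ltr1n.
Qed.

Lemma continuous_box f p (e : R) : {for p, continuous f} -> 0 < e ->
  exists2 h : R, 0 < h & forall x y, `|x - p.1| <= h -> `|y - p.2| <= h ->
    `|f p - f (x, y)| <= e.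
Proof.
move=> Cf e0; have /cvgrPdist_le /(_ _ e0) N := Cf.
by have [h h0 H] := near_box N; exists h => // x y hx hy; exact: H.
Qed.

Lemma MVT_closed (F G : R -> R) (x y : R) : x < y ->
  (forall s : R, x <= s <= y -> is_derive s 1 F (G s)) ->
  exists2 s, x <= s <= y & F y - F x = G s * (y - x).
Proof.
move=> xy D.
have M : exists2 s, s \in `]x, y[ & F y - F x = G s * (y - x).
  apply: MVT => //.
    by move=> s; rewrite in_itv /= => /andP[? ?]; apply: D; rewrite !ltW.
  by apply: derivable_within_continuous => s; rewrite in_itv /= => /D [].
by case: M => s; rewrite in_itv /= => /andP[? ?] E; exists s => //; rewrite !ltW.
Qed.

Lemma smooth_swap U f (W := [set p : R * R | U (p.2, p.1)]) :
  smooth_on U f -> smooth_on W (fun p => f (p.2, p.1)).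
Proof.
move=> Sf k; elim: k f {Sf}(Sf k) => [|k IH] f /= Cf.
  move=> p Wp; have := Cf _ Wp => Cfp.
  exact: (continuous_comp (@swap_continuous R R p) Cfp).
have Ex p v (w := (v.2, v.1)) : 'D_v (fun p => f (p.2, p.1)) p = 'D_w f (p.2, p.1).
  by [].
have Dv p v (w := (v.2, v.1)) : derivable f (p.2, p.1) w -> derivable (fun p => f (p.2, p.1)) p v.
  by [].
case: Cf => Dx Dy Cx Cy; split.
- by move=> p Wp; apply: Dv; exact: Dy.
- by move=> p Wp; apply: Dv; exact: Dx.
- by rewrite (_ : dx _ = (fun p => dy f (p.2, p.1))); [exact: IH|apply/funext => p; exact: Ex].
- by rewrite (_ : dy _ = (fun p => dx f (p.2, p.1))); [exact: IH|apply/funext => p; exact: Ex].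
Qed.

Opaque dx dy.

(* the second difference of f is h^2 times a mixed derivative *)
Lemma second_difference f (x y h : R) U : 0 < h -> smooth_on U f ->
  (forall s t, x <= s <= x + h -> y <= t <= y + h -> U (s, t)) ->
  exists s t, [/\ x <= s <= x + h, y <= t <= y + h &
   f (x + h, y + h) - f (x + h, y) - (f (x, y + h) - f (x, y)) = h * (h * dy (dx f) (s, t))].
Proof.
move=> h0 Sf HU.
have hx : x < x + h by rewrite ltrDl.
have hy : y < y + h by rewrite ltrDl.
have yy : y <= y <= y + h by rewrite lexx ltW.
have yyh : y <= y + h <= y + h by rewrite lexx ltW.
pose F1 (s : R) : R := f (s, y + h) - f (s, y).
pose G1 (s : R) : R := dx f (s, y + h) - dx f (s, y).
pose F2 (s t : R) : R := dx f (s, t).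
pose G2 (s t : R) : R := dy (dx f) (s, t).
have D1 (s : R) : x <= s <= x + h -> is_derive s 1 F1 (G1 s).
  move=> hs; apply: is_deriveB.
    exact: (is_derive_slice_x Sf (HU _ _ hs yyh)).
  exact: (is_derive_slice_x Sf (HU _ _ hs yy)).
have [s hs E] := MVT_closed hx D1.
have D2 (t : R) : y <= t <= y + h -> is_derive t 1 (F2 s) (G2 s t).
  by move=> ht; exact: (is_derive_slice_y (smooth_dx Sf) (HU _ _ hs ht)).
have [t ht E2] := MVT_closed hy D2.
exists s, t; split => //.
rewrite -/(F1 (x + h)) -/(F1 x) E /G1 -/(F2 s (y + h)) -/(F2 s y) E2 /G2.
by rewrite ![_ + h]addrC !addrK; ring.
Qed.

Theorem dxdyC U f p : open U -> smooth_on U f -> U p -> dx (dy f) p = dy (dx f) p.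
Proof.
move=> oU Sf Up; apply/eqP; rewrite -subr_eq0 -normr_le0; apply/ler_addgt0Pr => e e0.
rewrite add0r.
have C1 : {for p, continuous (dy (dx f))} := smooth_continuous (smooth_dy (smooth_dx Sf)) Up.
have C2 : {for p, continuous (dx (dy f))} := smooth_continuous (smooth_dx (smooth_dy Sf)) Up.
have e2 : 0 < e / 2 by rewrite divr_gt0.
have [h1 h10 H1] := continuous_box C1 e2.
have [h2 h20 H2] := continuous_box C2 e2.
have [h3 h30 H3] := near_box (open_near oU Up).
pose h := Num.min h1 (Num.min h2 h3).
have h0 : 0 < h by rewrite !lt_min h10 h20 h30.
have H x y : `|x - p.1| <= h -> `|y - p.2| <= h ->
   [/\ U (x, y), `|dy (dx f) p - dy (dx f) (x, y)| <= e / 2 &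
       `|dx (dy f) p - dx (dy f) (x, y)| <= e / 2].
  rewrite !le_min => /and3P[a1 a2 a3] /and3P[b1 b2 b3].
  by split; [exact: H3|exact: H1|exact: H2].
have aux (a b : R) : a <= b <= a + h -> `|b - a| <= h.
  by move=> /andP[? ?]; rewrite ger0_norm ?subr_ge0 // lerBlDl.
have HU s t : p.1 <= s <= p.1 + h -> p.2 <= t <= p.2 + h -> U (s, t).
  by move=> /aux hs /aux ht; have [] := H s t hs ht.
have [s [t [hs ht E1]]] := second_difference h0 Sf HU.
have [t' [s' [ht' hs' E2]]] : exists t' s', [/\ p.2 <= t' <= p.2 + h, p.1 <= s' <= p.1 + h &
   f (p.1 + h, p.2 + h) - f (p.1, p.2 + h) - (f (p.1 + h, p.2) - f (p.1, p.2)) =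
   h * (h * dx (dy f) (s', t'))].
  have Sg := smooth_swap Sf.
  have HW a b : p.2 <= a <= p.2 + h -> p.1 <= b <= p.1 + h -> [set p : R * R | U (p.2, p.1)] (a, b).
    by move=> ha hb; exact: HU.
  by have [a [b [ha hb E]]] := second_difference h0 Sg HW; exists a, b; split.
have E : dy (dx f) (s, t) = dx (dy f) (s', t').
  have hn0 : h != 0 by rewrite gt_eqF.
  have ac (r1 r2 r3 r4 : R) : r1 - r2 - (r3 - r4) = r1 - r3 - (r2 - r4) by ring.
  have E12 := etrans (esym E1) (etrans (ac _ _ _ _) E2).
  exact: (mulfI hn0 (mulfI hn0 E12)).
have [_ B1 _] := H s t (aux _ _ hs) (aux _ _ ht).
have [_ _ B2] := H s' t' (aux _ _ hs') (aux _ _ ht').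
have ac (r1 r2 r3 : R) : r1 - r2 = (r1 - r3) - (r2 - r3) by ring.
rewrite (ac _ _ (dx (dy f) (s', t'))) -{2}E.
apply: (le_trans (ler_normB _ _)); rewrite [leRHS]splitr.
exact: (lerD B2 B1).
Qed.

End Deriv.

(*@@@ 20*)
Section LineLemma.
Context {R : realType}.
Variables (T om : R) (q q1 F F1 F2 G G1 G2 w w1 w2 : R -> R).
Hypotheses (T0 : 0 < T).
Hypotheses (DF : forall x : R, is_derive x 1 F (F1 x))
  (DF1 : forall x : R, is_derive x 1 F1 (F2 x))
  (DF2 : forall x : R, is_derive x 1 F2 (4 * q x * F1 x + 2 * q1 x * F x)).
Hypotheses (DG : forall x : R, is_derive x 1 G (G1 x))
  (DG1 : forall x : R, is_derive x 1 G1 (G2 x))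
  (DG2 : forall x : R, is_derive x 1 G2 (4 * q x * G1 x + 2 * q1 x * G x + 4 * F1 x)).
Hypotheses (Dw : forall x : R, is_derive x 1 w (w1 x))
  (Dw1 : forall x : R, is_derive x 1 w1 (w2 x))
  (Dw2 : forall x : R, is_derive x 1 w2 (4 * q x * w1 x + 2 * q1 x * w x)).
Hypotheses (pF : forall x, F (x + T) = F x) (pF1 : forall x, F1 (x + T) = F1 x)
  (pF2 : forall x, F2 (x + T) = F2 x) (pG : forall x, G (x + T) = G x)
  (pG1 : forall x, G1 (x + T) = G1 x) (pG2 : forall x, G2 (x + T) = G2 x)
  (pw : forall x, w (x + T) = w x) (pw1 : forall x, w1 (x + T) = w1 x)
  (pw2 : forall x, w2 (x + T) = w2 x).
Hypotheses (w0 : forall x, 0 < w x)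
  (wneg : forall x, w1 x ^+ 2 - 2 * w x * w2 x + 4 * q x * w x ^+ 2 < 0)
  (FF : forall x, F1 x ^+ 2 - 2 * F x * F2 x + 4 * q x * F x ^+ 2 = om).

Let c x := F1 x * w1 x - F x * w2 x - F2 x * w x + 4 * (q x * (F x * w x)).
Let A x := w1 x * w1 x - 2 * (w x * w2 x) + 4 * (q x * (w x * w x)).

Let Dmul (f g : R -> R) (x df dg : R) : is_derive x 1 f df -> is_derive x 1 g dg ->
  is_derive x 1 (fun x => f x * g x) (df * g x + f x * dg).
Proof.
move=> D1 D2; apply: is_derive_eq (is_deriveM D1 D2) _.
by rewrite -![_ *: _]/(_ * _); ring.
Qed.
Let Dadd (f g : R -> R) (x df dg : R) : is_derive x 1 f df -> is_derive x 1 g dg ->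
  is_derive x 1 (fun x => f x + g x) (df + dg).
Proof. exact: is_deriveD. Qed.
Let Dsub (f g : R -> R) (x df dg : R) : is_derive x 1 f df -> is_derive x 1 g dg ->
  is_derive x 1 (fun x => f x - g x) (df - dg).
Proof. exact: is_deriveB. Qed.
Let Dscl (k : R) (f : R -> R) (x df : R) : is_derive x 1 f df ->
  is_derive x 1 (fun x => k * f x) (k * df).
Proof. exact: is_deriveZ. Qed.

Let v x := F x * w1 x - F1 x * w x.
Let v1 x := F x * w2 x - F2 x * w x.
Let v2 x := F1 x * w2 x - F2 x * w1 x.
Let Z x := F x * v x - 2^-1 * (G2 x * v x - G1 x * v1 x + G x * v2 x).

Let DZ (x : R) : is_derive x 1 Z (om * w x - c x * F x).
Proof.
have Dv : is_derive x 1 v (v1 x).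
  apply: is_derive_eq (Dsub (Dmul (DF x) (Dw1 x)) (Dmul (DF1 x) (Dw x))) _.
  by rewrite /v1; ring.
have Dv1 : is_derive x 1 v1 (v2 x + 4 * (q x * v x)).
  apply: is_derive_eq (Dsub (Dmul (DF x) (Dw2 x)) (Dmul (DF2 x) (Dw x))) _.
  by rewrite /v2 /v; ring.
have Dv2 : is_derive x 1 v2 (- 2 * (q1 x * v x)).
  apply: is_derive_eq (Dsub (Dmul (DF1 x) (Dw2 x)) (Dmul (DF2 x) (Dw1 x))) _.
  by rewrite /v; ring.
apply: is_derive_eq (Dsub (Dmul (DF x) Dv) (@Dscl 2^-1 _ _ _ (Dadd (Dsub (Dmul (DG2 x) Dv)
  (Dmul (DG1 x) Dv1)) (Dmul (DG x) Dv2)))) _.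
by rewrite -(FF x) /c /v /v1 /v2; field; rewrite ?pnatr_eq0.
Qed.

Let pZ x : Z (x + T) = Z x.
Proof. by rewrite /Z /v /v1 /v2 !(pF, pF1, pF2, pG, pG1, pG2, pw, pw1, pw2). Qed.

Theorem line_lemma : 0 <= om -> forall x, F x = 0.
Proof.
rewrite le_eqVlt => /predU1P[om0|om0]; last first.
  have lt0T : 0 < 0 + T by rewrite add0r.
  have [s _ E] := @MVT_closed R Z (fun x => om * w x - c x * F x) 0 (0 + T) lt0T (fun s _ => DZ s).
  have {}E : om * w s = c s * F s.
    move: E; rewrite pZ subrr => /esym/eqP; rewrite mulf_eq0 subr_eq0 => /orP[/eqP //|].
    by rewrite subr_eq0 (gt_eqF lt0T).
  have H : (om * w1 s - c s * F1 s) ^+ 2 = om ^+ 2 * A s - om * c s ^+ 2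
     + 2 * (om * w s - c s * F s) * (om * w2 s - c s * F2 s)
     - 4 * q s * (om * w s - c s * F s) ^+ 2
     + c s ^+ 2 * ((F1 s ^+ 2 - 2 * F s * F2 s + 4 * q s * F s ^+ 2) - om).
    by rewrite /A /c; ring.
  rewrite FF subrr mulr0 addr0 E subrr !mulr0 mul0r expr0n /= mulr0 subr0 addr0 in H.
  have As : A s < 0 by have := wneg s; rewrite /A !expr2 !mulrA.
  have : om ^+ 2 * A s - om * c s ^+ 2 < 0.
    have : om ^+ 2 * A s < 0 by rewrite pmulr_rlt0 // exprn_gt0.
    have : 0 <= om * c s ^+ 2 by rewrite mulr_ge0 ?sqr_ge0 // ltW.
    by move: (_ * _) (_ * _) => x y; lra.
  by rewrite -H ltNge sqr_ge0.
have sgn x : F x != 0 -> c x * F x < 0.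
  move=> Fx; pose s := - F x / w x; have wn : w x != 0 by rewrite gt_eqF.
  have H : (F1 x + s * w1 x) ^+ 2 = om + 2 * s * c x + s ^+ 2 * A x.
    by rewrite -(FF x) /A /c /s; field.
  have As : A x < 0 by have := wneg x; rewrite /A !expr2 !mulrA.
  have s0 : s != 0 by rewrite mulf_neq0 ?oppr_eq0 // invr_eq0.
  have h1 : s ^+ 2 * A x < 0 by rewrite pmulr_rlt0 // lt0r sqrf_eq0 s0 sqr_ge0.
  have h2 : 0 < s * c x.
    have : 0 <= (F1 x + s * w1 x) ^+ 2 by exact: sqr_ge0.
    rewrite H -om0 add0r; move: h1; rewrite -mulrA; move: (s ^+ 2 * _) (s * c x) => y z; lra.
  have -> : c x * F x = - (s * c x) * w x by rewrite /s; field.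
  by rewrite pmulr_llt0 // oppr_lt0.
have mono x y : x < y -> Z x <= Z y.
  move=> xy; have [s _ E] := @MVT_closed R Z (fun x => om * w x - c x * F x) x y xy (fun s _ => DZ s).
  rewrite -subr_ge0 E mulr_ge0 //; last by rewrite subr_ge0 ltW.
  rewrite -om0 mul0r sub0r oppr_ge0; have [->|/sgn/ltW //] := eqVneq (F s) 0.
  by rewrite mulr0.
have Zc x y : x < y < x + T -> Z y = Z x.
  move=> /andP[xy yT]; apply/eqP; rewrite eq_le; apply/andP; split; last exact: mono.
  by rewrite -(pZ x); exact: mono.
move=> x; apply/eqP/negPn/negP => Fx; have := sgn x Fx.
have Zx y : x - T < y < x + T -> Z y = Z x.
  move=> /andP[h1 h2]; case: (ltgtP x y) => [xy|yx|->//]; first by rewrite (Zc x y) // xy.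
  by rewrite (Zc y x) // yx /= -ltrBlDr.
have : is_derive x 1 Z 0.
  have N : nbhs x (fun y => (cst (Z x)) y = Z y).
    have I : nbhs x [set y | x - T < y < x + T].
      have := near_in_itvoo; move=> /(_ R (x - T) (x + T) x).
      rewrite in_itv /= ltrBlDr ltrDl T0 => /(_ isT); apply: filterS => y.
      by rewrite in_itv.
    by apply: filterS I => y /= /Zx.
  exact: (near_eq_is_derive N (@is_derive_cst R R R (Z x) x 1)).
move=> [_ E0]; have [_ E1] := DZ x; move: E1; rewrite E0 -om0 mul0r sub0r => /eqP.
by rewrite eq_sym oppr_eq0 => /eqP ->; rewrite ltxx.
Qed.
End LineLemma.

(*@@@ 18*)
Section LamePolynomials.
Context {K : realFieldType}.
Implicit Types (f g h : {poly K}).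
Variables (N s c d : K).
Hypothesis N0 : N != 0.
Let A : K := 4 / N.

Definition cubic : {poly K} := A *: 'X^3 + s *: 'X^2 + (2 * c) *: 'X + d%:P.
Definition cubic1 : {poly K} := (3 * A) *: 'X^2 + (2 * s) *: 'X + (2 * c)%:P.
Definition cubic2 : {poly K} := (6 * A) *: 'X + (2 * s)%:P.

Lemma cubic_deriv : cubic^`() = cubic1.
Proof.
apply/polyP => i; rewrite /cubic /cubic1 !(coef_deriv, coefD, coefZ, coefXn, coefX, coefC).
by case: i => [|[|[|[|i]]]] /=; ring.
Qed.

Lemma cubic1_deriv : cubic1^`() = cubic2.
Proof.
apply/polyP => i; rewrite /cubic1 /cubic2 !(coef_deriv, coefD, coefZ, coefXn, coefX, coefC).
by case: i => [|[|[|i]]] /=; ring.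
Qed.

Definition lame f : {poly K} :=
  2 * (cubic * f^`()^`()^`()) + 3 * (cubic1 * f^`()^`()) + (cubic2 - 8 * 'X) * f^`() - 4 * f.

Definition lame_eig (k : nat) : K := 4 * (2 * k%:R + 1) * ((k * k.+1)%:R / N - 1).

Lemma lameB f g : lame (f - g) = lame f - lame g.
Proof. by rewrite /lame !derivB; ring. Qed.

Lemma lameD f g : lame (f + g) = lame f + lame g.
Proof. by rewrite /lame !derivD; ring. Qed.

Lemma lameZ k f : lame (k *: f) = k *: lame f.
Proof. by rewrite /lame !derivZ -!mul_polyC; ring. Qed.

Lemma lame0 : lame 0 = 0.
Proof. by have := lameZ 0 0; rewrite !scale0r. Qed.

Lemma lame_expand f (f1 := f^`()) (f2 := f^`()^`()) (f3 := f^`()^`()^`()) : lame f =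
  (2 * A) *: ('X^3 * f3) + (2 * s) *: ('X^2 * f3) + (4 * c) *: ('X^1 * f3) + (2 * d) *: f3 +
  (9 * A) *: ('X^2 * f2) + (6 * s) *: ('X^1 * f2) + (6 * c) *: f2 +
  (6 * A - 8) *: ('X^1 * f1) + (2 * s) *: f1 - 4 *: f.
Proof.
rewrite /lame /cubic /cubic1 /cubic2 -/f1 -/f2 -/f3 -!mul_polyC; ring.
Qed.

Lemma coef_lame f k : (size f <= k.+1)%N -> (lame f)`_k = lame_eig k * f`_k.
Proof.
move=> fk; have f0 j : (k < j)%N -> f`_j = 0 by move=> kj; rewrite nth_default // (leq_trans fk).
have f1 := f0 k.+1 (ltnSn k).
have f2 : f`_k.+2 = 0 by apply: f0; lia.
have f3 : f`_k.+3 = 0 by apply: f0; lia.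
rewrite lame_expand !(coefD, coefB, coefN, coefZ, coefXnM, coef_deriv) /lame_eig /A.
case: k {fk f0} f1 f2 f3 => [|[|[|k]]] f1 f2 f3; rewrite ?subSS ?subn0 /= ?(f1, f2, f3).
- by field.
- by field.
- by field.
by field.
Qed.

Lemma size_lame f : (size (lame f) <= size f)%N.
Proof.
apply/leq_sizeP => j hj; rewrite coef_lame; last exact: leq_trans hj _.
by rewrite nth_default // mulr0.
Qed.

(* triangular solve *)
Lemma lame_solve m : (forall k, (k < m)%N -> lame_eig k != 0) -> forall h, (size h <= m)%N ->
  exists2 g : {poly K}, (size g <= m)%N & lame g = h.
Proof.
elim: m => [|m IH] eig h hm.
  exists 0; first by rewrite size_poly0.
  by rewrite lame0; apply/esym/eqP; rewrite -size_poly_eq0 -leqn0.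
have em : lame_eig m != 0 by apply: eig.
pose k := h`_m / lame_eig m; pose x : {poly K} := k *: 'X^m.
have sx : (size x <= m.+1)%N by apply: leq_trans (size_scale_leq _ _) _; rewrite size_polyXn.
have hx : (size (h - lame x)%R <= m)%N.
  apply/leq_sizeP => j; rewrite leq_eqVlt coefB => /predU1P[<-|mj].
    by rewrite coef_lame // coefZ coefXn eqxx mulr1 /k mulrC mulfVK // subrr.
  rewrite coef_lame ?(leq_trans sx) //; last exact: ltnW.
  by rewrite coefZ coefXn gtn_eqF // !mulr0 subr0 nth_default // (leq_trans hm).
have [g gm gE] := IH (fun j jm => eig j (ltnW jm)) _ hx.
exists (g + x).
  by apply: leq_trans (size_polyD _ _) _; rewrite geq_max sx (leq_trans gm).
by rewrite lameD gE subrK.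
Qed.

Lemma lame_kernel n : lame_eig n = 0 -> (forall k, (k < n)%N -> lame_eig k != 0) ->
  exists F G : {poly K}, [/\ F != 0, lame F = 0 & lame G = 8 * F^`()].
Proof.
move=> en eig.
have sn : (size (lame 'X^n) <= n)%N.
  apply/leq_sizeP => j; rewrite leq_eqVlt => /predU1P[<-|nj].
    by rewrite coef_lame ?size_polyXn // en mul0r.
  by rewrite nth_default // (leq_trans (size_lame _)) // size_polyXn.
have [g gn gE] := lame_solve eig sn.
pose F := 'X^n - g.
have sF : size F = n.+1.
  by rewrite size_polyDl ?size_polyXn // size_polyN ltnS.
have F0 : F != 0 by rewrite -size_poly_eq0 sF.
have sF' : (size (8 * F^`())%R <= n)%N.
  have -> : 8 * F^`() = (8 : K) *: F^`() by rewrite -mul_polyC; ring.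
  apply: leq_trans (size_scale_leq _ _) _.
  by rewrite -ltnS -sF; exact: lt_size_deriv.
have [G _ GE] := lame_solve eig sF'.
by exists F, G; split=> //; rewrite lameB gE subrr.
Qed.

(* first integral of the third order equation *)
Definition pairing F : {poly K} :=
  cubic * F^`() ^+ 2 - F * (2 * (cubic * F^`()^`()) + cubic1 * F^`()) + 4 * ('X * F ^+ 2).

Lemma deriv0_const (P : {poly K}) : P^`() = 0 -> P = (P`_0)%:P.
Proof.
move=> P0; apply/polyP => -[|i]; rewrite coefC //=.
have := congr1 (fun Q : {poly K} => Q`_i) P0; rewrite coef_deriv coef0 => /eqP.
by rewrite mulrn_eq0 => /eqP.
Qed.

Lemma pairing_const F : lame F = 0 -> pairing F = ((pairing F)`_0)%:P.
Proof.
move=> E; apply: deriv0_const.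
have -> : (pairing F)^`() = - F * lame F.
  rewrite /pairing /lame !mulr_natl !expr2 !(cubic_deriv, cubic1_deriv, derivX, derivB, derivMn, derivM, derivD).
  ring.
by rewrite E mulr0.
Qed.

Lemma second_deriv f : (2 * (cubic * f^`()^`()) + cubic1 * f^`())^`() =
  lame f + 8 * ('X * f^`()) + 4 * f.
Proof.
by rewrite /lame !mulr_natl !(cubic_deriv, cubic1_deriv, derivMn, derivM, derivD); ring.
Qed.

End LamePolynomials.

Opaque cubic cubic1 lame.

Section LineArgument.
Context {R : realType}.
Variables (N s c d : R).
Hypothesis N0 : N != 0.
Local Notation Rp := (cubic N s c d).
Local Notation L := (lame N s c d).

(** a continuous function with values among the roots of a nonzero polynomial is constant *)
Lemma root_valued_const (F : {poly R}) (f f1 : R -> R) : F != 0 ->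
  (forall x : R, is_derive x 1 f (f1 x)) -> (forall x, F.[f x] = 0) -> forall x y, f x = f y.
Proof.
move=> F0 Df Froot; suff H x y : x < y -> f x = f y.
  by move=> x y; case: (ltgtP x y) => [/H|/H ->|->].
move=> xy; apply/eqP/negPn/negP => ne.
pose v (i : nat) : R := f x + i%:R / (size F)%:R * (f y - f x).
have s0 : (0 : R) < (size F)%:R by rewrite ltr0n size_poly_gt0.
have vroot i : (i < size F)%N -> root F (v i).
  move=> hi; have t0 : 0 <= i%:R / (size F)%:R :> R by rewrite divr_ge0.
  have t1 : i%:R / (size F)%:R <= 1 :> R by rewrite ler_pdivrMr // mul1r ler_nat ltnW.
  have cf : {within `[x, y], continuous f}.
    by apply: continuous_subspaceT => z; exact: is_derive_continuous (Df z).
  have [z _ <-] : exists2 z, z \in `[x, y] & f z = v i.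
    apply: (IVT (ltW xy) cf); rewrite /v; move: t0 t1; move: (_ / _) => t t0 t1.
    case: (leP (f x) (f y)) => h; apply/andP; split; nra.
  by rewrite rootE Froot.
have vinj : injective v.
  move=> i j /addrI /(mulIf _); rewrite subr_eq0 eq_sym => /(_ ne).
  have sn : (size F)%:R^-1 != 0 :> R by rewrite invr_eq0 gt_eqF.
  by move/(mulIf sn) => /eqP; rewrite eqr_nat => /eqP.
have := max_poly_roots F0 (rs := [seq v i | i <- iota 0 (size F)]).
rewrite size_map size_iota ltnn map_inj_uniq // iota_uniq => H.
have : all (root F) [seq v i | i <- iota 0 (size F)].
  by rewrite all_map; apply/allP => i; rewrite mem_iota add0n /= => hi; exact: vroot.
by move=> /H /(_ isT).
Qed.

(* f is the restriction of the potential to the line, sg the sign of the square of the direction *)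
Variables (T sg : R) (f f1 w w1 w2 : R -> R) (F G : {poly R}).
Hypotheses (T0 : 0 < T) (sg2 : sg * sg = 1).
Hypotheses (Df : forall x : R, is_derive x 1 f (f1 x))
  (Df1 : forall x : R, is_derive x 1 f1 (2^-1 * sg * (cubic1 N s c).[f x]))
  (sqf1 : forall x, f1 x ^+ 2 = sg * Rp.[f x]).
Hypotheses (Dw : forall x : R, is_derive x 1 w (w1 x))
  (Dw1 : forall x : R, is_derive x 1 w1 (w2 x))
  (Dw2 : forall x : R, is_derive x 1 w2 (4 * (sg * f x) * w1 x + 2 * (sg * f1 x) * w x)).
Hypotheses (pf : forall x, f (x + T) = f x) (pf1 : forall x, f1 (x + T) = f1 x)
  (pw : forall x, w (x + T) = w x) (pw1 : forall x, w1 (x + T) = w1 x)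
  (pw2 : forall x, w2 (x + T) = w2 x).
Hypotheses (w0 : forall x, 0 < w x)
  (wneg : forall x, w1 x ^+ 2 - 2 * w x * w2 x + 4 * (sg * f x) * w x ^+ 2 < 0).
Hypotheses (F0 : F != 0) (LF : L F = 0) (LG : L G = 8 * F^`()).

Let S (P : {poly R}) : {poly R} := 2 * (Rp * P^`()^`()) + cubic1 N s c * P^`().

Let Dcomp (P : {poly R}) (x : R) : is_derive x 1 (fun x => P.[f x]) (P^`().[f x] * f1 x).
Proof. exact: (is_derive1_comp (is_derive_poly P (f x)) (Df x)). Qed.

Let Dcomp1 (P : {poly R}) (x : R) :
  is_derive x 1 (fun x => P^`().[f x] * f1 x) (2^-1 * sg * (S P).[f x]).
Proof.
apply: is_derive_eq (is_deriveM (Dcomp P^`() x) (Df1 x)) _.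
rewrite -![_ *: _]/(_ * _) /S mulr_natl (hornerD (_ *+ 2)) hornerMn !hornerM.
have -> : f1 x * (P^`()^`().[f x] * f1 x) = P^`()^`().[f x] * f1 x ^+ 2 by ring.
by rewrite sqf1; field.
Qed.

Let Dcomp2 (P : {poly R}) (x : R) : is_derive x 1 (fun x => 2^-1 * sg * (S P).[f x])
  (2^-1 * sg * ((L P).[f x] + 8 * (f x * P^`().[f x]) + 4 * P.[f x]) * f1 x).
Proof.
apply: is_derive_eq (is_deriveZ (2^-1 * sg) (Dcomp (S P) x)) _.
rewrite -![_ *: _]/(_ * _) /S second_deriv !mulr_natl !(hornerMn, hornerX, hornerM, hornerD).
by ring.
Qed.

(** the potential is constant on the line *)
Theorem potential_constant : 0 <= sg * (pairing N s c d F)`_0 -> forall x, f1 x = 0.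
Proof.
move=> om0.
have sgF (a : R) : sg * (sg * a) = a by rewrite mulrA sg2 mul1r.
suff Froot : forall x, F.[f x] = 0.
  move=> x; have fc := root_valued_const F0 Df Froot.
  have D0 : is_derive x 1 f 0.
    have := @is_derive_cst R R R (f 0) x 1.
    by rewrite (_ : cst (f 0) = f) //; apply/funext => y; exact: fc.
  by have [_ E0] := D0; have [_ E1] := Df x; rewrite -E1 E0.
pose q x := sg * f x; pose q1 x := sg * f1 x.
pose G0 x := sg * G.[f x]; pose G1 x := sg * (G^`().[f x] * f1 x); pose G2 x := sg * (2^-1 * sg * (S G).[f x]).
have per (P : {poly R}) x : P.[f (x + T)] = P.[f x] by rewrite pf.
have HDF2 (x : R) : is_derive x 1 (fun x => 2^-1 * sg * (S F).[f x])
    (4 * q x * (F^`().[f x] * f1 x) + 2 * q1 x * F.[f x]).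
  apply: is_derive_eq (Dcomp2 F x) _.
  by rewrite LF hornerC /q /q1; field.
have HDG (x : R) : is_derive x 1 G0 (G1 x) by exact: (is_deriveZ sg (Dcomp G x)).
have HDG1 (x : R) : is_derive x 1 G1 (G2 x) by exact: (is_deriveZ sg (Dcomp1 G x)).
have HDG2 (x : R) : is_derive x 1 G2
    (4 * q x * G1 x + 2 * q1 x * G0 x + 4 * (F^`().[f x] * f1 x)).
  apply: is_derive_eq (is_deriveZ sg (Dcomp2 G x)) _.
  rewrite -![_ *: _]/(_ * _) LG mulr_natl hornerMn -(mulr_natl _ 8).
  rewrite /q /q1 /G0 /G1.
  have -> : sg * (2^-1 * sg * (8 * F^`().[f x] + 8 * (f x * G^`().[f x]) + 4 * G.[f x]) * f1 x) =
    sg * sg * (2^-1 * (8 * F^`().[f x] + 8 * (f x * G^`().[f x]) + 4 * G.[f x]) * f1 x) by ring.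
  have -> : 4 * (sg * f x) * (sg * (G^`().[f x] * f1 x)) + 2 * (sg * f1 x) * (sg * G.[f x]) + 4 * (F^`().[f x] * f1 x) =
    sg * sg * (4 * f x * (G^`().[f x] * f1 x) + 2 * f1 x * G.[f x]) + 4 * (F^`().[f x] * f1 x) by ring.
  by rewrite sg2; field.
have HFF x : (F^`().[f x] * f1 x) ^+ 2 - 2 * F.[f x] * (2^-1 * sg * (S F).[f x]) +
    4 * q x * F.[f x] ^+ 2 = sg * (pairing N s c d F)`_0.
  rewrite exprMn sqf1.
  have := congr1 (horner^~ (f x)) (pairing_const LF); rewrite hornerC => <-.
  rewrite /pairing /q -/(S F) !mulr_natl !(hornerMn, hornerX, horner_exp, hornerN, hornerM, hornerD).
  by field.
have pF x : F.[f (x + T)] = F.[f x] by rewrite per.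
have pF1 x : F^`().[f (x + T)] * f1 (x + T) = F^`().[f x] * f1 x by rewrite per pf1.
have pF2 x : 2^-1 * sg * (S F).[f (x + T)] = 2^-1 * sg * (S F).[f x] by rewrite per.
have pG x : G0 (x + T) = G0 x by rewrite /G0 per.
have pG1 x : G1 (x + T) = G1 x by rewrite /G1 per pf1.
have pG2 x : G2 (x + T) = G2 x by rewrite /G2 per.
exact: (@line_lemma R T _ q q1 (fun x => F.[f x]) (fun x => F^`().[f x] * f1 x)
  (fun x => 2^-1 * sg * (S F).[f x]) G0 G1 G2 w w1 w2 T0 (Dcomp F) (Dcomp1 F) HDF2
  HDG HDG1 HDG2 Dw Dw1 Dw2 pF pF1 pF2 pG pG1 pG2 pw pw1 pw2 w0 wneg HFF om0).
Qed.

End LineArgument.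

(*@@@ 3*)
Section RectInt.
Context {R : realType}.
Implicit Types (f g : R * R -> R) (a b c d : R).
Local Notation mu := (@lebesgue_measure R).

Definition rect a b c d : set (R * R) := `[a, b] `*` `[c, d].
Definition rint a b c d f : R := \int[@area R]_(p in rect a b c d) f p.

Lemma open_measurable2 (A : set (R * R)) : open A -> measurable A.
Proof.
move=> oA.
pose B (q : (rat * rat) * (rat * rat)) : set (R * R) :=
  `]ratr q.1.1, ratr q.1.2[ `*` `]ratr q.2.1, ratr q.2.2[.
have -> : A = \bigcup_(q in [set q | B q `<=` A]) B q.
  apply/seteqP; split => [[x y] Axy|p [q /= qA Bp]]; last exact: qA.
  have /nbhs_ballP [e /= e0 eA] : nbhs (x, y) A by exact: open_near.
  have x1 : x - e < x by rewrite ltrBlDr ltrDl.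
  have x2 : x < x + e by rewrite ltrDl.
  have y1 : y - e < y by rewrite ltrBlDr ltrDl.
  have y2 : y < y + e by rewrite ltrDl.
  have [q1 h1] := rat_in_itvoo x1.
  have [q2 h2] := rat_in_itvoo x2.
  have [q3 h3] := rat_in_itvoo y1.
  have [q4 h4] := rat_in_itvoo y2.
  move: h1 h2 h3 h4; rewrite !in_itv /= => /andP[? ?] /andP[? ?] /andP[? ?] /andP[? ?].
  exists ((q1, q2), (q3, q4)) => /=.
    move=> [s t] /= [] /=; rewrite !in_itv /= => /andP[? ?] /andP[? ?]; apply: eA.
    by split; rewrite /ball /= ltr_norml; apply/andP; split; lra.
  by split; rewrite /= in_itv /=; apply/andP; split.
rewrite bigcup_mkcond; apply: countable_bigcupT_measurable => // q.
case: ifPn => // _; exact: measurableX.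
Qed.

Lemma measurable_rect a b c d :
  @measurable _ (measurableTypeR R * measurableTypeR R)%type (rect a b c d).
Proof. exact: measurableX. Qed.

Lemma continuous_measurable2 (D : set (R * R)) f : measurable D ->
  (forall p, D p -> {for p, continuous f}) -> measurable_fun D f.
Proof.
move=> mD Cf.
apply: (measurability _ (measurable_realfun.RGenOpens.measurableE R)) => _ [_ [x [y ->] <-]].
set O := [set` _]; have oO : open O by exact: interval_open.
have -> : D `&` f @^-1` O = D `&` interior (f @^-1` O).
  apply/seteqP; split => p [Dp Op]; split => //; last exact: interior_subset Op.
  by apply: (Cf p Dp); exact: open_nbhs_nbhs.
by apply: measurableI => //; apply: open_measurable2; exact: open_interior.
Qed.

Lemma area_rectE a b c d :
  @area R (rect a b c d) = (mu `[a, b]%classic * mu `[c, d]%classic)%E.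
Proof. exact: product_measure1E. Qed.

Lemma compact_rect a b c d : compact (rect a b c d).
Proof. by apply: compact_setX; exact: segment_compact. Qed.

Lemma rect_bounded a b c d f : (forall p, rect a b c d p -> {for p, continuous f}) ->
  exists M, forall p, rect a b c d p -> `|f p| <= M.
Proof.
move=> Cf.
have /compact_bounded [M [_ HM]] : compact (f @` rect a b c d).
  apply: continuous_compact; last exact: compact_rect.
  by apply: continuous_in_subspaceT => p; rewrite inE => /Cf.
exists (M + 1) => p Dp; apply: HM; last by exists p.
by rewrite ltrDl.
Qed.

Lemma rect_integrable a b c d f : (forall p, rect a b c d p -> {for p, continuous f}) ->
  (@area R).-integrable (rect a b c d) (EFin \o f).
Proof.
move=> Cf; apply: measurable_bounded_integrable.
- exact: measurable_rect.
- apply: (le_lt_trans (y := (mu `[a, b]%classic * mu `[c, d]%classic)%E)); first by rewrite -area_rectE.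
  by rewrite !lebesgue_measure_itv /=; case: ifP => _; case: ifP => _;
    rewrite ?mul0e ?mule0 // -!EFinB -EFinM ltry.
- by apply: continuous_measurable2 => //; exact: measurable_rect.
- have [M HM] := rect_bounded Cf.
  by exists M; split; [exact: num_real|move=> x Mx p /= Dp; apply: le_trans (HM p Dp) (ltW Mx)].
Qed.


Lemma area_rect a b c d : a <= b -> c <= d -> fine (@area R (rect a b c d)) = (b - a) * (d - c).
Proof.
move=> ab cd; rewrite area_rectE !lebesgue_measure_itv /= !lte_fin.
have [ab'|] := ltP a b; last first.
  by move=> ba; rewrite mul0e /= (_ : b = a) ?subrr ?mul0r //; apply/eqP; rewrite eq_le ab ba.
have [cd'|] := ltP c d; last first.
  by move=> dc; rewrite mule0 /= (_ : d = c) ?subrr ?mulr0 //; apply/eqP; rewrite eq_le cd dc.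
by [].
Qed.

Lemma rint_cst a b c d k : a <= b -> c <= d -> rint a b c d (fun=> k) = k * ((b - a) * (d - c)).
Proof. by move=> ab cd; rewrite /rint (@Rintegral_cst _ _ _ (@area R)) ?area_rect //; exact: measurable_rect. Qed.

Section ops.
Variables (a b c d : R).
Local Notation D := (rect a b c d).
Local Notation I := (rint a b c d).
Local Notation cont f := (forall p, D p -> {for p, continuous f}).

Lemma eq_rint f g : (forall p, D p -> f p = g p) -> I f = I g.
Proof. by move=> fg; apply: eq_Rintegral => p; rewrite inE => /fg. Qed.

Lemma rintD f g : cont f -> cont g -> I (fun p => f p + g p) = I f + I g.
Proof.
by move=> Cf Cg; apply: RintegralD; [exact: measurable_rect|exact: rect_integrable..].
Qed.

Lemma rintB f g : cont f -> cont g -> I (fun p => f p - g p) = I f - I g.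
Proof.
by move=> Cf Cg; apply: RintegralB; [exact: measurable_rect|exact: rect_integrable..].
Qed.

Lemma rintZ k f : cont f -> I (fun p => k * f p) = k * I f.
Proof. by move=> Cf; apply: RintegralZl; [exact: measurable_rect|exact: rect_integrable]. Qed.

Lemma le_rint f g : cont f -> cont g -> (forall p, D p -> f p <= g p) -> I f <= I g.
Proof.
move=> Cf Cg fg.
by apply: (@le_Rintegral _ _ _ (@area R)) fg; [exact: measurable_rect|exact: rect_integrable..].
Qed.

Lemma rint_ge0 f : (forall p, D p -> 0 <= f p) -> 0 <= I f.
Proof. exact: (@Rintegral_ge0 _ _ _ (@area R)). Qed.

Lemma rint_bound f M : a <= b -> c <= d -> cont f -> (forall p, D p -> `|f p| <= M) ->
  `|I f| <= M * ((b - a) * (d - c)).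
Proof.
move=> ab cd Cf fM; rewrite ler_norml -mulNr -!rint_cst //; apply/andP.
have Cc k : cont (fun=> k : R) by move=> p _; exact: cvg_cst.
split.
  by apply: (le_rint (Cc (- M)) Cf) => p /fM; rewrite ler_norml => /andP[].
by apply: (le_rint Cf (Cc M)) => p /fM; rewrite ler_norml => /andP[].
Qed.

Lemma rint_sub a' b' c' d' f : rect a' b' c' d' `<=` D ->
  (forall p, D p -> ~ rect a' b' c' d' p -> f p = 0) ->
  I f = rint a' b' c' d' f.
Proof.
move=> sub f0; rewrite /rint Rintegral_mkcond [RHS]Rintegral_mkcond.
congr (\int[_]_(_ in _) _) => //; apply/funext => p; rewrite !patchE.
case: ifPn => pD; case: ifPn => pD' //.
  by apply: f0; [rewrite inE in pD|rewrite notin_setE in pD'].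
by move: pD; rewrite notin_setE => -[]; apply: sub; rewrite inE in pD'.
Qed.

End ops.

Section ops2.
Variables (a b c d : R).
Local Notation D := (rect a b c d).
Local Notation I := (rint a b c d).
Local Notation cont f := (forall p, D p -> {for p, continuous f}).

Lemma rint_eq0 f p : a < b -> c < d -> cont f -> (forall p, D p -> 0 <= f p) -> I f = 0 ->
  D p -> f p = 0.
Proof.
move=> ab cd Cf f0 If Dp; apply: contrapT => /eqP fp0.
have {fp0} fp : 0 < f p by rewrite lt0r fp0 f0.
have [e e0 H] : exists2 e : R, 0 < e & forall x y, `|x - p.1| <= e -> `|y - p.2| <= e ->
    f p / 2 <= f (x, y).
  apply: (@near_box R p (fun q => f p / 2 <= f q)).
  have fp2 : 0 < f p / 2 by rewrite divr_gt0.
  have /cvgrPdist_le /(_ _ fp2) := Cf p Dp; apply: filterS => q.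
  rewrite ler_norml => /andP[_]; lra.
have [[]] := Dp; rewrite /= !in_itv /= => /andP[ap pb] /andP[cp pd].
have sub1 (l r t : R) : l < r -> l <= t <= r -> exists l' r', [/\ l <= l', l' < r', r' <= r,
    t - e <= l' & r' <= t + e].
  move=> lr /andP[lt tr]; have [tr'|rt] := ltP t r.
    exists t, (Num.min r (t + e)); split => //.
    - by rewrite lt_min tr' ltrDl.
    - by rewrite ge_min lexx.
    - by rewrite gerBl ltW.
    - by rewrite ge_min lexx orbT.
  have E : t = r by apply/eqP; rewrite eq_le tr rt.
  exists (Num.max l (t - e)), t; split => //.
  - by rewrite le_max lexx.
  - by rewrite gt_max E lr gtrBl.
  - by rewrite le_max lexx orbT.
  - by rewrite lerDl ltW.
have hp1 : a <= p.1 <= b by rewrite ap pb.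
have hp2 : c <= p.2 <= d by rewrite cp pd.
have [a' [b' [h1 h2 h3 h4 h5]]] := sub1 a b p.1 ab hp1.
have [c' [d' [k1 k2 k3 k4 k5]]] := sub1 c d p.2 cd hp2.
have sub : rect a' b' c' d' `<=` D.
  move=> [x y] [] /=; rewrite !in_itv /= => /andP[u1 u2] /andP[u3 u4].
  split => /=; rewrite in_itv /=.
    by rewrite (le_trans h1 u1) (le_trans u2 h3).
  by rewrite (le_trans k1 u3) (le_trans u4 k3).
have L : rint a' b' c' d' f <= I f.
  rewrite /rint /Rintegral; apply: fine_le.
  - apply: integrable_fin_num; first exact: measurable_rect.
    by apply: rect_integrable => q /sub; exact: Cf.
  - by apply: integrable_fin_num; [exact: measurable_rect|exact: rect_integrable].
  - apply: ge0_subset_integral => //; try exact: measurable_rect.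
      by case/integrableP: (rect_integrable Cf).
have : f p / 2 * ((b' - a') * (d' - c')) <= 0.
  rewrite -If; apply: le_trans L; rewrite -(rint_cst _ (ltW h2) (ltW k2)).
  apply: le_rint => [q _|q /sub|[x y] [] /=]; [exact: cvg_cst|exact: Cf|].
  rewrite !in_itv /= => /andP[u1 u2] /andP[u3 u4]; apply: H; rewrite ler_norml.
    by rewrite lerBrDr lerBlDr (le_trans _ u1) ?(le_trans u2) // addrC // -lerBlDr.
  by rewrite lerBrDr lerBlDr (le_trans _ u3) ?(le_trans u4) // addrC // -lerBlDr.
by rewrite leNgt mulr_gt0 ?divr_gt0 ?mulr_gt0 ?subr_gt0.
Qed.

Lemma rint_dx0 U f : a < b -> open U -> D `<=` U -> smooth_on U f ->
  (forall y, c <= y <= d -> f (a, y) = f (b, y)) -> I (dx f) = 0.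
Proof.
move=> ab oU DU Sf fab.
have Cx : cont (dx f) by move=> p /DU; exact: smooth_continuous (smooth_dx Sf).
have /(integrable_mkcond _ (measurable_rect _ _ _ _)) Ix := rect_integrable Cx.
rewrite /rint /Rintegral integral_mkcond -(integral21_prod_meas1 Ix).
rewrite /fubini_G (_ : (fun y => _) = cst 0%E) ?integral0 //.
apply/funext => y /=; have [ycd|ycd] := boolP (y \in `[c, d]); last first.
  rewrite (_ : (fun x => _) = cst 0%E) ?integral0 //.
  apply/funext => x; rewrite patchE ifF //; apply/negbTE; rewrite notin_setE => -[_ /=].
  by rewrite (negbTE ycd).
transitivity (\int[mu]_(x in `[a, b]) (dx f (x, y))%:E)%E.
  rewrite [RHS]integral_mkcond; apply: eq_integral => x _; rewrite !patchE.
  congr (if _ then _ else _); apply/idP/idP; rewrite !inE /=; first by case.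
  by move=> xab'; split.
have DUx x : x \in `[a, b] -> U (x, y) by move=> xab; apply: DU.
have Dfx x : x \in `[a, b] -> is_derive x 1 (fun x => f (x, y)) (dx f (x, y)).
  by move=> /DUx; exact: is_derive_slice_x Sf.
rewrite (@continuous_FTC2 _ _ (fun x => f (x, y)) a b ab).
- by rewrite (fab y) ?subee //; move: ycd; rewrite in_itv.
- apply: derivable_within_continuous => x xab.
  by have [] := is_derive_slice_x (smooth_dx Sf) (DUx x xab).
- split.
  + by move=> x /(subset_itv_oo_cc) /Dfx [].
  + have aab : a \in `[a, b] by rewrite in_itv /= lexx ltW.
    by apply: cvg_at_right_filter; exact: is_derive_continuous (Dfx a aab).
  + have bab : b \in `[a, b] by rewrite in_itv /= lexx ltW.
    by apply: cvg_at_left_filter; exact: is_derive_continuous (Dfx b bab).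
- by move=> x /(subset_itv_oo_cc) /Dfx [_ <-]; rewrite derive1E.
Qed.

Lemma rint_dy0 U f : c < d -> open U -> D `<=` U -> smooth_on U f ->
  (forall x, a <= x <= b -> f (x, c) = f (x, d)) -> I (dy f) = 0.
Proof.
move=> cd oU DU Sf fcd.
have Cy : cont (dy f) by move=> p /DU; exact: smooth_continuous (smooth_dy Sf).
have /(integrable_mkcond _ (measurable_rect _ _ _ _)) Iy := rect_integrable Cy.
rewrite /rint /Rintegral integral_mkcond -(integral12_prod_meas1 Iy).
rewrite /fubini_F (_ : (fun x => _) = cst 0%E) ?integral0 //.
apply/funext => x /=; have [xab|xab] := boolP (x \in `[a, b]); last first.
  rewrite (_ : (fun y => _) = cst 0%E) ?integral0 //.
  apply/funext => y; rewrite patchE ifF //; apply/negbTE; rewrite notin_setE => -[/=].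
  by rewrite (negbTE xab).
transitivity (\int[mu]_(y in `[c, d]) (dy f (x, y))%:E)%E.
  rewrite [RHS]integral_mkcond; apply: eq_integral => y _; rewrite !patchE.
  congr (if _ then _ else _); apply/idP/idP; rewrite !inE /=; first by case.
  by move=> ycd'; split.
have DUy y : y \in `[c, d] -> U (x, y) by move=> ycd; apply: DU.
have Dfy y : y \in `[c, d] -> is_derive y 1 (fun y => f (x, y)) (dy f (x, y)).
  by move=> /DUy; exact: is_derive_slice_y Sf.
rewrite (@continuous_FTC2 _ _ (fun y => f (x, y)) c d cd).
- by rewrite (fcd x) ?subee //; move: xab; rewrite in_itv.
- apply: derivable_within_continuous => y ycd.
  by have [] := is_derive_slice_y (smooth_dy Sf) (DUy y ycd).
- split.
  + by move=> y /(subset_itv_oo_cc) /Dfy [].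
  + have ccd : c \in `[c, d] by rewrite in_itv /= lexx ltW.
    by apply: cvg_at_right_filter; exact: is_derive_continuous (Dfy c ccd).
  + have dcd : d \in `[c, d] by rewrite in_itv /= lexx ltW.
    by apply: cvg_at_left_filter; exact: is_derive_continuous (Dfy d dcd).
- by move=> y /(subset_itv_oo_cc) /Dfy [_ <-]; rewrite derive1E.
Qed.
End ops2.
End RectInt.

(*@@@ 4*)
Opaque dx dy.

Section Cutoff.
Context {R : realType}.
Implicit Types (f g : R * R -> R) (e t : R) (p : R * R).

(** t^{-k} exp(-1/t) for t > 0, extended by 0 *)
Definition flat (k : nat) t : R := if 0 < t then t^-1 ^+ k * expR (- t^-1) else 0.

Lemma flat_ge0 k t : 0 <= flat k t.
Proof.
rewrite /flat; case: ifP => // t0; rewrite mulr_ge0 ?expR_ge0 // exprn_ge0 // invr_ge0 ltW //.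
Qed.

Lemma flat_gt0 k t : 0 < t -> 0 < flat k t.
Proof. by move=> t0; rewrite /flat t0 mulr_gt0 ?expR_gt0 // exprn_gt0 // invr_gt0. Qed.

Lemma flat_le0 k t : t <= 0 -> flat k t = 0.
Proof. by rewrite /flat ltNge => ->. Qed.

Lemma flat_le_sqr k t : flat k t <= (k.+2)`!%:R * t ^+ 2.
Proof.
have [t0|t0] := leP t 0; first by rewrite flat_le0 // mulr_ge0 ?sqr_ge0 // ler0n.
rewrite /flat t0 expRN -ler_pdivlMr ?invr_gt0 ?expR_gt0 // invrK.
set s := t^-1; have s0 : 0 < s by rewrite invr_gt0.
have -> : t ^+ 2 = (s ^+ 2)^-1 by rewrite /s -exprVn invrK.
have E : s ^+ k.+2 / (k.+2)`!%:R <= expR s.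
  by apply: le_trans (expR_ge1Dxn k.+1 (ltW s0)); rewrite lerDr ler01.
have f0 : (0 : R) < (k.+2)`!%:R by rewrite ltr0n fact_gt0.
rewrite -mulrA [_^-1 * _]mulrC mulrA ler_pdivlMr ?exprn_gt0 // -exprD addn2.
by rewrite mulrC -ler_pdivrMr.
Qed.

Lemma is_derive_flat k t : is_derive t 1 (flat k) (- k%:R * flat k.+1 t + flat k.+2 t).
Proof.
have [t0|t0|->] := ltgtP t 0.
- have E j : flat j t = 0 by rewrite flat_le0 // ltW.
  have near0 : \near t, (fun=> 0 : R) t = flat k t.
    have : \near t, t < 0 by exact: lt_nbhsl.
    by apply: filterS => s s0; rewrite flat_le0 ?ltW.
  rewrite !E mulr0 addr0.
  exact: (near_eq_is_derive near0 (@is_derive_cst R R R 0 t 1)).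
- have tn0 : t != 0 by rewrite gt_eqF.
  have near0 : \near t, (fun s => s^-1 ^+ k * expR (- s^-1)) t = flat k t.
    have : \near t, 0 < t by exact: lt_nbhsr.
    by apply: filterS => s s0; rewrite /flat s0.
  apply: (near_eq_is_derive near0).
  have Di : is_derive (t : R) 1 (fun y : R => y^-1) (- t ^- 2 *: 1) by apply: is_deriveV.
  have Dn := is_deriveN Di.
  have De := @is_derive1_comp R expR (fun s => - s^-1) t _ _ (is_derive_expR (- t^-1)) Dn.
  have DX := is_deriveX k Di.
  have := is_deriveM DX De.
  set a := (X in is_derive _ _ _ X) => D; set b := (X in is_derive _ _ _ X).
  have -> : b = a; last by move: D; congr (is_derive _ _ _ _); apply/funext => s /=; rewrite exprfctE.
  rewrite /a /b /flat t0 -![_ *: _]/(_ * _) exprfctE /=.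
  by case: k {DX a b D near0} => [|k] /=; rewrite ?exprS ?expr0; field.
- rewrite !flat_le0 // mulr0 addr0.
  have q0 : (fun h : R => h^-1 *: (flat k (h + 0) - flat k 0)) @ 0^' --> (0 : R).
    have cv : (fun h : R => (k.+2)`!%:R * `|h|) @ 0^' --> (0 : R).
      rewrite -[X in _ --> X](mulr0 ((k.+2)`!%:R)) -[X in _ * X](normr0 R).
      by apply: cvgMr; apply: cvg_norm; exact: nbhs_dnbhs.
    apply/cvgrPdist_le => e e0; move/cvgrPdist_le : cv => /(_ _ e0).
    apply: filterS2 (nbhs_dnbhs_neq _) => h h0.
    rewrite !sub0r !normrN addr0 (flat_le0 _ (lexx 0)) subr0 => H; apply: le_trans H.
    rewrite [_ *: _]/(_ * _) normrM normfV ler_pdivrMl ?normr_gt0 //.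
    rewrite (ger0_norm (flat_ge0 _ _)); apply: le_trans (flat_le_sqr _ _) _.
    rewrite normrM normr_id ger0_norm ?ler0n // [leRHS]mulrCA.
    by rewrite -[`|h| * `|h|]/(`|h| ^+ 2) real_normK ?num_real.
  have q1 : (fun h : R => h^-1 *: ((flat k \o shift 0) (h *: 1) - flat k 0)) @ 0^' --> (0 : R).
    rewrite (_ : (fun _ => _) = (fun h : R => h^-1 *: (flat k (h + 0) - flat k 0))) //.
    by apply/funext => h /=; rewrite [h *: _]mulr1.
  apply: DeriveDef; first by apply/cvg_ex; exists 0.
  exact: cvg_lim q1.
Qed.

Lemma smooth_flat U f k : open U -> smooth_on U f -> smooth_on U (fun p => flat k (f p)).
Proof.
move=> oU Sf; apply: (@smooth_comp R nat flat (fun k => [:: (- k%:R, k.+1); (1, k.+2)]) setT _ _ k) => //.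
by move=> j x _; rewrite big_cons big_seq1 /= mul1r; exact: is_derive_flat.
Qed.


Definition snorm p : R := Num.max `|p.1| `|p.2|.

Lemma snorm_continuous : continuous snorm.
Proof.
by move=> p; rewrite (_ : snorm = fun q : R * R => `|q|); [exact: norm_continuous|apply/funext].
Qed.

Lemma open_snorm_lt e : open [set p | snorm p < e].
Proof. by apply: (@open_comp _ _ snorm [set x | x < e]) => [p _|]; [exact: snorm_continuous|exact: open_lt]. Qed.

Lemma open_snorm_gt e : open [set p | e < snorm p].
Proof. by apply: (@open_comp _ _ snorm [set x | e < x]) => [p _|]; [exact: snorm_continuous|exact: open_gt]. Qed.

Lemma snorm_le p e : (snorm p <= e) = (`|p.1| <= e) && (`|p.2| <= e).
Proof. by rewrite ge_max. Qed.
Lemma snorm_ge0 p : 0 <= snorm p.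
Proof. by rewrite le_max normr_ge0. Qed.
Lemma snorm_eq0 p : (snorm p == 0) = (p == (0, 0)).
Proof.
apply/eqP/eqP => [s0|->]; last by rewrite /snorm /= normr0 maxxx.
have : snorm p <= 0 by rewrite s0.
by rewrite snorm_le !normr_le0 => /andP[/eqP h1 /eqP h2]; rewrite (surjective_pairing p) h1 h2.
Qed.
Lemma snorm_gt0 p : (0 < snorm p) = (p != (0, 0)).
Proof. by rewrite lt0r snorm_ge0 andbT snorm_eq0. Qed.
Lemma snorm_rect p e : rect (- e) e (- e) e p <-> snorm p <= e.
Proof.
rewrite snorm_le !ler_norml; split.
  by move=> []; rewrite /= !in_itv /= => -> ->.
by move=> /andP[? ?]; split; rewrite /= in_itv.
Qed.

(** smooth step: 1 for s <= 1, 0 for s >= 4 *)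
Definition step (s : R) : R := flat 0 (4 - s) / (flat 0 (4 - s) + flat 0 (s - 1)).

Lemma step_den_gt0 s : 0 < flat 0 (4 - s) + flat 0 (s - 1).
Proof.
have [s4|s4] := ltP s 4.
  by apply: ltr_wpDr; [exact: flat_ge0|apply: flat_gt0; rewrite subr_gt0].
by apply: ltr_wpDl; [exact: flat_ge0|apply: flat_gt0; rewrite subr_gt0; lra].
Qed.

Lemma step_ge0 s : 0 <= step s.
Proof. by rewrite divr_ge0 ?flat_ge0 // ltW // step_den_gt0. Qed.

Lemma step_le1 s : step s <= 1.
Proof. by rewrite ler_pdivrMr ?step_den_gt0 // mul1r lerDl flat_ge0. Qed.

Lemma step1 s : s <= 1 -> step s = 1.
Proof.
move=> s1; have := step_den_gt0 s; rewrite /step (flat_le0 0 (_ : s - 1 <= 0)) ?subr_le0 // addr0.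
by move=> h; rewrite divff // gt_eqF.
Qed.

Lemma step0 s : 4 <= s -> step s = 0.
Proof. by move=> s4; rewrite /step (flat_le0 0 (_ : 4 - s <= 0)) ?subr_le0 // mul0r. Qed.

Definition chi1 p : R := step (p.1 ^+ 2) * step (p.2 ^+ 2).
Definition chi e p : R := chi1 (p.1 / e, p.2 / e).

Lemma smooth_step U f : open U -> smooth_on U f -> smooth_on U (fun p => step (f p)).
Proof.
move=> oU Sf.
have S1 : smooth_on U (fun p => flat 0 (4 - f p)).
  by apply: smooth_flat => //; apply: smoothB => //; exact: smooth_cst.
have S2 : smooth_on U (fun p => flat 0 (f p - 1)).
  by apply: smooth_flat => //; apply: smoothB => //; exact: smooth_cst.
apply: smoothM => //; apply: smooth_inv => //; first exact: smoothD.
by move=> p _; rewrite gt_eqF // step_den_gt0.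
Qed.

Lemma smooth_chi U e : open U -> smooth_on U (chi e).
Proof.
move=> oU.
have S1 : smooth_on U (fun p => (p.1 / e) ^+ 2).
  by apply: smoothX => //; apply: smoothM => //; [exact: smooth_fst|exact: smooth_cst].
have S2 : smooth_on U (fun p => (p.2 / e) ^+ 2).
  by apply: smoothX => //; apply: smoothM => //; [exact: smooth_snd|exact: smooth_cst].
by apply: smoothM => //; exact: smooth_step.
Qed.

Lemma chi_ge0 e p : 0 <= chi e p.
Proof. by rewrite mulr_ge0 ?step_ge0. Qed.

Lemma chi_le1 e p : chi e p <= 1.
Proof. by rewrite mulr_ile1 ?step_ge0 ?step_le1. Qed.

Lemma chi_eq1 e p : 0 < e -> snorm p <= e -> chi e p = 1.
Proof.
move=> e0; rewrite snorm_le => /andP[h1 h2].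
have aux (x : R) : `|x| <= e -> (x / e) ^+ 2 <= 1.
  move=> xe; rewrite -real_normK ?num_real // expr_le1 ?normr_ge0 //.
  by rewrite normrM normfV (gtr0_norm e0) ler_pdivrMr // mul1r.
by rewrite /chi /chi1 /= !step1 ?mulr1 ?aux.
Qed.

Lemma chi_eq0 e p : 0 < e -> 2 * e <= snorm p -> chi e p = 0.
Proof.
move=> e0; have aux (x : R) : 2 * e <= `|x| -> 4 <= (x / e) ^+ 2.
  move=> xe; rewrite -real_normK ?num_real //.
  have : 2 <= `|x / e| by rewrite normrM normfV (gtr0_norm e0) ler_pdivlMr.
  by move=> h; rewrite (_ : 4 = 2 ^+ 2); [rewrite lerXn2r ?nnegrE ?normr_ge0|rewrite expr2; lra].
rewrite le_max /chi /chi1 /= => /orP[h|h]; first by rewrite step0 ?mul0r ?aux.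
by rewrite [step ((p.2 / e) ^+ 2)]step0 ?mulr0 ?aux.
Qed.

Lemma chi_sym e x y : chi e (- x, y) = chi e (x, y) /\ chi e (x, - y) = chi e (x, y).
Proof. by rewrite /chi /chi1 /= !mulNr !sqrrN. Qed.

End Cutoff.

(*@@@ 5*)
Local Open Scope complex_scope.
Opaque dx dy.

Section ComplexFun.
Context {R : realType}.
Local Notation C := R[i].
Local Notation re := (@complex.Re R).
Local Notation im := (@complex.Im R).
Implicit Types (U V : set (R * R)) (F G : R * R -> C) (p : R * R).

Lemma complex_ext (x y : C) : re x = re y -> im x = im y -> x = y.
Proof. by case: x y => [a b] [c d] /= -> ->. Qed.
Lemma reD (x y : C) : re (x + y) = re x + re y. Proof. by case: x y => [a b] [c d]. Qed.
Lemma imD (x y : C) : im (x + y) = im x + im y. Proof. by case: x y => [a b] [c d]. Qed.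
Lemma reN (x : C) : re (- x) = - re x. Proof. by case: x. Qed.
Lemma imN (x : C) : im (- x) = - im x. Proof. by case: x. Qed.
Lemma reM (x y : C) : re (x * y) = re x * re y - im x * im y.
Proof. by case: x y => [a b] [c d]. Qed.
Lemma imM (x y : C) : im (x * y) = re x * im y + im x * re y.
Proof. by case: x y => [a b] [c d]. Qed.
Lemma reV (x : C) : re x^-1 = re x / (re x ^+ 2 + im x ^+ 2). Proof. by case: x. Qed.
Lemma imV (x : C) : im x^-1 = - im x / (re x ^+ 2 + im x ^+ 2).
Proof. by case: x => a b; rewrite /= mulNr. Qed.
Lemma reR (x : R) : re x%:C = x. Proof. by []. Qed.
Lemma sqr_norm_neq0 (x : C) : x != 0 -> re x ^+ 2 + im x ^+ 2 != 0.
Proof.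
apply: contra; rewrite paddr_eq0 ?sqr_ge0 // !sqrf_eq0 => /andP[/eqP h1 /eqP h2].
by apply/eqP; apply: complex_ext.
Qed.

Definition csm U F := smooth_on U (re \o F) /\ smooth_on U (im \o F).
Definition cdx F p : C := dx (re \o F) p +i* dx (im \o F) p.
Definition cdy F p : C := dy (re \o F) p +i* dy (im \o F) p.
Definition dbar F p : C := 2^-1%:C * (cdx F p + 'i * cdy F p).
Definition dz F p : C := 2^-1%:C * (cdx F p - 'i * cdy F p).
Definition zc p : C := p.1 +i* p.2.

Section near.
Variables (U : set (R * R)) (F G : R * R -> C).
Hypotheses (oU : open U) (FG : forall q, U q -> F q = G q).
Lemma cdx_near p : U p -> cdx F p = cdx G p.
Proof. by move=> Up; congr (_ +i* _); apply: (dx_near oU Up) => q /FG /= ->. Qed.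
Lemma cdy_near p : U p -> cdy F p = cdy G p.
Proof. by move=> Up; congr (_ +i* _); apply: (dy_near oU Up) => q /FG /= ->. Qed.
Lemma dbar_near p : U p -> dbar F p = dbar G p.
Proof. by move=> Up; rewrite /dbar cdx_near ?cdy_near. Qed.
Lemma dz_near p : U p -> dz F p = dz G p.
Proof. by move=> Up; rewrite /dz cdx_near ?cdy_near. Qed.
Lemma csm_ext : csm U F -> csm U G.
Proof.
by case=> S1 S2; split; [apply: smooth_on_ext S1|apply: smooth_on_ext S2] => // q /FG /= ->.
Qed.
End near.

Lemma csm_cst U c : open U -> csm U (fun=> c).
Proof. by move=> oU; split; exact: smooth_cst. Qed.
Lemma csmU U V F : csm U F -> csm V F -> csm (U `|` V) F.
Proof. by move=> [? ?] [? ?]; split; exact: smooth_onU. Qed.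
Lemma csm_sub U V F : V `<=` U -> csm U F -> csm V F.
Proof. by move=> VU [? ?]; split; apply: smooth_on_sub VU _. Qed.
Lemma csm_zc U : open U -> csm U zc.
Proof. by move=> oU; split; [exact: smooth_fst|exact: smooth_snd]. Qed.
Lemma csm_real U f : open U -> smooth_on U f -> csm U (fun p => (f p)%:C).
Proof. by move=> oU Sf; split => //; exact: smooth_cst. Qed.

Section rules.
Variables (U : set (R * R)).
Hypothesis (oU : open U).

Lemma csmD F G : csm U F -> csm U G -> csm U (fun p => F p + G p).
Proof.
move=> [F1 F2] [G1 G2]; split.
  by apply: smooth_on_ext (smoothD oU F1 G1) => // p _ /=; rewrite reD.
by apply: smooth_on_ext (smoothD oU F2 G2) => // p _ /=; rewrite imD.
Qed.
Lemma csmN F : csm U F -> csm U (fun p => - F p).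
Proof.
move=> [F1 F2]; split.
  by apply: smooth_on_ext (smoothN oU F1) => // p _ /=; rewrite reN.
by apply: smooth_on_ext (smoothN oU F2) => // p _ /=; rewrite imN.
Qed.
Lemma csmB F G : csm U F -> csm U G -> csm U (fun p => F p - G p).
Proof. by move=> SF SG; apply: csmD => //; exact: csmN. Qed.
Lemma csmM F G : csm U F -> csm U G -> csm U (fun p => F p * G p).
Proof.
move=> [F1 F2] [G1 G2]; split.
  apply: smooth_on_ext (smoothB oU (smoothM oU F1 G1) (smoothM oU F2 G2)) => // p _ /=.
  by rewrite reM.
apply: smooth_on_ext (smoothD oU (smoothM oU F1 G2) (smoothM oU F2 G1)) => // p _ /=.
by rewrite imM.
Qed.
Lemma csmV F : csm U F -> (forall p, U p -> F p != 0) -> csm U (fun p => (F p)^-1).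
Proof.
move=> [F1 F2] F0.
have S : smooth_on U (fun p => re (F p) ^+ 2 + im (F p) ^+ 2).
  by apply: smoothD => //; apply: smoothX.
have Si := smooth_inv oU S (fun p Up => sqr_norm_neq0 (F0 p Up)).
split.
  by apply: smooth_on_ext (smoothM oU F1 Si) => // p _ /=; rewrite reV.
by apply: smooth_on_ext (smoothM oU (smoothN oU F2) Si) => // p _ /=; rewrite imV.
Qed.
Lemma csmX F n : csm U F -> csm U (fun p => F p ^+ n).
Proof.
move=> SF; elim: n => [|n IH]; first exact: csm_cst.
by apply: (csm_ext oU _ (csmM SF IH)) => p _; rewrite exprS.
Qed.
Lemma csm_conj F : csm U F -> csm U (fun p => (F p)^*).
Proof.
move=> [F1 F2]; split.
  by apply: smooth_on_ext F1 => // p _ /=; case: (F p).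
by apply: smooth_on_ext (smoothN oU F2) => // p _ /=; case: (F p).
Qed.
Lemma csm_cdx F : csm U F -> csm U (cdx F).
Proof. by move=> [F1 F2]; split; exact: smooth_dx. Qed.
Lemma csm_cdy F : csm U F -> csm U (cdy F).
Proof. by move=> [F1 F2]; split; exact: smooth_dy. Qed.
Lemma csm_dbar F : csm U F -> csm U (dbar F).
Proof.
move=> SF; apply: csmM; first exact: csm_cst.
apply: csmD; first exact: csm_cdx.
by apply: csmM; [exact: csm_cst|exact: csm_cdy].
Qed.
Lemma csm_dz F : csm U F -> csm U (dz F).
Proof.
move=> SF; apply: csmM; first exact: csm_cst.
apply: csmB; first exact: csm_cdx.
by apply: csmM; [exact: csm_cst|exact: csm_cdy].
Qed.

Section pt.
Variables (p : R * R).
Hypothesis Up : U p.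
Lemma cdxD F G : csm U F -> csm U G -> cdx (fun p => F p + G p) p = cdx F p + cdx G p.
Proof.
move=> [F1 F2] [G1 G2]; apply: complex_ext; rewrite ?reD ?imD /=.
  rewrite -(dxD F1 G1 Up); apply: (dx_near oU Up) => q _ /=; exact: reD.
rewrite -(dxD F2 G2 Up); apply: (dx_near oU Up) => q _ /=; exact: imD.
Qed.
Lemma cdyD F G : csm U F -> csm U G -> cdy (fun p => F p + G p) p = cdy F p + cdy G p.
Proof.
move=> [F1 F2] [G1 G2]; apply: complex_ext; rewrite ?reD ?imD /=.
  rewrite -(dyD F1 G1 Up); apply: (dy_near oU Up) => q _ /=; exact: reD.
rewrite -(dyD F2 G2 Up); apply: (dy_near oU Up) => q _ /=; exact: imD.
Qed.
Lemma cdxM F G : csm U F -> csm U G ->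
  cdx (fun p => F p * G p) p = cdx F p * G p + F p * cdx G p.
Proof.
move=> [F1 F2] [G1 G2].
have E1 : dx (re \o (fun p => F p * G p)) p = dx (re \o F) p * re (G p) + re (F p) * dx (re \o G) p
   - (dx (im \o F) p * im (G p) + im (F p) * dx (im \o G) p).
  rewrite -(dxM F1 G1 Up) -(dxM F2 G2 Up) -(dxB (smoothM oU F1 G1) (smoothM oU F2 G2) Up).
  apply: (dx_near oU Up) => q _ /=; exact: reM.
have E2 : dx (im \o (fun p => F p * G p)) p = dx (re \o F) p * im (G p) + re (F p) * dx (im \o G) p
   + (dx (im \o F) p * re (G p) + im (F p) * dx (re \o G) p).
  rewrite -(dxM F1 G2 Up) -(dxM F2 G1 Up) -(dxD (smoothM oU F1 G2) (smoothM oU F2 G1) Up).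
  apply: (dx_near oU Up) => q _ /=; exact: imM.
rewrite /cdx E1 E2; move: (dx _ _) (dx _ _) (dx _ _) (dx _ _) (F p) (G p) => a b c d [x y] [s t].
by apply: complex_ext; rewrite /=; ring.
Qed.
Lemma cdyM F G : csm U F -> csm U G ->
  cdy (fun p => F p * G p) p = cdy F p * G p + F p * cdy G p.
Proof.
move=> [F1 F2] [G1 G2].
have E1 : dy (re \o (fun p => F p * G p)) p = dy (re \o F) p * re (G p) + re (F p) * dy (re \o G) p
   - (dy (im \o F) p * im (G p) + im (F p) * dy (im \o G) p).
  rewrite -(dyM F1 G1 Up) -(dyM F2 G2 Up) -(dyB (smoothM oU F1 G1) (smoothM oU F2 G2) Up).
  apply: (dy_near oU Up) => q _ /=; exact: reM.
have E2 : dy (im \o (fun p => F p * G p)) p = dy (re \o F) p * im (G p) + re (F p) * dy (im \o G) p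
   + (dy (im \o F) p * re (G p) + im (F p) * dy (re \o G) p).
  rewrite -(dyM F1 G2 Up) -(dyM F2 G1 Up) -(dyD (smoothM oU F1 G2) (smoothM oU F2 G1) Up).
  apply: (dy_near oU Up) => q _ /=; exact: imM.
rewrite /cdy E1 E2; move: (dy _ _) (dy _ _) (dy _ _) (dy _ _) (F p) (G p) => a b c d [x y] [s t].
by apply: complex_ext; rewrite /=; ring.
Qed.
Lemma dbarD F G : csm U F -> csm U G -> dbar (fun p => F p + G p) p = dbar F p + dbar G p.
Proof. by move=> SF SG; rewrite /dbar cdxD // cdyD //; ring. Qed.
Lemma dzD F G : csm U F -> csm U G -> dz (fun p => F p + G p) p = dz F p + dz G p.
Proof. by move=> SF SG; rewrite /dz cdxD // cdyD //; ring. Qed.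
Lemma dbarM F G : csm U F -> csm U G ->
  dbar (fun p => F p * G p) p = dbar F p * G p + F p * dbar G p.
Proof. by move=> SF SG; rewrite /dbar cdxM // cdyM //; ring. Qed.
Lemma dzM F G : csm U F -> csm U G ->
  dz (fun p => F p * G p) p = dz F p * G p + F p * dz G p.
Proof. by move=> SF SG; rewrite /dz cdxM // cdyM //; ring. Qed.
End pt.
End rules.

Lemma cdx_cst c p : cdx (fun=> c) p = 0.
Proof. by rewrite /cdx !dx_cst. Qed.
Lemma cdy_cst c p : cdy (fun=> c) p = 0.
Proof. by rewrite /cdy !dy_cst. Qed.
Lemma dbar_cst c p : dbar (fun=> c) p = 0.
Proof. by rewrite /dbar cdx_cst cdy_cst !mulr0 addr0 mulr0. Qed.
Lemma dz_cst c p : dz (fun=> c) p = 0.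
Proof. by rewrite /dz cdx_cst cdy_cst !mulr0 subr0 mulr0. Qed.

(** holomorphic functions *)
Definition hol U F := csm U F /\ forall p, U p -> dbar F p = 0.

Lemma dx_fst p : dx (fun q : R * R => q.1) p = 1.
Proof.
apply: dx_val; apply/is_derive_line.
rewrite (_ : (fun h : R => _) = (fun h : R => h + p.1)).
  have D1 := @is_derive_id R R 0 1; have D2 := @is_derive_cst R R R p.1 0 1.
  by have := is_deriveD D1 D2; rewrite addr0.
by apply/funext => h /=; rewrite [h *: _]mulr1.
Qed.
Lemma dy_fst p : dy (fun q : R * R => q.1) p = 0.
Proof.
apply: dy_val; apply/is_derive_line.
rewrite (_ : (fun h : R => _) = (fun h : R => p.1)); first exact: is_derive_cst.
by apply/funext => h /=; rewrite [h *: _]mulr0 add0r.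
Qed.
Lemma dx_snd p : dx (fun q : R * R => q.2) p = 0.
Proof.
apply: dx_val; apply/is_derive_line.
rewrite (_ : (fun h : R => _) = (fun h : R => p.2)); first exact: is_derive_cst.
by apply/funext => h /=; rewrite [h *: _]mulr0 add0r.
Qed.
Lemma dy_snd p : dy (fun q : R * R => q.2) p = 1.
Proof.
apply: dy_val; apply/is_derive_line.
rewrite (_ : (fun h : R => _) = (fun h : R => h + p.2)).
  have D1 := @is_derive_id R R 0 1; have D2 := @is_derive_cst R R R p.2 0 1.
  by have := is_deriveD D1 D2; rewrite addr0.
by apply/funext => h /=; rewrite [h *: _]mulr1.
Qed.

Lemma cdx_zc p : cdx zc p = 1.
Proof. by apply: complex_ext; [exact: dx_fst|exact: dx_snd]. Qed.
Lemma cdy_zc p : cdy zc p = 'i.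
Proof. by apply: complex_ext; [exact: dy_fst|exact: dy_snd]. Qed.
Lemma dbar_zc p : dbar zc p = 0.
Proof. by rewrite /dbar cdx_zc cdy_zc; apply: complex_ext; rewrite /=; ring. Qed.
Lemma dz_zc p : dz zc p = 1.
Proof. by rewrite /dz cdx_zc cdy_zc; apply: complex_ext; rewrite /=; field. Qed.

Section hol.
Variables (U : set (R * R)).
Hypothesis (oU : open U).
Lemma hol_cst c : hol U (fun=> c).
Proof. by split; [exact: csm_cst|move=> p _; exact: dbar_cst]. Qed.
Lemma hol_zc : hol U zc.
Proof. by split; [exact: csm_zc|move=> p _; exact: dbar_zc]. Qed.
Lemma holD F G : hol U F -> hol U G -> hol U (fun p => F p + G p).
Proof.
move=> [SF DF] [SG DG]; split; first exact: csmD.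
by move=> p Up; rewrite (dbarD oU Up SF SG) DF // DG // addr0.
Qed.
Lemma holM F G : hol U F -> hol U G -> hol U (fun p => F p * G p).
Proof.
move=> [SF DF] [SG DG]; split; first exact: csmM.
by move=> p Up; rewrite (dbarM oU Up SF SG) DF // DG // mul0r mulr0 addr0.
Qed.
Lemma holZ c F : hol U F -> hol U (fun p => c * F p).
Proof. by move=> HF; exact: (holM (hol_cst c) HF). Qed.
Lemma hol_ext F G : (forall p, U p -> F p = G p) -> hol U F -> hol U G.
Proof.
move=> FG [SF DF]; split; first exact: csm_ext SF.
by move=> p Up; rewrite -(dbar_near oU FG Up) DF.
Qed.
Lemma holN F : hol U F -> hol U (fun p => - F p).
Proof. by move=> HF; apply: hol_ext (holZ (-1) HF) => p _; rewrite mulN1r. Qed.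
Lemma holB F G : hol U F -> hol U G -> hol U (fun p => F p - G p).
Proof. by move=> HF HG; exact: (holD HF (holN HG)). Qed.
Lemma holX F n : hol U F -> hol U (fun p => F p ^+ n).
Proof.
move=> HF; elim: n => [|n IH]; first exact: hol_cst.
by apply: hol_ext (holM HF IH) => p _; rewrite exprS.
Qed.
Lemma holV F : hol U F -> (forall p, U p -> F p != 0) -> hol U (fun p => (F p)^-1).
Proof.
move=> [SF DF] F0; have SV := csmV oU SF F0; split => // p Up.
have : dbar (fun p => F p * (F p)^-1) p = 0.
  rewrite (dbar_near oU (G := fun=> 1)) ?dbar_cst // => q Uq.
  by rewrite divff // F0.
rewrite (dbarM oU Up SF SV) DF // mul0r add0r => /eqP; rewrite mulf_eq0 (negbTE (F0 p Up)) /=.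
by move/eqP.
Qed.

Lemma cdxdyC F p : csm U F -> U p -> cdx (cdy F) p = cdy (cdx F) p.
Proof.
move=> [F1 F2] Up.
transitivity (dx (dy (re \o F)) p +i* dx (dy (im \o F)) p); first by [].
by rewrite (dxdyC oU F1 Up) (dxdyC oU F2 Up).
Qed.

Lemma cdxZ c F p : U p -> csm U F -> cdx (fun q => c * F q) p = c * cdx F p.
Proof. by move=> Up SF; rewrite (cdxM oU Up (csm_cst c oU) SF) cdx_cst mul0r add0r. Qed.
Lemma cdyZ c F p : U p -> csm U F -> cdy (fun q => c * F q) p = c * cdy F p.
Proof. by move=> Up SF; rewrite (cdyM oU Up (csm_cst c oU) SF) cdy_cst mul0r add0r. Qed.
Lemma dbarZ c F p : U p -> csm U F -> dbar (fun q => c * F q) p = c * dbar F p.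
Proof. by move=> Up SF; rewrite (dbarM oU Up (csm_cst c oU) SF) dbar_cst mul0r add0r. Qed.
Lemma dzZ c F p : U p -> csm U F -> dz (fun q => c * F q) p = c * dz F p.
Proof. by move=> Up SF; rewrite (dzM oU Up (csm_cst c oU) SF) dz_cst mul0r add0r. Qed.

Lemma dbar_dzC F p : csm U F -> U p -> dbar (dz F) p = dz (dbar F) p.
Proof.
move=> SF Up; have Sx := csm_cdx SF; have Sy := csm_cdy SF.
have Siy c := csmM oU (csm_cst c oU) Sy.
have Sp c := csmD oU Sx (Siy c).
have E1 c : cdx (fun q => 2^-1%:C * (cdx F q + c * cdy F q)) p =
    2^-1%:C * (cdx (cdx F) p + c * cdx (cdy F) p).
  by rewrite (cdxZ _ Up (Sp c)) (cdxD oU Up Sx (Siy c)) (cdxZ _ Up Sy).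
have E2 c : cdy (fun q => 2^-1%:C * (cdx F q + c * cdy F q)) p =
    2^-1%:C * (cdy (cdx F) p + c * cdy (cdy F) p).
  by rewrite (cdyZ _ Up (Sp c)) (cdyD oU Up Sx (Siy c)) (cdyZ _ Up Sy).
have Edz : dz F = (fun q => 2^-1%:C * (cdx F q + - 'i * cdy F q)).
  by apply/funext => q; rewrite mulNr.
rewrite Edz {1}/dbar E1 E2 /dz [cdx (dbar F) p]E1 [cdy (dbar F) p]E2 (cdxdyC SF Up).
move: (cdx _ _) (cdy _ _) (cdy _ _) => a b c; ring.
Qed.

Lemma hol_dz F : hol U F -> hol U (dz F).
Proof.
move=> [SF DF]; split; first exact: csm_dz.
move=> p Up; rewrite (dbar_dzC SF Up) (dz_near oU (G := fun=> 0)) ?dz_cst //.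
Qed.

Lemma hol_cdx F p : hol U F -> U p -> dz F p = cdx F p /\ cdy F p = 'i * cdx F p.
Proof.
move=> [SF DF] Up; have := DF p Up; rewrite /dbar /dz => /eqP.
rewrite mulf_eq0 => /orP[/eqP h|].
  have : re (2^-1%:C : C) = 0 by rewrite h.
  by move=> /= /eqP; rewrite invr_eq0 pnatr_eq0.
rewrite addr_eq0 => /eqP E.
have i2 : 'i * 'i = -1 :> C by rewrite -expr2 sqr_i.
have -> : cdy F p = 'i * cdx F p by rewrite E mulrN mulrA i2 mulN1r opprK.
split=> //; rewrite mulrA i2 mulN1r opprK.
have -> : 2^-1%:C = 2^-1 :> C by rewrite rmorphV ?unitfE ?pnatr_eq0 // rmorph_nat.
by field.
Qed.
End hol.

End ComplexFun.

(*@@@ 6*)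
Opaque dx dy.

Section ChiBounds.
Context {R : realType}.
Implicit Types (f g : R * R -> R) (e t : R) (p : R * R).

Definition scal e p : R * R := (p.1 / e, p.2 / e).

Lemma is_derive_scal f e p v a : is_derive (scal e p) v f a ->
  is_derive p v (f \o scal e) (e^-1 * a).
Proof.
move=> /is_derive_line D; apply/is_derive_line.
have D2 : is_derive (0 : R) 1 (fun h : R => h * e^-1) e^-1.
  have := is_deriveM (@is_derive_id R R 0 1) (@is_derive_cst R R R e^-1 0 1).
  by rewrite -![_ *: _]/(_ * _) mulr0 add0r mulr1.
have D1 : is_derive (0 * e^-1) 1 (fun h : R => f (h *: v + scal e p)) a by rewrite mul0r.
have := @is_derive1_comp R _ (fun h : R => h * e^-1) 0 _ _ D1 D2.
rewrite mulrC; congr (is_derive _ _ _ _); apply/funext => h /=; congr f.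
apply: injective_projections => /=; rewrite -![_ *: _]/(_ * _).
  by rewrite mulrAC -mulrDl.
by rewrite mulrAC -mulrDl.
Qed.

Lemma smooth_scal f e : smooth_on setT f -> smooth_on setT (f \o scal e).
Proof.
move=> Sf; apply: (@smooth_coind _ setT [set g | exists c h, smooth_on setT h /\ g = (fun p => c * h (scal e p))]).
- exact: openT.
- move=> _ [c [h [Sh ->]]] p _; apply: continuousM; first exact: cvg_cst.
  apply: (@continuous_comp _ _ _ (scal e) h); last exact: smooth_continuous Sh _.
  have S1 := smoothM openT (smooth_fst openT) (smooth_cst e^-1 openT).
  have S2 := smoothM openT (smooth_snd openT) (smooth_cst e^-1 openT).
  exact: (cvg_pair (smooth_continuous S1 (I : setT p)) (smooth_continuous S2 (I : setT p))).
- move=> _ v [c [h [Sh ->]]] ev; exists (fun p => (c * e^-1) * dv v h (scal e p)).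
    apply: span_in; exists (c * e^-1), (dv v h); split => //; exact: smooth_dv.
  move=> p _; have D := is_derive_scal (smooth_is_derive Sh (I : setT (scal e p)) ev).
  by have := is_deriveZ c D; rewrite -[_ *: _]/(_ * _) mulrA.
- by exists 1, f; split => //; apply/funext => p /=; rewrite mul1r.
Qed.

Lemma dx_scal f e p : smooth_on setT f -> dx (f \o scal e) p = e^-1 * dx f (scal e p).
Proof. by move=> Sf; exact: dx_val (is_derive_scal (smooth_is_dx Sf (I : setT (scal e p)))). Qed.
Lemma dy_scal f e p : smooth_on setT f -> dy (f \o scal e) p = e^-1 * dy f (scal e p).
Proof. by move=> Sf; exact: dy_val (is_derive_scal (smooth_is_dy Sf (I : setT (scal e p)))). Qed.

Lemma smooth_chi1 : smooth_on setT (@chi1 R).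
Proof.
have S := @smooth_chi R setT 1 openT; apply: smooth_on_ext S; first exact: openT.
by move=> [x y] _; rewrite /chi /= !divr1.
Qed.

Lemma chiE e : chi e = @chi1 R \o scal e. Proof. by []. Qed.

Lemma bounded_support f r : smooth_on setT f -> (forall p, r < snorm p -> f p = 0) ->
  exists2 M, 0 < M & forall p, `|f p| <= M.
Proof.
move=> Sf f0.
have [M HM] : exists M, forall p, rect (- r) r (- r) r p -> `|f p| <= M.
  by apply: rect_bounded => p _; exact: smooth_continuous Sf I.
exists (Num.max M 1); first by rewrite lt_max ltr01 orbT.
move=> p; have [pr|pr] := leP (snorm p) r; rewrite le_max.
  by rewrite HM //; apply/snorm_rect.
by rewrite f0 // normr0 ler01 orbT.
Qed.

Lemma chi1_0 p : 2 < snorm p -> chi1 p = 0 :> R.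
Proof.
move=> h; have := @chi_eq0 R 1 p ltr01; rewrite /chi !divr1 -surjective_pairing; apply.
by rewrite mulr1 ltW.
Qed.

Lemma d_out f r : (forall p : R * R, r < snorm p -> f p = 0) ->
  (forall p, r < snorm p -> dx f p = 0) /\ (forall p, r < snorm p -> dy f p = 0).
Proof.
move=> f0; split=> p hp.
  by rewrite (dx_near (g := fun=> 0) (@open_snorm_gt R r) hp f0) ?dx_cst.
by rewrite (dy_near (g := fun=> 0) (@open_snorm_gt R r) hp f0) ?dy_cst.
Qed.

Lemma d_in f r c : (forall p : R * R, snorm p < r -> f p = c) ->
  (forall p, snorm p < r -> dx f p = 0) /\ (forall p, snorm p < r -> dy f p = 0).
Proof.
move=> f0; split=> p hp.
  by rewrite (dx_near (g := fun=> c) (@open_snorm_lt R r) hp f0) ?dx_cst.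
by rewrite (dy_near (g := fun=> c) (@open_snorm_lt R r) hp f0) ?dy_cst.
Qed.

Lemma chi_bounds : exists2 M : R, 0 < M & forall e p, 0 < e ->
  [/\ `|dx (chi e) p| <= M / e, `|dy (chi e) p| <= M / e &
   [/\ `|dx (dx (chi e)) p| <= M / e ^+ 2, `|dy (dx (chi e)) p| <= M / e ^+ 2,
       `|dx (dy (chi e)) p| <= M / e ^+ 2 & `|dy (dy (chi e)) p| <= M / e ^+ 2]].
Proof.
have S := smooth_chi1; have Sx := smooth_dx S; have Sy := smooth_dy S.
have [ox oy] := d_out chi1_0; have [oxx oxy] := d_out ox; have [oyx oyy] := d_out oy.
have [M1 p1 H1] := bounded_support Sx ox.
have [M2 p2 H2] := bounded_support Sy oy.
have [M3 p3 H3] := bounded_support (smooth_dx Sx) oxx.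
have [M4 p4 H4] := bounded_support (smooth_dy Sx) oxy.
have [M5 p5 H5] := bounded_support (smooth_dx Sy) oyx.
have [M6 p6 H6] := bounded_support (smooth_dy Sy) oyy.
pose M := M1 + M2 + M3 + M4 + M5 + M6; exists M; first by rewrite !addr_gt0.
have [h1 h2 h3] : [/\ M1 <= M, M2 <= M & M3 <= M] by rewrite /M; split; lra.
have [h4 h5 h6] : [/\ M4 <= M, M5 <= M & M6 <= M] by rewrite /M; split; lra.
move=> e p e0.
have Ex q : dx (chi e) q = e^-1 * dx chi1 (scal e q) by rewrite chiE dx_scal.
have Ey q : dy (chi e) q = e^-1 * dy chi1 (scal e q) by rewrite chiE dy_scal.
have Zx f q : smooth_on setT f -> dx (fun q => e^-1 * f (scal e q)) q = e^-1 * (e^-1 * dx f (scal e q)).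
  by move=> Sf; rewrite (dxZ (smooth_scal e Sf) I) dx_scal.
have Zy f q : smooth_on setT f -> dy (fun q => e^-1 * f (scal e q)) q = e^-1 * (e^-1 * dy f (scal e q)).
  by move=> Sf; rewrite (dyZ (smooth_scal e Sf) I) dy_scal.
have b1 (x y : R) : `|x| <= y -> `|e^-1 * x| <= y / e.
  by move=> h; rewrite normrM gtr0_norm ?invr_gt0 // mulrC ler_pM2r ?invr_gt0.
have b2 (x y : R) : `|x| <= y -> `|e^-1 * (e^-1 * x)| <= y / e ^+ 2.
  by move=> h; rewrite (le_trans (b1 _ _ (b1 _ _ h))) // expr2 invfM mulrA.
have Fx : dx (chi e) = (fun q => e^-1 * dx chi1 (scal e q)) := funext Ex.
have Fy : dy (chi e) = (fun q => e^-1 * dy chi1 (scal e q)) := funext Ey.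
have Exx := etrans (congr1 (fun f => dx f p) Fx) (Zx _ p Sx).
have Eyx := etrans (congr1 (fun f => dy f p) Fx) (Zy _ p Sx).
have Exy := etrans (congr1 (fun f => dx f p) Fy) (Zx _ p Sy).
have Eyy := etrans (congr1 (fun f => dy f p) Fy) (Zy _ p Sy).
split.
- exact: (eq_rect_r (fun z => `|z| <= M / e) (b1 _ _ (le_trans (H1 (scal e p)) h1)) (Ex p)).
- exact: (eq_rect_r (fun z => `|z| <= M / e) (b1 _ _ (le_trans (H2 (scal e p)) h2)) (Ey p)).
split.
- exact: (eq_rect_r (fun z => `|z| <= M / e ^+ 2) (b2 _ _ (le_trans (H3 (scal e p)) h3)) Exx).
- exact: (eq_rect_r (fun z => `|z| <= M / e ^+ 2) (b2 _ _ (le_trans (H4 (scal e p)) h4)) Eyx).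
- exact: (eq_rect_r (fun z => `|z| <= M / e ^+ 2) (b2 _ _ (le_trans (H5 (scal e p)) h5)) Exy).
- exact: (eq_rect_r (fun z => `|z| <= M / e ^+ 2) (b2 _ _ (le_trans (H6 (scal e p)) h6)) Eyy).
Qed.

Lemma is_derive_step (s : R) : exists2 d : R, d <= 0 & is_derive s 1 (@step R) d.
Proof.
pose A (s : R) := flat 0 (4 - s); pose B (s : R) := flat 0 (s - 1).
have DA : is_derive s 1 A (- flat 2 (4 - s)).
  have D1 := is_deriveB (@is_derive_cst R R R 4 s 1) (@is_derive_id R R s 1).
  have := @is_derive1_comp R (flat 0) (fun s => 4 - s) s _ _ (is_derive_flat 0 (4 - s)) D1.
  by rewrite oppr0 mul0r add0r sub0r mulrN1.
have DB : is_derive s 1 B (flat 2 (s - 1)).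
  have D1 := is_deriveB (@is_derive_id R R s 1) (@is_derive_cst R R R 1 s 1).
  have := @is_derive1_comp R (flat 0) (fun s => s - 1) s _ _ (is_derive_flat 0 (s - 1)) D1.
  by rewrite oppr0 mul0r add0r addr0 mulr1.
have DAB := is_deriveD DA DB.
have AB0 : (A + B) s != 0 by rewrite gt_eqF // step_den_gt0.
have DV := is_deriveV AB0 DAB.
have D := is_deriveM DA DV.
exists (- (flat 2 (4 - s) * B s + A s * flat 2 (s - 1)) / (A s + B s) ^+ 2).
  rewrite mulNr oppr_le0 divr_ge0 ?sqr_ge0 // addr_ge0 // mulr_ge0 ?flat_ge0 //.
move: D; set a := (X in is_derive _ _ _ X) => D; set b := (X in is_derive _ _ _ X).
suff -> : b = a by [].
rewrite /a /b -![_ *: _]/(_ * _).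
move: AB0; rewrite -![(A + B) s]/(A s + B s); move: (A s) (B s) (flat 2 _) (flat 2 _) => x y z t xy.
by field.
Qed.

Lemma chi_radial e p : 0 < e -> p.1 * dx (chi e) p <= 0 /\ p.2 * dy (chi e) p <= 0.
Proof.
move=> e0.
have aux (x : R) : exists2 d : R, x * d <= 0 & is_derive x 1 (fun x => step ((x / e) ^+ 2)) d.
  have [d d0 D] := is_derive_step ((x / e) ^+ 2).
  have D2 : is_derive x 1 (fun x => (x / e) ^+ 2) (2 * (x / e) * e^-1).
    have D3 : is_derive x 1 (fun x => x / e) e^-1.
      have := is_deriveM (@is_derive_id R R x 1) (@is_derive_cst R R R e^-1 x 1).
      by rewrite -![_ *: _]/(_ * _) mulr0 add0r mulr1.
    have := is_deriveM D3 D3; rewrite -![_ *: _]/(_ * _).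
    set a := (X in is_derive _ _ _ X) => D'; set b := (X in is_derive _ _ _ X).
    by have -> : b = a by rewrite /a /b; ring.
  exists (d * (2 * (x / e) * e^-1)).
    rewrite (_ : _ * _ = d * (2 * (x / e) ^+ 2)); last by rewrite expr2; ring.
    by rewrite mulr_le0_ge0 // mulr_ge0 // sqr_ge0.
  exact: (@is_derive1_comp R step (fun x => (x / e) ^+ 2) x _ _ D D2).
split.
  have [d h D] := aux p.1.
  have D1 := is_derive_comp1 D (smooth_is_dx (@smooth_fst R setT openT) (I : setT p)).
  have D2 := is_deriveM D1 (@is_derive_cst _ _ _ (step ((p.2 / e) ^+ 2)) p e_x).
  have S2 : smooth_on setT (fun q : R * R => step ((q.2 / e) ^+ 2)).
    apply: smooth_step; first exact: openT.
    apply: smoothX; first exact: openT.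
    by apply: smoothM; [exact: openT|apply: smooth_snd; exact: openT|apply: smooth_cst; exact: openT].
  have S1 : smooth_on setT (fun q : R * R => step ((q.1 / e) ^+ 2)).
    apply: smooth_step; first exact: openT.
    apply: smoothX; first exact: openT.
    by apply: smoothM; [exact: openT|apply: smooth_fst; exact: openT|apply: smooth_cst; exact: openT].
  rewrite (_ : chi e = fun q => step ((q.1 / e) ^+ 2) * step ((q.2 / e) ^+ 2)) //.
  rewrite (dxM S1 S2 I) (dx_val D1) dx_fst mulr1.
  have E : is_derive p e_x (fun q : R * R => step ((q.2 / e) ^+ 2)) 0.
    have [d' _ D'] := aux p.2.
    have := is_derive_comp1 D' (smooth_is_dx (@smooth_snd R setT openT) (I : setT p)).
    by rewrite dx_snd mulr0.
  by rewrite (dx_val E) mulr0 addr0 mulrA mulr_le0_ge0 ?step_ge0.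
have [d h D] := aux p.2.
have S2 : smooth_on setT (fun q : R * R => step ((q.2 / e) ^+ 2)).
  apply: smooth_step; first exact: openT.
  apply: smoothX; first exact: openT.
  by apply: smoothM; [exact: openT|apply: smooth_snd; exact: openT|apply: smooth_cst; exact: openT].
have S1 : smooth_on setT (fun q : R * R => step ((q.1 / e) ^+ 2)).
  apply: smooth_step; first exact: openT.
  apply: smoothX; first exact: openT.
  by apply: smoothM; [exact: openT|apply: smooth_fst; exact: openT|apply: smooth_cst; exact: openT].
have D1 := is_derive_comp1 D (smooth_is_dy (@smooth_snd R setT openT) (I : setT p)).
rewrite (_ : chi e = fun q => step ((q.1 / e) ^+ 2) * step ((q.2 / e) ^+ 2)) //.
rewrite (dyM S1 S2 I) (dy_val D1) dy_snd mulr1.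
have E : is_derive p e_y (fun q : R * R => step ((q.1 / e) ^+ 2)) 0.
  have [d' _ D'] := aux p.1.
  have := is_derive_comp1 D' (smooth_is_dy (@smooth_fst R setT openT) (I : setT p)).
  by rewrite dy_fst mulr0.
by rewrite (dy_val E) mul0r add0r mulrCA mulr_ge0_le0 ?step_ge0.
Qed.

End ChiBounds.

(*@@@ 7*)
Local Open Scope complex_scope.
Opaque dx dy.

Section Norm.
Context {R : realType}.
Local Notation C := R[i].
Local Notation re := (@complex.Re R).
Local Notation im := (@complex.Im R).
Implicit Types (x y : C) (p q : R * R).
Definition nc x : R := Normc.normc x.

Lemma ncE x : nc x = Num.sqrt (re x ^+ 2 + im x ^+ 2). Proof. by case: x. Qed.
Lemma nc_ge0 x : 0 <= nc x. Proof. by rewrite ncE sqrtr_ge0. Qed.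
Lemma nc0 : nc 0 = 0. Proof. exact: Normc.normc0. Qed.
Lemma ncM x y : nc (x * y) = nc x * nc y. Proof. exact: Normc.normcM. Qed.
Lemma ncV x : nc x^-1 = (nc x)^-1. Proof. exact: Normc.normcV. Qed.
Lemma ncD x y : nc (x + y) <= nc x + nc y. Proof. exact: le_normcD. Qed.
Lemma ncN x : nc (- x) = nc x. Proof. exact: normcN. Qed.
Lemma ncB x y : nc (x - y) <= nc x + nc y. Proof. by rewrite -(ncN y) ncD. Qed.
Lemma nc_eq0 x : nc x = 0 -> x = 0. Proof. exact: Normc.eq0_normc. Qed.
Lemma nc_gt0 x : (0 < nc x) = (x != 0).
Proof.
rewrite lt0r nc_ge0 andbT; apply/idP/idP; apply: contra => /eqP; first by move=> ->; rewrite nc0.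
by move/nc_eq0 => ->.
Qed.
Lemma ncR (k : R) : nc k%:C = `|k|.
Proof. by rewrite ncE /= expr0n addr0 sqrtr_sqr. Qed.
Lemma nci : nc 'i = 1.
Proof. by rewrite ncE /= expr0n add0r expr1n sqrtr1. Qed.
Lemma nc1 : nc 1 = 1.
Proof. by rewrite ncE /= expr0n addr0 expr1n sqrtr1. Qed.
Lemma nc_re x : `|re x| <= nc x.
Proof. by rewrite ncE -sqrtr_sqr ler_sqrt ?addr_ge0 ?sqr_ge0 // lerDl sqr_ge0. Qed.
Lemma nc_im x : `|im x| <= nc x.
Proof. by rewrite ncE -sqrtr_sqr ler_sqrt ?addr_ge0 ?sqr_ge0 // lerDr sqr_ge0. Qed.
Lemma nc_le x : nc x <= `|re x| + `|im x|.
Proof.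
rewrite ncE -(ger0_norm (_ : 0 <= `|re x| + `|im x|)) ?addr_ge0 // -sqrtr_sqr.
rewrite ler_sqrt ?sqr_ge0 // sqrrD !real_normK ?num_real // lerD2r lerDl.
by rewrite mulrn_wge0 // mulr_ge0.
Qed.

Lemma snormE p : snorm p = `|p|. Proof. by []. Qed.
Lemma snormD p q : snorm (p + q) <= snorm p + snorm q. Proof. by rewrite !snormE ler_normD. Qed.
Lemma snormB p q : snorm (p - q) = snorm (q - p). Proof. by rewrite !snormE distrC. Qed.
Lemma snorm_sub p q : snorm p - snorm q <= snorm (p - q).
Proof. by rewrite !snormE lerB_dist. Qed.
Lemma snorm_nc p : snorm p <= nc (zc p).
Proof. by rewrite snorm_le; apply/andP; split; [exact: (nc_re (zc p))|exact: (nc_im (zc p))]. Qed.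
Lemma nc_snorm p : nc (zc p) <= 2 * snorm p.
Proof.
apply: (le_trans (nc_le _)); have := lexx (snorm p); rewrite {1}snorm_le => /andP[/= h1 h2]; lra.
Qed.
Lemma zcB p q : zc (p - q) = zc p - zc q. Proof. by []. Qed.
Lemma zc_eq0 p : (zc p == 0) = (p == (0, 0)).
Proof.
apply/eqP/eqP => [E|->//]; rewrite (surjective_pairing p).
by have := congr1 re E; have := congr1 im E => /= -> ->.
Qed.
Lemma zc_neq0 p : 0 < snorm p -> zc p != 0.
Proof. by rewrite snorm_gt0 zc_eq0. Qed.
Lemma zcB_neq0 p q : 0 < snorm (p - q) -> zc p - zc q != 0.
Proof. by rewrite -zcB => /zc_neq0. Qed.
End Norm.

Section ComplexIntegral.
Context {R : realType}.
Local Notation C := R[i].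
Local Notation re := (@complex.Re R).
Local Notation im := (@complex.Im R).
Implicit Types (U V : set (R * R)) (F G g h psi : R * R -> C) (p q : R * R) (c : C) (e d r : R).
Variables (a b : R).
Hypotheses (a0 : 0 < a) (b0 : 0 < b).
Local Notation D := (rect (- a) a (- b) b).
Local Notation rI := (rint (- a) a (- b) b).

Definition cint F : C := rI (re \o F) +i* rI (im \o F).

Let aa : - a < a. Proof. by rewrite gtrN. Qed.
Let bb : - b < b. Proof. by rewrite gtrN. Qed.

Lemma eq_cint F G : (forall p, D p -> F p = G p) -> cint F = cint G.
Proof. by move=> FG; congr (_ +i* _); apply: eq_rint => p /FG /= ->. Qed.

Section lin.
Variable U : set (R * R).
Hypothesis DU : D `<=` U.
Let cont_re F : csm U F -> forall p, D p -> {for p, continuous (re \o F)}.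
Proof. by move=> [S _] p /DU; exact: smooth_continuous. Qed.
Let cont_im F : csm U F -> forall p, D p -> {for p, continuous (im \o F)}.
Proof. by move=> [_ S] p /DU; exact: smooth_continuous. Qed.

Lemma cintD F G : csm U F -> csm U G -> cint (fun p => F p + G p) = cint F + cint G.
Proof.
move=> SF SG; apply: complex_ext; rewrite ?reD ?imD /=.
  rewrite -(rintD (cont_re SF) (cont_re SG)); apply: eq_rint => p _ /=; exact: reD.
rewrite -(rintD (cont_im SF) (cont_im SG)); apply: eq_rint => p _ /=; exact: imD.
Qed.

Lemma cintZ c F : csm U F -> cint (fun p => c * F p) = c * cint F.
Proof.
move=> SF; have cr := cont_re SF; have ci := cont_im SF.
have Zc k (f : R * R -> R) : (forall p, D p -> {for p, continuous f}) ->
    forall p, D p -> {for p, continuous (fun p => k * f p)}.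
  by move=> Cf p Dp; apply: continuousM; [exact: cvg_cst|exact: Cf].
apply: complex_ext; rewrite ?reM ?imM /=.
  rewrite -(rintZ _ cr) -(rintZ _ ci) -(rintB (Zc _ _ cr) (Zc _ _ ci)).
  by apply: eq_rint => p _ /=; exact: reM.
rewrite -(rintZ _ cr) -(rintZ _ ci) -(rintD (Zc _ _ ci) (Zc _ _ cr)).
by apply: eq_rint => p _ /=; exact: imM.
Qed.

Lemma cintB F G : csm U F -> csm U G -> open U -> cint (fun p => F p - G p) = cint F - cint G.
Proof.
move=> SF SG oU; rewrite (cintD SF (csmN oU SG)); congr (_ + _).
by rewrite -mulN1r -(cintZ _ SG); apply: eq_cint => p _; rewrite mulN1r.
Qed.

Lemma cint_cdx0 F : open U -> csm U F -> (forall y, - b <= y <= b -> F (- a, y) = F (a, y)) ->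
  cint (cdx F) = 0.
Proof.
move=> oU [S1 S2] per; apply: complex_ext; rewrite /cint /=.
  by apply: (rint_dx0 aa oU DU S1) => y /per /= ->.
by apply: (rint_dx0 aa oU DU S2) => y /per /= ->.
Qed.

Lemma cint_cdy0 F : open U -> csm U F -> (forall x, - a <= x <= a -> F (x, - b) = F (x, b)) ->
  cint (cdy F) = 0.
Proof.
move=> oU [S1 S2] per; apply: complex_ext; rewrite /cint /=.
  by apply: (rint_dy0 bb oU DU S1) => y /per /= ->.
by apply: (rint_dy0 bb oU DU S2) => y /per /= ->.
Qed.

Lemma cint_stokes F : open U -> csm U F -> (forall y, - b <= y <= b -> F (- a, y) = F (a, y)) ->
  (forall x, - a <= x <= a -> F (x, - b) = F (x, b)) ->
  cint (dbar F) = 0 /\ cint (dz F) = 0.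
Proof.
move=> oU SF px py; have Sx := csm_cdx SF; have Sy := csm_cdy SF.
have Siy c := csmM oU (csm_cst c oU) Sy.
split.
  by rewrite (cintZ _ (csmD oU Sx (Siy _))) (cintD Sx (Siy _)) (cintZ _ Sy) cint_cdx0 // cint_cdy0 // !mulr0 addr0 mulr0.
rewrite (cintZ _ (csmB oU Sx (Siy _))) (cintB Sx (Siy _) oU) (cintZ _ Sy) cint_cdx0 // cint_cdy0 //.
by rewrite !mulr0 subr0 mulr0.
Qed.

Lemma cint_bound F M a1 b1 a2 b2 : csm U F -> a1 <= b1 -> a2 <= b2 ->
  rect a1 b1 a2 b2 `<=` D -> (forall p, D p -> ~ rect a1 b1 a2 b2 p -> F p = 0) ->
  (forall p, rect a1 b1 a2 b2 p -> nc (F p) <= M) ->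
  nc (cint F) <= 2 * (M * ((b1 - a1) * (b2 - a2))).
Proof.
move=> SF h1 h2 sub F0 FM; apply: (le_trans (nc_le _)).
have -> (x : R) : 2 * x = x + x by ring.
apply: lerD; rewrite /cint /=.
  rewrite (rint_sub sub) => [|p Dp np /=]; last by rewrite F0.
  apply: rint_bound => // [p /sub|p /FM]; first exact: cont_re.
  exact: le_trans (nc_re _).
rewrite (rint_sub sub) => [|p Dp np /=]; last by rewrite F0.
apply: rint_bound => // [p /sub|p /FM]; first exact: cont_im.
exact: le_trans (nc_im _).
Qed.

Lemma cint_le F (f : R * R -> R) : csm U F -> (forall p, D p -> {for p, continuous f}) ->
  (forall p, D p -> nc (F p) <= f p) -> nc (cint F) <= 2 * rI f.
Proof.
move=> SF Cf FM; apply: (le_trans (nc_le _)).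
have -> (x : R) : 2 * x = x + x by ring.
have Cn : forall p, D p -> {for p, continuous (fun p => - f p)}.
  by move=> p Dp; apply: continuousN; exact: Cf.
have IN : - rI f = rI (fun p => - f p).
  by rewrite -mulN1r -(rintZ _ Cf); apply: eq_rint => p _; rewrite mulN1r.
have cr := cont_re SF; have ci := cont_im SF.
have bd (g : R * R -> R) : (forall p, D p -> {for p, continuous g}) ->
    (forall p, D p -> `|g p| <= f p) -> `|rI g| <= rI f.
  move=> Cg gf; rewrite ler_norml IN; apply/andP; split.
    by apply: (le_rint Cn Cg) => p /gf; rewrite ler_norml => /andP[].
  by apply: (le_rint Cg Cf) => p /gf; rewrite ler_norml => /andP[].
apply: lerD; apply: bd => // p Dp; apply: le_trans (FM p Dp); [exact: nc_re|exact: nc_im].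
Qed.
End lin.

Lemma csm_patch U V F : open U -> open V -> csm U F -> (forall p, V p -> F p = 0) ->
  csm (U `|` V) F.
Proof.
move=> oU oV SF F0; apply: csmU => //.
by apply: (csm_ext oV _ (csm_cst 0 oV)) => p /F0.
Qed.

(** integration by parts against a cutoff supported where g is holomorphic *)
Lemma stokes U V g psi : open U -> open V -> D `<=` U `|` V -> hol U g -> csm setT psi ->
  (forall p, V p -> psi p = 0) ->
  (forall y, - b <= y <= b -> g (- a, y) * psi (- a, y) = g (a, y) * psi (a, y)) ->
  (forall x, - a <= x <= a -> g (x, - b) * psi (x, - b) = g (x, b) * psi (x, b)) ->
  csm (U `|` V) (fun p => g p * dbar psi p) /\ cint (fun p => g p * dbar psi p) = 0.
Proof.
move=> oU oV DUV [Sg Hg] Sp p0 px py.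
have oUV := openU oU oV.
have SU : csm U psi by apply: csm_sub Sp.
have Sgp : csm (U `|` V) (fun p => g p * psi p).
  by apply: csm_patch => //; [exact: csmM|move=> p /p0 ->; rewrite mulr0].
have d0 p : V p -> dbar psi p = 0.
  by move=> Vp; rewrite (dbar_near oV p0 Vp) dbar_cst.
split.
  apply: csm_patch => //; first by apply: csmM => //; exact: csm_dbar.
  by move=> p /d0 ->; rewrite mulr0.
have [<- _] := cint_stokes DUV oUV Sgp px py.
apply: eq_cint => p Dp; case: (DUV p Dp) => [Up|Vp].
  by rewrite (dbarM oU Up Sg SU) Hg // mul0r add0r.
rewrite d0 // mulr0 (dbar_near oV (G := fun=> 0) _ Vp) ?dbar_cst // => q /p0 ->.
by rewrite mulr0.
Qed.

Definition chic e p : C := (chi e p)%:C.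
Definition residue g e : C := cint (fun p => g p * dbar (chic e) p).
Local Notation res := residue.
Definition pb r := [set p : R * R | 0 < snorm p < r].

Lemma open_pb r : open (pb r).
Proof.
rewrite (_ : pb r = [set p | 0 < snorm p] `&` [set p | snorm p < r]).
  by apply: openI; [exact: open_snorm_gt|exact: open_snorm_lt].
by apply/seteqP; split=> p /andP.
Qed.

Lemma csm_chic U e : open U -> csm U (chic e).
Proof. by move=> oU; apply: csm_real => //; exact: smooth_chi. Qed.

Lemma dbar_chic0 e p : 0 < e -> snorm p < e \/ 2 * e < snorm p -> dbar (chic e) p = 0.
Proof.
move=> e0 [h|h].
  rewrite (dbar_near (@open_snorm_lt R e) (G := fun=> 1) _ h) ?dbar_cst // => q qe.
  by rewrite /chic chi_eq1 // ltW.
rewrite (dbar_near (@open_snorm_gt R (2 * e)) (G := fun=> 0) _ h) ?dbar_cst // => q qe.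
by rewrite /chic chi_eq0 // ltW.
Qed.

Lemma dbar_real (f : R * R -> R) p : dbar (fun p => (f p)%:C) p = 2^-1%:C * (dx f p +i* dy f p).
Proof.
rewrite /dbar /cdx /cdy /=.
rewrite (_ : dx (im \o _) p = 0); last exact: dx_cst.
rewrite (_ : dy (im \o _) p = 0); last exact: dy_cst.
by congr (_ * _); apply: complex_ext; rewrite /=; ring.
Qed.

Lemma dbar_chic_bound : exists2 M : R, 0 < M & forall e p, 0 < e -> nc (dbar (chic e) p) <= M / e.
Proof.
have [M M0 HM] := @chi_bounds R; exists M => // e p e0.
have [h1 h2 _] := HM e p e0.
have hs : nc (dx (chi e) p +i* dy (chi e) p) <= M / e + M / e.
  by apply: (le_trans (nc_le _)); exact: (lerD h1 h2).
rewrite dbar_real ncM ncR ger0_norm ?invr_ge0 //.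
have -> : M / e = 2^-1 * (M / e + M / e) by field; rewrite gt_eqF.
by rewrite ler_pM2l.
Qed.

Section punctured.
Variable r : R.
Hypotheses (ra : r <= a) (rb : r <= b).

Lemma pb_cover s t : 0 < s -> t < r ->
  D `<=` pb r `|` ([set p | snorm p < s] `|` [set p | t < snorm p]).
Proof.
move=> s0 tr p _; have [h|h] := ltP (snorm p) s; first by right; left.
have [h'|h'] := ltP t (snorm p); first by right; right.
by left; rewrite /pb /= (lt_le_trans s0 h) (le_lt_trans h' tr).
Qed.

Lemma snorm_bd x y : - b <= y <= b -> x = a \/ x = - a -> a <= snorm (x, y).
Proof.
move=> _ [] ->; rewrite /snorm /= le_max ?normrN (gtr0_norm a0) lexx //.
Qed.
Lemma snorm_bd2 x y : - a <= x <= a -> y = b \/ y = - b -> b <= snorm (x, y).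
Proof.
move=> _ [] ->; rewrite /snorm /= le_max ?normrN (gtr0_norm b0) lexx orbT //.
Qed.

(* a cutoff vanishing near the boundary of the cell satisfies the boundary
   conditions of [stokes] *)
Lemma stokes_cut U V g psi t : open U -> open V -> D `<=` U `|` V -> hol U g -> csm setT psi ->
  (forall p, V p -> psi p = 0) -> t < r -> (forall p, t < snorm p -> psi p = 0) ->
  csm (U `|` V) (fun p => g p * dbar psi p) /\ cint (fun p => g p * dbar psi p) = 0.
Proof.
move=> oU oV DUV Hg Sp p0 tr pt; apply: stokes => //.
  move=> y hy; rewrite !pt ?mulr0 //.
    by apply: lt_le_trans tr _; apply: (le_trans ra); apply: snorm_bd => //; left.
  by apply: lt_le_trans tr _; apply: (le_trans ra); apply: snorm_bd => //; right.
move=> x hx; rewrite !pt ?mulr0 //.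
  by apply: lt_le_trans tr _; apply: (le_trans rb); apply: snorm_bd2 => //; left.
by apply: lt_le_trans tr _; apply: (le_trans rb); apply: snorm_bd2 => //; right.
Qed.

Lemma open_hole s t : open ([set p : R * R | snorm p < s] `|` [set p | t < snorm p]).
Proof. by apply: openU; [exact: open_snorm_lt|exact: open_snorm_gt]. Qed.

Lemma csm_res g e : csm (pb r) g -> 0 < e -> 2 * e < r ->
  csm (pb r `|` ([set p | snorm p < e] `|` [set p | 2 * e < snorm p]))
    (fun p => g p * dbar (chic e) p).
Proof.
move=> Sg e0 er; apply: csm_patch.
- exact: open_pb.
- exact: open_hole.
- apply: csmM; [exact: open_pb|exact: Sg|].
  by apply: csm_dbar; [exact: open_pb|apply: csm_chic; exact: open_pb].
- by move=> p hp; rewrite dbar_chic0 ?mulr0.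
Qed.

Lemma res_const g e e' : hol (pb r) g -> 0 < e -> 0 < e' -> 2 * e < r -> 2 * e' < r ->
  res g e = res g e'.
Proof.
move=> Hg e0 e0' er er'; have [Sg _] := Hg.
pose s := Num.min e e'; pose t := Num.max (2 * e) (2 * e').
have s0 : 0 < s by rewrite lt_min e0.
have tr : t < r by rewrite gt_max er.
have oT := @openT (R * R)%type.
have Sc k := @csm_chic setT k oT.
have Spsi := csmB oT (Sc e) (Sc e').
pose psi p := chic e p - chic e' p.
have psi0 p : ([set p : R * R | snorm p < s] `|` [set p | t < snorm p]) p -> psi p = 0.
  rewrite /psi /chic /s /t; case=> /=.
    by rewrite lt_min => /andP[h h']; rewrite !chi_eq1 ?subrr // ltW.
  by rewrite gt_max => /andP[h h']; rewrite !chi_eq0 ?subrr // ltW.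
have [] := stokes_cut (@open_pb r) (@open_hole s t) (pb_cover s0 tr) Hg Spsi psi0 tr.
  by move=> p hp; apply: psi0; right.
move=> _ I0; apply/eqP; rewrite -subr_eq0 -I0 /res; apply/eqP.
have W k : 0 < k -> 2 * k < r -> s <= k -> 2 * k <= t ->
    csm (pb r `|` ([set p | snorm p < s] `|` [set p | t < snorm p]))
     (fun p => g p * dbar (chic k) p).
  move=> k0 kr sk kt; apply: csm_sub (csm_res Sg k0 kr) => p [|[|]] /= h; [by left|right; left|right; right].
    exact: lt_le_trans h sk.
  exact: le_lt_trans kt h.
have oW := openU (@open_pb r) (@open_hole s t).
rewrite -(cintB (pb_cover s0 tr) (W e _ _ _ _) (W e' _ _ _ _) oW) //;
  rewrite ?ge_min ?le_max ?lexx ?orbT //.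
apply: eq_cint => p _; rewrite -mulrBr; congr (_ * _).
have oTp : [set: R * R] p by [].
rewrite (_ : (fun p => chic e p - chic e' p) = (fun p => chic e p + (-1) * chic e' p)).
  by rewrite (dbarD oT oTp (Sc e) (csmM oT (csm_cst _ oT) (Sc e'))) (dbarZ oT _ oTp (Sc e')) // mulN1r.
by apply/funext => q; rewrite mulN1r.
Qed.

(* vanishing of the residue at the only pole of an elliptic function *)
Lemma res_periodic U g e : open U -> D `<=` U `|` [set (0, 0)] -> hol U g ->
  (forall y, - b <= y <= b -> g (- a, y) = g (a, y)) ->
  (forall x, - a <= x <= a -> g (x, - b) = g (x, b)) ->
  pb r `<=` U -> 0 < e -> 2 * e < r -> res g e = 0.
Proof.
move=> oU DU Hg px py pU e0 er; have [Sg _] := Hg.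
have oT := @openT (R * R)%type.
pose psi p := 1 - chic e p.
have Spsi : csm setT psi by apply: csmB => //; [exact: csm_cst|exact: csm_chic].
have oV := @open_snorm_lt R e.
have psi0 p : snorm p < e -> psi p = 0.
  by move=> h; rewrite /psi /chic chi_eq1 ?subrr // ltW.
have DUV : D `<=` U `|` [set p | snorm p < e].
  move=> p /DU [Up|->]; [by left|right]; rewrite /=.
  by rewrite (_ : snorm _ = 0) //; apply/eqP; rewrite snorm_eq0.
have psi1 p : r <= snorm p -> psi p = 1.
  by move=> h; rewrite /psi /chic chi_eq0 ?subr0 // (le_trans (ltW er)).
have [] := stokes oU oV DUV Hg Spsi psi0.
- move=> y hy; rewrite !psi1 ?mulr1 ?px //.
    by apply: (le_trans ra); apply: snorm_bd => //; left.
  by apply: (le_trans ra); apply: snorm_bd => //; right.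
- move=> x hx; rewrite !psi1 ?mulr1 ?py //.
    by apply: (le_trans rb); apply: snorm_bd2 => //; left.
  by apply: (le_trans rb); apply: snorm_bd2 => //; right.
move=> S I0.
have E p : g p * dbar psi p = (-1) * (g p * dbar (chic e) p).
  have oTp : [set: R * R] p by [].
  have Epsi : psi = (fun p => 1 + (-1) * chic e p) by apply/funext => q; rewrite mulN1r.
  have -> : dbar psi p = - dbar (chic e) p.
    rewrite Epsi (dbarD oT oTp (csm_cst _ oT) (csmM oT (csm_cst _ oT) (csm_chic e oT))).
    by rewrite dbar_cst add0r (dbarZ oT _ oTp (csm_chic e oT)) mulN1r.
  by rewrite mulrN mulN1r.
have SN := csmN (openU oU oV) S.
have : cint (fun p => - (g p * dbar psi p)) = 0.
  rewrite (eq_cint (G := fun p => (-1) * (g p * dbar psi p))) => [|p _]; last by rewrite mulN1r.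
  by rewrite (cintZ DUV _ S) I0 mulr0.
by rewrite /res => <-; apply: eq_cint => p _; rewrite E mulN1r opprK.
Qed.

(* a residue is small when the function is small *)
Lemma res_bound : exists2 M : R, 0 < M & forall g e K, csm (pb r) g -> 0 < e -> 2 * e < r ->
  (forall p, e <= snorm p <= 2 * e -> nc (g p) <= K) -> 0 <= K -> nc (res g e) <= M * (K * e).
Proof.
have [M M0 HM] := dbar_chic_bound; exists (32 * M); first by rewrite mulr_gt0.
move=> g e K Sg e0 er gK K0.
have S := csm_res Sg e0 er.
have e20 : 0 < 2 * e by rewrite mulr_gt0.
have -> : 32 * M * (K * e) = 2 * (K * (M / e) * ((2 * e - - (2 * e)) * (2 * e - - (2 * e)))).
  by field; rewrite gt_eqF.
have le2 : - (2 * e) <= 2 * e by rewrite (le_trans _ (ltW e20)) // oppr_le0 ltW.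
apply: (cint_bound (pb_cover e0 er) S le2 le2).
- move=> [x y] [] /=; rewrite !in_itv /= => /andP[h1 h2] /andP[h3 h4].
  have h5 := ltW (lt_le_trans er ra); have h6 := ltW (lt_le_trans er rb).
  split; rewrite /= in_itv /=.
    by rewrite (le_trans h2 h5) (le_trans _ h1) // lerN2.
  by rewrite (le_trans h4 h6) (le_trans _ h3) // lerN2.
- move=> p _ np; rewrite dbar_chic0 ?mulr0 //; right; rewrite ltNge; apply/negP => h.
  by apply: np; apply/snorm_rect.
move=> p /snorm_rect h; have [h'|h'] := ltP (snorm p) e.
  rewrite dbar_chic0 ?mulr0 ?nc0; [|done|by left].
  by rewrite mulr_ge0 // divr_ge0 // ltW.
rewrite ncM; apply: ler_pM; rewrite ?nc_ge0 //; last exact: HM.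
by apply: gK; rewrite h'.
Qed.

(* integration by parts: derivatives can be moved inside a residue *)
Lemma res_dz h e : hol (pb r) h -> 0 < e -> 2 * e < r -> res (dz h) e = 0.
Proof.
move=> [Sh Hh] e0 er.
have oP := @open_pb r; have oH := @open_hole e (2 * e); have oW := openU oP oH.
have cov := pb_cover e0 er.
have Sc U : open U -> csm U (chic e) by exact: csm_chic.
have Sdz := csm_dz oP Sh.
have dz0 p : ([set p : R * R | snorm p < e] `|` [set p | 2 * e < snorm p]) p -> dz (chic e) p = 0.
  case=> h'.
    rewrite (dz_near (@open_snorm_lt R e) (G := fun=> 1) _ h') ?dz_cst // => q qe.
    by rewrite /chic chi_eq1 // ltW.
  rewrite (dz_near (@open_snorm_gt R (2 * e)) (G := fun=> 0) _ h') ?dz_cst // => q qe.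
  by rewrite /chic chi_eq0 // ltW.
have db0 p : ([set p : R * R | snorm p < e] `|` [set p | 2 * e < snorm p]) p -> dbar (chic e) p = 0.
  by move=> hp; apply: dbar_chic0.
pose W := pb r `|` ([set p | snorm p < e] `|` [set p | 2 * e < snorm p]).
have SA : csm W (fun p => h p * dbar (chic e) p).
  apply: (csm_patch oP oH (csmM oP Sh (csm_dbar oP (Sc _ oP)))) => p hp.
  by rewrite db0 ?mulr0.
have SB : csm W (fun p => h p * dz (chic e) p).
  apply: (csm_patch oP oH (csmM oP Sh (csm_dz oP (Sc _ oP)))) => p hp.
  by rewrite dz0 ?mulr0.
have bd0 F y x : (forall p, ([set p : R * R | snorm p < e] `|` [set p | 2 * e < snorm p]) p -> F p = 0) ->
   (- b <= y <= b -> F (- a, y) = F (a, y) :> C) /\ (- a <= x <= a -> F (x, - b) = F (x, b)).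
  move=> F0; split=> hy; rewrite !F0 //; right; rewrite /=.
  - by apply: (lt_le_trans er); apply: (le_trans ra); apply: snorm_bd => //; left.
  - by apply: (lt_le_trans er); apply: (le_trans ra); apply: snorm_bd => //; right.
  - by apply: (lt_le_trans er); apply: (le_trans rb); apply: snorm_bd2 => //; left.
  - by apply: (lt_le_trans er); apply: (le_trans rb); apply: snorm_bd2 => //; right.
have A0 p : ([set p : R * R | snorm p < e] `|` [set p | 2 * e < snorm p]) p -> h p * dbar (chic e) p = 0.
  by move=> hp; rewrite db0 ?mulr0.
have B0 p : ([set p : R * R | snorm p < e] `|` [set p | 2 * e < snorm p]) p -> h p * dz (chic e) p = 0.
  by move=> hp; rewrite dz0 ?mulr0.
have [_ IA] := cint_stokes cov oW SA (fun y => (bd0 _ y 0 A0).1) (fun x => (bd0 _ 0 x A0).2).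
have [IB _] := cint_stokes cov oW SB (fun y => (bd0 _ y 0 B0).1) (fun x => (bd0 _ 0 x B0).2).
have SdzA := csm_dz oW SA; have SdbB := csm_dbar oW SB.
rewrite /res -[RHS](subrr (0 : C)) -{1}IA -IB -(cintB cov SdzA SdbB oW).
apply: eq_cint => p Dp.
have [Pp|Hp] : pb r p \/ ([set p : R * R | snorm p < e] `|` [set p | 2 * e < snorm p]) p by exact: (cov p Dp).
  rewrite (dzM oP Pp Sh (csm_dbar oP (Sc _ oP))) (dbarM oP Pp Sh (csm_dz oP (Sc _ oP))).
  by rewrite Hh // mul0r add0r (dbar_dzC oP (Sc _ oP) Pp) addrK.
rewrite db0 // mulr0 (dz_near oH (G := fun=> 0) A0 Hp) dz_cst.
by rewrite (dbar_near oH (G := fun=> 0) B0 Hp) dbar_cst subr0.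
Qed.
End punctured.
End ComplexIntegral.

(*@@@ 8*)
Local Open Scope complex_scope.
Opaque dx dy.

Section Shift.
Context {R : realType}.
Implicit Types (f : R * R -> R) (p q v : R * R).

Lemma is_derive_translate f q p v a : is_derive (p - q) v f a ->
  is_derive p v (fun p => f (p - q)) a.
Proof.
move=> /is_derive_line D; apply/is_derive_line; move: D; congr (is_derive _ _ _ _).
by apply/funext => h; rewrite addrA.
Qed.

Lemma smooth_shift f q : smooth_on setT f -> smooth_on setT (fun p => f (p - q)).
Proof.
move=> Sf.
apply: (@smooth_coind _ setT [set g | exists h, smooth_on setT h /\ g = (fun p => h (p - q))]).
- exact: openT.
- move=> _ [h [Sh ->]] p _.
  apply: (@continuous_comp _ _ _ (fun p => p - q) h); last exact: smooth_continuous Sh I.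
  by apply: cvgB; [exact: cvg_id|exact: cvg_cst].
- move=> _ v [h [Sh ->]] ev; exists (fun p => dv v h (p - q)).
    by apply: span_in; exists (dv v h); split => //; exact: smooth_dv.
  move=> p _; exact: is_derive_translate (smooth_is_derive Sh (I : setT (p - q)) ev).
- by exists f.
Qed.

Lemma csm_shift (F : R * R -> R[i]) q : csm setT F -> csm setT (fun p => F (p - q)).
Proof.
by move=> [S1 S2]; split; [exact: (smooth_shift q S1)|exact: (smooth_shift q S2)].
Qed.

Lemma dbar_shift (F : R * R -> R[i]) q p : csm setT F ->
  dbar (fun p => F (p - q)) p = dbar F (p - q).
Proof.
move=> [S1 S2].
have E1 := dx_val (is_derive_translate (smooth_is_dx S1 (I : setT (p - q)))).
have E2 := dx_val (is_derive_translate (smooth_is_dx S2 (I : setT (p - q)))).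
have E3 := dy_val (is_derive_translate (smooth_is_dy S1 (I : setT (p - q)))).
have E4 := dy_val (is_derive_translate (smooth_is_dy S2 (I : setT (p - q)))).
have Ex : cdx (fun p => F (p - q)) p = cdx F (p - q) by exact: (f_equal2 (@Complex R) E1 E2).
have Ey : cdy (fun p => F (p - q)) p = cdy F (p - q) by exact: (f_equal2 (@Complex R) E3 E4).
by rewrite /dbar Ex Ey.
Qed.

Lemma csm_near (U : set (R * R)) (F : R * R -> R[i]) p (e : R) : csm U F -> U p -> 0 < e ->
  exists2 h, 0 < h & forall q, snorm (q - p) <= h -> nc (F q - F p) <= e.
Proof.
move=> [S1 S2] Up e0; have e20 : 0 < e / 2 by rewrite divr_gt0.
have [h1 h10 H1] := continuous_box (smooth_continuous S1 Up) e20.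
have [h2 h20 H2] := continuous_box (smooth_continuous S2 Up) e20.
exists (Num.min h1 h2); first by rewrite lt_min h10.
move=> [x y]; rewrite snorm_le /= !le_min => /andP[/andP[a1 a2] /andP[b1 b2]].
apply: (le_trans (nc_le _)); rewrite [leRHS]splitr reD imD reN imN.
by apply: lerD; rewrite distrC; [exact: H1|exact: H2].
Qed.
End Shift.

Section Pompeiu.
Context {R : realType}.
Local Notation C := R[i].
Local Notation re := (@complex.Re R).
Local Notation im := (@complex.Im R).
Implicit Types (U V : set (R * R)) (F g h : R * R -> C) (p q : R * R) (e d rho : R).
Variables (a b r : R).
Hypotheses (a0 : 0 < a) (b0 : 0 < b) (ra : r <= a) (rb : r <= b).
Local Notation D := (rect (- a) a (- b) b).
Local Notation cint := (cint a b).
Local Notation res := (residue a b).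

Definition ckern z0 p : C := (zc p - zc z0)^-1.
Definition chis z0 d p : C := chic d (p - z0).
Definition away z0 := [set p : R * R | 0 < snorm (p - z0)].

Lemma open_away z0 : open (away z0).
Proof.
have c : continuous (fun p : R * R => snorm (p - z0)).
  move=> p; apply: (@continuous_comp _ _ _ (fun p => p - z0) snorm); last exact: snorm_continuous.
  by apply: cvgB; [exact: cvg_id|exact: cvg_cst].
by apply: (@open_comp _ _ (fun p : R * R => snorm (p - z0)) [set x | 0 < x]) => [p _|]; [exact: c|exact: open_gt].
Qed.

Lemma open_close z0 d : open [set p : R * R | snorm (p - z0) < d].
Proof.
have c : continuous (fun p : R * R => snorm (p - z0)).
  move=> p; apply: (@continuous_comp _ _ _ (fun p => p - z0) snorm); last exact: snorm_continuous.
  by apply: cvgB; [exact: cvg_id|exact: cvg_cst].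
by apply: (@open_comp _ _ (fun p : R * R => snorm (p - z0)) [set x | x < d]) => [p _|]; [exact: c|exact: open_lt].
Qed.

Lemma hol_ckern z0 : hol (away z0) (ckern z0).
Proof.
apply: holV; [exact: open_away| |by move=> p; exact: zcB_neq0].
by apply: (holB (@open_away z0)); [exact: (hol_zc (@open_away z0))|exact: (hol_cst (@open_away z0))].
Qed.

Lemma nc_ckern z0 p d : 0 < d -> d <= snorm (p - z0) -> nc (ckern z0 p) <= d^-1.
Proof.
move=> d0 h; rewrite /ckern ncV -zcB.
have h' := le_trans h (snorm_nc (p - z0)).
by rewrite lef_pV2 ?posrE // (lt_le_trans d0 h').
Qed.

Let oT := @openT (R * R)%type.

Lemma csm_chis U z0 d : csm U (chis z0 d).
Proof.
have SF := csm_shift z0 (@csm_chic R setT d oT).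
exact: csm_sub (@subsetT _ U) SF.
Qed.

Lemma dbar_chis0 z0 d p : 0 < d -> snorm (p - z0) < d \/ 2 * d < snorm (p - z0) ->
  dbar (chis z0 d) p = 0.
Proof. by move=> d0 h; rewrite (dbar_shift z0 p (@csm_chic R setT d oT)) dbar_chic0. Qed.

Section fixed.
Variables (g : R * R -> C) (rho e : R) (z0 : R * R).
Hypotheses (Hg : hol (pb r) g) (rho0 : 0 < rho) (rhor : 2 * rho < r) (z00 : 0 < snorm z0)
  (z0rho : 2 * snorm z0 <= rho) (e0 : 0 < e) (ez0 : 8 * e <= snorm z0).
Let s := snorm z0.

Section withd.
Variables (h : R * R -> C) (d : R).
Hypotheses (d0 : 0 < d) (dz0 : 8 * d <= snorm z0).
Let U := pb r `&` away z0.
Let V := [set p : R * R | snorm p < e] `|` ([set p | snorm (p - z0) < d] `|` [set p | 2 * rho < snorm p]).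

Lemma pompeiu_open : open U /\ open V.
Proof.
split; first by apply: openI; [exact: open_pb|exact: open_away].
by apply: openU; [exact: open_snorm_lt|apply: openU; [exact: open_close|exact: open_snorm_gt]].
Qed.

Lemma pompeiu_cover : D `<=` U `|` V.
Proof.
move=> p _; have [h1|h1] := ltP (snorm p) e; first by right; left.
have [h2|h2] := ltP (snorm (p - z0)) d; first by right; right; left.
have [h3|h3] := ltP (2 * rho) (snorm p); first by right; right; right.
left; split; last exact: lt_le_trans d0 h2.
by rewrite /pb /= (lt_le_trans e0 h1) (le_lt_trans h3 rhor).
Qed.

Lemma pompeiu_geom p : V p ->
  [\/ [/\ snorm p < e, snorm p < rho & 2 * d < snorm (p - z0)],
      [/\ snorm (p - z0) < d, snorm p < rho & 2 * e < snorm p] |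
      [/\ 2 * rho < snorm p, 2 * e < snorm p & 2 * d < snorm (p - z0)] ].
Proof.
have t1 := snorm_sub z0 p; have t2 := snorm_sub p z0.
move: t1; rewrite snormB => t1.
case=> [h1|[h1|h1]]; [constructor 1|constructor 2|constructor 3]; move: h1; rewrite /= => h1;
  move: h1 t1 t2 ez0 dz0 z0rho z00 d0 e0; move: (snorm p) (snorm (p - z0)) (snorm z0) => x y z *; split; lra.
Qed.

Hypothesis Hh : hol U h.

Lemma pompeiu_csm : [/\ csm (U `|` V) (fun p => h p * dbar (chic rho) p),
   csm (U `|` V) (fun p => h p * dbar (chic e) p) &
   csm (U `|` V) (fun p => h p * dbar (chis z0 d) p)].
Proof.
have [oU oV] := pompeiu_open; have [Sh _] := Hh.
have Sc k := csm_dbar oU (@csm_chic R U k oU).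
split.
- apply: (csm_patch oU oV (csmM oU Sh (Sc rho))) => p /pompeiu_geom [] [h1 h2 h3];
    rewrite dbar_chic0 ?mulr0 //; by [left|right].
- apply: (csm_patch oU oV (csmM oU Sh (Sc e))) => p /pompeiu_geom [] [h1 h2 h3];
    rewrite dbar_chic0 ?mulr0 //; by [left|right].
- apply: (csm_patch oU oV (csmM oU Sh (csm_dbar oU (csm_chis U z0 d)))) => p /pompeiu_geom [] [h1 h2 h3];
    rewrite dbar_chis0 ?mulr0 //; by [left|right].
Qed.

Lemma pompeiu_stokes : cint (fun p => h p * dbar (chic rho) p) - res h e =
  cint (fun p => h p * dbar (chis z0 d) p).
Proof.
have [oU oV] := pompeiu_open; have DUV := pompeiu_cover; have oW := openU oU oV.
have [S1 S2 S3] := pompeiu_csm.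
have Sc k := @csm_chic R setT k oT.
have Ss := csm_chis setT z0 d.
pose psi p := chic rho p - chic e p - chis z0 d p.
have Spsi : csm setT psi := csmB oT (csmB oT (Sc rho) (Sc e)) Ss.
have psi0 p : V p -> psi p = 0.
  move=> /pompeiu_geom [] [h1 h2 h3]; rewrite /psi /chis /chic.
  - by rewrite (chi_eq1 rho0 (ltW h2)) (chi_eq1 e0 (ltW h1)) (chi_eq0 d0 (ltW h3)) subrr subr0.
  - by rewrite (chi_eq1 rho0 (ltW h2)) (chi_eq0 e0 (ltW h3)) (chi_eq1 d0 (ltW h1)) subr0 subrr.
  - by rewrite (chi_eq0 rho0 (ltW h1)) (chi_eq0 e0 (ltW h2)) (chi_eq0 d0 (ltW h3)) !subr0.
have [] := stokes_cut a0 b0 ra rb oU oV DUV Hh Spsi psi0 rhor.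
  by move=> p hp; apply: psi0; right; right.
move=> _ I0; apply/eqP; rewrite -subr_eq0 -I0; apply/eqP.
rewrite /residue -(cintB DUV S1 S2 oW) -(cintB DUV (csmB oW S1 S2) S3 oW).
apply: eq_cint => p _; rewrite -2!mulrBr; congr (_ * _).
have oTp : [set: R * R] p by [].
have Epsi : psi = (fun p => chic rho p + (-1) * chic e p + (-1) * chis z0 d p).
  by apply/funext => q; rewrite !mulN1r.
have SZ F : csm setT F -> csm setT (fun p => (-1) * F p).
  by move=> SF; exact: (csmM oT (csm_cst _ oT) SF).
rewrite (congr1 (fun F => dbar F p) Epsi).
rewrite (dbarD oT oTp (csmD oT (Sc rho) (SZ _ (Sc e))) (SZ _ Ss)).
rewrite (dbarD oT oTp (Sc rho) (SZ _ (Sc e))).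
have EZ F : csm setT F -> dbar (fun q => (-1) * F q) p = - dbar F p.
  by move=> SF; rewrite (dbarZ oT _ oTp SF) mulN1r.
rewrite (EZ (chic e) (Sc e)) (EZ (chis z0 d) Ss); exact: erefl.
Qed.
End withd.

(* the constant function *)
Lemma res_ckern : res (ckern z0) e = 0.
Proof.
have oU := @open_away z0.
pose V := [set p : R * R | snorm (p - z0) < snorm z0 / 4].
have oV : open V by exact: open_close.

have DUV : D `<=` away z0 `|` V.
  move=> p _; have [h|h] := ltP (snorm (p - z0)) (snorm z0 / 4); first by right.
  by left; apply: lt_le_trans h; rewrite divr_gt0.
have er : 2 * e < r by move: ez0 z0rho rhor z00 e0; move: (snorm z0) => x *; lra.
have psi0 p : V p -> chic e p = 0.
  rewrite /V /= snormB => h; rewrite /chic chi_eq0 //.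
  move: h (snorm_sub z0 p) ez0 z00; move: (snorm p) (snorm (z0 - p)) (snorm z0) => x y z *; lra.
have [|_ I0] := stokes_cut a0 b0 ra rb oU oV DUV (hol_ckern z0) (@csm_chic R setT e oT) psi0 er.
  by move=> p h; rewrite /chic chi_eq0 // ltW.
exact: I0.
Qed.

Lemma pompeiu : g z0 * cint (fun p => ckern z0 p * dbar (chic rho) p) =
  cint (fun p => g p * ckern z0 p * dbar (chic rho) p) - res (fun p => g p * ckern z0 p) e.
Proof.
pose U := pb r `&` away z0.
have oU : open U by apply: openI; [exact: open_pb|exact: open_away].
have HU V F : U `<=` V -> hol V F -> hol U F.
  by move=> UV [SF HF]; split; [exact: csm_sub SF|move=> p /UV /HF].
have Hc : hol U (ckern z0) by apply: HU (hol_ckern z0) => p [].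
have HgU : hol U g by apply: HU Hg => p [].
have Hgc : hol U (fun p => g p * ckern z0 p) by exact: holM.
set K := cint (fun p => ckern z0 p * _).
set X := cint _ - _.
have [M M0 HM] := @dbar_chic_bound R.
apply/eqP; rewrite -subr_eq0; apply/eqP; apply: nc_eq0; apply/eqP; rewrite eq_le nc_ge0 andbT.
apply/ler_addgt0Pr => eps eps0; rewrite add0r.
pose eps' := eps / (32 * M).
have eps'0 : 0 < eps' by rewrite divr_gt0 // mulr_gt0.
have pz0 : pb r z0.
  by rewrite /pb /= z00 /=; move: z00 z0rho rhor; move: (snorm z0) => x *; lra.
have [k k0 Hk] := csm_near (proj1 Hg) pz0 eps'0.
pose d := Num.min (snorm z0 / 8) (k / 2).
have d0 : 0 < d by rewrite lt_min !divr_gt0.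
have dz0 : 8 * d <= snorm z0 by rewrite -ler_pdivlMl // mulrC ge_min lexx.
have dk : 2 * d <= k by rewrite -ler_pdivlMl // mulrC ge_min lexx orbT.
have E1 := pompeiu_stokes d0 dz0 Hc; have E2 := pompeiu_stokes d0 dz0 Hgc.
rewrite res_ckern subr0 in E1.
have DUV := @pompeiu_cover d d0.
have [oU' oV'] := @pompeiu_open d; have oW := openU oU' oV'.
have [_ _ S1] := pompeiu_csm d0 dz0 Hc; have [_ _ S2] := pompeiu_csm d0 dz0 Hgc.
rewrite /K E1 /X E2 -(cintZ DUV _ S1) -(cintB DUV (csmM oW (csm_cst _ oW) S1) S2 oW).
have -> : eps = 2 * (eps' * (d^-1 * (M / d)) * ((z0.1 + 2 * d - (z0.1 - 2 * d)) * (z0.2 + 2 * d - (z0.2 - 2 * d)))).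
  by rewrite /eps'; field; rewrite !gt_eqF.
have bx p : rect (z0.1 - 2 * d) (z0.1 + 2 * d) (z0.2 - 2 * d) (z0.2 + 2 * d) p <-> snorm (p - z0) <= 2 * d.
  rewrite snorm_le /= !ler_norml; split.
    by case; rewrite /= !in_itv /= => /andP[h1 h2] /andP[h3 h4]; rewrite !lerBlDl !lerBrDl h1 h2 h3 h4.
  by rewrite !lerBlDl !lerBrDl => /andP[h1 h2]; split; rewrite /= in_itv.
apply: (cint_bound DUV (csmB oW (csmM oW (csm_cst _ oW) S1) S2)).
- by rewrite lerD2l; move: d0; lra.
- by rewrite lerD2l; move: d0; lra.
- move=> p /bx hp; have := snormD (p - z0) z0; rewrite subrK => hp'.
  have : snorm p <= r by apply: (le_trans hp'); move: hp dz0 z0rho rhor z00 d0; move: (snorm z0) (snorm (p - z0)) => x y *; lra.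
  rewrite snorm_le !ler_norml => /andP[/andP[h1 h2] /andP[h3 h4]].
  split; rewrite /= in_itv /=.
    apply/andP; split; last exact: (le_trans h2 ra).
    by apply: (le_trans _ h1); rewrite lerN2.
  apply/andP; split; last exact: (le_trans h4 rb).
  by apply: (le_trans _ h3); rewrite lerN2.
- move=> p _ np; have hp : 2 * d < snorm (p - z0).
    by rewrite ltNge; apply/negP => h; apply: np; apply/bx.
  have zz := @dbar_chis0 z0 d p d0 (or_intror hp).
  by rewrite zz !mulr0 subrr.
move=> p /bx hp.
have -> : g z0 * (ckern z0 p * dbar (chis z0 d) p) - g p * ckern z0 p * dbar (chis z0 d) p =
   - ((g p - g z0) * (ckern z0 p * dbar (chis z0 d) p)) by ring.
rewrite ncN ncM; apply: (ler_pM (nc_ge0 _) (nc_ge0 _)).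
  by apply: Hk; exact: (le_trans hp dk).
have [h|h] := ltP (snorm (p - z0)) d.
  have zz := @dbar_chis0 z0 d p d0 (or_introl h).
  by rewrite zz mulr0 nc0 mulr_ge0 ?invr_ge0 ?divr_ge0 ?ltW.
rewrite ncM; apply: (ler_pM (nc_ge0 _) (nc_ge0 _)); first exact: nc_ckern.
by rewrite (dbar_shift z0 p (@csm_chic R setT d oT)); exact: HM.
Qed.
End fixed.
End Pompeiu.

(*@@@ 9*)
Local Open Scope complex_scope.
Opaque dx dy.

Section BoundedNear.
Context {R : realType}.
Local Notation C := R[i].
Local Notation re := (@complex.Re R).
Local Notation im := (@complex.Im R).
Variables (a b r rho : R).
Hypotheses (a0 : 0 < a) (b0 : 0 < b) (ra : r <= a) (rb : r <= b)
  (rho0 : 0 < rho) (rhor : 2 * rho < r).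
Local Notation D := (rect (- a) a (- b) b).
Local Notation cint := (cint a b).
Local Notation res := (residue a b).
Implicit Types (p : R * R) (g : R * R -> C).
Let oT := @openT (R * R)%type.
Let o : R * R := (0, 0).

Definition kern (z0 p : R * R) : C := ckern z0 p * dbar (chic rho) p.
Definition kap (z0 : R * R) : C := cint (kern z0).

Lemma kern0 z0 p : snorm p < rho \/ 2 * rho < snorm p -> kern z0 p = 0.
Proof. by move=> h; rewrite /kern (dbar_chic0 rho0 h) mulr0. Qed.

Lemma csm_kern z0 : snorm z0 < rho -> csm setT (kern z0).
Proof.
move=> h; have oU := @open_away R z0.
have S : csm (away z0 `|` [set p | snorm p < rho]) (kern z0).
  apply: (csm_patch oU (@open_snorm_lt R rho) (csmM oU (proj1 (hol_ckern z0))
    (csm_dbar oU (@csm_chic R (away z0) rho oU)))) => p hp.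
  by apply: kern0; left.
apply: csm_sub S => p _; have [h'|h'] := ltP (snorm p) rho; first by right.
by left; rewrite /away /=; have := snorm_sub p z0; move: h h'; move: (snorm p) (snorm z0) (snorm (p - z0)) => x y z; lra.
Qed.

Let DT : D `<=` setT. Proof. by []. Qed.

Lemma re_kern p : re (kern o p) =
  2^-1 * (p.1 * dx (chi rho) p + p.2 * dy (chi rho) p) / (p.1 ^+ 2 + p.2 ^+ 2).
Proof.
rewrite /kern /ckern (_ : zc p - zc o = zc p); last by apply: complex_ext; rewrite /= oppr0 addr0.
rewrite dbar_real; move: (dx _ _) (dy _ _) => u v.
by rewrite reM reV imV /= !mul0r subr0 addr0; ring.
Qed.

Lemma kap0 : kap o != 0.
Proof.
apply/negP => /eqP K0.
have h0 : snorm o < rho.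
  by rewrite (_ : snorm o = 0) //; apply/eqP; rewrite snorm_eq0.
have [S1 _] := csm_kern h0.
have I0 : rint (- a) a (- b) b (re \o kern o) = 0 by exact: (congr1 re K0).
have neg p : 0 <= - (re \o kern o) p.
  rewrite oppr_ge0 [leLHS](re_kern p); have [h1 h2] := chi_radial p rho0.
  rewrite mulr_le0_ge0 ?invr_ge0 ?addr_ge0 ?sqr_ge0 // mulr_ge0_le0 ?invr_ge0 //.
  by move: h1 h2; move: (_ * _) (_ * _) => x y; lra.
have cont p : D p -> {for p, continuous (re \o kern o)} by move=> _; exact: smooth_continuous S1 I.
have contN p : D p -> {for p, continuous (fun p => - (re \o kern o) p)}.
  by move=> Dp; apply: continuousN; exact: cont.
have IN : rint (- a) a (- b) b (fun p => - (re \o kern o) p) = 0.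
  rewrite (eq_rint (g := fun p => (-1) * (re \o kern o) p)) => [|p _]; last by rewrite mulN1r.
  by rewrite (rintZ _ cont) I0 mulr0.
have aa : - a < a by rewrite gtrN.
have bb : - b < b by rewrite gtrN.
have Z p : D p -> re (kern o p) = 0.
  move=> Dp; have := rint_eq0 aa bb contN (fun p _ => neg p) IN Dp.
  by move/eqP; rewrite oppr_eq0 => /eqP.
pose y0 : R := 0.
have dx0 x : rho <= x <= 2 * rho -> dx (chi rho) (x, y0) = 0.
  move=> /andP[h1 h2]; have x0 : 0 < x by exact: lt_le_trans h1.
  have Dx : D (x, y0).
    split; rewrite /= in_itv /= /y0; last by rewrite oppr_le0 !ltW.
    rewrite (le_trans h2 (le_trans (ltW rhor) ra)) (le_trans _ (ltW x0)) //.
    by rewrite oppr_le0 ltW.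
  have := Z _ Dx; rewrite (re_kern (x, y0)) /= /y0 mul0r addr0 expr0n addr0.
  move: (dx _ _) => u H; have -> : u = 2 * x * (2^-1 * (x * u) / x ^+ 2).
    by field; rewrite gt_eqF.
  by rewrite H mulr0.
have r2 : rho < 2 * rho by rewrite ltr_pMl // ltr1n.
have sn (x : R) : 0 < x -> snorm (x, y0) = x.
  by move=> x0; rewrite /snorm /= normr0 gtr0_norm //; apply/max_idPl; rewrite ltW.
have r20 : 0 < 2 * rho by rewrite mulr_gt0.
have c1 : chi rho (rho, y0) = 1 by rewrite chi_eq1 // sn.
have c2 : chi rho (2 * rho, y0) = 0 by rewrite chi_eq0 // sn.
have [z hz E2] := @MVT_closed R (fun x => chi rho (x, y0)) (fun x => dx (chi rho) (x, y0)) rho (2 * rho) r2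
  (fun x _ => is_derive_slice_x (smooth_chi rho oT) (I : setT (x, y0))).
by move: E2; rewrite (dx0 z hz) mul0r c1 c2 sub0r => /eqP; rewrite oppr_eq0 oner_eq0.
Qed.

Lemma D_box p : snorm p <= 2 * rho -> D p.
Proof.
move=> h; have : snorm p <= r by apply: (le_trans h (ltW rhor)).
rewrite snorm_le !ler_norml => /andP[/andP[h1 h2] /andP[h3 h4]].
split; rewrite /= in_itv /=.
  apply/andP; split; last exact: (le_trans h2 ra).
  by apply: (le_trans _ h1); rewrite lerN2.
apply/andP; split; last exact: (le_trans h4 rb).
by apply: (le_trans _ h3); rewrite lerN2.
Qed.

Let rho2 : - (2 * rho) <= 2 * rho.
Proof. by rewrite ge0_cp // mulr_ge0 // ltW. Qed.

Lemma kap_lower : exists2 k, 0 < k & exists2 dl, 0 < dl & forall z0, snorm z0 <= dl -> k <= nc (kap z0).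
Proof.
have [M M0 HM] := @dbar_chic_bound R.
have k0 : 0 < nc (kap o) by rewrite nc_gt0 kap0.
pose L := 2 * (4 / rho ^+ 2 * (M / rho) * ((2 * rho - - (2 * rho)) * (2 * rho - - (2 * rho)))).
have L0 : 0 < L.
  have h : 0 < 2 * rho - - (2 * rho) by rewrite opprK addr_gt0 // mulr_gt0.
  by rewrite /L !mulr_gt0 // ?invr_gt0 ?exprn_gt0.
exists (nc (kap o) / 2); first by rewrite divr_gt0.
exists (Num.min (rho / 2) (nc (kap o) / (2 * L))).
  by rewrite lt_min !divr_gt0 // mulr_gt0.
move=> z0; rewrite le_min => /andP[h1 h2].
have o0 : snorm o = 0 by apply/eqP; rewrite snorm_eq0.
have so : snorm o < rho by rewrite o0.
have sz : snorm z0 < rho by apply: (le_lt_trans h1); move: rho0; lra.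
suff H : nc (kap z0 - kap o) <= snorm z0 * L.
  have h3 : snorm z0 * L <= nc (kap o) / 2.
    have -> : nc (kap o) / 2 = nc (kap o) / (2 * L) * L by field; rewrite gt_eqF.
    by rewrite ler_pM2r.
  have := ncB (kap z0) (kap z0 - kap o); rewrite opprB addrC subrK => h4.
  move: h4 (le_trans H h3); move: (nc _) (nc _) (nc _) => x y z; lra.
have So := csm_kern so; have Sz := csm_kern sz.
rewrite /kap -(cintB DT Sz So oT) /L mulrCA mulrA -mulrA.
rewrite [snorm z0 * _]mulrA; rewrite [snorm z0 * _]mulrA.
apply: (cint_bound DT (csmB oT Sz So) rho2 rho2).
- by move=> p /snorm_rect; exact: D_box.
- move=> p _ np; have hp : 2 * rho < snorm p.
    by rewrite ltNge; apply/negP => h; apply: np; apply/snorm_rect.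
  by rewrite !kern0 ?subrr //; right.
move=> p /snorm_rect hp; have [h|h] := ltP (snorm p) rho.
  have e1 : kern z0 p = 0 by apply: kern0; left.
  have e2 : kern o p = 0 by apply: kern0; left.
  rewrite e1 e2 subrr nc0 !mulr_ge0 ?snorm_ge0 ?invr_ge0 ?exprn_ge0 // ltW //.
have hz : rho / 2 <= snorm (p - z0).
  by have := snorm_sub p z0; move: h h1; move: (snorm p) (snorm z0) (snorm (p - z0)) => x y z; lra.
have r20 : 0 < rho / 2 by rewrite divr_gt0.
have pz : zc p - zc z0 != 0 by apply: zcB_neq0; exact: lt_le_trans hz.
have po : 0 < snorm (p - o) by rewrite (_ : p - o = p) ?(lt_le_trans rho0 h) // /o subr0.
have pn : zc p - zc o != 0 by apply: zcB_neq0.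
have -> : kern z0 p - kern o p = zc z0 * (ckern z0 p * ckern o p) * dbar (chic rho) p.
  rewrite /kern /ckern; have E0 : zc z0 = (zc p - zc o) - (zc p - zc z0).
    by rewrite (_ : zc o = 0) //; ring.
  move: pz pn E0; move: (dbar _ _) (zc z0) (zc p - zc o) (zc p - zc z0) => z t y x hx hy ->.
  by field; rewrite hx hy.
rewrite ncM; apply: (ler_pM (nc_ge0 _) (nc_ge0 _)); last exact: HM.
rewrite ncM; have -> : snorm z0 * (4 / rho ^+ 2) = 2 * snorm z0 * ((rho / 2)^-1 * rho^-1).
  by field; rewrite gt_eqF.
apply: (ler_pM (nc_ge0 _) (nc_ge0 _)); first exact: nc_snorm.
rewrite ncM; apply: (ler_pM (nc_ge0 _) (nc_ge0 _)); first exact: nc_ckern.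
by apply: nc_ckern => //; rewrite /o subr0.
Qed.

(** a holomorphic function on a punctured disc whose Laurent coefficients of
    negative index vanish is bounded near the puncture *)
Theorem hol_bounded_near g : hol (pb r) g ->
  (exists2 dl, 0 < dl & forall z0, 0 < snorm z0 <= dl ->
     exists e, [/\ 0 < e, 8 * e <= snorm z0 & res (fun p => g p * ckern z0 p) e = 0]) ->
  exists2 dl, 0 < dl & exists M, forall z0, 0 < snorm z0 <= dl -> nc (g z0) <= M.
Proof.
move=> Hg [d1 d10 Hres]; have [k k0 [d2 d20 Hk]] := kap_lower.
have [Sg _] := Hg.
have oP := @open_pb R r.
have Sgc : csm setT (fun p => g p * dbar (chic rho) p).
  have S := csm_res Sg rho0 rhor; apply: csm_sub S => p _.
  have [h|h] := ltP (snorm p) rho; first by right; left.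
  have [h'|h'] := ltP (2 * rho) (snorm p); first by right; right.
  by left; rewrite /pb /= (lt_le_trans rho0 h) (le_lt_trans h' rhor).
have [B [B0 HB]] : exists B, 0 <= B /\ forall p, D p -> nc (g p * dbar (chic rho) p) <= B.
  have [S1 S2] := Sgc.
  have [B1 H1] := rect_bounded (fun p (_ : D p) => smooth_continuous S1 (I : setT p)).
  have [B2 H2] := rect_bounded (fun p (_ : D p) => smooth_continuous S2 (I : setT p)).
  exists (`|B1| + `|B2|); split; first by rewrite addr_ge0.
  move=> p Dp; apply: (le_trans (nc_le _)); apply: lerD.
    exact: (le_trans (H1 p Dp) (ler_norm _)).
  exact: (le_trans (H2 p Dp) (ler_norm _)).
exists (Num.min (rho / 2) (Num.min d1 d2)); first by rewrite !lt_min divr_gt0 // d10.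
exists (2 * (B * (rho / 2)^-1 * ((2 * rho - - (2 * rho)) * (2 * rho - - (2 * rho)))) / k).
move=> z0 /andP[z00]; rewrite !le_min => /and3P[h1 h2 h3].
have z01 : 0 < snorm z0 <= d1 by rewrite z00.
have [e [e0 ez E]] := Hres z0 z01.
have z0rho : 2 * snorm z0 <= rho by move: h1; move: (snorm z0) => x; lra.
have P := pompeiu a0 b0 ra rb Hg rho0 rhor z00 z0rho e0 ez.
rewrite E subr0 in P.
rewrite ler_pdivlMr //; apply: (le_trans (y := nc (g z0) * nc (kap z0))).
  by rewrite ler_wpM2l ?nc_ge0 // Hk.
rewrite -ncM P.
have sz : snorm z0 < rho by move: h1 rho0; move: (snorm z0) => x; lra.
have EF p : g p * ckern z0 p * dbar (chic rho) p = ckern z0 p * (g p * dbar (chic rho) p) by ring.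
rewrite (eq_cint (fun p _ => EF p)).
have z0p : forall p, snorm p < rho -> g p * dbar (chic rho) p = 0.
  by move=> p hp; rewrite dbar_chic0 ?mulr0 //; left.
have SF : csm setT (fun p => ckern z0 p * (g p * dbar (chic rho) p)).
  have oU := @open_away R z0.
  have S : csm (away z0 `|` [set p | snorm p < rho]) (fun p => ckern z0 p * (g p * dbar (chic rho) p)).
    apply: (csm_patch oU (@open_snorm_lt R rho) (csmM oU (proj1 (hol_ckern z0)) (csm_sub (@subsetT _ _) Sgc))) => p hp.
    by rewrite z0p ?mulr0.
  apply: csm_sub S => p _; have [h'|h'] := ltP (snorm p) rho; first by right.
  by left; rewrite /away /=; have := snorm_sub p z0; move: sz h'; move: (snorm p) (snorm z0) (snorm (p - z0)) => x y z; lra.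
apply: (cint_bound DT SF rho2 rho2).
- by move=> p /snorm_rect; exact: D_box.
- move=> p _ np; have hp : 2 * rho < snorm p.
    by rewrite ltNge; apply/negP => h; apply: np; apply/snorm_rect.
  have -> : dbar (chic rho) p = 0 by apply: dbar_chic0 => //; right.
  by rewrite !mulr0.
move=> p /snorm_rect hp; rewrite mulrC; have [h|h] := ltP (snorm p) rho.
  by rewrite z0p // mul0r nc0 mulr_ge0 // invr_ge0 divr_ge0 // ltW.
rewrite ncM; apply: (ler_pM (nc_ge0 _) (nc_ge0 _)); first by apply: HB; exact: D_box.
apply: nc_ckern; first by rewrite divr_gt0.
by have := snorm_sub p z0; move: h h1; move: (snorm p) (snorm z0) (snorm (p - z0)) => x y z; lra.
Qed.

End BoundedNear.

(*@@@ 10*)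
Local Open Scope complex_scope.
Opaque dx dy.

Section Energy.
Context {R : realType}.
Implicit Types (p : R * R) (f g v : R * R -> R) (e t : R).
Let oT := @openT (R * R)%type.

Lemma smooth_patch (U W : set (R * R)) f : open W -> smooth_on U f ->
  (forall p, W p -> f p = 0) -> smooth_on (U `|` W) f.
Proof.
move=> oW S H; apply: smooth_onU S _.
by apply: (smooth_on_ext oW _ (smooth_cst 0 oW)) => p /H ->.
Qed.

Lemma half_sum (x y z : R) : 0 <= x -> 0 <= y -> 2^-1 * (x + y) + z <= x + z + y.
Proof. by move=> x0 y0; lra. Qed.

Variables (a b r : R).
Hypotheses (a0 : 0 < a) (b0 : 0 < b) (ra : r <= a) (rb : r <= b).
Local Notation D := (rect (- a) a (- b) b).
Local Notation I := (rint (- a) a (- b) b).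

Lemma smooth_contD (U : set (R * R)) f : D `<=` U -> smooth_on U f ->
  forall p, D p -> {for p, continuous f}.
Proof. by move=> DU S p Dp; apply: smooth_continuous S (DU _ Dp). Qed.

Lemma box_sub_D e p : e <= r -> snorm p <= e -> D p.
Proof.
move=> er h; have : snorm p <= r by apply: (le_trans h er).
rewrite snorm_le !ler_norml => /andP[/andP[h1 h2] /andP[h3 h4]].
split; rewrite /= in_itv /=.
  apply/andP; split; last exact: (le_trans h2 ra).
  by apply: (le_trans _ h1); rewrite lerN2.
apply/andP; split; last exact: (le_trans h4 rb).
by apply: (le_trans _ h3); rewrite lerN2.
Qed.

Lemma chi_contD e p : D p -> {for p, continuous (chi e)}.
Proof. by move=> _; apply: smooth_continuous (smooth_chi e oT) _. Qed.

Lemma rint_chi_le e : 0 < e -> 2 * e <= r -> I (chi e) <= 16 * e ^+ 2.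
Proof.
move=> e0 er; have e2 : - (2 * e) <= 2 * e by rewrite ge0_cp // mulr_ge0 // ltW.
have sub : rect (- (2 * e)) (2 * e) (- (2 * e)) (2 * e) `<=` D.
  by move=> p /snorm_rect; apply: box_sub_D.
rewrite (rint_sub sub); last first.
  move=> p _ np; apply: chi_eq0 => //; rewrite leNgt; apply/negP => h; apply: np.
  by apply/snorm_rect; rewrite ltW.
have H := rint_bound e2 e2 (fun p (_ : rect (- (2 * e)) (2 * e) (- (2 * e)) (2 * e) p) =>
  smooth_continuous (smooth_chi e oT) (Logic.I : setT p)).
apply: (le_trans (ler_norm _)); apply: (le_trans (H 1 _)).
  by move=> p _; rewrite ger0_norm ?chi_ge0 // chi_le1.
by rewrite le_eqVlt; apply/orP; left; apply/eqP; ring.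
Qed.

(** the shell cutoff *)
Definition shell e' e p := chi e' p - chi e p.

Lemma shell_ge0 e' e p : 0 < e -> 2 * e <= e' -> 0 <= shell e' e p.
Proof.
move=> e0 he; have e'0 : 0 < e' by apply: lt_le_trans he; rewrite mulr_gt0.
rewrite /shell subr_ge0; have [h|h] := leP (snorm p) e'.
  by rewrite (chi_eq1 e'0 h) chi_le1.
by rewrite (chi_eq0 e0 (le_trans he (ltW h))) chi_ge0.
Qed.

Lemma smooth_shell e' e : smooth_on setT (shell e' e).
Proof. exact: (smoothB oT (smooth_chi e' oT) (smooth_chi e oT)). Qed.

Lemma shell_out e' e p : 0 < e -> 2 * e <= e' -> snorm p < e \/ 2 * e' < snorm p -> shell e' e p = 0.
Proof.
move=> e0 he; have e'0 : 0 < e' by apply: lt_le_trans he; rewrite mulr_gt0.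
rewrite /shell => -[h|h].
  rewrite !chi_eq1 ?subrr // ?ltW //; apply: (lt_le_trans h).
  by apply: le_trans he; rewrite ler_peMl ?ltW // ltr1n.
rewrite !chi_eq0 ?subrr // ?ltW //; apply: le_lt_trans h.
by rewrite ler_pM2l //; apply: le_trans he; rewrite ler_peMl ?ltW // ltr1n.
Qed.

Lemma shell_eq1 e' e p : 0 < e -> 0 < e' -> 2 * e <= snorm p <= e' -> shell e' e p = 1.
Proof. by move=> e0 e'0 /andP[h1 h2]; rewrite /shell (chi_eq1 e'0 h2) (chi_eq0 e0 h1) subr0. Qed.

Definition sqgrad v p := dx v p ^+ 2 + dy v p ^+ 2.
Definition lap v p := dx (dx v) p + dy (dy v) p.

Lemma smooth_sqgrad U v : open U -> smooth_on U v -> smooth_on U (sqgrad v).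
Proof.
by move=> oU S; apply: smoothD => //; apply: smoothX => //; [apply: smooth_dx|apply: smooth_dy].
Qed.

Lemma smooth_lap U v : open U -> smooth_on U v -> smooth_on U (lap v).
Proof.
by move=> oU S; apply: smoothD => //; [do 2 apply: smooth_dx|do 2 apply: smooth_dy].
Qed.

(* f vanishes near the boundary and on an open set W covering the singularity *)
Lemma green (U W : set (R * R)) (v z : R * R -> R) t : open U -> open W -> D `<=` U `|` W ->
  smooth_on U v -> smooth_on setT z -> (forall p, W p -> z p = 0) -> t < r ->
  (forall p, t < snorm p -> z p = 0) ->
  [/\ smooth_on (U `|` W) (fun p => z p * sqgrad v p),
   smooth_on (U `|` W) (fun p => 2^-1 * (v p * v p * lap z p) - z p * (v p * lap v p)) &
   I (fun p => z p * sqgrad v p) = I (fun p => 2^-1 * (v p * v p * lap z p) - z p * (v p * lap v p))].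
Proof.
move=> oU oW DU Sv Sz zW tr zt.
have SzU : smooth_on U z by apply: smooth_on_sub Sz.
have [zx zy] : (forall p, W p -> dx z p = 0) /\ (forall p, W p -> dy z p = 0).
  by split=> p Wp; rewrite -(dx_cst 0 p, dy_cst 0 p); [apply: dx_near zW|apply: dy_near zW].
have lz p : W p -> lap z p = 0.
  move=> Wp; rewrite /lap (dx_near (g := fun=> 0) oW Wp zx) (dy_near (g := fun=> 0) oW Wp zy).
  by rewrite dx_cst dy_cst addr0.
have Svx := smooth_dx Sv; have Svy := smooth_dy Sv.
have Szx := smooth_dx SzU; have Szy := smooth_dy SzU.
have S1 : smooth_on (U `|` W) (fun p => z p * sqgrad v p).
  apply: smooth_patch => // [|p /zW ->]; last by rewrite mul0r.
  exact: smoothM (smooth_sqgrad oU Sv).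
have S2 : smooth_on (U `|` W) (fun p => 2^-1 * (v p * v p * lap z p) - z p * (v p * lap v p)).
  apply: smooth_patch => // [|p Wp]; last by rewrite zW // lz // mulr0 mul0r mulr0 subrr.
  apply: (smoothB oU (smoothZ _ oU (smoothM oU (smoothM oU Sv Sv) (smooth_lap oU SzU)))).
  exact: (smoothM oU SzU (smoothM oU Sv (smooth_lap oU Sv))).
pose P p := z p * (v p * dx v p) - 2^-1 * (v p * v p * dx z p).
pose Q p := z p * (v p * dy v p) - 2^-1 * (v p * v p * dy z p).
have P1 : smooth_on U P.
  exact: (smoothB oU (smoothM oU SzU (smoothM oU Sv Svx)) (smoothZ _ oU (smoothM oU (smoothM oU Sv Sv) Szx))).
have Q1 : smooth_on U Q.
  exact: (smoothB oU (smoothM oU SzU (smoothM oU Sv Svy)) (smoothZ _ oU (smoothM oU (smoothM oU Sv Sv) Szy))).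
have PW p : W p -> P p = 0 by move=> Wp; rewrite /P zW // zx // mul0r !mulr0 subrr.
have QW p : W p -> Q p = 0 by move=> Wp; rewrite /Q zW // zy // mul0r !mulr0 subrr.
have SP := smooth_patch oW P1 PW; have SQ := smooth_patch oW Q1 QW.
have oUW := openU oU oW.
have ot := @open_snorm_gt R t.
have [zxt zyt] : (forall p, t < snorm p -> dx z p = 0) /\ (forall p, t < snorm p -> dy z p = 0).
  by split=> p Wp; rewrite -(dx_cst 0 p, dy_cst 0 p); [apply: dx_near ot Wp zt|apply: dy_near ot Wp zt].
have Pt p : t < snorm p -> P p = 0 by move=> Wp; rewrite /P zt // zxt // mul0r !mulr0 subrr.
have Qt p : t < snorm p -> Q p = 0 by move=> Wp; rewrite /Q zt // zyt // mul0r !mulr0 subrr.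
have aa : - a < a by rewrite gtrN.
have bb : - b < b by rewrite gtrN.
have IP : I (dx P) = 0.
  apply: (rint_dx0 aa oUW DU SP) => y hy.
  have h x : x = a \/ x = - a -> P (x, y) = 0.
    by move=> hx; apply: Pt; exact: (lt_le_trans tr (le_trans ra (snorm_bd a0 hy hx))).
  by rewrite !h; [|left|right].
have IQ : I (dy Q) = 0.
  apply: (rint_dy0 bb oUW DU SQ) => x hx.
  have h y : y = b \/ y = - b -> Q (x, y) = 0.
    by move=> hy; apply: Qt; exact: (lt_le_trans tr (le_trans rb (snorm_bd2 b0 hx hy))).
  by rewrite !h; [|left|right].
split=> //.
have -> : I (fun p => z p * sqgrad v p) =
    I (fun p => dx P p + dy Q p + (2^-1 * (v p * v p * lap z p) - z p * (v p * lap v p))).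
  apply: eq_rint => p /DU [Up|Wp]; last first.
    rewrite (dx_near (g := fun=> 0) oW Wp PW) (dy_near (g := fun=> 0) oW Wp QW).
    by rewrite dx_cst dy_cst zW // lz // !mul0r !mulr0 subrr !addr0.
  rewrite /P /Q; have SvDx := smoothM oU Sv Svx; have SvDy := smoothM oU Sv Svy.
  have Svv := smoothM oU Sv Sv.
  rewrite (dxB (smoothM oU SzU SvDx) (smoothZ _ oU (smoothM oU Svv Szx)) Up).
  rewrite (dyB (smoothM oU SzU SvDy) (smoothZ _ oU (smoothM oU Svv Szy)) Up).
  rewrite (dxM SzU SvDx Up) (dyM SzU SvDy Up) (dxM Sv Svx Up) (dyM Sv Svy Up).
  rewrite (dxZ (smoothM oU Svv Szx) Up) (dyZ (smoothM oU Svv Szy) Up).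
  rewrite (dxM Svv Szx Up) (dyM Svv Szy Up) (dxM Sv Sv Up) (dyM Sv Sv Up).
  rewrite /sqgrad /lap; move: (z p) (v p) (dx z p) (dy z p) (dx v p) (dy v p) => z' v' zx' zy' vx vy.
  move: (dx _ _) (dy _ _) (dx _ _) (dy _ _) => c1 c2 c3 c4.
  by field.
have SdP := smooth_dx SP; have SdQ := smooth_dy SQ.
have E2 := rintD (smooth_contD DU SdP) (smooth_contD DU SdQ).
have {}E2 := etrans E2 (etrans (f_equal2 +%R IP IQ) (addr0 0)).
have E1 := rintD (smooth_contD DU (smoothD oUW SdP SdQ)) (smooth_contD DU S2).
exact: (etrans E1 (etrans (f_equal2 +%R E2 erefl) (add0r _))).
Qed.

Section bounded.
Variables (v : R * R -> R) (V K : R).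
Hypotheses (Sv : smooth_on (pb r) v) (vV : forall p, pb r p -> `|v p| <= V)
  (vK : forall p, pb r p -> `|lap v p| <= K).
Local Notation hole e' e := ([set p : R * R | snorm p < e] `|` [set p | 2 * e' < snorm p]).

Let shell0 e' e : 0 < e -> 2 * e <= e' -> forall p, hole e' e p -> shell e' e p = 0.
Proof. by move=> e0 he p h; apply: shell_out. Qed.

Let shell_t e' e : 0 < e -> 2 * e <= e' -> forall p, 2 * e' < snorm p -> shell e' e p = 0.
Proof. by move=> e0 he p h; apply: shell_out => //; right. Qed.

Lemma shell_energy_cont e' e : 0 < e -> 2 * e <= e' -> 2 * e' < r -> forall p, D p ->
  {for p, continuous (fun p => shell e' e p * sqgrad v p)}.
Proof.
move=> e0 he e'r; have DU := pb_cover (a := a) (b := b) (r := r) e0 e'r.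
have [S1 _ _] := green (@open_pb R r) (@open_hole R e (2 * e')) DU Sv (smooth_shell e' e)
  (shell0 e0 he) e'r (shell_t e0 he).
exact: smooth_contD DU S1.
Qed.

Lemma lap_chi_bound : exists2 M : R, 0 < M & forall e p, 0 < e ->
  `|lap (chi e) p| <= M / e ^+ 2 * chi (2 * e) p /\ `|lap (chi e) p| <= M / e ^+ 2.
Proof.
have [M M0 HM] := @chi_bounds R; exists (2 * M); first by rewrite mulr_gt0.
move=> e p e0; have [_ _ [h1 _ _ h2]] := HM e p e0.
have h : `|lap (chi e) p| <= 2 * M / e ^+ 2.
  rewrite /lap -mulrA; move: h1 h2; move: (dx _ p) (dy _ p) (M / _) => x y z h1 h2.
  by rewrite mulrDl !mul1r; apply: (le_trans (ler_normD _ _)); exact: lerD.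
split=> //; have [hp|hp] := leP (snorm p) (2 * e).
  by rewrite (chi_eq1 _ hp) ?mulr1 // mulr_gt0.
have o := @open_snorm_gt R (2 * e).
have [k1 k2] := d_out (fun p (hp : 2 * e < snorm p) => chi_eq0 e0 (ltW hp)).
have [l1 _] := d_out k1; have [_ l2] := d_out k2.
rewrite /lap l1 // l2 // addr0 normr0 mulr_ge0 ?chi_ge0 // divr_ge0 ?sqr_ge0 // mulr_ge0 // ltW //.
Qed.

Lemma lap_shell e' e p : lap (shell e' e) p = lap (chi e') p - lap (chi e) p.
Proof.
have S1 := smooth_chi e' oT; have S2 := smooth_chi e oT.
have Tp : setT p by [].
rewrite /lap (dx_near (g := fun p => dx (chi e') p - dx (chi e) p) oT Tp); last first.
  by move=> q Tq; exact: dxB S1 S2 Tq.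
rewrite (dy_near (g := fun p => dy (chi e') p - dy (chi e) p) oT Tp); last first.
  by move=> q Tq; exact: dyB S1 S2 Tq.
rewrite (dxB (smooth_dx S1) (smooth_dx S2) Tp) (dyB (smooth_dy S1) (smooth_dy S2) Tp).
by rewrite opprD addrACA.
Qed.

Lemma energy_bound A : 0 < A -> 2 * A < r -> exists2 E, 0 <= E & forall e, 0 < e -> 2 * e <= A ->
  I (fun p => shell A e p * sqgrad v p) <= E.
Proof.
move=> A0 Ar; have [M M0 HM] := lap_chi_bound.
have pA : pb r (A, 0).
  rewrite /pb /= /snorm /= normr0 gtr0_norm // (max_idPl (ltW A0)) A0 /=.
  by apply: (le_lt_trans _ Ar); rewrite ler_peMl ?ltW // ltr1n.
have V0 : 0 <= V := le_trans (normr_ge0 _) (vV pA).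
have K0 : 0 <= K := le_trans (normr_ge0 _) (vK pA).
have MA : 0 <= M / A ^+ 2 by rewrite divr_ge0 ?sqr_ge0 // ltW.
pose c1 := V ^+ 2 * (M / A ^+ 2) + V * K; pose c2 := V ^+ 2 * M.
have c10 : 0 <= c1 by rewrite addr_ge0 // mulr_ge0 // sqr_ge0.
have c20 : 0 <= c2 by rewrite mulr_ge0 ?sqr_ge0 // ltW.
have aa : - a <= a by rewrite ge0_cp // ltW.
have bb : - b <= b by rewrite ge0_cp // ltW.
exists (c1 * ((a - - a) * (b - - b)) + 64 * c2).
  have aD : 0 <= a - - a by rewrite subr_ge0.
  have bD : 0 <= b - - b by rewrite subr_ge0.
  exact: (addr_ge0 (mulr_ge0 c10 (mulr_ge0 aD bD)) (mulr_ge0 (ler0n _ _) c20)).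
move=> e e0 he; have DU := pb_cover (a := a) (b := b) (r := r) e0 Ar.
have [S1 S2 ->] := green (@open_pb R r) (@open_hole R e (2 * A)) DU Sv (smooth_shell A e)
  (shell0 e0 he) Ar (shell_t e0 he).
have e20 : 0 <= c2 / e ^+ 2 by rewrite divr_ge0 ?sqr_ge0.
pose m p := c1 + c2 / e ^+ 2 * chi (2 * e) p.
have Sm : smooth_on setT m.
  exact: (smoothD oT (smooth_cst c1 oT) (smoothZ _ oT (smooth_chi (2 * e) oT))).
apply: (le_trans (y := I m)).
  apply: (le_rint (smooth_contD DU S2) (smooth_contD (@subsetT _ _) Sm)) => p /DU [hp|hp]; last first.
    have z0 := shell0 e0 he.
    have oW := @open_hole R e (2 * A).
    have -> : lap (shell A e) p = 0.
      rewrite /lap (dx_near (g := fun=> 0) oW hp) ?(dy_near (g := fun=> 0) oW hp) ?dx_cst ?dy_cst ?addr0 //.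
        by move=> q hq; rewrite (dy_near oW hq z0) dy_cst.
      by move=> q hq; rewrite (dx_near oW hq z0) dx_cst.
    by rewrite z0 // mulr0 mul0r mulr0 subrr addr_ge0 // mulr_ge0 ?chi_ge0.
  have [Ha1 Ha2] := HM A p A0; have [He1 He2] := HM e p e0.
  have hv := vV hp; have hK := vK hp.
  have z1 : `|shell A e p| <= 1.
    rewrite ger0_norm ?shell_ge0 // /shell lerBlDr.
    by apply: (le_trans (chi_le1 A p)); rewrite lerDl chi_ge0.
  apply: (le_trans (ler_norm _)); apply: (le_trans (ler_normB _ _)).
  rewrite lap_shell !normrM (ger0_norm (x := 2^-1)) ?invr_ge0 //.
  apply: (le_trans (y := 2^-1 * (V * V * (M / A ^+ 2 + M / e ^+ 2 * chi (2 * e) p)) + 1 * (V * K))).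
    apply: lerD.
      rewrite ler_wpM2l ?invr_ge0 //.
      exact: (ler_pM (mulr_ge0 (normr_ge0 _) (normr_ge0 _)) (normr_ge0 _)
        (ler_pM (normr_ge0 _) (normr_ge0 _) hv hv) (le_trans (ler_normB _ _) (lerD Ha2 He1))).
    exact: (ler_pM (normr_ge0 _) (mulr_ge0 (normr_ge0 _) (normr_ge0 _)) z1
      (ler_pM (normr_ge0 _) (normr_ge0 _) hv hK)).
  rewrite /m /c1 /c2 mul1r.
  have t1 := mulr_ge0 (mulr_ge0 V0 V0) MA.
  have t2 := mulr_ge0 (mulr_ge0 V0 V0) (mulr_ge0 (divr_ge0 (ltW M0) (sqr_ge0 e)) (chi_ge0 (2 * e) p)).
  have -> : V ^+ 2 * M / e ^+ 2 * chi (2 * e) p = V * V * (M / e ^+ 2 * chi (2 * e) p).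
    by rewrite expr2 !mulrA.
  rewrite (expr2 V) (mulrDr (V * V)).
  exact: half_sum.
have e2r : 2 * (2 * e) <= r.
  by apply: ltW; apply: le_lt_trans Ar; rewrite ler_pM2l.
have e2 : 0 < 2 * e by rewrite mulr_gt0.
have cc : forall p, D p -> {for p, continuous (fun=> c1)} by move=> p _; exact: cst_continuous.
have E1 := rintD cc (smooth_contD (@subsetT _ _) (smoothZ (c2 / e ^+ 2) oT (smooth_chi (2 * e) oT))).
have E2 := rintZ (c2 / e ^+ 2) (chi_contD (e := 2 * e)).
rewrite /m E1 E2 rint_cst // lerD2l.
apply: (le_trans (ler_wpM2l e20 (rint_chi_le e2 e2r))).
by rewrite le_eqVlt; apply/orP; left; apply/eqP; field; rewrite gt_eqF.
Qed.

(** averaging over dyadic shells: a quantity which is controlled on every shell by the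
    energy of that shell vanishes, as the total energy is finite *)
Lemma energy_decay X B : 0 < r -> 0 <= B ->
  (forall e, 0 < e -> 8 * e < r -> exists f, [/\ forall p, D p -> {for p, continuous f},
     X <= I f,
     forall p, e <= snorm p <= 2 * e -> f p <= B * ((`|dx v p| + `|dy v p|) / e + sqgrad v p) &
     forall p, D p -> ~ (e <= snorm p <= 2 * e) -> f p <= 0]) -> X <= 0.
Proof.
move=> r0 B0 H; rewrite leNgt; apply/negP => X0.
pose A := r / 4; have A0 : 0 < A by rewrite divr_gt0.
have Ar : 2 * A < r by rewrite /A; move: r0; lra.
have [E E0 HE] := energy_bound A0 Ar.
pose ee (j : nat) := A / 8 ^+ j.
have ee0 j : 0 < ee j by rewrite divr_gt0 ?exprn_gt0.
have eeS j : ee j.+1 = ee j / 8 by rewrite /ee exprS invfM mulrA mulrAC.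
have eeA j : ee j <= A.
  rewrite /ee ler_pdivrMr ?exprn_gt0 //.
  by apply: ler_peMr; [exact: ltW|apply: exprn_ege1; rewrite ler1n].
have ee2 j : 2 * ee j.+1 <= ee j.
  by rewrite eeS; move: (ee0 j); move: (ee j) => x; lra.
have eer j : 2 * ee j < r.
  by apply: le_lt_trans Ar; rewrite ler_pM2l.
pose Ej j := I (fun p => shell (ee j) (ee j.+1) p * sqgrad v p).
have cE j := shell_energy_cont (ee0 j.+1) (ee2 j) (eer j).
have sumE J : \sum_(j < J.+1) Ej j = I (fun p => shell (ee 0) (ee J.+1) p * sqgrad v p).
  elim: J => [|J IH]; first by rewrite big_ord_recr big_ord0 /= add0r.
  have h0 : 2 * ee J.+1 <= ee 0%N.
    by rewrite {2}/ee expr0 divr1; apply: le_trans (ee2 J) (eeA J).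
  have c0 := shell_energy_cont (ee0 J.+1) h0 (eer 0%N).
  have e1 := rintD c0 (cE J.+1).
  rewrite big_ord_recr IH /=; apply: etrans (esym e1) _.
  by apply: eq_rint => p _; rewrite -mulrDl /shell; congr (_ * _); rewrite addrA subrK.
have bndE J : \sum_(j < J.+1) Ej j <= E.
  rewrite sumE {1}/ee expr0 divr1; apply: HE => //.
  by apply: le_trans (ee2 J) (eeA J).
have main t j : 0 < t -> X <= B * (1 + t^-1) * Ej j + 128 * (B * t).
  move=> t0; pose e := ee j / 4.
  have e0 : 0 < e by rewrite divr_gt0.
  have er : 8 * e < r by rewrite /e; move: (eer j); move: (ee j) => x; lra.
  have [f [cf Xf fin fout]] := H e e0 er.
  apply: le_trans Xf _; have e20 : 0 < 2 * e by rewrite mulr_gt0.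
  have k0 : 0 <= B * (1 + t^-1) by rewrite mulr_ge0 // addr_ge0 // invr_ge0 ltW.
  have k1 : 0 <= 2 * (B * t) / e ^+ 2.
    by rewrite divr_ge0 ?sqr_ge0 // mulr_ge0 // mulr_ge0 // ltW.
  have cs := rintZ (B * (1 + t^-1)) (cE j).
  have cc := rintZ (2 * (B * t) / e ^+ 2) (chi_contD (e := 2 * e)).
  have c1 p : D p -> {for p, continuous (fun p => B * (1 + t^-1) * (shell (ee j) (ee j.+1) p * sqgrad v p))}.
    by move=> Dp; apply: continuousM; [exact: cst_continuous|exact: cE].
  have c2 p : D p -> {for p, continuous (fun p => 2 * (B * t) / e ^+ 2 * chi (2 * e) p)}.
    by move=> Dp; apply: continuousM; [exact: cst_continuous|exact: chi_contD].
  have cD p : D p -> {for p, continuous (fun p => B * (1 + t^-1) * (shell (ee j) (ee j.+1) p * sqgrad v p)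
     + 2 * (B * t) / e ^+ 2 * chi (2 * e) p)}.
    by move=> Dp; apply: continuousD; [exact: c1|exact: c2].
  have sD := rintD c1 c2.
  apply: (le_trans (le_rint cf cD _)); last first.
    rewrite sD cs cc lerD2l; have er2 : 2 * (2 * e) <= r.
      by apply: ltW; apply: le_lt_trans er; rewrite mulrA ler_pM2r // -natrM ler_nat.
    apply: (le_trans (ler_wpM2l k1 (rint_chi_le e20 er2))).
    by rewrite le_eqVlt; apply/orP; left; apply/eqP; field; rewrite gt_eqF.
  move=> p Dp; have sq0 : 0 <= sqgrad v p by rewrite addr_ge0 ?sqr_ge0.
  have [hp|/negP hp] := boolP (e <= snorm p <= 2 * e); last first.
    apply: le_trans (fout p Dp hp) _.
    exact: (addr_ge0 (mulr_ge0 k0 (mulr_ge0 (shell_ge0 p (ee0 j.+1) (ee2 j)) sq0)) (mulr_ge0 k1 (chi_ge0 _ _))).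
  apply: (le_trans (fin p hp)).
  have -> : shell (ee j) (ee j.+1) p = 1.
    apply: shell_eq1 => //; move: hp; rewrite eeS /e; move: (ee j) (ee0 j) (snorm p) => x x0 s; lra.
  have -> : chi (2 * e) p = 1 by apply: chi_eq1 => //; case/andP: hp.
  rewrite mul1r mulr1 -mulrA -[X in _ <= _ + X]mulrA.
  have -> : B * ((1 + t^-1) * sqgrad v p) + 2 * (B * t * (e ^+ 2)^-1) =
    B * ((1 + t^-1) * sqgrad v p + 2 * t / e ^+ 2).
    by move: (sqgrad v p) (t^-1) ((e ^+ 2)^-1) => x y z; ring.
  rewrite ler_wpM2l // (mulrDl 1) mul1r [leLHS]addrC -[leRHS]addrA lerD2l mulrDl.
  have am (y : R) : `|y| / e <= y ^+ 2 / t + t / e ^+ 2.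
    have h : 0 <= (`|y| / t - e^-1) ^+ 2 * t by rewrite mulr_ge0 ?sqr_ge0 // ltW.
    have h2 : 0 <= `|y| / e by rewrite divr_ge0 // ltW.
    have E3 : (`|y| / t - e^-1) ^+ 2 * t = y ^+ 2 / t + t / e ^+ 2 - 2 * (`|y| / e).
      by rewrite -(real_normK (num_real y)); field; rewrite !gt_eqF.
    move: h h2; rewrite E3; move: (`|y| / e) (y ^+ 2 / t + t / e ^+ 2) => u w; lra.
  have := lerD (am (dx v p)) (am (dy v p)); rewrite addrACA -mulrDl => h; apply: (le_trans h).
  by rewrite le_eqVlt; apply/orP; left; apply/eqP; rewrite /sqgrad; ring.
pose t := X / (256 * (B + 1)).
have B1 : 0 < B + 1 by rewrite ltr_wpDl.
have h256 : 0 < 256 :> R by rewrite ltr0n.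
have t0 : 0 < t := divr_gt0 X0 (mulr_gt0 h256 B1).
have tX : 128 * (B * t) <= X / 2.
  have -> : 128 * (B * t) = X / 2 * (B / (B + 1)) by rewrite /t; field; rewrite gt_eqF.
  by rewrite ler_piMr ?divr_ge0 ?ltW // ltr_pdivrMr // mul1r ltrDl.
have X2 j : X / 2 <= B * (1 + t^-1) * Ej j.
  have := main t j t0; move: tX; move: (128 * _) (_ * Ej j) => x y; lra.
have SX J : J.+1%:R * (X / 2) <= B * (1 + t^-1) * E.
  apply: (le_trans (y := B * (1 + t^-1) * \sum_(j < J.+1) Ej j)).
    have -> : J.+1%:R * (X / 2) = \sum_(j < J.+1) (X / 2).
      by rewrite sumr_const card_ord mulr_natl.
    by rewrite mulr_sumr; apply: ler_sum => j _; exact: X2.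
  by rewrite ler_wpM2l // mulr_ge0 // addr_ge0 // invr_ge0 ltW.
have [J HJ] : exists J : nat, B * (1 + t^-1) * E / (X / 2) < J.+1%:R.
  exists (Num.truncn (B * (1 + t^-1) * E / (X / 2))); exact: truncnS_gt.
have X20 : 0 < X / 2 by rewrite divr_gt0.
by move: HJ; rewrite ltr_pdivrMr // ltNge SX.
Qed.
End bounded.

End Energy.

(*@@@ 11*)
Local Open Scope complex_scope.
Opaque dx dy.

Section Translation.
Context {R : realType}.
Implicit Types (f : R * R -> R) (p w : R * R).
Transparent dx dy.
Lemma dv_translate f v w p : dv v (fun q => f (q + w)) p = dv v f (p + w).
Proof. 
rewrite /dv /derive.
have -> : (fun h : R => h^-1 *: (((fun q => f (q + w)) \o shift p) (h *: v) - f (p + w))) =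
    (fun h : R => h^-1 *: ((f \o shift (p + w)) (h *: v) - f (p + w))).
  by apply/funext => h /=; rewrite /shift /= !addrA.
by [].
Qed.
Lemma dx_translate f w p : dx (fun q => f (q + w)) p = dx f (p + w).
Proof. exact: dv_translate. Qed.
Lemma dy_translate f w p : dy (fun q => f (q + w)) p = dy f (p + w).
Proof. exact: dv_translate. Qed.
End Translation.
Opaque dx dy.

Section Periodic.
Context {R : realType}.
Local Notation C := R[i].
Local Notation re := (@complex.Re R).
Local Notation im := (@complex.Im R).
Variable beta : R.
Hypothesis beta0 : 0 < beta.
Implicit Types (p q : R * R).

Definition biperiodic (T : Type) (f : R * R -> T) : Prop :=
  (forall p, f (p + (1, 0)) = f p) /\ (forall p, f (p + (0, beta)) = f p).

Lemma periodic_comp (S T : Type) (h : S -> T) (f : R * R -> S) :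
  biperiodic f -> biperiodic (fun p => h (f p)).
Proof. by move=> [h1 h2]; split=> p; rewrite ?h1 ?h2. Qed.

Lemma periodic_comp2 (S S' T : Type) (h : S -> S' -> T) (f : R * R -> S) (g : R * R -> S') :
  biperiodic f -> biperiodic g -> biperiodic (fun p => h (f p) (g p)).
Proof. by move=> [h1 h2] [h3 h4]; split=> p; rewrite ?h1 ?h2 ?h3 ?h4. Qed.

Lemma periodic_dx (f : R * R -> R) : biperiodic f -> biperiodic (dx f).
Proof.
by move=> [h1 h2]; split=> p; rewrite -dx_translate; congr (dx _ p); apply/funext.
Qed.

Lemma periodic_dy (f : R * R -> R) : biperiodic f -> biperiodic (dy f).
Proof.
by move=> [h1 h2]; split=> p; rewrite -dy_translate; congr (dy _ p); apply/funext.
Qed.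

Lemma periodic_cdx (f : R * R -> C) : biperiodic f -> biperiodic (cdx f).
Proof.
move=> h; apply: (@periodic_comp2 _ _ _ (fun x y => x +i* y));
  by apply: periodic_dx; apply: periodic_comp.
Qed.

Lemma periodic_cdy (f : R * R -> C) : biperiodic f -> biperiodic (cdy f).
Proof.
move=> h; apply: (@periodic_comp2 _ _ _ (fun x y => x +i* y));
  by apply: periodic_dy; apply: periodic_comp.
Qed.

Lemma periodic_dz (f : R * R -> C) : biperiodic f -> biperiodic (dz f).
Proof.
move=> h; apply: (@periodic_comp _ _ (fun x => 2^-1%:C * x)).
by apply: (@periodic_comp2 _ _ _ (fun x y => x - 'i * y)); [exact: periodic_cdx|exact: periodic_cdy].
Qed.

Definition Omega : set (R * R) :=
  [set p | ~~ ((p.1 \is a Num.int) && (p.2 / beta \is a Num.int))].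

Lemma open_nonint (f : R * R -> R) : continuous f -> open [set p | f p \isn't a Num.int].
Proof.
move=> cf; have -> : [set p | f p \isn't a Num.int] =
    \bigcup_(m in [set: int]) ([set p | (m%:~R : R) < f p] `&` [set p | f p < (m + 1)%:~R]).
  apply/seteqP; split=> p /=.
    move=> h; exists (Num.floor (f p)) => //; have /andP[h1 h2] := floor_itv (f p).
    split=> //=; rewrite lt_neqAle h1 andbT; apply/negP => /eqP E.
    by move: h; rewrite -E intr_int.
  move=> [m _ [/= h1 h2]]; apply/negP => /intrP[k E].
  by move: h1 h2; rewrite E !ltr_int; lia.
apply: bigcup_open => m _; apply: openI.
  rewrite (_ : [set p | _] = f @^-1` [set x | x > m%:~R]) //.
  by apply: open_comp => [p _|]; [exact: cf|exact: open_gt].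
rewrite (_ : [set p | _] = f @^-1` [set x | x < (m + 1)%:~R]) //.
by apply: open_comp => [p _|]; [exact: cf|exact: open_lt].
Qed.

Lemma continuous_snd_scaled : continuous (fun p : R * R => p.2 / beta).
Proof.
move=> p; apply: continuousM; last exact: cst_continuous.
exact: (smooth_continuous (smooth_snd (@openT (R * R)%type)) (I : setT p)).
Qed.

Lemma continuous_fst : continuous (fun p : R * R => p.1).
Proof. by move=> p; exact: (smooth_continuous (smooth_fst (@openT (R * R)%type)) (I : setT p)). Qed.

Lemma open_Omega : open Omega.
Proof.
have -> : Omega = [set p | p.1 \isn't a Num.int] `|` [set p | p.2 / beta \isn't a Num.int].
  apply/seteqP; split=> p; rewrite /Omega /= negb_and.
    by case/orP => h; [left|right].
  by case=> ->; rewrite ?orbT.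
by apply: openU; apply: open_nonint; [exact: continuous_fst|exact: continuous_snd_scaled].
Qed.

Local Notation a := (2^-1 : R).
Local Notation b := (beta / 2).
Local Notation D := (rect (- a) a (- b) b).

Lemma ahalf_gt0 : 0 < a. Proof. by rewrite invr_gt0. Qed.
Lemma halfb_gt0 : 0 < b. Proof. by rewrite divr_gt0. Qed.

Lemma small_int (x : R) : x \is a Num.int -> `|x| < 1 -> x = 0.
Proof.
by move=> xi h; apply/eqP/negPn/negP => x0; move: h; rewrite ltNge norm_intr_ge1.
Qed.

Lemma cell_Omega p : D p -> p = (0, 0) \/ Omega p.
Proof.
rewrite /rect /= !in_itv /= => -[/andP[h1 h2] /andP[h3 h4]].
have [/andP[i1 i2]|h] := boolP ((p.1 \is a Num.int) && (p.2 / beta \is a Num.int)); last by right.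
left; have x0 : p.1 = 0.
  by apply: small_int i1 _; rewrite ltr_norml; move: h1 h2; lra.
have y0 : p.2 / beta = 0.
  apply: small_int i2 _; rewrite ltr_norml ltr_pdivlMr // ltr_pdivrMr //.
  by move: h3 h4 beta0; lra.
have {}y0 : p.2 = 0 by apply/eqP; move/eqP: y0; rewrite mulf_eq0 invr_eq0 (gt_eqF beta0) orbF.
by rewrite [p]surjective_pairing x0 y0.
Qed.

Lemma pb_D r p : r <= a -> r <= b -> pb r p -> D p.
Proof. by move=> ra rb /andP[h1 h2]; apply: (box_sub_D ra rb (lexx r)); exact: ltW. Qed.

Lemma pb_Omega r : r <= a -> r <= b -> pb r `<=` Omega.
Proof.
move=> ra rb p h; have [E|//] := cell_Omega (pb_D ra rb h).
by move: h; rewrite /pb /= E => /andP[]; rewrite snorm_gt0 eqxx.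
Qed.

Lemma periodic_int (T : Type) (f : R * R -> T) : biperiodic f -> forall (m n : int) p,
  f (p + (m%:~R, n%:~R * beta)) = f p.
Proof.
move=> [f1 f2]; have X (m : int) p : f (p + (m%:~R, 0)) = f p.
  elim/int_rec: m p => [|m IH|m IH] p; first by rewrite (_ : (_, _) = 0) // addr0.
    rewrite -(IH p) -[RHS]f1; congr f; apply/pair_equal_spec; split=> /=; last by rewrite !addr0.
    by rewrite -addrA -[m.+1]addn1 PoszD intrD.
  rewrite -(IH p) -[LHS]f1; congr f; apply/pair_equal_spec; split=> /=; last by rewrite !addr0.
  by rewrite -addrA -[m.+1]addn1 PoszD opprD intrD mulrN1z subrK.
have Y (n : int) p : f (p + (0, n%:~R * beta)) = f p.
  elim/int_rec: n p => [|m IH|m IH] p; first by rewrite mul0r (_ : (_, _) = 0) // addr0.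
    rewrite -(IH p) -[RHS]f2; congr f; apply/pair_equal_spec; split=> /=; first by rewrite !addr0.
    by rewrite -addrA -[m.+1]addn1 PoszD intrD mulrDl mul1r.
  rewrite -(IH p) -[LHS]f2; congr f; apply/pair_equal_spec; split=> /=; first by rewrite !addr0.
  by rewrite -addrA -[m.+1]addn1 PoszD opprD intrD mulrDl mulrN1z mulN1r subrK.
move=> m n p; rewrite -[RHS](X m) -[RHS](Y n); congr f.
by apply/pair_equal_spec; split; rewrite /= ?addr0 // addr0.
Qed.

Lemma reduce_cell p : Omega p -> exists q, [/\ D q, Omega q, q != (0, 0) &
  forall T (f : R * R -> T), biperiodic f -> f p = f q].
Proof.
move=> Op; pose m := Num.floor (p.1 + 2^-1); pose n := Num.floor (p.2 / beta + 2^-1).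
pose q := p - (m%:~R, n%:~R * beta) : R * R.
have pq : p = q + (m%:~R, n%:~R * beta) by rewrite subrK.
have /andP[h1 h2] := floor_itv (p.1 + 2^-1).
have /andP[h3 h4] := floor_itv (p.2 / beta + 2^-1).
have Dq : D q.
  rewrite /rect /= !in_itv /=; split.
    by move: h1 h2; rewrite -/m intrD; lra.
  have E : p.2 = p.2 / beta * beta by rewrite mulfVK // gt_eqF.
  have e1 : 0 <= (p.2 / beta + 2^-1 - n%:~R) * beta by rewrite mulr_ge0 ?subr_ge0 // ltW.
  have e2 : 0 <= (n%:~R + 1 - (p.2 / beta + 2^-1)) * beta.
    by rewrite mulr_ge0 ?subr_ge0 // ltW //; move: h4; rewrite intrD.
  move: e1 e2; rewrite E mulfK ?gt_eqF //; move: (p.2 / beta) (n%:~R : R) => y k; clear; nra.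
exists q; split=> //.
- have [E|//] := cell_Omega Dq; move: Op; rewrite pq E /Omega /= !add0r mulfK ?gt_eqF //.
  by rewrite !intr_int.
- apply/eqP => E; move: Op; rewrite pq E /Omega /= !add0r mulfK ?gt_eqF //.
  by rewrite !intr_int.
by move=> T f /periodic_int H; rewrite {1}pq H.
Qed.

Lemma Omega_top x : Omega (x, b).
Proof.
rewrite /Omega /= negb_and; apply/orP; right; rewrite mulrAC divff ?gt_eqF // mul1r.
by apply/negP => /small_int h; have := ahalf_gt0; rewrite h ?ltxx // gtr0_norm ?ahalf_gt0 // invf_lt1 // ltr1n.
Qed.

Lemma Omega_right y : Omega (a, y).
Proof.
rewrite /Omega /= negb_and; apply/orP; left.
by apply/negP => /small_int h; have := ahalf_gt0; rewrite h ?ltxx // gtr0_norm ?ahalf_gt0 // invf_lt1 // ltr1n.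
Qed.

Lemma slice_x_const (f : R * R -> R) y : smooth_on Omega f -> (forall x, Omega (x, y)) ->
  (forall x, dx f (x, y) = 0) -> forall x x', f (x, y) = f (x', y).
Proof.
move=> Sf Oy d0; suff H x x' : x < x' -> f (x, y) = f (x', y).
  by move=> x x'; case: (ltgtP x x') => [/H|/H ->|->].
move=> h; have [s _ E] := @MVT_closed R (fun x => f (x, y)) (fun x => dx f (x, y)) x x' h
  (fun s _ => is_derive_slice_x Sf (Oy s)).
by apply/eqP; rewrite eq_sym -subr_eq0 E d0 mul0r.
Qed.

Lemma slice_y_const (f : R * R -> R) x : smooth_on Omega f -> (forall y, Omega (x, y)) ->
  (forall y, dy f (x, y) = 0) -> forall y y', f (x, y) = f (x, y').
Proof.
move=> Sf Ox d0; suff H y y' : y < y' -> f (x, y) = f (x, y').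
  by move=> y y'; case: (ltgtP y y') => [/H|/H ->|->].
move=> h; have [s _ E] := @MVT_closed R (fun y => f (x, y)) (fun y => dy f (x, y)) y y' h
  (fun s _ => is_derive_slice_y Sf (Ox s)).
by apply/eqP; rewrite eq_sym -subr_eq0 E d0 mul0r.
Qed.

Lemma grad0_const (f : R * R -> R) : smooth_on Omega f -> (forall p, Omega p -> dx f p = 0) ->
  (forall p, Omega p -> dy f p = 0) -> forall p, Omega p -> f p = f (a, b).
Proof.
move=> Sf fx fy [x y]; rewrite {1}/Omega /= negb_and => /orP[h|h].
  have Ox y' : Omega (x, y') by rewrite /Omega /= negb_and h.
  rewrite (slice_y_const Sf Ox (fun y => fy _ (Ox y)) y b).
  exact: (slice_x_const Sf Omega_top (fun x => fx _ (Omega_top x))).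
have Oy x' : Omega (x', y) by rewrite /Omega /= negb_and h orbT.
rewrite (slice_x_const Sf Oy (fun y => fx _ (Oy y)) x a).
exact: (slice_y_const Sf Omega_right (fun x => fy _ (Omega_right x))).
Qed.

End Periodic.

(*@@@ 12*)
Local Open Scope complex_scope.
Opaque dx dy.

Section Liouville.
Context {R : realType}.
Local Notation C := R[i].
Local Notation re := (@complex.Re R).
Local Notation im := (@complex.Im R).
Variables (beta r : R).
Hypotheses (beta0 : 0 < beta) (r0 : 0 < r) (ra : r <= 2^-1) (rb : r <= beta / 2).
Implicit Types (p q : R * R).
Local Notation a := (2^-1 : R).
Local Notation b := (beta / 2).
Local Notation D := (rect (- a) a (- b) b).
Local Notation I := (rint (- a) a (- b) b).
Local Notation Om := (Omega beta).
Let oT := @openT (R * R)%type.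
Let oO := open_Omega beta0.

Lemma periodic_sides (T : Type) (f : R * R -> T) : biperiodic beta f ->
  (forall y, f (- a, y) = f (a, y)) /\ (forall x, f (x, - b) = f (x, b)).
Proof.
move=> [h1 h2]; split=> t.
  by rewrite -(h1 (- a, t)); congr f; apply/pair_equal_spec; split=> /=; lra.
by rewrite -(h2 (t, - b)); congr f; apply/pair_equal_spec; split=> /=; lra.
Qed.

Lemma cell_cover e : 0 < e -> D `<=` Om `|` [set p | snorm p < e].
Proof.
move=> e0 p /(cell_Omega beta0)[->|]; last by left.
by right; rewrite /= (_ : snorm _ = 0) //; apply/eqP; rewrite snorm_eq0.
Qed.

Lemma chi_sides e : 2 * e <= r -> 0 < e -> (forall y, chi e (- a, y) = chi e (a, y)) /\
  (forall x, chi e (x, - b) = chi e (x, b)).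
Proof. by move=> _ _; split=> t; have [h1 h2] := chi_sym e a t; have [h3 h4] := chi_sym e t b. Qed.

Lemma harmonic_energy (K : R * R -> R) e : smooth_on Om K -> biperiodic beta K ->
  (forall p, Om p -> lap K p = 0) -> 0 < e -> 2 * e <= r ->
  let f p := K p * (dx K p * dx (chi e) p + dy K p * dy (chi e) p) in
  [/\ forall p, D p -> {for p, continuous (fun p => (1 - chi e p) * sqgrad K p)},
    forall p, D p -> {for p, continuous f} &
    I (fun p => (1 - chi e p) * sqgrad K p) = I f].
Proof.
move=> SK pK lK e0 er f.
pose z p := 1 - chi e p.
have Sz : smooth_on setT z by exact: (smoothB oT (smooth_cst 1 oT) (smooth_chi e oT)).
pose W := [set p : R * R | snorm p < e].
have oW : open W := @open_snorm_lt R e.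
have DU := cell_cover e0.
have SzU : smooth_on Om z by apply: smooth_on_sub Sz.
have SKx := smooth_dx SK; have SKy := smooth_dy SK.
have zW p : W p -> z p = 0 by move=> h; rewrite /z chi_eq1 ?subrr // ltW.
have [zx zy] : (forall p, W p -> dx (chi e) p = 0) /\ (forall p, W p -> dy (chi e) p = 0).
  have H p : W p -> chi e p = 1 by move=> h; rewrite chi_eq1 // ltW.
  by split=> p Wp; rewrite -(dx_cst 1 p, dy_cst 1 p); [apply: dx_near H|apply: dy_near H].
have S1 : smooth_on (Om `|` W) (fun p => z p * sqgrad K p).
  apply: smooth_patch => // [|p /zW ->]; last by rewrite mul0r.
  exact: smoothM (smooth_sqgrad _ SK).
have Sc : smooth_on Om (chi e) by apply: smooth_chi.
have S2 : smooth_on (Om `|` W) f.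
  apply: smooth_patch => // [|p Wp]; last by rewrite /f zx // zy // !mulr0 addr0 mulr0.
  exact: (smoothM oO SK (smoothD oO (smoothM oO SKx (smooth_dx Sc)) (smoothM oO SKy (smooth_dy Sc)))).
pose P p := z p * (K p * dx K p).
pose Q p := z p * (K p * dy K p).
have SKx2 := smoothM oO SK SKx; have SKy2 := smoothM oO SK SKy.
have PW p : W p -> P p = 0 by move=> /zW E; rewrite /P E mul0r.
have QW p : W p -> Q p = 0 by move=> /zW E; rewrite /Q E mul0r.
have SP := smooth_patch oW (smoothM oO SzU SKx2) PW.
have SQ := smooth_patch oW (smoothM oO SzU SKy2) QW.
have oUW := openU oO oW.
have aa : - a < a by rewrite gtrN ?ahalf_gt0.
have bb : - b < b by rewrite gtrN ?halfb_gt0.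
have [c1 c2] := chi_sides er e0.
have [k1 k2] := periodic_sides pK; have [kx1 _] := periodic_sides (periodic_dx pK).
have [_ ky2] := periodic_sides (periodic_dy pK).
have IP : I (dx P) = 0 by apply: (rint_dx0 aa oUW DU SP) => y _; rewrite /P /z c1 k1 kx1.
have IQ : I (dy Q) = 0 by apply: (rint_dy0 bb oUW DU SQ) => x _; rewrite /Q /z c2 k2 ky2.
split; [exact: smooth_contD DU S1|exact: smooth_contD DU S2|].
have E0 p : D p -> z p * sqgrad K p = dx P p + dy Q p + f p.
  move=> /DU [Up|Wp]; last first.
    rewrite (dx_near (g := fun=> 0) oW Wp PW).
    rewrite (dy_near (g := fun=> 0) oW Wp QW).
    have f0 : f p = 0 by rewrite /f zx // zy // !mulr0 addr0 mulr0.
    by rewrite f0 zW // dx_cst dy_cst mul0r !addr0.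
  rewrite (dxM SzU SKx2 Up) (dyM SzU SKy2 Up) (dxM SK SKx Up) (dyM SK SKy Up).
  rewrite (dxB (smooth_cst 1 oO) Sc Up) (dyB (smooth_cst 1 oO) Sc Up) dx_cst dy_cst.
  have := lK p Up; rewrite /f /sqgrad /lap; move: (z p) (K p) (dx (chi e) p) (dy (chi e) p) => z' v' zx' zy'.
  move: (dx K p) (dy K p) => vx vy.
  move: (dx (dx K) p) (dy (dy K) p) => x1 x2 /eqP; rewrite addr_eq0 => /eqP ->.
  ring.
have SdP := smooth_dx SP; have SdQ := smooth_dy SQ.
have E2 := rintD (smooth_contD DU SdP) (smooth_contD DU SdQ).
have {}E2 := etrans E2 (etrans (f_equal2 +%R IP IQ) (addr0 0)).
have E1 := rintD (smooth_contD DU (smoothD oUW SdP SdQ)) (smooth_contD DU S2).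
exact: (etrans (eq_rint E0) (etrans E1 (etrans (f_equal2 +%R E2 erefl) (add0r _)))).
Qed.

Lemma harmonic_grad0 (K : R * R -> R) V : smooth_on Om K -> biperiodic beta K ->
  (forall p, Om p -> lap K p = 0) -> (forall p, pb r p -> `|K p| <= V) ->
  forall p, Om p -> dx K p = 0 /\ dy K p = 0.
Proof.
move=> SK pK lK KV.
have [M M0 HM] := @chi_bounds R.
have pbO : pb r `<=` Om := pb_Omega beta0 ra rb.
have a0 : 0 < a := ahalf_gt0; have b0 := halfb_gt0 beta0.
have aa : - a < a by rewrite gtrN.
have bb : - b < b by rewrite gtrN.
have V0 : 0 <= V.
  apply: le_trans (normr_ge0 _) (KV (r / 2, 0) _).
  rewrite /pb /= /snorm /= normr0 gtr0_norm ?divr_gt0 // max_l ?divr_ge0 ?ltW // divr_gt0 //=.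
  by rewrite ltr_pdivrMr // ltr_pMr // ltr1n.
have X0 r1 : 0 < r1 -> r1 <= r -> I (fun p => (1 - chi (r1 / 4) p) * sqgrad K p) <= 0.
  move=> r10 r1r; have sub : pb r1 `<=` pb r.
    by move=> p /andP[h1 h2]; rewrite /pb /= h1 (lt_le_trans h2).
  have e10 : 0 < r1 / 4 by rewrite divr_gt0.
  have e1r : 2 * (r1 / 4) <= r by apply: le_trans r1r; move: r10; lra.
  apply: (@energy_decay R a b r1 a0 b0 (le_trans r1r ra) (le_trans r1r rb) K V 0
    (smooth_on_sub (subset_trans sub pbO) SK) (fun p h => KV p (sub p h)) _ _ (V * M) r10
    (mulr_ge0 V0 (ltW M0))) => [p h|e e0 er].
    by rewrite lK ?normr0 //; apply: pbO; apply: sub.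
  have er2 : 2 * e <= r by apply: le_trans r1r; move: e0 er; lra.
  have er3 : 2 * e <= r1 / 4 by move: er; lra.
  have ch p : chi e p <= chi (r1 / 4) p by rewrite -subr_ge0; exact: (shell_ge0 p e0 er3).
  have er4 : 2 * e < r1 by move: er e0; lra.
  have [c1 c2 E] := harmonic_energy SK pK lK e0 er2.
  have [c3 _ _] := harmonic_energy SK pK lK e10 e1r.
  exists (fun p => K p * (dx K p * dx (chi e) p + dy K p * dy (chi e) p)); split; first exact: c2.
  - have mono p : D p -> (1 - chi (r1 / 4) p) * sqgrad K p <= (1 - chi e p) * sqgrad K p.
      move=> _; apply: ler_wpM2r; first by rewrite addr_ge0 ?sqr_ge0.
      exact: (lerB (lexx 1) (ch p)).
    by have := le_rint c3 c1 mono; rewrite E.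
  - move=> p /andP[h1 h2]; have [m1 m2 _] := HM e p e0.
    have hV : `|K p| <= V.
      apply: KV; rewrite /pb /= (lt_le_trans e0 h1) /=; apply: (lt_le_trans _ r1r).
      exact: le_lt_trans h2 er4.
    apply: (le_trans (ler_norm _)); rewrite normrM.
    apply: (le_trans (y := V * (M / e * (`|dx K p| + `|dy K p|)))).
      have t1 : `|dx K p * dx (chi e) p| <= M / e * `|dx K p|.
        by rewrite normrM [leLHS]mulrC; exact: (ler_wpM2r (normr_ge0 _) m1).
      have t2 : `|dy K p * dy (chi e) p| <= M / e * `|dy K p|.
        by rewrite normrM [leLHS]mulrC; exact: (ler_wpM2r (normr_ge0 _) m2).
      rewrite (mulrDr (M / e)).
      exact: (ler_pM (normr_ge0 _) (normr_ge0 _) hV (le_trans (ler_normD _ _) (lerD t1 t2))).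
    have -> : V * (M / e * (`|dx K p| + `|dy K p|)) = V * M * ((`|dx K p| + `|dy K p|) / e).
      by move: (`|_| + _) => s; ring.
    apply: (ler_wpM2l (mulr_ge0 V0 (ltW M0))).
    by rewrite lerDl; exact: (addr_ge0 (sqr_ge0 _) (sqr_ge0 _)).
  move=> p Dp hp; have [h|h] := ltP (snorm p) e.
    have [-> ->] : dx (chi e) p = 0 /\ dy (chi e) p = 0.
      have [k1 k2] := d_in (fun p (h : snorm p < e) => chi_eq1 e0 (ltW h)).
      by split; [exact: (k1 p h)|exact: (k2 p h)].
    by rewrite !mulr0 addr0 mulr0.
  have [k1 k2] := d_out (fun p (h : 2 * e < snorm p) => chi_eq0 e0 (ltW h)).
  have h' : 2 * e < snorm p by rewrite ltNge; apply/negP => h'; apply: hp; rewrite h h'.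
  by rewrite (k1 p h') (k2 p h') !mulr0 addr0 mulr0.
have G q : D q -> q != (0, 0) -> sqgrad K q = 0.
  move=> Dq; rewrite -snorm_gt0 => q0; pose r1 := Num.min r (snorm q).
  have r10 : 0 < r1 by rewrite lt_min r0.
  have r1r : r1 <= r by rewrite ge_min lexx.
  have r1q : r1 <= snorm q by rewrite ge_min lexx orbT.
  have e10 : 0 < r1 / 4 by rewrite divr_gt0.
  have e1r : 2 * (r1 / 4) <= r by apply: le_trans r1r; move: r10; lra.
  have [c1 _ _] := harmonic_energy SK pK lK e10 e1r.
  have pos p : D p -> 0 <= (1 - chi (r1 / 4) p) * sqgrad K p.
    by move=> _; rewrite mulr_ge0 ?subr_ge0 ?chi_le1 // addr_ge0 ?sqr_ge0.
  have I0 : I (fun p => (1 - chi (r1 / 4) p) * sqgrad K p) = 0.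
    by apply/eqP; rewrite eq_le X0 //= rint_ge0.
  have := rint_eq0 aa bb c1 pos I0 Dq; rewrite chi_eq0 ?subr0 ?mul1r //.
  by apply: le_trans r1q; move: r10; lra.
move=> p /(reduce_cell beta0)[q [Dq _ q0 E]].
rewrite (E _ _ (periodic_dx pK)) (E _ _ (periodic_dy pK)).
move: (G q Dq q0); rewrite /sqgrad => /eqP; rewrite paddr_eq0 ?sqr_ge0 // !sqrf_eq0.
by move=> /andP[/eqP -> /eqP ->].
Qed.

Lemma cauchy_riemann U (g : R * R -> C) p : hol U g -> U p ->
  dx (re \o g) p = dy (im \o g) p /\ dy (re \o g) p = - dx (im \o g) p.
Proof.
move=> Hg Up; have [_ E] := hol_cdx Hg Up.
have := congr1 re E; have := congr1 im E; rewrite /cdy /cdx /= => -> ->.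
by rewrite !mul0r !mul1r add0r sub0r.
Qed.

Lemma hol_lap0 U (g : R * R -> C) p : open U -> hol U g -> U p ->
  lap (re \o g) p = 0 /\ lap (im \o g) p = 0.
Proof.
move=> oU Hg Up; have [[S1 S2] _] := Hg; rewrite /lap.
have H1 q : U q -> dx (re \o g) q = dy (im \o g) q by move=> /(cauchy_riemann Hg)[].
have H2 q : U q -> dy (re \o g) q = - dx (im \o g) q by move=> /(cauchy_riemann Hg)[].
have H3 q : U q -> dx (im \o g) q = - dy (re \o g) q by move=> /H2 ->; rewrite opprK.
split.
  exact: (etrans (f_equal2 +%R (etrans (dx_near oU Up H1) (dxdyC oU S2 Up))
    (etrans (dy_near oU Up H2) (dyN (smooth_dx S2) Up))) (subrr _)).
have H4 q : U q -> dy (im \o g) q = dx (re \o g) q by move=> /H1 ->.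
exact: (etrans (f_equal2 +%R (etrans (dx_near oU Up H3) (dxN (smooth_dy S1) Up))
  (etrans (dy_near oU Up H4) (esym (dxdyC oU S1 Up)))) (addNr _)).
Qed.

(** a bounded elliptic function is constant *)
Theorem liouville (g : R * R -> C) V : hol Om g -> biperiodic beta g ->
  (forall p, pb r p -> nc (g p) <= V) -> forall p, Om p -> g p = g (a, b).
Proof.
move=> Hg pg gV p Op; have [[S1 S2] _] := Hg.
have H1 := harmonic_grad0 S1 (periodic_comp re pg) (fun p Op => proj1 (hol_lap0 oO Hg Op))
  (fun p hp => le_trans (nc_re _) (gV p hp)).
have H2 := harmonic_grad0 S2 (periodic_comp im pg) (fun p Op => proj2 (hol_lap0 oO Hg Op))
  (fun p hp => le_trans (nc_im _) (gV p hp)).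
apply: complex_ext.
  exact: (grad0_const beta0 S1 (fun p Op => proj1 (H1 p Op)) (fun p Op => proj2 (H1 p Op)) Op).
exact: (grad0_const beta0 S2 (fun p Op => proj1 (H2 p Op)) (fun p Op => proj2 (H2 p Op)) Op).
Qed.

End Liouville.

(*@@@ 13*)
Local Open Scope complex_scope.
Opaque dx dy.

Section EnergyResidue.
Context {R : realType}.
Local Notation C := R[i].
Local Notation re := (@complex.Re R).
Local Notation im := (@complex.Im R).
Implicit Types (p q : R * R) (F G g h phi : R * R -> C) (e : R).
Let oT := @openT (R * R)%type.

Lemma nc_dz F p : nc (dz F p) <=
  `|dx (re \o F) p| + `|dx (im \o F) p| + (`|dy (re \o F) p| + `|dy (im \o F) p|).
Proof.
rewrite /dz ncM ncR ger0_norm ?invr_ge0 //.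
have H : nc (cdx F p - 'i * cdy F p) <= `|dx (re \o F) p| + `|dx (im \o F) p| + (`|dy (re \o F) p| + `|dy (im \o F) p|).
  apply: (le_trans (ncB _ _)); rewrite ncM nci mul1r.
  exact: (lerD (nc_le (cdx F p)) (nc_le (cdy F p))).
apply: (le_trans _ H); rewrite ler_piMl ?nc_ge0 // invf_le1 ?ler1n //.
Qed.

Lemma quarter_sum (m x y z t : R) : `|x| <= m -> `|y| <= m -> `|z| <= m -> `|t| <= m ->
  `|2^-1 * x| + `|2^-1 * z| + (`|2^-1 * y| + `|2^-1 * t|) <= 2 * m.
Proof.
rewrite !(normrM 2^-1) (ger0_norm (x := 2^-1 : R)) ?invr_ge0 //.
by move: (`|x|) (`|y|) (`|z|) (`|t|) => x1 y1 z1 t1; lra.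
Qed.

Lemma abs_sum0 (x y z t : R) : y = 0 -> t = 0 -> `|x| + `|y| + (`|z| + `|t|) = `|x| + `|z|.
Proof. by move=> -> ->; rewrite normr0 !addr0. Qed.

Lemma cross_sum (x y z t : R) : 0 <= x -> 0 <= y -> 0 <= z -> 0 <= t ->
  z * x + t * y <= (z + t) * (x + y).
Proof.
move=> x0 y0 z0 t0; have -> : (z + t) * (x + y) = z * x + t * y + (z * y + t * x) by ring.
by rewrite lerDl; exact: (addr_ge0 (mulr_ge0 z0 y0) (mulr_ge0 t0 x0)).
Qed.

Lemma dz_dbar_chic_bound : exists2 M : R, 0 < M & forall e p, 0 < e -> nc (dz (dbar (chic e)) p) <= M / e ^+ 2.
Proof.
have [M M0 HM] := @chi_bounds R; exists (2 * M); first by rewrite mulr_gt0.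
move=> e p e0; have [_ _ [h1 h2 h3 h4]] := HM e p e0.
apply: (le_trans (nc_dz _ _)).
have S1 := smooth_dx (smooth_chi e oT); have S2 := smooth_dy (smooth_chi e oT).
have Tp : setT p by [].
have Er : re \o dbar (chic e) = (fun q => 2^-1 * dx (chi e) q).
  by apply/funext => q; apply: (etrans (congr1 re (dbar_real (chi e) q))); rewrite /= mul0r subr0.
have Ei : im \o dbar (chic e) = (fun q => 2^-1 * dy (chi e) q).
  by apply/funext => q; apply: (etrans (congr1 im (dbar_real (chi e) q))); rewrite /= mul0r addr0.
have e1 : dx (re \o dbar (chic e)) p = 2^-1 * dx (dx (chi e)) p by rewrite Er; exact: (dxZ S1 Tp).
have e2 : dy (re \o dbar (chic e)) p = 2^-1 * dy (dx (chi e)) p by rewrite Er; exact: (dyZ S1 Tp).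
have e3 : dx (im \o dbar (chic e)) p = 2^-1 * dx (dy (chi e)) p by rewrite Ei; exact: (dxZ S2 Tp).
have e4 : dy (im \o dbar (chic e)) p = 2^-1 * dy (dy (chi e)) p by rewrite Ei; exact: (dyZ S2 Tp).
rewrite e1 e2 e3 e4.
rewrite -(mulrA 2); exact: (quarter_sum h1 h2 h3 h4).
Qed.

Lemma dzV (U : set (R * R)) F p : open U -> csm U F -> (forall p, U p -> F p != 0) -> U p ->
  dz (fun q => (F q)^-1) p = - dz F p / F p ^+ 2.
Proof.
move=> oU SF F0 Up; have SV := csmV oU SF F0.
have E : dz (fun q => (F q)^-1 * F q) p = 0.
  rewrite (dz_near (G := fun=> 1) oU _ Up) ?dz_cst // => q /F0 h.
  by rewrite mulVf.
rewrite (dzM oU Up SV SF) in E; move: E (F0 p Up); move: (dz _ p) (dz _ p) (F p) => x y z E z0.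
have -> : y = (y * z + z^-1 * x) / z - x / z ^+ 2 by field; exact: z0.
by rewrite E mul0r sub0r mulNr.
Qed.

Variables (a b r : R).
Hypotheses (a0 : 0 < a) (b0 : 0 < b) (ra : r <= a) (rb : r <= b).
Local Notation D := (rect (- a) a (- b) b).
Local Notation I := (rint (- a) a (- b) b).
Local Notation cint := (cint a b).
Local Notation res := (residue a b).

Lemma nc_cint_abs (U : set (R * R)) F : D `<=` U -> csm U F ->
  (forall p, D p -> {for p, continuous (fun p => 2 * (`|re (F p)| + `|im (F p)|))}) /\
  nc (cint F) <= I (fun p => 2 * (`|re (F p)| + `|im (F p)|)).
Proof.
move=> DU SF; have [S1 S2] := SF.
have c1 p : D p -> {for p, continuous (fun p => `|re (F p)| + `|im (F p)|)}.
  move=> Dp; apply: continuousD.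
    apply: (continuous_comp (f := re \o F) (g := @Num.norm _ R)); last exact: norm_continuous.
    exact: smooth_continuous S1 (DU _ Dp).
  apply: (continuous_comp (f := im \o F) (g := @Num.norm _ R)); last exact: norm_continuous.
  exact: smooth_continuous S2 (DU _ Dp).
split; first by move=> p Dp; apply: continuousM; [exact: cst_continuous|exact: c1].
rewrite (rintZ 2 c1).
exact: (cint_le DU SF c1 (fun p _ => nc_le (F p))).
Qed.

Section fix_v.
Variables (v : R * R -> R) (V K : R).
Hypotheses (Sv : smooth_on (pb r) v) (vV : forall p, pb r p -> `|v p| <= V)
  (vK : forall p, pb r p -> `|lap v p| <= K).
Variables (c : C).
Let vz := dz (fun p => (v p)%:C).
Definition eres p : C := - 2^-1%:C * dz vz p + c / zc p * vz p + 4^-1%:C * vz p ^+ 2.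

Let nc_vz p : nc (vz p) <= `|dx v p| + `|dy v p|.
Proof.
apply: (le_trans (nc_dz _ _)).
have -> : re \o (fun p => (v p)%:C) = v by [].
have -> : im \o (fun p => (v p)%:C) = (fun=> 0) by [].
by rewrite (abs_sum0 _ _ (dx_cst 0 p) (dy_cst 0 p)).
Qed.

Let nc_vz2 p : nc (vz p) ^+ 2 <= sqgrad v p.
Proof.
have -> : vz p = 2^-1%:C * (dx v p +i* - dy v p).
  rewrite /vz /dz /cdx /cdy; have -> : re \o (fun p => (v p)%:C) = v by [].
  have -> : im \o (fun p => (v p)%:C) = (fun=> 0) by [].
  rewrite dx_cst dy_cst; apply: complex_ext => /=; ring.
rewrite ncM ncR ger0_norm ?invr_ge0 // ncE /= exprMn sqr_sqrtr ?addr_ge0 ?sqr_ge0 //.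
by rewrite sqrrN /sqgrad ler_piMl ?addr_ge0 ?sqr_ge0 // expr_le1 ?invr_ge0 // invf_le1 ?ler1n.
Qed.

(** residues of eres against holomorphic functions vanishing at 0 are zero *)
Lemma energy_res phi A e0 : hol (pb r) eres -> hol (pb r) phi -> 0 <= A ->
  (forall p, pb r p -> nc (phi p) <= A * snorm p) -> (forall p, pb r p -> nc (dz phi p) <= A) ->
  0 < e0 -> 2 * e0 < r -> res (fun p => eres p * phi p) e0 = 0.
Proof.
move=> He Hp A0 pA dA e00 e0r; apply: nc_eq0.
have r0 : 0 < r by apply: lt_trans e0r; rewrite mulr_gt0.
have oP := @open_pb R r.
have [M1 M10 HM1] := @dbar_chic_bound R; have [M2 M20 HM2] := dz_dbar_chic_bound.
pose B := 4 * (A * M1 + A * M2 + 2 * nc c * A * M1 + A * M1).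
have B0 : 0 <= B.
  by rewrite mulr_ge0 // !addr_ge0 // ?mulr_ge0 ?nc_ge0 // ltW.
apply/eqP; rewrite eq_le nc_ge0 andbT.
apply: (energy_decay a0 b0 ra rb Sv vV vK r0 B0) => e e1 er.
have e2r : 2 * e < r by move: er e1; lra.
rewrite (res_const a0 b0 ra rb (holM oP He Hp) e00 e1 e0r e2r).
pose W := [set p : R * R | snorm p < e] `|` [set p | 2 * e < snorm p].
have oW : open W := @open_hole R e (2 * e).
have DU : D `<=` pb r `|` W := pb_cover (a := a) (b := b) e1 e2r.
have oU := openU oP oW.
have Svz : csm (pb r) vz := csm_dz oP (csm_real oP Sv).
have [Sphi _] := Hp.
have Sdb : csm (pb r) (dbar (chic e)) := csm_dbar oP (csm_chic e oP).
pose psi p := phi p * dbar (chic e) p.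
have Spsi : csm (pb r) psi := csmM oP Sphi Sdb.
have psi0 p : W p -> psi p = 0 by move=> Wp; rewrite /psi dbar_chic0 ?mulr0.
have dpsi0 p : W p -> dz psi p = 0.
  by move=> Wp; rewrite (dz_near oW psi0 Wp) dz_cst.
pose F p := 2^-1%:C * (vz p * dz psi p) + c / zc p * vz p * psi p + 4^-1%:C * vz p ^+ 2 * psi p.
have Sz : csm (pb r) (fun p => (zc p)^-1).
  by apply: (csmV oP (csm_zc oP)) => p /andP[h _]; exact: zc_neq0.
have SF1 : csm (pb r) F.
  apply: (csmD oP (csmD oP _ _) _).
  - exact: (csmM oP (csm_cst _ oP) (csmM oP Svz (csm_dz oP Spsi))).
  - exact: (csmM oP (csmM oP (csmM oP (csm_cst _ oP) Sz) Svz) Spsi).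
  exact: (csmM oP (csmM oP (csm_cst _ oP) (csmX oP 2 Svz)) Spsi).
have F0 p : W p -> F p = 0.
  by move=> Wp; rewrite /F psi0 // dpsi0 // !mulr0 !addr0.
have SF := csm_patch oP oW SF1 F0.
pose H p := vz p * psi p.
have H0 p : W p -> H p = 0 by move=> Wp; rewrite /H psi0 // mulr0.
have SH := csm_patch oP oW (csmM oP Svz Spsi) H0.
have [_ IH] : cint (dbar H) = 0 /\ cint (dz H) = 0.
  apply: (cint_stokes a0 b0 DU oU SH) => t ht.
    have h x : x = a \/ x = - a -> H (x, t) = 0.
      by move=> hx; apply: H0; right; exact: (lt_le_trans e2r (le_trans ra (snorm_bd a0 ht hx))).
    exact: (etrans (h _ (or_intror erefl)) (esym (h _ (or_introl erefl)))).
  have h y : y = b \/ y = - b -> H (t, y) = 0.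
    by move=> hy; apply: H0; right; exact: (lt_le_trans e2r (le_trans rb (snorm_bd2 b0 ht hy))).
  exact: (etrans (h _ (or_intror erefl)) (esym (h _ (or_introl erefl)))).
have EF p : D p -> eres p * phi p * dbar (chic e) p = F p - 2^-1%:C * dz H p.
  move=> /DU [Up|Wp]; last first.
    by rewrite F0 // (dz_near oW H0 Wp) dz_cst mulr0 subrr dbar_chic0 ?mulr0.
  rewrite (dzM oP Up Svz Spsi) /eres /F /psi.
  move: (dz (fun q => phi q * dbar (chic e) q) p) (dz vz p) (dbar (chic e) p) => x y z.
  by move: (vz p) (phi p) (2^-1%:C) (4^-1%:C) (c / zc p) => x1 x2 x3 x4 x5; ring.
have SdH : csm (pb r `|` W) (fun p => 2^-1%:C * dz H p) := csmM oU (csm_cst _ oU) (csm_dz oU SH).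
have IE : res (fun p => eres p * phi p) e = cint F.
  rewrite /residue (eq_cint EF) (cintB DU SF SdH oU) (cintZ DU _ (csm_dz oU SH)) IH.
  by rewrite mulr0 subr0.
have [cF leF] := nc_cint_abs DU SF.
exists (fun p => 2 * (`|re (F p)| + `|im (F p)|)); split; first exact: cF.
- by rewrite IE.
- move=> p hp; have /andP[hp1 hp2] := hp.
  have Up : pb r p by rewrite /pb /= (lt_le_trans e1 hp1) (le_lt_trans hp2 e2r).
  have t1 : 2 * (`|re (F p)| + `|im (F p)|) <= 4 * nc (F p).
    have := nc_re (F p); have := nc_im (F p); move: (nc _) (`|_|) (`|_|) => x y z; lra.
  apply: (le_trans t1); have m1 := HM1 e p e1; have m2 := HM2 e p e1.
  have k1 : nc (phi p) <= A * (2 * e).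
    by apply: (le_trans (pA p Up)); exact: ler_wpM2l.
  have k2 := dA p Up.
  have k3 : nc (zc p)^-1 <= e^-1.
    rewrite ncV lef_pV2 ?posrE //; first exact: le_trans hp1 (snorm_nc p).
    by rewrite nc_gt0 zc_neq0 // (lt_le_trans e1).
  have kpsi : nc (psi p) <= 2 * (A * M1).
    have -> : 2 * (A * M1) = A * (2 * e) * (M1 / e) by field; rewrite gt_eqF.
    by rewrite /psi ncM; exact: (ler_pM (nc_ge0 _) (nc_ge0 _) k1 m1).
  have kdpsi : nc (dz psi p) <= (A * M1 + 2 * (A * M2)) / e.
    have -> : (A * M1 + 2 * (A * M2)) / e = A * (M1 / e) + A * (2 * e) * (M2 / e ^+ 2).
      by field; rewrite gt_eqF.
    rewrite (dzM oP Up Sphi Sdb); apply: (le_trans (ncD _ _)); rewrite (ncM (dz phi p)) (ncM (phi p)).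
    exact: (lerD (ler_pM (nc_ge0 _) (nc_ge0 _) k2 m1) (ler_pM (nc_ge0 _) (nc_ge0 _) k1 m2)).
  have [S ES] : exists S, S = `|dx v p| + `|dy v p| by eexists.
  have g1 := nc_vz p; have g2 := nc_vz2 p; rewrite -ES in g1 *.
  have S0 : 0 <= S by rewrite ES addr_ge0.
  have AM0 : 0 <= A * M1 by rewrite mulr_ge0 // ltW.
  have u1 : nc (2^-1%:C * (vz p * dz psi p)) <= (A * M1 + A * M2) * (S / e).
    rewrite (ncM 2^-1%:C) (ncM (vz p)) ncR ger0_norm ?invr_ge0 //.
    apply: (le_trans (y := 2^-1 * (S * ((A * M1 + 2 * (A * M2)) / e)))).
      apply: ler_wpM2l; first by rewrite invr_ge0.
      exact: (ler_pM (nc_ge0 _) (nc_ge0 _) g1 kdpsi).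
    have s0 : 0 <= S / e.
      exact: (divr_ge0 S0 (ltW e1)).
    have -> : 2^-1 * (S * ((A * M1 + 2 * (A * M2)) / e)) =
      (2^-1 * (A * M1) + A * M2) * (S / e) by field; rewrite gt_eqF.
    apply: (ler_wpM2r s0); rewrite lerD2r ler_piMl // invf_le1 ?ler1n //.
  have u2 : nc (c / zc p * vz p * psi p) <= (2 * nc c * A * M1) * (S / e).
    have -> : (2 * nc c * A * M1) * (S / e) =
       nc c * e^-1 * S * (2 * (A * M1)) by ring.
    rewrite (ncM _ (psi p)) (ncM _ (vz p)) (ncM c).
    apply: (ler_pM (mulr_ge0 (mulr_ge0 (nc_ge0 _) (nc_ge0 _)) (nc_ge0 _)) (nc_ge0 _) _ kpsi).
    apply: (ler_pM (mulr_ge0 (nc_ge0 _) (nc_ge0 _)) (nc_ge0 _) _ g1).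
    exact: (ler_wpM2l (nc_ge0 _) k3).
  have u3 : nc (4^-1%:C * vz p ^+ 2 * psi p) <= A * M1 * sqgrad v p.
    rewrite (ncM _ (psi p)) (ncM _ (vz p ^+ 2)) (ncM (vz p)) ncR ger0_norm ?invr_ge0 // -expr2.
    apply: (le_trans (y := 4^-1 * sqgrad v p * (2 * (A * M1)))).
      apply: (ler_pM (mulr_ge0 _ (sqr_ge0 _)) (nc_ge0 _) _ kpsi); first by rewrite invr_ge0.
      by apply: ler_wpM2l => //; rewrite invr_ge0.
    have s0 : 0 <= A * M1 * sqgrad v p := mulr_ge0 AM0 (addr_ge0 (sqr_ge0 _) (sqr_ge0 _)).
    have -> : 4^-1 * sqgrad v p * (2 * (A * M1)) = 2^-1 * (A * M1 * sqgrad v p) by field.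
    by rewrite ler_piMl // invf_le1 ?ler1n //.
  rewrite /B -[leRHS]mulrA; apply: ler_wpM2l => //.
  apply: (le_trans (ncD _ _)); apply: (le_trans (lerD (ncD _ _) (lexx _))).
  apply: (le_trans (lerD (lerD u1 u2) u3)).
  have s0 : 0 <= S / e.
    exact: (divr_ge0 S0 (ltW e1)).
  have s1 : 0 <= sqgrad v p := addr_ge0 (sqr_ge0 _) (sqr_ge0 _).
  have P2 : 0 <= A * M1 + A * M2 + 2 * nc c * A * M1.
    by rewrite !addr_ge0 // ?mulr_ge0 ?nc_ge0 // ltW.
  by rewrite -mulrDl; exact: (cross_sum s0 s1 P2 AM0).
move=> p Dp hp; have Wp : W p.
  have [h|h] := ltP (snorm p) e; first by left.
  by right; rewrite /= ltNge; apply/negP => h'; apply: hp; rewrite h h'.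
by rewrite (F0 p Wp) /= normr0 addr0 mulr0.
Qed.

End fix_v.
End EnergyResidue.

(*@@@ 14*)
Local Open Scope complex_scope.
Opaque dx dy.

Section ResidueRules.
Context {R : realType}.
Local Notation C := R[i].
Implicit Types (p q : R * R) (F G : R * R -> C) (e : R).
Variables (a b r : R).
Hypotheses (a0 : 0 < a) (b0 : 0 < b) (ra : r <= a) (rb : r <= b).
Local Notation D := (rect (- a) a (- b) b).
Local Notation res := (residue a b).

Lemma eq_res F G e : (forall p, pb r p -> F p = G p) -> 0 < e -> 2 * e < r -> res F e = res G e.
Proof.
move=> FG e0 er; apply: eq_cint => p /(pb_cover (a := a) (b := b) e0 er) [/FG -> //|h].
by rewrite dbar_chic0 ?mulr0.
Qed.

Lemma resD F G e : csm (pb r) F -> csm (pb r) G -> 0 < e -> 2 * e < r ->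
  res (fun p => F p + G p) e = res F e + res G e.
Proof.
move=> SF SG e0 er; have DU := pb_cover (a := a) (b := b) e0 er.
have E := cintD DU (csm_res SF e0 er) (csm_res SG e0 er).
by apply: etrans E; apply: eq_cint => p _; rewrite mulrDl.
Qed.

Lemma resZ (c : C) F e : csm (pb r) F -> 0 < e -> 2 * e < r ->
  res (fun p => c * F p) e = c * res F e.
Proof.
move=> SF e0 er; have DU := pb_cover (a := a) (b := b) e0 er.
have E := cintZ DU c (csm_res SF e0 er).
by apply: etrans E; apply: eq_cint => p _; rewrite mulrA.
Qed.

Lemma hol_inv_zc : hol (pb r) (fun p => (zc p)^-1).
Proof.
by apply: (holV (@open_pb R r) (hol_zc (@open_pb R r))) => p /andP[h _]; exact: zc_neq0.
Qed.

Lemma dz_inv_zc p : pb r p -> dz (fun p => (zc p)^-1) p = - (zc p) ^- 2.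
Proof.
move=> hp; have oP := @open_pb R r.
rewrite (dzV oP (csm_zc oP) _ hp) ?dz_zc ?mulN1r //.
by move=> q /andP[h _]; exact: zc_neq0.
Qed.

Lemma res_inv_sqr (N : C) e : 0 < e -> 2 * e < r -> res (fun p => N / zc p ^+ 2) e = 0.
Proof.
move=> e0 er; have oP := @open_pb R r; have H := hol_inv_zc.
have E p : pb r p -> N / zc p ^+ 2 = - N * dz (fun p => (zc p)^-1) p.
  by move=> hp; rewrite dz_inv_zc // mulrNN.
rewrite (eq_res E e0 er) (resZ _ (proj1 (hol_dz oP H)) e0 er) (res_dz a0 b0 ra rb H e0 er) mulr0 //.
Qed.

(** shrinking the punctured neighbourhood *)
Lemma pb_sub s : s <= r -> pb s `<=` pb r.
Proof. by move=> sr p /andP[h1 h2]; rewrite /pb /= h1 (lt_le_trans h2). Qed.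

Lemma hol_sub (U V : set (R * R)) F : V `<=` U -> hol U F -> hol V F.
Proof. by move=> VU [S H]; split; [exact: csm_sub S|move=> p /VU; exact: H]. Qed.

End ResidueRules.

Section Pole.
Context {R : realType}.
Local Notation C := R[i].
Implicit Types (p q : R * R) (F G : R * R -> C) (e : R).
Variables (a b r : R).
Hypotheses (a0 : 0 < a) (b0 : 0 < b) (r0 : 0 < r) (ra : r <= a) (rb : r <= b).
Local Notation D := (rect (- a) a (- b) b).
Local Notation res := (residue a b).

(** the Laurent coefficients of negative index of g are all controlled by the residues
    of g itself and of the functions g * phi where phi vanishes at the puncture *)
Lemma bounded_of_residues g : hol (pb r) g -> (forall e, 0 < e -> 2 * e < r -> res g e = 0) ->
  (forall s phi A e, 0 < s -> s <= r -> hol (pb s) phi -> 0 <= A ->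
    (forall p, pb s p -> nc (phi p) <= A * snorm p) -> (forall p, pb s p -> nc (dz phi p) <= A) ->
    (forall p, pb s p -> nc (dz (dz phi) p) <= A) ->
    0 < e -> 2 * e < s -> res (fun p => g p * phi p) e = 0) ->
  exists2 dl, 0 < dl & exists M, forall z0, 0 < snorm z0 <= dl -> nc (g z0) <= M.
Proof.
move=> Hg res0 resphi.
have rho0 : 0 < r / 4 by rewrite divr_gt0.
have rhor : 2 * (r / 4) < r by move: r0; lra.
apply: (hol_bounded_near a0 b0 ra rb rho0 rhor Hg).
exists r => // z0 /andP[z00 z0r]; pose s := snorm z0 / 2; exists (snorm z0 / 16).
have s0 : 0 < s by rewrite divr_gt0.
have e0 : 0 < snorm z0 / 16 by rewrite divr_gt0.
have sr : s <= r by rewrite /s; move: z00 z0r; move: (snorm z0) => x; lra.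
have es : 2 * (snorm z0 / 16) < s by rewrite /s; move: z00; move: (snorm z0) => x; lra.
have er := lt_le_trans es sr.
split=> //; first by move: z00; move: (snorm z0) => x; lra.
have oS := @open_pb R s; have oR := @open_pb R r.
have hpb p : pb s p -> s <= snorm (p - z0).
  move=> /andP[_ h]; have := snorm_sub z0 p; rewrite snormB; move: h; rewrite /s.
  by move: (snorm _) (snorm _) (snorm _) => x y z; lra.
have aw : pb s `<=` away z0 by move=> p hp; rewrite /away /= (lt_le_trans s0) // hpb.
have Hk : hol (pb s) (ckern z0) := hol_sub aw (hol_ckern z0).
have zk p : pb s p -> zc p - zc z0 != 0.
  by move=> hp; apply: zcB_neq0; rewrite (lt_le_trans s0) // hpb.
have dk p : pb s p -> dz (ckern z0) p = - ckern z0 p ^+ 2.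
  move=> hp; have S1 : csm (pb s) (fun p => zc p - zc z0) := csmB oS (csm_zc oS) (csm_cst _ oS).
  have := dzV oS S1 zk hp; rewrite -/(ckern z0) => ->.
  have -> : dz (fun p => zc p - zc z0) p = 1.
    by have := dzD oS hp (csm_zc oS) (csm_cst (- zc z0) oS); rewrite dz_zc dz_cst addr0.
  by rewrite /ckern exprVn mulN1r.
have Hphi : hol (pb s) (fun p => zc p * ckern z0 p) := holM oS (hol_zc oS) Hk.
have nk p : pb s p -> nc (ckern z0 p) <= s^-1 by move=> hp; apply: nc_ckern s0 (hpb p hp).
have Ephi p : pb s p -> zc p * ckern z0 p = 1 + zc z0 * ckern z0 p.
  by move=> hp; have := zk p hp; rewrite /ckern => h; field.
have dphi p : pb s p -> dz (fun p => zc p * ckern z0 p) p = - zc z0 * ckern z0 p ^+ 2.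
  move=> hp; rewrite (dz_near oS Ephi hp).
  rewrite (dzD oS hp (csm_cst 1 oS) (csmM oS (csm_cst (zc z0) oS) (proj1 Hk))) dz_cst add0r.
  by rewrite (dzZ oS _ hp (proj1 Hk)) dk // mulrN mulNr.
have d2phi p : pb s p -> dz (dz (fun p => zc p * ckern z0 p)) p = 2 * zc z0 * ckern z0 p ^+ 3.
  move=> hp; rewrite (dz_near oS dphi hp).
  rewrite (dzZ oS _ hp (csmX oS 2 (proj1 Hk))).
  have E2 p' : pb s p' -> ckern z0 p' ^+ 2 = ckern z0 p' * ckern z0 p' by rewrite expr2.
  rewrite (dz_near oS E2 hp) (dzM oS hp (proj1 Hk) (proj1 Hk)) dk //.
  by move: (ckern z0 p) (zc z0) => x y; ring.
have nz0 : nc (zc z0) <= 4 * s by apply: le_trans (nc_snorm _) _; rewrite /s; move: (snorm z0) => x; lra.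
pose A := s^-1 * 2 + 4 * s * s^-1 ^+ 2 + 8 * s * s^-1 ^+ 3.
have si : 0 <= s^-1 by rewrite invr_ge0 ltW.
have A1 : 0 <= s^-1 * 2 by rewrite mulr_ge0.
have A2 : 0 <= 4 * s * s^-1 ^+ 2 by rewrite !mulr_ge0 ?exprn_ge0 // ltW.
have A3 : 0 <= 8 * s * s^-1 ^+ 3 by rewrite !mulr_ge0 ?exprn_ge0 // ltW.
have A0 : 0 <= A by rewrite !addr_ge0.
have nX (x : C) n : nc (x ^+ n) = nc x ^+ n.
  by elim: n => [|n IH]; rewrite ?expr0 ?nc1 // !exprS ncM IH.
have R1 : res (fun p => g p * (zc p * ckern z0 p)) (snorm z0 / 16) = 0.
  apply: (resphi s _ A) => // p hp.
  - rewrite ncM; apply: (le_trans (y := (2 * snorm p) * s^-1)).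
      exact: (ler_pM (nc_ge0 _) (nc_ge0 _) (nc_snorm p) (nk p hp)).
    have -> : 2 * snorm p * s^-1 = s^-1 * 2 * snorm p by ring.
    apply: ler_wpM2r; first exact: snorm_ge0.
    by rewrite /A -addrA lerDl addr_ge0.
  - rewrite dphi // mulNr ncN ncM nX.
    apply: (le_trans (y := 4 * s * s^-1 ^+ 2)).
      apply: (ler_pM (nc_ge0 _) (exprn_ge0 _ (nc_ge0 _)) nz0).
      by rewrite lerXn2r ?nnegrE ?nc_ge0 ?nk.
    by rewrite /A; move: A1 A2 A3; move: (_ * 2) (4 * _ * _) (8 * _ * _) => x y z; lra.
  have n2 : nc (2 : C) = 2 by rewrite (_ : (2 : C) = (2 : R)%:C) ?ncR ?ger0_norm // rmorph_nat.
  rewrite d2phi // (ncM _ (ckern z0 p ^+ 3)) (ncM 2) nX n2.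
  apply: (le_trans (y := 2 * (4 * s) * s^-1 ^+ 3)).
    apply: (ler_pM (mulr_ge0 _ (nc_ge0 _)) (exprn_ge0 _ (nc_ge0 _))) => //.
      by rewrite ler_wpM2l.
    by rewrite lerXn2r ?nnegrE ?nc_ge0 ?nk.
  rewrite mulrA -natrM.
  by rewrite /A; move: A1 A2 A3; move: (_ * 2) (4 * _ * _) (8 * _ * _) => x y z; lra.
have R0 := res0 _ e0 er.
have sa := le_trans sr ra; have sb := le_trans sr rb.
have Sg : csm (pb s) g := csm_sub (pb_sub sr) (proj1 Hg).
have z0n : zc z0 != 0 by apply: zc_neq0.
have E : res (fun p => g p * (zc p * ckern z0 p)) (snorm z0 / 16) =
   res g (snorm z0 / 16) + zc z0 * res (fun p => g p * ckern z0 p) (snorm z0 / 16).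
  rewrite -(resZ a b (zc z0) (csmM oS Sg (proj1 Hk)) e0 es) -(resD a b Sg _ e0 es); last first.
    exact: (csmM oS (csm_cst _ oS) (csmM oS Sg (proj1 Hk))).
  apply: (eq_res a b _ e0 es) => p hp; rewrite Ephi // mulrDr mulr1.
  by rewrite mulrCA.
move: E; rewrite R1 R0 add0r => /esym/eqP; rewrite mulf_eq0 (negPf z0n) => /eqP.
exact.
Qed.

(** removing the double pole *)
Theorem double_pole (q : R * R -> C) (v : R * R -> R) (V K : R) (N c : C) : hol (pb r) q ->
  smooth_on (pb r) v -> (forall p, pb r p -> `|v p| <= V) -> (forall p, pb r p -> `|lap v p| <= K) ->
  (forall p, pb r p -> q p = N / zc p ^+ 2 + eres v c p) ->
  (forall e, 0 < e -> 2 * e < r -> res q e = 0) ->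
  exists2 dl, 0 < dl & exists M, forall z0, 0 < snorm z0 <= dl -> nc (q z0 - N / zc z0 ^+ 2) <= M.
Proof.
move=> Hq Sv vV vK E q0; have oP := @open_pb R r.
have HN : hol (pb r) (fun p => N / zc p ^+ 2).
  apply: (holZ oP); apply: (hol_ext oP _ (holX oP 2 (@hol_inv_zc R r))) => p _; exact: exprVn.
have Hg := holB oP Hq HN.
apply: (bounded_of_residues Hg) => [e e0 er|s phi A e s0 sr Hphi A0 h1 h2 _ e0 es].
  have F p : pb r p -> q p - N / zc p ^+ 2 = q p + (- N) / zc p ^+ 2 by rewrite mulNr.
  have SN : csm (pb r) (fun p => (- N) / zc p ^+ 2).
    by apply: (csm_ext oP _ (csmN oP (proj1 HN))) => p _; rewrite mulNr.
  by rewrite (eq_res a b F e0 er) (resD a b (proj1 Hq) SN e0 er) q0 // (res_inv_sqr a0 b0 ra rb) // addr0.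
have oS := @open_pb R s; have sub := pb_sub sr.
have EE p : pb s p -> q p - N / zc p ^+ 2 = eres v c p.
  by move=> /sub hp; rewrite E // addrC addKr.
have He : hol (pb s) (eres v c) := hol_ext oS EE (hol_sub sub Hg).
have EF p : pb s p -> (q p - N / zc p ^+ 2) * phi p = eres v c p * phi p by move=> /EE ->.
apply: (etrans (eq_res a b EF e0 es)).
exact: (energy_res a0 b0 (le_trans sr ra) (le_trans sr rb) (smooth_on_sub sub Sv)
  (fun p hp => vV p (sub p hp)) (fun p hp => vK p (sub p hp)) He Hphi A0 h1 h2 e0 es).
Qed.
End Pole.

(*@@@ 15*)
Local Open Scope complex_scope.
Opaque dx dy.

Section DzRules.
Context {R : realType}.
Local Notation C := R[i].
Implicit Types (p : R * R) (F G : R * R -> C) (U : set (R * R)).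
Lemma dzX U F p n : open U -> csm U F -> U p ->
  dz (fun q => F q ^+ n.+1) p = n.+1%:R * F p ^+ n * dz F p.
Proof.
move=> oU SF; elim: n p => [|n IH] p Up.
  by rewrite expr0 !mul1r; congr (dz _ p); apply/funext => q; rewrite expr1.
have E q : U q -> F q ^+ n.+2 = F q * F q ^+ n.+1 by rewrite exprS.
rewrite (dz_near oU E Up) (dzM oU Up SF (csmX oU n.+1 SF)) (IH p Up) exprS -[n.+2]addn1 natrD.
by ring.
Qed.

Lemma dzN U F p : open U -> U p -> csm U F -> dz (fun q => - F q) p = - dz F p.
Proof.
move=> oU Up SF; have := dzZ oU (-1) Up SF; rewrite mulN1r => <-.
by congr (dz _ p); apply/funext => q; rewrite mulN1r.
Qed.

Lemma dzB U F G p : open U -> U p -> csm U F -> csm U G ->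
  dz (fun q => F q - G q) p = dz F p - dz G p.
Proof. by move=> oU Up SF SG; rewrite (dzD oU Up SF (csmN oU SG)) (dzN oU Up SG). Qed.
End DzRules.

Section Ode.
Context {R : realType}.
Local Notation C := R[i].
Implicit Types (p : R * R) (q F G : R * R -> C) (e : R).
Section bounded.
Variables (a b r : R).
Hypotheses (a0 : 0 < a) (b0 : 0 < b) (ra : r <= a) (rb : r <= b).
Local Notation res := (residue a b).

Lemma res_of_bounded F K e : hol (pb r) F -> (forall p, pb r p -> nc (F p) <= K) ->
  0 < e -> 2 * e < r -> res F e = 0.
Proof.
move=> HF HK e0 er; apply: nc_eq0; apply/eqP; rewrite eq_le nc_ge0 andbT.
have [M M0 HM] := res_bound ra rb.
have pe : pb r (e, 0).
  rewrite /pb /= /snorm /= normr0 gtr0_norm // (max_idPl (ltW e0)) e0 /=.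
  by apply: le_lt_trans er; rewrite ler_peMl ?ltW // ltr1n.
have K0 : 0 <= K := le_trans (nc_ge0 _) (HK _ pe).
rewrite leNgt; apply/negP => X0.
pose X := nc (res F e); pose t := Num.min e (X / (2 * (M * K + 1))).
have MK : 0 <= M * K by rewrite mulr_ge0 // ltW.
have MK1 : 0 < M * K + 1 by rewrite ltr_wpDl.
have t0 : 0 < t by rewrite lt_min e0 divr_gt0 // mulr_gt0.
have te : t <= e by rewrite ge_min lexx.
have tr : 2 * t < r by apply: le_lt_trans er; rewrite ler_pM2l.
have tX : t <= X / (2 * (M * K + 1)) by rewrite ge_min lexx orbT.
have := HM F t K (proj1 HF) t0 tr _ K0.
rewrite -(res_const a0 b0 ra rb HF e0 t0 er tr) => H.
have {}H : X <= M * (K * t).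
  apply: H => p /andP[h1 h2]; apply: HK.
  by rewrite /pb /= (lt_le_trans t0 h1) (le_lt_trans h2 tr).
have : M * (K * t) <= (M * K + 1) * (X / (2 * (M * K + 1))).
  have MKle : M * K <= M * K + 1 by rewrite lerDl.
  by rewrite (mulrA M); exact: (ler_pM MK (ltW t0) MKle tX).
have -> : (M * K + 1) * (X / (2 * (M * K + 1))) = X / 2 by field; rewrite gt_eqF.
by move: H X0; rewrite -/X; move: (M * _) => y; lra.
Qed.

Lemma res_by_parts F G e : hol (pb r) F -> hol (pb r) G -> 0 < e -> 2 * e < r ->
  res (fun p => dz F p * G p) e = - res (fun p => F p * dz G p) e.
Proof.
move=> HF HG e0 er; have oP := @open_pb R r.
have S1 := proj1 (holM oP (hol_dz oP HF) HG); have S2 := proj1 (holM oP HF (hol_dz oP HG)).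
have := res_dz a0 b0 ra rb (holM oP HF HG) e0 er.
have E p : pb r p -> dz (fun p => F p * G p) p = dz F p * G p + F p * dz G p.
  by move=> hp; exact: (dzM oP hp (proj1 HF) (proj1 HG)).
rewrite (eq_res a b E e0 er) (resD a b S1 S2 e0 er) => /eqP; rewrite addr_eq0 => /eqP.
exact.
Qed.

Lemma res_inv_neq0 e : 0 < e -> 2 * e < r -> res (fun p => (zc p)^-1) e != 0.
Proof.
move=> e0 er; have := kap0 a0 b0 ra e0 er; rewrite /kap.
rewrite (@eq_cint _ _ _ _ (fun p => (zc p)^-1 * dbar (chic e) p)) // => p _.
rewrite /kern /ckern (_ : zc (0, 0) = 0) ?subr0 //.
Qed.
End bounded.

Variables (beta r : R).
Hypotheses (beta0 : 0 < beta) (r0 : 0 < r) (ra : r <= 2^-1) (rb : r <= beta / 2).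
Local Notation a := (2^-1 : R).
Local Notation b := (beta / 2).
Local Notation D := (rect (- a) a (- b) b).
Local Notation Om := (Omega beta).
Local Notation res := (residue a b).
Let oO := open_Omega beta0.
Let a0 : 0 < a := ahalf_gt0.
Let b0 : 0 < b := halfb_gt0 beta0.

Lemma res_elliptic g e : hol Om g -> biperiodic beta g -> 0 < e -> 2 * e < r -> res g e = 0.
Proof.
move=> Hg pg e0 er; have [k1 k2] := periodic_sides pg.
apply: (res_periodic a0 b0 ra rb oO _ Hg (fun y _ => k1 y) (fun x _ => k2 x) (pb_Omega beta0 ra rb) e0 er).
by move=> p /(cell_Omega beta0)[->|]; [right|left].
Qed.

(** the differential equation of elliptic functions with a single double pole *)
Theorem elliptic_ode q (N : C) (dl M : R) : hol Om q -> biperiodic beta q -> N != 0 ->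
  0 < dl -> (forall p, 0 < snorm p <= dl -> nc (q p - N / zc p ^+ 2) <= M) ->
  exists s c : C, forall p, Om p -> dz (dz q) p = 6 / N * q p ^+ 2 + s * q p + c.
Proof.
move=> Hq pq N0 dl0 qM; pose d := Num.min dl r.
have d0 : 0 < d by rewrite lt_min dl0.
have ddl : d <= dl by rewrite ge_min lexx.
have dr : d <= r by rewrite ge_min lexx orbT.
have da := le_trans dr ra; have db := le_trans dr rb.
have oP := @open_pb R d; have pO := pb_Omega beta0 da db.
have Hz := @hol_inv_zc R d.
have HN : hol (pb d) (fun p => N / zc p ^+ 2).
  by apply: (holZ oP); apply: (hol_ext oP _ (holX oP 2 Hz)) => p _; exact: exprVn.
have Hqd : hol (pb d) q := hol_sub pO Hq.
pose h p := q p - N / zc p ^+ 2.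
have Hh : hol (pb d) h := holB oP Hqd HN.
have hM p : pb d p -> nc (h p) <= M.
  by move=> /andP[h1 h2]; apply: qM; rewrite h1 (le_trans (ltW h2)).
have e10 : 0 < d / 4 by rewrite divr_gt0.
have e1d : 2 * (d / 4) < d by move: d0; lra.
have kap := res_inv_neq0 a0 b0 da e10 e1d.
pose h0 := res (fun p => h p / zc p) (d / 4) / res (fun p => (zc p)^-1) (d / 4).
pose k p := (h p - h0) / zc p.
have Hk : hol (pb d) k := holM oP (holB oP Hh (hol_cst oP h0)) Hz.
have znz s p : pb s p -> zc p != 0 by move=> /andP[h' _]; exact: zc_neq0.
have nz (p : R * R) s : pb s p -> snorm p * nc (zc p)^-1 <= 1.
  move=> hp; rewrite ncV ler_pdivrMr ?nc_gt0 ?(znz s) // mul1r; exact: snorm_nc.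
have [d2 d20 [Mk kM]] : exists2 dl, 0 < dl & exists M, forall z0, 0 < snorm z0 <= dl -> nc (k z0) <= M.
  apply: (bounded_of_residues a0 b0 d0 da db Hk) => [e e0 ed|s phi A e s0 sd Hphi A0 h1 h2 _ e0 es].
    rewrite (res_const a0 b0 da db Hk e0 e10 ed e1d).
    have E p : pb d p -> k p = h p / zc p + (- h0) * (zc p)^-1 by rewrite /k mulrBl mulNr.
    have S1 : csm (pb d) (fun p => h p / zc p) := proj1 (holM oP Hh Hz).
    rewrite (eq_res a b E e10 e1d) (resD a b S1 (csmM oP (csm_cst _ oP) (proj1 Hz)) e10 e1d).
    by rewrite (resZ a b _ (proj1 Hz) e10 e1d) /h0 mulNr mulfVK // subrr.
  have oS := @open_pb R s; have sub := pb_sub sd.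
  apply: (res_of_bounded (K := (M + nc h0) * A) a0 b0 (le_trans sd da) (le_trans sd db) _ _ e0 es).
    exact: (holM oS (hol_sub sub Hk) Hphi).
  move=> p hp.
  have b1 : nc (h p - h0) <= M + nc h0 := le_trans (ncB _ _) (lerD (hM p (sub p hp)) (lexx _)).
  have b2 : nc (zc p)^-1 * nc (phi p) <= A.
    apply: (le_trans (ler_wpM2l (nc_ge0 _) (h1 p hp))).
    rewrite mulrCA -[leRHS]mulr1; apply: ler_wpM2l => //.
    by rewrite mulrC; exact: nz hp.
  rewrite (ncM (k p)) /k (ncM (h p - h0)) -mulrA.
  exact: (ler_pM (nc_ge0 _) (mulr_ge0 (nc_ge0 _) (nc_ge0 _)) b1 b2).
pose s := - 12 * h0 / N.
pose g p := dz (dz q) p - 6 / N * q p ^+ 2 - s * q p.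
have Hg : hol Om g.
  exact: (holB oO (holB oO (hol_dz oO (hol_dz oO Hq)) (holZ oO _ (holX oO 2 Hq))) (holZ oO _ Hq)).
have pg : biperiodic beta g.
  apply: (@periodic_comp2 R beta C C C (fun x y => x - s * y) _ _ _ pq).
  apply: (@periodic_comp2 R beta C C C (fun x y => x - 6 / N * y ^+ 2) _ _ _ pq).
  by do 2 apply: periodic_dz.
pose d3 := Num.min d d2.
have d30 : 0 < d3 by rewrite lt_min d0.
have d3d : d3 <= d by rewrite ge_min lexx.
have d32 : d3 <= d2 by rewrite ge_min lexx orbT.
have d3a := le_trans d3d da; have d3b := le_trans d3d db.
have pO3 := pb_Omega beta0 d3a d3b.
have eg p : pb d p -> g p = dz (dz h) p + (- 12 * (k p / zc p) - 6 / N * h p ^+ 2 - s * h p).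
  move=> hp; have z0 := znz _ p hp.
  have Eq p' : pb d p' -> q p' = h p' + N * (zc p')^-1 ^+ 2 by move=> _; rewrite /h exprVn subrK.
  have SX n : csm (pb d) (fun p => (zc p)^-1 ^+ n) := csmX oP n (proj1 Hz).
  have E1 p' : pb d p' -> dz q p' = dz h p' + N * (-2 * (zc p')^-1 ^+ 3).
    move=> hp'; rewrite (dz_near oP Eq hp').
    rewrite (dzD oP hp' (proj1 Hh) (csmM oP (csm_cst N oP) (SX 2))) (dzZ oP N hp' (SX 2)).
    rewrite (dzX 1 oP (proj1 Hz) hp') (dz_inv_zc hp') -exprVn.
    by congr (_ + N * _); move: (zc p')^-1 => y; ring.
  have E2 : dz (dz q) p = dz (dz h) p + N * (6 * (zc p)^-1 ^+ 4).
    have S3 : csm (pb d) (fun p => - 2 * (zc p)^-1 ^+ 3) := csmM oP (csm_cst _ oP) (SX 3).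
    rewrite (dz_near oP E1 hp).
    rewrite (dzD oP hp (proj1 (hol_dz oP Hh)) (csmM oP (csm_cst N oP) S3)) (dzZ oP N hp S3).
    rewrite (dzZ oP _ hp (SX 3)) (dzX 2 oP (proj1 Hz) hp) (dz_inv_zc hp) -exprVn.
    by congr (_ + N * _); move: (zc p)^-1 => y; ring.
  rewrite /g E2 (Eq p hp) /s /k; move: (dz (dz h) p) (h p) (zc p) z0 => x y z z0.
  by field; rewrite N0.
have [d4 d40 [Mg gM]] : exists2 dl, 0 < dl & exists M, forall z0, 0 < snorm z0 <= dl -> nc (g z0) <= M.
  apply: (bounded_of_residues a0 b0 d30 d3a d3b (hol_sub pO3 Hg)) => [e e0 ed|t phi A e t0 td Hphi A0 h1 h2 h3 e0 et].
    apply: res_elliptic => //; apply: (lt_le_trans ed (le_trans d3d dr)).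
  have td' := le_trans td d3d.
  have oS := @open_pb R t; have sub := pb_sub td'.
  have ta := le_trans td' da; have tb := le_trans td' db.
  have Hht := hol_sub sub Hh; have Hkt := hol_sub sub Hk.
  pose L p := - 12 * (k p / zc p) - 6 / N * h p ^+ 2 - s * h p.
  have HL : hol (pb t) L.
    apply: (holB oS (holB oS (holZ oS _ _) (holZ oS _ (holX oS 2 Hht))) (holZ oS _ Hht)).
    exact: (holM oS Hkt (@hol_inv_zc R t)).
  have E p : pb t p -> g p * phi p = dz (dz h) p * phi p + L p * phi p.
    by move=> /sub /eg ->; rewrite mulrDl.
  have H1 := holM oS (hol_dz oS (hol_dz oS Hht)) Hphi; have H2 := holM oS HL Hphi.
  rewrite (eq_res a b E e0 et) (resD a b (proj1 H1) (proj1 H2) e0 et).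
  rewrite (res_by_parts a0 b0 ta tb (hol_dz oS Hht) Hphi e0 et).
  rewrite (res_by_parts a0 b0 ta tb Hht (hol_dz oS Hphi) e0 et) opprK.
  have hb p : pb t p -> nc (h p) <= M by move=> /sub; exact: hM.
  rewrite (res_of_bounded (K := M * A) a0 b0 ta tb (holM oS Hht (hol_dz oS (hol_dz oS Hphi))) _ e0 et); last first.
    by move=> p hp; rewrite ncM; exact: (ler_pM (nc_ge0 _) (nc_ge0 _) (hb p hp) (h3 p hp)).
  rewrite add0r.
  apply: (res_of_bounded (K := (nc (-12) * Mk + nc (6 / N) * (M * M) * t + nc s * M * t) * A) a0 b0 ta tb H2 _ e0 et).
  move=> p hp; have pt : snorm p <= t by case/andP: hp => _ /ltW.
  have kb : nc (k p) <= Mk.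
    by apply: kM; case/andP: hp => -> h' /=; exact: (le_trans (ltW h') (le_trans td d32)).
  have phb := h1 p hp; have hbp := hb p hp.
  have M0 : 0 <= M := le_trans (nc_ge0 _) hbp.
  have phz : nc ((zc p)^-1 * phi p) <= A.
    rewrite ncM; apply: (le_trans (ler_wpM2l (nc_ge0 _) phb)).
    rewrite mulrCA -[leRHS]mulr1; apply: ler_wpM2l => //.
    by rewrite mulrC; exact: nz hp.
  have ph : nc (phi p) <= t * A.
    by apply: (le_trans phb); rewrite mulrC; exact: ler_wpM2r.
  have -> : L p * phi p = - 12 * (k p * ((zc p)^-1 * phi p)) - 6 / N * (h p * h p) * phi p - s * h p * phi p.
    by rewrite /L; move: (6 / N) (zc p)^-1 => x y; ring.
  apply: (le_trans (ncB _ _)); apply: (le_trans (lerD (ncB _ _) (lexx _))).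
  have b1 : nc (- 12 * (k p * ((zc p)^-1 * phi p))) <= nc (-12) * Mk * A.
    rewrite (ncM (-12)) (ncM (k p)) -mulrA; apply: ler_wpM2l; first exact: nc_ge0.
    exact: (ler_pM (nc_ge0 _) (nc_ge0 _) kb phz).
  have b2 : nc (6 / N * (h p * h p) * phi p) <= nc (6 / N) * (M * M) * (t * A).
    rewrite (ncM _ (phi p)) (ncM (6 / N)) (ncM (h p)).
    apply: (ler_pM (mulr_ge0 (nc_ge0 _) (mulr_ge0 (nc_ge0 _) (nc_ge0 _))) (nc_ge0 _) _ ph).
    apply: ler_wpM2l; first exact: nc_ge0.
    exact: (ler_pM (nc_ge0 _) (nc_ge0 _) hbp hbp).
  have b3 : nc (s * h p * phi p) <= nc s * M * (t * A).
    rewrite (ncM _ (phi p)) (ncM s).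
    apply: (ler_pM (mulr_ge0 (nc_ge0 _) (nc_ge0 _)) (nc_ge0 _) _ ph).
    by apply: ler_wpM2l; first exact: nc_ge0.
  apply: (le_trans (lerD (lerD b1 b2) b3)).
  by rewrite le_eqVlt; apply/orP; left; apply/eqP; ring.
pose d5 := Num.min r d4.
have d50 : 0 < d5 by rewrite lt_min r0.
have d5r : d5 <= r by rewrite ge_min lexx.
have d54 : d5 <= d4 by rewrite ge_min lexx orbT.
exists s, (g (a, b)) => p Op.
have gb p' : pb d5 p' -> nc (g p') <= Mg.
  by move=> /andP[h1 h2]; apply: gM; rewrite h1 (le_trans (ltW h2)).
rewrite -(liouville beta0 d50 (le_trans d5r ra) (le_trans d5r rb) Hg pg gb Op) /g.
by move: (dz (dz q) p) (6 / N * _) (s * _) => x y z; ring.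
Qed.

Lemma hol_dz0_const F : hol Om F -> (forall p, Om p -> dz F p = 0) -> forall p, Om p -> F p = F (a, b).
Proof.
move=> HF d0 p Op; have [[S1 S2] _] := HF.
have H p' : Om p' -> cdx F p' = 0 /\ cdy F p' = 0.
  by move=> Op'; have [E1 E2] := hol_cdx HF Op'; rewrite E2 -E1 d0 // mulr0.
apply: complex_ext.
  apply: (grad0_const beta0 S1 _ _ Op) => p' /H[h1 h2]; [exact: (congr1 (@complex.Re R) h1)|exact: (congr1 (@complex.Re R) h2)].
apply: (grad0_const beta0 S2 _ _ Op) => p' /H[h1 h2]; [exact: (congr1 (@complex.Im R) h1)|exact: (congr1 (@complex.Im R) h2)].
Qed.

(** first integral *)
Lemma elliptic_ode1 q (N s c : C) : hol Om q -> N != 0 ->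
  (forall p, Om p -> dz (dz q) p = 6 / N * q p ^+ 2 + s * q p + c) ->
  exists d : C, forall p, Om p -> dz q p ^+ 2 = 4 / N * q p ^+ 3 + s * q p ^+ 2 + 2 * c * q p + d.
Proof.
move=> Hq N0 E; pose F p := dz q p ^+ 2 - (4 / N * q p ^+ 3 + s * q p ^+ 2 + 2 * c * q p).
have H1 := holX oO 2 (hol_dz oO Hq).
have A3 := holZ oO (4 / N) (holX oO 3 Hq); have A2 := holZ oO s (holX oO 2 Hq).
have A1 := holZ oO (2 * c) Hq.
have HF : hol Om F := holB oO H1 (holD oO (holD oO A3 A2) A1).
exists (F (a, b)) => p Op; rewrite -(hol_dz0_const HF _ Op) => [|{p Op} p Op].
  by rewrite /F addrC subrK.
have Sq := proj1 Hq.
rewrite /F (dzB oO Op (proj1 H1) (proj1 (holD oO (holD oO A3 A2) A1))).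
rewrite (dzD oO Op (proj1 (holD oO A3 A2)) (proj1 A1)) (dzD oO Op (proj1 A3) (proj1 A2)).
rewrite (dzZ oO _ Op (csmX oO 3 Sq)) (dzZ oO _ Op (csmX oO 2 Sq)) (dzZ oO _ Op Sq).
rewrite (dzX 1 oO (csm_dz oO Sq) Op) (dzX 2 oO Sq Op) (dzX 1 oO Sq Op) (E p Op).
by move: (dz q p) (q p) => x y; field.
Qed.

End Ode.

(*@@@ 16*)
Local Open Scope complex_scope.
Opaque dx dy.

Section Distribution.
Context {R : realType}.
Local Notation C := R[i].
Variable tau : C.
Hypotheses (tau_Re : complex.Re tau = 0) (tau_Im : 0 < complex.Im tau).
Local Notation beta := (complex.Im tau).
Implicit Types (p : R * R) (f : R * R -> R).
Local Notation Om := (Omega beta).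
Let oT := @openT (R * R)%type.
Let oO := open_Omega tau_Im.

Lemma no_int01 (m : int) : (0 : R) < m%:~R -> (m%:~R : R) < 1 -> False.
Proof. by rewrite ltr0z ltrz1; lia. Qed.

Lemma tauE : tau = 0 +i* beta.
Proof. by apply: complex_ext. Qed.

Lemma lattice_elt (m n : int) : m%:~R + n%:~R * tau = (m%:~R : R) +i* (n%:~R * beta).
Proof.
have E (k : int) : k%:~R = (k%:~R : R)%:C by rewrite rmorph_int.
rewrite tauE !E; apply: complex_ext; rewrite /= ?mulr0 ?mul0r ?subrr ?subr0 ?addr0 ?add0r //.
Qed.

Lemma lattice_Omega : [set p | ~ lattice tau (to_complex p)] = Om.
Proof.
apply/seteqP; split=> p; rewrite /Omega /=.
  move=> h; apply/negP => /andP[/intrP[m Em] /intrP[k Ek]]; apply: h; exists m, k.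
  rewrite lattice_elt /to_complex Em; congr (_ +i* _).
  by rewrite -Ek mulfVK // gt_eqF.
move=> /negP h [m [k]]; rewrite lattice_elt /to_complex => -[E1 E2]; apply: h.
by rewrite E1 E2 mulfK ?gt_eqF // !intr_int.
Qed.

Lemma torus_biperiodic (u : C -> R) : on_torus tau u -> biperiodic beta (in_plane u).
Proof.
move=> H; split=> p; rewrite /in_plane /=.
  have L1 : lattice tau (to_complex (1, 0)) by exists 1, 0; rewrite lattice_elt mul0r.
  by rewrite -[RHS](H _ _ L1).
have L2 : lattice tau (to_complex (0, beta)) by exists 0, 1; rewrite lattice_elt mul1r.
by rewrite -[RHS](H _ _ L2).
Qed.

Lemma biperiodic_torus f : biperiodic beta f -> on_torus tau (fun z => f (complex.Re z, complex.Im z)).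
Proof.
move=> pf z w [m [k ->]]; rewrite lattice_elt -[RHS](periodic_int pf m k).
by rewrite reD imD.
Qed.

Local Notation FD := (fundamental_domain tau).

Lemma fundamental_domainE : FD = `[0, 1[ `*` `[0, beta[.
Proof.
apply/seteqP; split=> p /=.
  move=> [s [t [/andP[s0 s1] /andP[t0 t1] E]]].
  have [E1 E2] : p.1 = s /\ p.2 = t * beta.
    have := congr1 (@complex.Re R) E; have := congr1 (@complex.Im R) E; rewrite tauE /=.
    by move=> -> ->; split; ring.
  rewrite !in_itv /= E1 E2 s0 s1 mulr_ge0 // ?ltW //=; split=> //.
  by rewrite -[ltRHS]mul1r ltr_pM2r.
rewrite !in_itv /= => -[/andP[s0 s1] /andP[t0 t1]].
exists p.1, (p.2 / beta); split; first by rewrite s0.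
  by apply/andP; split; [exact: divr_ge0 t0 (ltW tau_Im)|rewrite ltr_pdivrMr // mul1r].
rewrite tauE; apply: complex_ext => /=; [ring|by field; rewrite gt_eqF].
Qed.

Lemma measurable_FD : @measurable _ (measurableTypeR R * measurableTypeR R)%type FD.
Proof. by rewrite fundamental_domainE; apply: measurableX. Qed.

Lemma FD_rint a b c d f : rect a b c d `<=` FD ->
  (forall p, FD p -> ~ rect a b c d p -> f p = 0) ->
  \int[@area R]_(p in FD) f p = rint a b c d f.
Proof.
move=> sub f0; rewrite /rint Rintegral_mkcond [RHS]Rintegral_mkcond.
congr (\int[_]_(_ in _) _) => //; apply/funext => p; rewrite !patchE.
case: ifPn => pD; case: ifPn => pD' //.
  by apply: f0; [rewrite inE in pD|rewrite notin_setE in pD'].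
by move: pD; rewrite notin_setE => -[]; apply: sub; rewrite inE in pD'.
Qed.

Lemma dirac_FD0 f : continuous f -> f (0, 0) = 0 ->
  \int[\d_((0, 0) : R * R)]_(p in FD) f p = 0.
Proof.
move=> cf f0; rewrite /Rintegral integral_dirac.
- by rewrite f0 mule0.
- exact: measurable_FD.
apply/measurable_realfun.measurable_EFinP; apply: continuous_measurable2; first exact: measurable_FD.
by move=> p _; exact: cf.
Qed.

(** bumps *)
Definition omega2 (L : R) : R := pi *+ 2 / L.
Definition pbump (L c h x : R) : R := flat 0 (cos (omega2 L * (x - c)) - cos (omega2 L * h)).

Lemma pbump_periodic L c h x : 0 < L -> pbump L c h (x + L) = pbump L c h x.
Proof.
move=> L0; rewrite /pbump; congr (flat _ (_ - _)).
have -> : omega2 L * (x + L - c) = omega2 L * (x - c) + pi *+ 2.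
  by rewrite /omega2; field; rewrite gt_eqF.
exact: cosD2pi.
Qed.

Lemma pbump_ge0 L c h x : 0 <= pbump L c h x.
Proof. exact: flat_ge0. Qed.

Lemma omega2_gt0 L : 0 < L -> 0 < omega2 L.
Proof. by move=> L0; rewrite divr_gt0 // mulrn_wgt0 // pi_gt0. Qed.

Lemma cos_lt_small L h t : 0 < L -> 0 < h -> h <= `|t| -> `|t| <= L - h ->
  cos (omega2 L * t) <= cos (omega2 L * h).
Proof.
move=> L0 h0 ht tL; have w0 := omega2_gt0 L0.
have half s : s <= L / 2 -> omega2 L * s <= pi.
  move=> hs; have -> : pi = omega2 L * (L / 2) by rewrite /omega2; field; rewrite gt_eqF.
  by rewrite ler_pM2l.
have main s : h <= s -> s <= L / 2 -> cos (omega2 L * s) <= cos (omega2 L * h).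
  move=> hs sL; have s0 := lt_le_trans h0 hs.
  have I1 : omega2 L * s \in `[0, pi].
    by rewrite in_itv /=; apply/andP; split; [exact: mulr_ge0 (ltW w0) (ltW s0)|exact: half].
  have I2 : omega2 L * h \in `[0, pi].
    rewrite in_itv /=; apply/andP; split; first exact: mulr_ge0 (ltW w0) (ltW h0).
    by apply: half; exact: le_trans sL.
  by rewrite leNgt; apply/negP; rewrite (ltr_cos I1 I2) ltr_pM2l // ltNge hs.
have -> : cos (omega2 L * t) = cos (omega2 L * `|t|).
  by case: (ger0P t) => _ //; rewrite mulrN cosN.
have [h1|h1] := leP `|t| (L / 2); first exact: main.
have -> : cos (omega2 L * `|t|) = cos (omega2 L * (L - `|t|)).
  rewrite -cosN; have -> : omega2 L * (L - `|t|) = - (omega2 L * `|t|) + pi *+ 2.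
    by rewrite /omega2; field; rewrite gt_eqF.
  by rewrite cosD2pi.
apply: main; first by move: tL; move: (`|t|) => x; lra.
by move: h1; move: (`|t|) => x; lra.
Qed.

Lemma pbump0 L c h x : 0 < L -> 0 < h -> h <= `|x - c| -> `|x - c| <= L - h -> pbump L c h x = 0.
Proof. by move=> L0 h0 h1 h2; apply: flat_le0; rewrite subr_le0; exact: cos_lt_small. Qed.

Lemma pbump_gt0 L c h : 0 < L -> 0 < h -> h <= L / 2 -> 0 < pbump L c h c.
Proof.
move=> L0 h0 hL; apply: flat_gt0; rewrite subr_gt0 subrr mulr0.
have w0 := omega2_gt0 L0.
have I1 : omega2 L * h \in `[0, pi].
  rewrite in_itv /=; apply/andP; split; first exact: mulr_ge0 (ltW w0) (ltW h0).
  have -> : pi = omega2 L * (L / 2) by rewrite /omega2; field; rewrite gt_eqF.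
  by rewrite ler_pM2l.
have I2 : (0 : R) \in `[0, pi] by rewrite in_itv /= lexx pi_ge0.
by rewrite (ltr_cos I2 I1) mulr_gt0.
Qed.

Definition bump2 (c c' h h' : R) p : R := pbump 1 c h p.1 * pbump beta c' h' p.2.

Lemma smooth_bump2 c c' h h' : smooth_on setT (bump2 c c' h h').
Proof.
have S L k l (g : R * R -> R) : smooth_on setT g -> smooth_on setT (fun p => pbump L k l (g p)).
  move=> Sg; apply: smooth_flat => //; apply: (smoothB oT _ (smooth_cst _ oT)).
  apply: smooth_cos => //; apply: (smoothM oT (smooth_cst _ oT)).
  exact: (smoothB oT Sg (smooth_cst _ oT)).
exact: (smoothM oT (S _ _ _ _ (smooth_fst oT)) (S _ _ _ _ (smooth_snd oT))).
Qed.

Lemma biperiodic_bump2 c c' h h' : biperiodic beta (bump2 c c' h h').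
Proof.
split=> p; rewrite /bump2 /= ?addr0; first by rewrite pbump_periodic.
by rewrite pbump_periodic.
Qed.

Section solution.
Variables (rho : R) (u : C -> R).
Hypotheses (ut : on_torus tau u) (Su : smooth_on Om (in_plane u))
  (Eu : distributional_solution tau rho u).
Local Notation U := (in_plane u).
Definition defect p := lap U p + expR (U p).

Let Sdef : smooth_on Om defect.
Proof. exact: (smoothD oO (smooth_lap oO Su) (smooth_expR oO Su)). Qed.

(* the equation against a bump supported in a small box of the open cell *)
Lemma tested c c' h : 0 < h -> h < c -> c < 1 - h -> h < c' -> c' < beta - h ->
  rint (c - h) (c + h) (c' - h) (c' + h) (fun p => bump2 c c' (h / 2) (h / 2) p * defect p) = 0.
Proof.
move=> h0 hc1 hc2 hc3 hc4; pose phi := bump2 c c' (h / 2) (h / 2).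
have Sphi : smooth_on setT phi := smooth_bump2 c c' (h / 2) (h / 2).
have h20 : 0 < h / 2 by rewrite divr_gt0.
pose B := rect (c - h) (c + h) (c' - h) (c' + h).
have BO : B `<=` Om.
  move=> p; rewrite /B /rect /= !in_itv /= => -[/andP[h1 h2] /andP[h3 h4]].
  rewrite /Omega /=; apply/negP => /andP[/intrP[m Em] _].
  apply: (@no_int01 m); rewrite -Em; first by apply: lt_le_trans h1; rewrite subr_gt0.
  by apply: le_lt_trans h2 _; move: hc2; rewrite ltrBrDr.
have BFD : B `<=` FD.
  move=> p; rewrite fundamental_domainE /B /rect /= !in_itv /= => -[/andP[h1 h2] /andP[h3 h4]].
  by split; apply/andP; split; move: h0 hc1 hc2 hc3 hc4 h1 h2 h3 h4; lra.
have Bc p : B p <-> `|p.1 - c| <= h /\ `|p.2 - c'| <= h.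
  rewrite /B /rect /= !in_itv /= !ler_norml.
  by split=> -[/andP[x1 x2] /andP[y1 y2]]; split; apply/andP; split; lra.
(* phi vanishes near the complement of B in the cell *)
pose W := [set p : R * R | h / 2 < `|p.1 - c|] `&` [set p : R * R | `|p.1 - c| < 1 - h / 2] `|`
  [set p : R * R | h / 2 < `|p.2 - c'|] `&` [set p : R * R | `|p.2 - c'| < beta - h / 2].
have oW : open W.
  have cn (g : R * R -> R) k : smooth_on setT g -> continuous (fun p => `|g p - k|).
    move=> Sg p; apply: (continuous_comp (f := fun p => g p - k) (g := @Num.norm _ R)); last exact: norm_continuous.
    exact: (smooth_continuous (smoothB oT Sg (smooth_cst k oT)) (I : setT p)).
  have o1 (g : R * R -> R) k l : continuous g -> open ([set p | k < g p] `&` [set p | g p < l]).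
    move=> cg; apply: openI; [rewrite (_ : [set p | _] = g @^-1` [set x | x > k]) //|rewrite (_ : [set p | _] = g @^-1` [set x | x < l]) //].
      by apply: open_comp => [p _|]; [exact: cg|exact: open_gt].
    by apply: open_comp => [p _|]; [exact: cg|exact: open_lt].
  apply: openU; apply: o1; apply: cn; [exact: smooth_fst|exact: smooth_snd].
have phiW p : W p -> phi p = 0.
  case=> -[/ltW k1 /ltW k2]; rewrite /phi /bump2.
    by rewrite (pbump0 ltr01 h20 k1 k2) mul0r.
  by rewrite (pbump0 tau_Im h20 k1 k2) mulr0.
have dW p : W p -> dx phi p = 0 /\ dy phi p = 0.
  by move=> Wp; rewrite (dx_near oW Wp phiW) (dy_near oW Wp phiW) dx_cst dy_cst.
have lW p : W p -> lap phi p = 0.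
  move=> Wp; rewrite /lap (dx_near (g := fun=> 0) oW Wp) ?(dy_near (g := fun=> 0) oW Wp) ?dx_cst ?dy_cst ?addr0 //.
    by move=> q /dW[].
  by move=> q /dW[].
have FDW p : FD p -> ~ B p -> W p.
  rewrite fundamental_domainE Bc /= !in_itv /= => -[/andP[s0 s1] /andP[t0 t1]].
  have [k|k] := leP (`|p.1 - c|) h.
    have [k'|k'] := leP (`|p.2 - c'|) h; first by move=> [].
    move=> _; right; split=> /=; first by apply: lt_trans k'; rewrite ltr_pdivrMr // ltr_pMr // ltr1n.
    by rewrite ltr_norml; apply/andP; split; move: h0 hc3 hc4 t0 t1; lra.
  move=> _; left; split=> /=; first by apply: lt_trans k; rewrite ltr_pdivrMr // ltr_pMr // ltr1n.
  by rewrite ltr_norml; apply/andP; split; move: h0 hc1 hc2 s0 s1; lra.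
have sideW x y : `|x - c| = h \/ `|y - c'| = h -> W (x, y).
  by case=> E; [left|right]; rewrite /= E; split=> /=; move: h0 hc1 hc2 hc3 hc4; lra.
have [psi Epsi] : exists psi : C -> R, [/\ test_function tau psi & in_plane psi = phi].
  exists (fun z => phi (complex.Re z, complex.Im z)).
  have E : in_plane (fun z => phi (complex.Re z, complex.Im z)) = phi by apply/funext => -[x y].
  split=> //; split; last by rewrite E.
  by apply: biperiodic_torus; exact: biperiodic_bump2.
have [tpsi E] := Epsi; have [_ _ /(_ _ tpsi)] := Eu; rewrite E.
have phi00 : phi (0, 0) = 0.
  apply: phiW; left; rewrite /= sub0r normrN gtr0_norm; last exact: lt_trans hc1.
  by split=> /=; move: h0 hc1 hc2; lra.
have cphi : continuous phi by move=> p; exact: (smooth_continuous Sphi (I : setT p)).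
rewrite (dirac_FD0 cphi phi00) mulr0.
rewrite (FD_rint BFD); last by move=> p Fp nB; rewrite [laplacian _ _](lW p (FDW p Fp nB)) mulr0.
rewrite (FD_rint BFD); last by move=> p Fp nB; rewrite (phiW p (FDW p Fp nB)) mulr0.
have SphiO : smooth_on Om phi by apply: smooth_on_sub Sphi.
pose P p := U p * dx phi p - phi p * dx U p.
pose Q p := U p * dy phi p - phi p * dy U p.
have Sx := smooth_dx SphiO; have Sy := smooth_dy SphiO.
have Ux := smooth_dx Su; have Uy := smooth_dy Su.
have SP : smooth_on Om P := smoothB oO (smoothM oO Su Sx) (smoothM oO SphiO Ux).
have SQ : smooth_on Om Q := smoothB oO (smoothM oO Su Sy) (smoothM oO SphiO Uy).
have hh : c - h < c + h by move: h0; lra.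
have hh' : c' - h < c' + h by move: h0; lra.
have PW p : W p -> P p = 0 by move=> Wp; have [d1 _] := dW p Wp; rewrite /P phiW // d1 mulr0 mul0r subrr.
have QW p : W p -> Q p = 0 by move=> Wp; have [_ d2] := dW p Wp; rewrite /Q phiW // d2 mulr0 mul0r subrr.
have nh k : `|k - h - k| = h by rewrite addrAC subrr add0r normrN gtr0_norm.
have nh' k : `|k + h - k| = h by rewrite addrAC subrr add0r gtr0_norm.
have IP : rint (c - h) (c + h) (c' - h) (c' + h) (dx P) = 0.
  apply: (rint_dx0 hh oO BO SP) => y _.
  exact: (etrans (PW _ (sideW _ _ (or_introl (nh c)))) (esym (PW _ (sideW _ _ (or_introl (nh' c)))))).
have IQ : rint (c - h) (c + h) (c' - h) (c' + h) (dy Q) = 0.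
  apply: (rint_dy0 hh' oO BO SQ) => x _.
  exact: (etrans (QW _ (sideW _ _ (or_intror (nh c')))) (esym (QW _ (sideW _ _ (or_intror (nh' c')))))).
have cB f : smooth_on Om f -> forall p, B p -> {for p, continuous f}.
  by move=> Sf p /BO Op; exact: smooth_continuous Sf Op.
have S1 : smooth_on Om (fun p => U p * laplacian phi p) := smoothM oO Su (smooth_lap oO SphiO).
have S2 : smooth_on Om (fun p => expR (U p) * phi p) := smoothM oO (smooth_expR oO Su) SphiO.
have E1 := rintD (cB _ S1) (cB _ S2).
have S3 := smoothM oO SphiO Sdef.
have E2 := rintD (cB _ (smooth_dx SP)) (cB _ (smooth_dy SQ)).
have {}E2 := etrans E2 (etrans (f_equal2 +%R IP IQ) (addr0 0)).
have E3 := rintD (cB _ (smoothD oO (smooth_dx SP) (smooth_dy SQ))) (cB _ S3).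
have {}E3 := etrans E3 (etrans (f_equal2 +%R E2 erefl) (add0r _)).
move=> E4; apply: etrans (esym E3) _; apply: etrans _ E4; apply: etrans _ E1.
apply: eq_rint => p /BO Op.
have -> : dx P p = dx U p * dx phi p + U p * dx (dx phi) p - (dx phi p * dx U p + phi p * dx (dx U) p).
  by rewrite (dxB (smoothM oO Su Sx) (smoothM oO SphiO Ux) Op) (dxM Su Sx Op) (dxM SphiO Ux Op).
have -> : dy Q p = dy U p * dy phi p + U p * dy (dy phi) p - (dy phi p * dy U p + phi p * dy (dy U) p).
  by rewrite (dyB (smoothM oO Su Sy) (smoothM oO SphiO Uy) Op) (dyM Su Sy Op) (dyM SphiO Uy Op).
have -> : laplacian phi p = dx (dx phi) p + dy (dy phi) p by [].
rewrite /defect /lap -/phi.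
move: (expR (U p)) (U p) (phi p) (dx U p) (dy U p) (dx phi p) (dy phi p) => e u0 f0 ux uy fx fy.
move: (dx (dx phi) p) (dy (dy phi) p) (dx (dx U) p) (dy (dy U) p) => x1 x2 x3 x4; ring.
Qed.

Lemma defect_cell c c' : 0 < c < 1 -> 0 < c' < beta -> defect (c, c') = 0.
Proof.
move=> /andP[c0 c1] /andP[c'0 c'1].
have Oc : Om (c, c').
  rewrite /Omega /=; apply/negP => /andP[/intrP[m Em] _].
  by apply: (@no_int01 m); rewrite -Em.
have [//|ne] := eqVneq (defect (c, c')) 0.
have key sg : 0 < sg * defect (c, c') -> False.
  move=> pos.
  have Sg := smoothZ sg oO Sdef.
  have pos2 : 0 < sg * defect (c, c') / 2 by rewrite divr_gt0.
  have [h1 h10 H1] := continuous_box (smooth_continuous Sg Oc) pos2.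
  pose h := Num.min h1 (Num.min (Num.min (c / 2) ((1 - c) / 2)) (Num.min (c' / 2) ((beta - c') / 2))).
  have h0 : 0 < h by rewrite !lt_min h10 !divr_gt0 // subr_gt0.
  have hh1 : h <= h1 by rewrite ge_min lexx.
  have [k1 k2 k3 k4] : [/\ h <= c / 2, h <= (1 - c) / 2, h <= c' / 2 & h <= (beta - c') / 2].
    by split; rewrite /h !ge_min lexx ?orbT.
  have a1 : h < c by move: k1 c0; lra.
  have a2 : c < 1 - h by move: k2 c1; lra.
  have a3 : h < c' by move: k3 c'0; lra.
  have a4 : c' < beta - h by move: k4 c'1; lra.
  have T := tested h0 a1 a2 a3 a4.
  pose f p := bump2 c c' (h / 2) (h / 2) p * (sg * defect p).
  have box p : rect (c - h) (c + h) (c' - h) (c' + h) p -> 0 < sg * defect p /\ Om p.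
    rewrite /rect /= !in_itv /= => -[/andP[b1 b2] /andP[b3 b4]]; split.
      have := H1 p.1 p.2; rewrite -surjective_pairing /= => H.
      have {}H : `|sg * defect (c, c') - sg * defect p| <= sg * defect (c, c') / 2.
        by apply: H; rewrite ler_norml; apply/andP; split; move: b1 b2 b3 b4 hh1; lra.
      by move: H pos; rewrite ler_norml => /andP[_]; move: (sg * _) (sg * _) => x y; lra.
    rewrite /Omega /=; apply/negP => /andP[/intrP[m Em] _].
    apply: (@no_int01 m); rewrite -Em; first by apply: lt_le_trans b1; rewrite subr_gt0.
    by apply: le_lt_trans b2 _; move: a2; rewrite ltrBrDr.
  have hc : c - h < c + h by move: h0; lra.
  have hc' : c' - h < c' + h by move: h0; lra.
  have Sb := smooth_on_sub (@subsetT _ Om) (smooth_bump2 c c' (h / 2) (h / 2)).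
  have Sf : smooth_on Om f := smoothM oO Sb Sg.
  have cf p : rect (c - h) (c + h) (c' - h) (c' + h) p -> {for p, continuous f}.
    by move=> /box[_ Op]; exact: smooth_continuous Sf Op.
  have f0 p : rect (c - h) (c + h) (c' - h) (c' + h) p -> 0 <= f p.
    by move=> /box[/ltW d0 _]; exact: (mulr_ge0 (mulr_ge0 (pbump_ge0 _ _ _ _) (pbump_ge0 _ _ _ _)) d0).
  have cg p : rect (c - h) (c + h) (c' - h) (c' + h) p ->
      {for p, continuous (fun p => bump2 c c' (h / 2) (h / 2) p * defect p)}.
    by move=> /box[_ Op]; exact: (smooth_continuous (smoothM oO Sb Sdef) Op).
  have If : rint (c - h) (c + h) (c' - h) (c' + h) f = 0.
    have E := rintZ sg cg; rewrite T mulr0 in E; apply: etrans E.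
    by apply: eq_rint => p _; rewrite /f mulrCA.
  have Bc : rect (c - h) (c + h) (c' - h) (c' + h) (c, c').
    by rewrite /rect /= !in_itv /=; split; apply/andP; split; move: h0; lra.
  have := rint_eq0 hc hc' cf f0 If Bc; apply/eqP; rewrite gt_eqF //.
  have h20 : 0 < h / 2 by rewrite divr_gt0.
  apply: mulr_gt0; last exact: pos.
  by apply: mulr_gt0; apply: pbump_gt0 => //=; move: k1 k2 k3 k4; lra.
case: (ltgtP (defect (c, c')) 0) ne => // d _; exfalso.
  by apply: (key (-1)); rewrite mulN1r oppr_gt0.
by apply: (key 1); rewrite mul1r.
Qed.

(** the equation holds pointwise away from the lattice *)
Theorem pointwise_equation p : Om p -> lap U p = - expR (U p).
Proof.
move=> Op; apply/eqP; rewrite -addr_eq0; apply/eqP; rewrite -/(defect p).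
have [//|ne] := eqVneq (defect p) 0; exfalso.
have pU := torus_biperiodic ut.
have pd : biperiodic beta defect.
  apply: (@periodic_comp2 _ _ _ _ _ (fun x y => x + expR y) _ _ _ pU).
  by apply: (@periodic_comp2 _ _ _ _ _ (fun x y => x + y)); [do 2 apply: periodic_dx|do 2 apply: periodic_dy].
have pos2 : 0 < `|defect p| / 2 by rewrite divr_gt0 // normr_gt0.
have [h h0 H] := continuous_box (smooth_continuous Sdef Op) pos2.
(* a nearby point whose translate lies in the open cell *)
have near_nonint (L x : R) : 0 < L -> exists2 y, `|y - x| <= h & y / L \isn't a Num.int.
  move=> L0; have [i|] := boolP (x / L \is a Num.int); last first.
    by exists x => //; rewrite subrr normr0 ltW.
  pose t := Num.min h (L / 2).
  have t0 : 0 < t by rewrite lt_min h0 divr_gt0.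
  have th : t <= h by rewrite ge_min lexx.
  have tL : t <= L / 2 by rewrite ge_min lexx orbT.
  exists (x + t); first by rewrite addrAC subrr add0r gtr0_norm.
  apply/negP => i2; have i3 : t / L \is a Num.int.
    by have -> : t / L = (x + t) / L - x / L by [rewrite -mulrBl addrAC subrr add0r]; rewrite rpredB.
  have := small_int i3; rewrite gtr0_norm ?divr_gt0 // ltr_pdivrMr // mul1r => E.
  have {}E : t / L = 0 by apply: E; move: tL L0; lra.
  by have := divr_gt0 t0 L0; rewrite E ltxx.
have [x hx nx] := near_nonint 1 p.1 ltr01.
have [y hy ny] := near_nonint beta p.2 tau_Im.
rewrite divr1 in nx.
have := H x y hx hy.
have fl (z : R) : z \isn't a Num.int -> 0 < z - (Num.floor z)%:~R < 1.
  move=> nz; have /andP[f1 f2] := floor_itv z.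
  rewrite subr_gt0 lt_neqAle f1 andbT ltrBlDl.
  move: f2; rewrite intrD => ->; rewrite andbT; apply/negP => /eqP E.
  by move: nz; rewrite -E intr_int.
pose m := Num.floor x; pose k := Num.floor (y / beta).
have /andP[m0 m1] := fl _ nx; have /andP[k0 k1] := fl _ ny.
have E : (x, y) = (x - m%:~R, y - k%:~R * beta) + (m%:~R, k%:~R * beta).
  by apply/pair_equal_spec; split; rewrite /= subrK.
rewrite E (periodic_int pd) defect_cell.
- rewrite subr0; move: pos2; move: (`|_|) => z; lra.
- by rewrite m0.
have -> : y - k%:~R * beta = (y / beta - k%:~R) * beta by rewrite mulrBl mulfVK // gt_eqF.
by rewrite mulr_gt0 //= -[ltRHS]mul1r ltr_pM2r.
Qed.

End solution.
End Distribution.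

(*@@@ 17*)
Local Open Scope complex_scope.
Opaque dx dy.

Section Schwarzian.
Context {R : realType}.
Local Notation C := R[i].
Local Notation re := (@complex.Re R).
Local Notation im := (@complex.Im R).
Implicit Types (p : R * R) (f : R * R -> R).

(** w_zz / w for w = exp (- f / 2) *)
Definition schw f p : C := eres f 0 p.

Lemma dz_real f p : dz (fun p => (f p)%:C) p = (2^-1 * dx f p) +i* (- (2^-1 * dy f p)).
Proof.
rewrite /dz /cdx /cdy.
have -> : re \o (fun p => (f p)%:C) = f by [].
have -> : im \o (fun p => (f p)%:C) = (fun=> 0) by [].
rewrite (dx_cst 0 p) (dy_cst 0 p).
by move: (dx f p) (dy f p) => x y; apply: complex_ext => /=; ring.
Qed.

Section on_open.
Variables (U : set (R * R)) (f : R * R -> R) (p : R * R).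
Hypotheses (oU : open U) (Sf : smooth_on U f) (Up : U p).
Let uz := dz (fun p => (f p)%:C).
Let Sx := smooth_dx Sf.
Let Sy := smooth_dy Sf.

Lemma csm_uz : csm U uz.
Proof. exact: (csm_dz oU (csm_real oU Sf)). Qed.

Let re_uz : re \o uz = (fun p => 2^-1 * dx f p).
Proof. by apply/funext => q; exact: (congr1 re (dz_real f q)). Qed.
Let im_uz : im \o uz = (fun p => - (2^-1 * dy f p)).
Proof. by apply/funext => q; exact: (congr1 im (dz_real f q)). Qed.

Lemma dx_re_uz : dx (re \o uz) p = 2^-1 * dx (dx f) p.
Proof. by rewrite re_uz; exact: (dxZ Sx Up). Qed.
Lemma dy_re_uz : dy (re \o uz) p = 2^-1 * dy (dx f) p.
Proof. by rewrite re_uz; exact: (dyZ Sx Up). Qed.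
Lemma dx_im_uz : dx (im \o uz) p = - (2^-1 * dy (dx f) p).
Proof.
rewrite im_uz; apply: etrans (dxN (smoothZ 2^-1 oU Sy) Up) _; congr (- _).
by apply: etrans (dxZ Sy Up _) _; rewrite (dxdyC oU Sf Up).
Qed.
Lemma dy_im_uz : dy (im \o uz) p = - (2^-1 * dy (dy f) p).
Proof.
rewrite im_uz; apply: etrans (dyN (smoothZ 2^-1 oU Sy) Up) _; congr (- _).
exact: (dyZ Sy Up).
Qed.

Lemma dbar_uz : dbar uz p = (4^-1 * lap f p)%:C.
Proof.
rewrite /dbar /cdx /cdy dx_re_uz dx_im_uz dy_re_uz dy_im_uz /lap.
by move: (dx (dx f) p) (dy (dx f) p) (dy (dy f) p) => x y z; apply: complex_ext => /=; field.
Qed.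

Lemma dz_uz : dz uz p = (4^-1 * (dx (dx f) p - dy (dy f) p)) +i* (- (2^-1 * dy (dx f) p)).
Proof.
rewrite /dz /cdx /cdy dx_re_uz dx_im_uz dy_re_uz dy_im_uz.
by move: (dx (dx f) p) (dy (dx f) p) (dy (dy f) p) => x y z; apply: complex_ext => /=; field.
Qed.

Lemma schwE : schw f p = - 2^-1%:C * dz uz p + 4^-1%:C * uz p ^+ 2.
Proof. by rewrite /schw /eres mul0r mul0r addr0. Qed.

Lemma re_schw : re (schw f p) =
  - (8^-1 * (dx (dx f) p - dy (dy f) p)) + 16^-1 * (dx f p ^+ 2 - dy f p ^+ 2).
Proof.
rewrite schwE dz_uz /uz dz_real.
move: (dx (dx f) p) (dy (dx f) p) (dy (dy f) p) (dx f p) (dy f p) => x y z t k.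
by rewrite expr2 !(reD, reM, imM, imD, reN, imN) /=; field.
Qed.

Lemma im_schw : im (schw f p) = 4^-1 * dy (dx f) p - 8^-1 * (dx f p * dy f p).
Proof.
rewrite schwE dz_uz /uz dz_real.
move: (dx (dx f) p) (dy (dx f) p) (dy (dy f) p) (dx f p) (dy f p) => x y z t k.
by rewrite expr2 !(reD, reM, imM, imD, reN, imN) /=; field.
Qed.
End on_open.

Lemma csm_schw U f : open U -> smooth_on U f -> csm U (schw f).
Proof.
move=> oU Sf; have S := csm_uz oU Sf.
apply: (csm_ext oU (F := fun p => - 2^-1%:C * dz (dz (fun p => (f p)%:C)) p + 4^-1%:C * dz (fun p => (f p)%:C) p ^+ 2)).
  by move=> p Up; rewrite schwE.
exact: (csmD oU (csmM oU (csm_cst _ oU) (csm_dz oU S)) (csmM oU (csm_cst _ oU) (csmX oU 2 S))).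
Qed.

(** the equation makes the Schwarzian holomorphic *)
Lemma hol_schw U f : open U -> smooth_on U f -> (forall p, U p -> lap f p = - expR (f p)) ->
  hol U (schw f).
Proof.
move=> oU Sf E; split=> [|p Up]; first exact: csm_schw.
have S := csm_uz oU Sf.
have E1 q : U q -> dbar (dz (fun p => (f p)%:C)) q = (- (4^-1 * expR (f q)))%:C.
  by move=> Uq; rewrite (dbar_uz oU Sf Uq) E // mulrN.
rewrite (dbar_near oU (G := fun p => - 2^-1%:C * dz (dz (fun p => (f p)%:C)) p + 4^-1%:C * (dz (fun p => (f p)%:C) p * dz (fun p => (f p)%:C) p)) _ Up); last first.
  by move=> q Uq; rewrite schwE expr2.
rewrite (dbarD oU Up (csmM oU (csm_cst _ oU) (csm_dz oU S)) (csmM oU (csm_cst _ oU) (csmM oU S S))).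
rewrite (dbarZ oU _ Up (csm_dz oU S)) (dbarZ oU _ Up (csmM oU S S)) (dbarM oU Up S S).
rewrite (dbar_dzC oU S Up) (dz_near oU E1 Up) E1 //.
have Se := smoothN oU (smoothZ 4^-1 oU (smooth_expR oU Sf)).
have -> : dz (fun q => (- (4^-1 * expR (f q)))%:C) p = (- (4^-1 * expR (f p)))%:C * dz (fun q => (f q)%:C) p.
  rewrite !dz_real.
  have -> : dx (fun q => - (4^-1 * expR (f q))) p = - (4^-1 * expR (f p)) * dx f p.
    apply: etrans (dxN (smoothZ 4^-1 oU (smooth_expR oU Sf)) Up) _; rewrite mulNr; congr (- _).
    apply: etrans (dxZ (smooth_expR oU Sf) Up _) _; rewrite -mulrA; congr (_ * _).
    exact: (dx_comp Sf Up (is_derive_expR (f p))).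
  have -> : dy (fun q => - (4^-1 * expR (f q))) p = - (4^-1 * expR (f p)) * dy f p.
    apply: etrans (dyN (smoothZ 4^-1 oU (smooth_expR oU Sf)) Up) _; rewrite mulNr; congr (- _).
    apply: etrans (dyZ (smooth_expR oU Sf) Up _) _; rewrite -mulrA; congr (_ * _).
    exact: (dy_comp Sf Up (is_derive_expR (f p))).
  by move: (expR (f p)) (dx f p) (dy f p) => x y z; apply: complex_ext => /=; ring.
move: (dz (fun q => (f q)%:C) p) (expR (f p)) => [x y] e.
by apply: complex_ext => /=; field.
Qed.

Lemma biperiodic_schw beta f : biperiodic beta f -> biperiodic beta (schw f).
Proof.
move=> pf; have pu : biperiodic beta (dz (fun p => (f p)%:C)).
  by apply: periodic_dz; exact: periodic_comp.
have -> : schw f = (fun p => - 2^-1%:C * dz (dz (fun p => (f p)%:C)) p + 4^-1%:C * dz (fun p => (f p)%:C) p ^+ 2).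
  by apply/funext => p; rewrite schwE.
by apply: (@periodic_comp2 R beta C C C (fun x y => - 2^-1%:C * x + 4^-1%:C * y ^+ 2) _ _ (periodic_dz pu) pu).
Qed.

(** the function w = exp (- f / 2) *)
Definition halfexp f p : R := expR (- 2^-1 * f p).

Section halfexp.
Variables (U : set (R * R)) (f : R * R -> R).
Hypotheses (oU : open U) (Sf : smooth_on U f).
Local Notation w := (halfexp f).

Lemma smooth_halfexp : smooth_on U w.
Proof. exact: (smooth_expR oU (smoothZ _ oU Sf)). Qed.

Lemma halfexp_gt0 p : 0 < w p. Proof. exact: expR_gt0. Qed.

Lemma dx_halfexp p : U p -> dx w p = (- 2^-1 * dx f p) * w p.
Proof.
move=> Up; apply: etrans (dx_comp (smoothZ (- 2^-1) oU Sf) Up (is_derive_expR _)) _.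
by rewrite mulrC; congr (_ * _); exact: (dxZ Sf Up).
Qed.

Lemma dy_halfexp p : U p -> dy w p = (- 2^-1 * dy f p) * w p.
Proof.
move=> Up; apply: etrans (dy_comp (smoothZ (- 2^-1) oU Sf) Up (is_derive_expR _)) _.
by rewrite mulrC; congr (_ * _); exact: (dyZ Sf Up).
Qed.

Lemma dxdx_halfexp p : U p -> dx (dx w) p = (- 2^-1 * dx (dx f) p + 4^-1 * dx f p ^+ 2) * w p.
Proof.
move=> Up; have Sx := smooth_dx Sf.
have Sk : smooth_on U (fun p => - 2^-1 * dx f p) := smoothZ (- 2^-1) oU Sx.
have E1 := dxM Sk smooth_halfexp Up; have E2 := dxZ Sx Up (- 2^-1).
rewrite (dx_near oU Up dx_halfexp) E1 E2 (dx_halfexp Up).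
by move: (dx (dx f) p) (dx f p) (w p) => x y z; field.
Qed.

Lemma dydy_halfexp p : U p -> dy (dy w) p = (- 2^-1 * dy (dy f) p + 4^-1 * dy f p ^+ 2) * w p.
Proof.
move=> Up; have Sx := smooth_dy Sf.
have Sk : smooth_on U (fun p => - 2^-1 * dy f p) := smoothZ (- 2^-1) oU Sx.
have E1 := dyM Sk smooth_halfexp Up; have E2 := dyZ Sx Up (- 2^-1).
rewrite (dy_near oU Up dy_halfexp) E1 E2 (dy_halfexp Up).
by move: (dy (dy f) p) (dy f p) (w p) => x y z; field.
Qed.

Lemma dydx_halfexp p : U p -> dy (dx w) p = (- 2^-1 * dy (dx f) p + 4^-1 * (dx f p * dy f p)) * w p.
Proof.
move=> Up; have Sx := smooth_dx Sf.
have Sk : smooth_on U (fun p => - 2^-1 * dx f p) := smoothZ (- 2^-1) oU Sx.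
have E1 := dyM Sk smooth_halfexp Up; have E2 := dyZ Sx Up (- 2^-1).
rewrite (dy_near oU Up dx_halfexp) E1 E2 (dy_halfexp Up).
by move: (dy (dx f) p) (dx f p) (dy f p) (w p) => x y t z; field.
Qed.

Lemma schw_halfexp_re p : U p -> dx (dx w) p - dy (dy w) p = 4 * re (schw f p) * w p.
Proof.
move=> Up; rewrite dxdx_halfexp // dydy_halfexp // (re_schw oU Sf Up).
by move: (dx (dx f) p) (dy (dy f) p) (dx f p) (dy f p) (w p) => x y t s z; field.
Qed.

Lemma schw_halfexp_im p : U p -> dy (dx w) p = - 2 * im (schw f p) * w p.
Proof.
move=> Up; rewrite dydx_halfexp // (im_schw oU Sf Up).
by move: (dy (dx f) p) (dx f p) (dy f p) (w p) => x t s z; field.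
Qed.

Lemma lap_halfexp p : U p -> lap f p = - expR (f p) ->
  w p * (dx (dx w) p + dy (dy w) p) = dx w p ^+ 2 + dy w p ^+ 2 + 2^-1.
Proof.
move=> Up; rewrite /lap dxdx_halfexp // dydy_halfexp // dx_halfexp // dy_halfexp // => E.
have E2 : expR (f p) * w p ^+ 2 = 1.
  rewrite /halfexp expr2 -!expRD -[X in _ = X]expR0; congr expR; by field.
have {}E : dy (dy f) p = - expR (f p) - dx (dx f) p by rewrite -E addrAC subrr add0r.
rewrite E; move: E2; move: (dx (dx f) p) (dx f p) (dy f p) (w p) (expR (f p)) => x t s z e E2.
apply/eqP; rewrite -subr_eq0; apply/eqP; transitivity (2^-1 * (e * z ^+ 2 - 1)); first by field.
by rewrite E2 subrr mulr0.
Qed.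
End halfexp.
Lemma cr_of_dbar (x y z t : R) : 2^-1%:C * ((x +i* y) + 'i * (z +i* t)) = 0 :> C ->
  x = t /\ y = - z.
Proof.
move=> E; have := congr1 re E; have := congr1 im E => /=.
by move=> e1 e2; split; move: e1 e2; lra.
Qed.

Section Reflection.
Variables (beta sg : R).
Hypotheses (beta0 : 0 < beta) (sg2 : sg * sg = 1).
Definition mirror p : R * R := (sg * p.1, - sg * p.2).
Let sg_int : (sg = 1) \/ (sg = -1).
Proof.
have : (sg - 1) * (sg + 1) = 0 by rewrite mulrDr mulrBl mulrBl sg2; ring.
by move/eqP; rewrite mulf_eq0 subr_eq0 addr_eq0 => /orP[] /eqP ->; [left|right].
Qed.

Lemma mirror_Omega p : Omega beta p -> Omega beta (mirror p).
Proof.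
rewrite /Omega /mirror /= => h; apply: contra h.
by case: sg_int => ->; rewrite ?opprK ?mul1r ?mulN1r ?mulNr ?rpredN.
Qed.

Lemma is_derive_reflect_x f p d : is_derive (mirror p) e_x f d ->
  is_derive p e_x (f \o mirror) (sg * d).
Proof.
move=> /is_derive_line D; apply/is_derive_line.
have D2 : is_derive (0 : R) 1 (fun h : R => h * sg) sg.
  have := is_deriveM (@is_derive_id R R 0 1) (@is_derive_cst R R R sg 0 1).
  by rewrite -![_ *: _]/(_ * _) mulr0 add0r mulr1.
have D1 : is_derive (0 * sg) 1 (fun h : R => f (h *: e_x + mirror p)) d by rewrite mul0r.
have := @is_derive1_comp R _ (fun h : R => h * sg) 0 _ _ D1 D2.
rewrite mulrC; congr (is_derive _ _ _ _); apply/funext => h /=; congr f.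
by apply: injective_projections => /=; rewrite -![_ *: _]/(_ * _); ring.
Qed.

Lemma is_derive_reflect_y f p d : is_derive (mirror p) e_y f d ->
  is_derive p e_y (f \o mirror) (- sg * d).
Proof.
move=> /is_derive_line D; apply/is_derive_line.
have D2 : is_derive (0 : R) 1 (fun h : R => h * - sg) (- sg).
  have := is_deriveM (@is_derive_id R R 0 1) (@is_derive_cst R R R (- sg) 0 1).
  by rewrite -![_ *: _]/(_ * _) mulr0 add0r mulr1.
have D1 : is_derive (0 * - sg) 1 (fun h : R => f (h *: e_y + mirror p)) d by rewrite mul0r.
have := @is_derive1_comp R _ (fun h : R => h * - sg) 0 _ _ D1 D2.
rewrite mulrC; congr (is_derive _ _ _ _); apply/funext => h /=; congr f.
by apply: injective_projections => /=; rewrite -![_ *: _]/(_ * _); ring.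
Qed.

Lemma smooth_reflect f : smooth_on (Omega beta) f -> smooth_on (Omega beta) (f \o mirror).
Proof.
move=> Sf; apply: (@smooth_coind _ _ [set g | exists c h, smooth_on (Omega beta) h /\ g = (fun p => c * h (mirror p))]).
- exact: open_Omega beta0.
- move=> _ [c [h [Sh ->]]] p Op; apply: continuousM; first exact: cvg_cst.
  apply: (@continuous_comp _ _ _ mirror h); last exact: smooth_continuous Sh (mirror_Omega Op).
  have oT := @openT (R * R)%type.
  have S1 := smoothZ sg oT (smooth_fst oT); have S2 := smoothZ (- sg) oT (smooth_snd oT).
  exact: (cvg_pair (smooth_continuous S1 (I : setT p)) (smooth_continuous S2 (I : setT p))).
- move=> _ v [c [h [Sh ->]]] ev; exists (fun p => (c * (if v == e_x then sg else - sg)) * dv v h (mirror p)).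
    apply: span_in; exists (c * (if v == e_x then sg else - sg)), (dv v h); split => //; exact: smooth_dv.
  move=> p Op; have D := smooth_is_derive Sh (mirror_Omega Op) ev.
  have yx : (e_y == e_x :> R * R) = false.
    by apply/eqP => -[/eqP]; rewrite eq_sym oner_eq0.
  case: ev D => -> D; rewrite ?eqxx ?yx.
    by have := is_deriveZ c (is_derive_reflect_x D); rewrite -[_ *: _]/(_ * _) mulrA.
  by have := is_deriveZ c (is_derive_reflect_y D); rewrite -[_ *: _]/(_ * _) mulrA.
by exists 1, f; split => //; apply/funext => p; rewrite mul1r.
Qed.

Lemma dx_reflect f p : smooth_on (Omega beta) f -> Omega beta p ->
  dx (f \o mirror) p = sg * dx f (mirror p) /\ dy (f \o mirror) p = - sg * dy f (mirror p).
Proof.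
move=> Sf Op; have Or := mirror_Omega Op; split.
  by apply: dx_val; apply: is_derive_reflect_x; exact: smooth_is_dx Sf Or.
by apply: dy_val; apply: is_derive_reflect_y; exact: smooth_is_dy Sf Or.
Qed.

(** Schwarz reflection *)
Lemma hol_reflect (F : R * R -> C) : hol (Omega beta) F ->
  hol (Omega beta) (fun p => (F (mirror p))^*).
Proof.
move=> [[S1 S2] H]; have oO := open_Omega beta0.
have Sr : csm (Omega beta) (F \o mirror) by split; [exact: (smooth_reflect S1)|exact: (smooth_reflect S2)].
split=> [|p Op]; first exact: (csm_conj oO Sr).
have [r1 r2] := dx_reflect S1 Op; have [i1 i2] := dx_reflect S2 Op.
have E := H _ (mirror_Omega Op).
have [E1 E2] : dx (re \o F) (mirror p) = dy (im \o F) (mirror p) /\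
   dx (im \o F) (mirror p) = - dy (re \o F) (mirror p).
  exact: (cr_of_dbar E).
have Sm := smooth_reflect S2.
have Ei : im \o (fun p => (F (mirror p))^*) = (fun p => - ((im \o F) \o mirror) p).
  by apply/funext => q /=; case: (F (mirror q)).
have Er : re \o (fun p => (F (mirror p))^*) = (re \o F) \o mirror.
  by apply/funext => q /=; case: (F (mirror q)).
have n1 : dx (im \o (fun p => (F (mirror p))^*)) p = - (sg * dx (im \o F) (mirror p)).
  by rewrite Ei -i1; exact: (dxN Sm Op).
have n2 : dy (im \o (fun p => (F (mirror p))^*)) p = - (- sg * dy (im \o F) (mirror p)).
  by rewrite Ei -i2; exact: (dyN Sm Op).
have n3 : dx (re \o (fun p => (F (mirror p))^*)) p = sg * dx (re \o F) (mirror p) by rewrite Er.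
have n4 : dy (re \o (fun p => (F (mirror p))^*)) p = - sg * dy (re \o F) (mirror p) by rewrite Er.
rewrite /dbar /cdx /cdy n1 n2 n3 n4 E1 E2.
by move: (dy (re \o F) (mirror p)) (dy (im \o F) (mirror p)) => x y; apply: complex_ext => /=; ring.
Qed.

Lemma biperiodic_reflect (T : Type) (F : R * R -> T) : biperiodic beta F ->
  biperiodic beta (fun p => F (mirror p)).
Proof.
move=> pF; have [k Ek] : exists k : int, sg = k%:~R.
  by case: sg_int => ->; [exists 1|exists (-1)]; rewrite ?mulrN1z.
split=> p.
  rewrite -[RHS](periodic_int pF k 0); congr F.
  by apply/pair_equal_spec; split; rewrite /= ?mul0r ?addr0 -?Ek ?mulrDr ?mulr1.
rewrite -[RHS](periodic_int pF 0 (- k)); congr F.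
by apply/pair_equal_spec; split; rewrite /= ?addr0 ?intrN -?Ek ?mulrDr.
Qed.

End Reflection.

End Schwarzian.

(*@@@ 19*)
Local Open Scope complex_scope.
Opaque dx dy.

Section LogPart.
Context {R : realType}.
Local Notation C := R[i].
Local Notation re := (@complex.Re R).
Local Notation im := (@complex.Im R).
Implicit Types (p : R * R).
Variables (r : R).
Let oP := @open_pb R r.

Definition sqm p : R := p.1 ^+ 2 + p.2 ^+ 2.
Definition lg p : R := ln (sqm p).

Lemma sqm_gt0 p : pb r p -> 0 < sqm p.
Proof.
move=> /andP[h _]; move: h; rewrite snorm_gt0 => h.
rewrite lt0r addr_ge0 ?sqr_ge0 // andbT paddr_eq0 ?sqr_ge0 // !sqrf_eq0.
by apply: contra h => /andP[/eqP h1 /eqP h2]; rewrite [p]surjective_pairing h1 h2.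
Qed.

Let Ssq : smooth_on (pb r) sqm.
Proof. exact: (smoothD oP (smoothX 2 oP (smooth_fst oP)) (smoothX 2 oP (smooth_snd oP))). Qed.

Lemma smooth_lg : smooth_on (pb r) lg.
Proof. exact: (smooth_ln oP Ssq sqm_gt0). Qed.

Lemma dsqm p : pb r p -> dx sqm p = 2 * p.1 /\ dy sqm p = 2 * p.2.
Proof.
move=> hp; have S1 := smooth_fst oP; have S2 := smooth_snd oP.
have -> : sqm = (fun p => p.1 * p.1 + p.2 * p.2) by apply/funext => q; rewrite /sqm !expr2.
rewrite (dxD (smoothM oP S1 S1) (smoothM oP S2 S2) hp) (dyD (smoothM oP S1 S1) (smoothM oP S2 S2) hp).
rewrite (dxM S1 S1 hp) (dyM S1 S1 hp) (dxM S2 S2 hp) (dyM S2 S2 hp).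
by rewrite dx_fst dy_fst dx_snd dy_snd; split; ring.
Qed.

Lemma dlg p : pb r p -> dx lg p = 2 * p.1 * (sqm p)^-1 /\ dy lg p = 2 * p.2 * (sqm p)^-1.
Proof.
move=> hp; have D := is_derive1_ln (sqm_gt0 hp); have [E1 E2] := dsqm hp.
by split; [apply: etrans (dx_comp Ssq hp D) _; rewrite E1 mulrC|apply: etrans (dy_comp Ssq hp D) _; rewrite E2 mulrC].
Qed.

Lemma lap_lg p : pb r p -> lap lg p = 0.
Proof.
move=> hp; have s0 := sqm_gt0 hp; have [E1 E2] := dsqm hp.
have SV : smooth_on (pb r) (fun p => (sqm p)^-1).
  by apply: (smooth_inv oP Ssq) => q /sqm_gt0 /lt0r_neq0.
have S1 := smoothZ 2 oP (smooth_fst oP); have S2 := smoothZ 2 oP (smooth_snd oP).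
rewrite /lap (dx_near oP hp (fun q hq => proj1 (dlg hq))) (dy_near oP hp (fun q hq => proj2 (dlg hq))).
rewrite (dxM S1 SV hp) (dyM S2 SV hp) (dxV Ssq hp (lt0r_neq0 s0)) (dyV Ssq hp (lt0r_neq0 s0)).
rewrite (dxZ (smooth_fst oP) hp) (dyZ (smooth_snd oP) hp) dx_fst dy_snd E1 E2.
move: s0; rewrite /sqm; move: p.1 p.2 => x y s0; field; exact: lt0r_neq0.
Qed.

Lemma dz_lg (k : R) p : pb r p -> dz (fun p => (k * lg p)%:C) p = k%:C / zc p.
Proof.
move=> hp; have [E1 E2] := dlg hp; rewrite dz_real.
have -> : dx (fun p => k * lg p) p = k * dx lg p by exact: (dxZ smooth_lg hp).
have -> : dy (fun p => k * lg p) p = k * dy lg p by exact: (dyZ smooth_lg hp).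
have s0 := lt0r_neq0 (sqm_gt0 hp).
rewrite E1 E2; apply: complex_ext; rewrite (reM, imM) reV imV /= -/(sqm p); move: s0; move: (sqm p) => s s0; by field.
Qed.

Lemma schw_log (U : R * R -> R) (k : R) p : smooth_on (pb r) U -> pb r p ->
  schw U p = ((k / 2 + k ^+ 2 / 4)%:C) / zc p ^+ 2 + eres (fun p => U p - k * lg p) (k / 2)%:C p.
Proof.
move=> SU hp; pose v p := U p - k * lg p.
have Skl := smoothZ k oP smooth_lg.
have Sv : smooth_on (pb r) v := smoothB oP SU Skl.
have E q : pb r q -> dz (fun p => (U p)%:C) q = dz (fun p => (v p)%:C) q + k%:C / zc q.
  move=> hq; rewrite -(dz_lg k hq) -(dzD oP hq (csm_real oP Sv) (csm_real oP Skl)).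
  congr (dz _ q); apply/funext => q'; apply: complex_ext; rewrite /= ?addr0 //.
  by rewrite /v subrK.
have Hi := @hol_inv_zc R r.
have E2 : dz (dz (fun p => (U p)%:C)) p = dz (dz (fun p => (v p)%:C)) p + k%:C * (- (zc p) ^- 2).
  rewrite (dz_near oP E hp) (dzD oP hp (csm_uz oP Sv) (csmM oP (csm_cst _ oP) (proj1 Hi))).
  by rewrite (dzZ oP _ hp (proj1 Hi)) (dz_inv_zc hp).
rewrite schwE E2 (E p hp) /eres -/v.
have z0 : zc p != 0 by apply: zc_neq0; case/andP: hp.
have -> : (k / 2 + k ^+ 2 / 4)%:C = k%:C / 2 + k%:C ^+ 2 / 4.
  by apply: complex_ext; rewrite expr2 !(reD, reM, imD, imM, reV, imV) /=; field.
have -> : (k / 2)%:C = k%:C / 2 by apply: complex_ext; rewrite !(reM, imM, reV, imV) /=; field.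
have -> : 2^-1%:C = 2^-1 :> C by apply: complex_ext; rewrite !(reV, imV) /=; field.
have -> : 4^-1%:C = 4^-1 :> C by apply: complex_ext; rewrite !(reV, imV) /=; field.
move: (dz (dz _) p) (dz (fun p => (v p)%:C) p) (zc p) (k%:C) z0 => x y z kk z0.
by field.
Qed.
End LogPart.

Section OdeUnique.
Context {R : realType}.

Lemma gronwall0 (E E1 : R -> R) (K t0 t1 : R) : t0 < t1 ->
  (forall t : R, t0 <= t <= t1 -> is_derive t 1 E (E1 t)) ->
  (forall t, t0 <= t <= t1 -> E1 t <= K * E t) -> E t0 = 0 -> E t1 <= 0.
Proof.
move=> t01 DE bnd E0.
pose F t := E t * expR (- K * t).
have DF (t : R) : t0 <= t <= t1 -> is_derive t 1 F ((E1 t - K * E t) * expR (- K * t)).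
  move=> ht; have D1 : is_derive t 1 (fun t => - K * t) (- K).
    by have := is_deriveZ (- K) (@is_derive_id R R t 1); rewrite -[_ *: _]/(_ * _) mulr1.
  have D2 : is_derive t 1 (fun t => expR (- K * t)) (expR (- K * t) * - K) :=
    is_derive1_comp (is_derive_expR (- K * t)) D1.
  have := is_deriveM (DE t ht) D2; rewrite -![_ *: _]/(_ * _).
  by congr (is_derive _ _ _ _); ring.
have [s hs] := MVT_closed t01 DF.
rewrite /F E0 mul0r subr0 => H.
have : E t1 * expR (- K * t1) <= 0.
  have h1 : E1 s - K * E s <= 0 by rewrite subr_le0; exact: bnd.
  have h2 : 0 <= t1 - t0 by rewrite subr_ge0 ltW.
  by rewrite H; exact: (mulr_le0_ge0 (mulr_le0_ge0 h1 (expR_ge0 _)) h2).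
by rewrite pmulr_lle0 // expR_gt0.
Qed.

Lemma ode_unique (x y u v al be : R -> R) (B t0 t1 : R) : t0 < t1 -> 0 <= B ->
  (forall t : R, t0 <= t <= t1 -> is_derive t 1 x (u t)) ->
  (forall t : R, t0 <= t <= t1 -> is_derive t 1 y (v t)) ->
  (forall t : R, t0 <= t <= t1 -> is_derive t 1 u (al t * x t - be t * y t)) ->
  (forall t : R, t0 <= t <= t1 -> is_derive t 1 v (al t * y t + be t * x t)) ->
  (forall t, t0 <= t <= t1 -> `|al t| <= B /\ `|be t| <= B) ->
  x t0 = 0 -> y t0 = 0 -> u t0 = 0 -> v t0 = 0 ->
  [/\ x t1 = 0, y t1 = 0, u t1 = 0 & v t1 = 0].
Proof.
move=> t01 B0 Dx Dy Du Dv bnd x0 y0 u0 v0.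
pose E t := x t * x t + y t * y t + (u t * u t + v t * v t).
pose E1 t := 2 * (x t * u t + y t * v t + (u t * (al t * x t - be t * y t) + v t * (al t * y t + be t * x t))).
have DE (t : R) : t0 <= t <= t1 -> is_derive t 1 E (E1 t).
  move=> ht; have D := is_deriveD (is_deriveD (is_deriveM (Dx t ht) (Dx t ht)) (is_deriveM (Dy t ht) (Dy t ht)))
    (is_deriveD (is_deriveM (Du t ht) (Du t ht)) (is_deriveM (Dv t ht) (Dv t ht))).
  move: D; rewrite -![_ *: _]/(_ * _); congr (is_derive _ _ _ _); rewrite /E1; ring.
have E0 : E t0 = 0 by rewrite /E x0 y0 u0 v0 !mul0r !addr0.
have am (k p q : R) : `|k| <= B -> 2 * (k * (p * q)) <= B * (p * p + q * q).
  move=> hk; have h1 : 2 * `|p * q| <= p * p + q * q.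
    rewrite normrM -!expr2 -(real_normK (num_real p)) -(real_normK (num_real q)).
    have := sqr_ge0 (`|p| - `|q|); rewrite sqrrB; move: (`|p|) (`|q|) => P Q; nra.
  apply: (le_trans (y := 2 * (B * `|p * q|))).
    rewrite ler_pM2l //; apply: (le_trans (ler_norm _)); rewrite normrM.
    by apply: ler_wpM2r.
  by rewrite mulrCA; apply: ler_wpM2l.
have bE t : t0 <= t <= t1 -> E1 t <= (1 + 2 * B) * E t.
  move=> ht; have [ha hb] := bnd t ht.
  have k1 := am (al t) (u t) (x t) ha; have nb : `|- be t| <= B by rewrite normrN.
  have k2 := am (- be t) (u t) (y t) nb.
  have k3 := am (al t) (v t) (y t) ha; have k4 := am (be t) (v t) (x t) hb.
  have s1 := sqr_ge0 (x t - u t); have s2 := sqr_ge0 (y t - v t).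
  rewrite /E1 /E; move: k1 k2 k3 k4 s1 s2.
  move: (x t) (y t) (u t) (v t) (al t) (be t) => x' y' u' v' a' b' k1 k2 k3 k4 s1 s2.
  have -> : 2 * (x' * u' + y' * v' + (u' * (a' * x' - b' * y') + v' * (a' * y' + b' * x'))) =
    (x' * x' + u' * u' - (x' - u') ^+ 2) + (y' * y' + v' * v' - (y' - v') ^+ 2) +
    (2 * (a' * (u' * x')) + 2 * (- b' * (u' * y')) + 2 * (a' * (v' * y')) + 2 * (b' * (v' * x'))) by ring.
  have -> : (1 + 2 * B) * (x' * x' + y' * y' + (u' * u' + v' * v')) =
    (x' * x' + u' * u') + (y' * y' + v' * v') + (B * (u' * u' + x' * x') + B * (u' * u' + y' * y') +
     B * (v' * v' + y' * y') + B * (v' * v' + x' * x')) by ring.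
  apply: lerD; last by apply: lerD => //; apply: lerD => //; apply: lerD.
  by apply: lerD; rewrite lerBlDr lerDl.
have H := gronwall0 t01 DE bE E0.
move: H; rewrite /E -!expr2.
have sx := sqr_ge0 (x t1); have sy := sqr_ge0 (y t1); have su := sqr_ge0 (u t1); have sv := sqr_ge0 (v t1) => H.
have z k : 0 <= k ^+ 2 -> k ^+ 2 <= 0 -> k = 0 :> R.
  by move=> h1 h2; apply/eqP; rewrite -sqrf_eq0 eq_le h1 h2.
split; apply: z => //; move: sx sy su sv H.
- by move: (x t1 ^+ 2) (y t1 ^+ 2) (u t1 ^+ 2) (v t1 ^+ 2) => a1 a2 a3 a4; lra.
- by move: (x t1 ^+ 2) (y t1 ^+ 2) (u t1 ^+ 2) (v t1 ^+ 2) => a1 a2 a3 a4; lra.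
- by move: (x t1 ^+ 2) (y t1 ^+ 2) (u t1 ^+ 2) (v t1 ^+ 2) => a1 a2 a3 a4; lra.
by move: (x t1 ^+ 2) (y t1 ^+ 2) (u t1 ^+ 2) (v t1 ^+ 2) => a1 a2 a3 a4; lra.
Qed.
End OdeUnique.

(*@@@ 21*)
Local Open Scope complex_scope.
Opaque dx dy cubic cubic1 lame.

Section NoSolution.
Context {R : realType}.
Local Notation C := R[i].
Local Notation re := (@complex.Re R).
Local Notation im := (@complex.Im R).
Implicit Types (p : R * R).
Variables (beta : R) (n : nat) (U : R * R -> R) (V r : R).
Hypotheses (beta0 : 0 < beta) (n1 : (0 < n)%N) (r0 : 0 < r) (ra : r <= 2^-1) (rb : r <= beta / 2).
Local Notation Om := (Omega beta).
Local Notation a := (2^-1 : R).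
Local Notation b := (beta / 2).
Hypotheses (SU : smooth_on Om U) (pU : biperiodic beta U) (EU : forall p, Om p -> lap U p = - expR (U p))
  (UV : forall p, pb r p -> `|U p - 2 * n%:R * lg p| <= V).
Let oO := open_Omega beta0.
Let a0 : 0 < a := ahalf_gt0.
Let b0 : 0 < b := halfb_gt0 beta0.
Let N : R := (n * n.+1)%:R.
Let q := schw U.
Let w := halfexp U.

Let N0 : N != 0. Proof. by rewrite pnatr_eq0 muln_eq0 negb_or -lt0n n1. Qed.
Let NC0 : N%:C != 0. Proof. by apply: contra N0 => /eqP E; apply/eqP; exact: (congr1 re E). Qed.

Let Hq : hol Om q. Proof. exact: hol_schw. Qed.
Let pq : biperiodic beta q. Proof. exact: biperiodic_schw. Qed.
Let Hq1 : hol Om (dz q) := hol_dz oO Hq.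
Let Sw : smooth_on Om w := smooth_halfexp oO SU.

Lemma potential_pole : exists2 dl, 0 < dl & exists M, forall p, 0 < snorm p <= dl ->
  nc (q p - N%:C / zc p ^+ 2) <= M.
Proof.
have oP := @open_pb R r; have pO := pb_Omega beta0 ra rb.
have SUr : smooth_on (pb r) U := smooth_on_sub pO SU.
pose k : R := 2 * n%:R; pose v p := U p - k * lg p.
have Skl := smoothZ k oP (@smooth_lg R r).
have Sv : smooth_on (pb r) v := smoothB oP SUr Skl.
have lgle p : pb r p -> lg p <= 0.
  move=> hp; apply: ln_le0; rewrite /sqm.
  have : snorm p <= a by case/andP: hp => _ h; exact: (le_trans (ltW h) ra).
  rewrite snorm_le => /andP[h1 h2].
  have e1 : p.1 ^+ 2 <= a ^+ 2 by rewrite -real_normK ?num_real // lerXn2r ?nnegrE ?normr_ge0 // ltW.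
  have e2 : p.2 ^+ 2 <= a ^+ 2 by rewrite -real_normK ?num_real // lerXn2r ?nnegrE ?normr_ge0 // ltW.
  apply: (le_trans (lerD e1 e2)); lra.
have vK p : pb r p -> `|lap v p| <= expR V.
  move=> hp; have -> : lap v p = - expR (U p).
    have E1 q' : pb r q' -> dx v q' = dx U q' - k * dx lg q'.
      by move=> hq; apply: etrans (dxB SUr Skl hq) _; congr (_ - _); exact: (dxZ (@smooth_lg R r) hq).
    have E2 q' : pb r q' -> dy v q' = dy U q' - k * dy lg q'.
      by move=> hq; apply: etrans (dyB SUr Skl hq) _; congr (_ - _); exact: (dyZ (@smooth_lg R r) hq).
    have Sx := smooth_dx (@smooth_lg R r); have Sy := smooth_dy (@smooth_lg R r).
    have F1 : dx (dx v) p = dx (dx U) p - k * dx (dx lg) p.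
      apply: etrans (dx_near oP hp E1) _; apply: etrans (dxB (smooth_dx SUr) (smoothZ k oP Sx) hp) _.
      by congr (_ - _); exact: (dxZ Sx hp).
    have F2 : dy (dy v) p = dy (dy U) p - k * dy (dy lg) p.
      apply: etrans (dy_near oP hp E2) _; apply: etrans (dyB (smooth_dy SUr) (smoothZ k oP Sy) hp) _.
      by congr (_ - _); exact: (dyZ Sy hp).
    have := lap_lg hp; have := EU (pO _ hp); rewrite /lap F1 F2 => <-.
    move: (dx (dx lg) p) (dy (dy lg) p) (dx (dx U) p) (dy (dy U) p) => x y z t h.
    by have -> : y = - x by [move/eqP: h; rewrite addrC addr_eq0 => /eqP]; ring.
  rewrite normrN ger0_norm ?expR_ge0 // ler_expR.
  have := UV hp; rewrite -/k ler_norml => /andP[_ h].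
  have : k * lg p <= 0 by rewrite mulr_ge0_le0 ?lgle // mulr_ge0.
  by move: h; move: (U p) (k * lg p) => x y; lra.
have Nk : N%:C = (k / 2 + k ^+ 2 / 4)%:C.
  congr (_%:C); rewrite /N /k natrM -[n.+1]addn1 natrD; move: (n%:R : R) => m; by field.
apply: (@double_pole R a b r a0 b0 r0 ra rb q v V (expR V) N%:C (k / 2)%:C (hol_sub pO Hq) Sv) => //.
  by move=> p hp; rewrite Nk; exact: schw_log.
by move=> e e0 er; exact: (res_elliptic beta0 ra rb Hq pq e0 er).
Qed.

(* the derivatives of q along the two directions *)
Lemma derivs_of_hol (F : R * R -> C) p : hol Om F -> Om p ->
  [/\ dx (re \o F) p = re (dz F p), dx (im \o F) p = im (dz F p),
      dy (re \o F) p = - im (dz F p) & dy (im \o F) p = re (dz F p)].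
Proof.
move=> HF Op; have [E1 E2] := hol_cdx HF Op; rewrite E1.
move: (congr1 re E2) (congr1 im E2); rewrite /cdy /cdx /= => -> ->.
by split=> //; rewrite ?mul0r ?mul1r ?sub0r ?add0r.
Qed.

Lemma reflect_const (sg : R) : sg * sg = 1 ->
  exists k : C, forall p, Om p -> q p - conjc (q (mirror sg p)) = k.
Proof.
move=> sg2; have [dl dl0 [M HM]] := potential_pole.
have Hr := hol_reflect beta0 sg2 Hq.
have HG := holB oO Hq Hr.
have pG : biperiodic beta (fun p => q p - conjc (q (mirror sg p))).
  apply: (@periodic_comp2 R beta C C C (fun x y => x - conjc y) _ _ pq).
  exact: (biperiodic_reflect sg2 pq).
pose d := Num.min dl r.
have d0 : 0 < d by rewrite lt_min dl0.
have ddl : d <= dl by rewrite ge_min lexx.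
have dr : d <= r by rewrite ge_min lexx orbT.
exists ((q (a, b) - conjc (q (mirror sg (a, b))))) => p Op.
have sgn : `|sg| = 1.
  have : `|sg| * `|sg| = 1 by rewrite -normrM sg2 normr1.
  by move=> h; apply/eqP; rewrite -(eqrXn2 (n := 2)) // expr1n expr2 h.
apply: (@liouville R beta d beta0 d0 (le_trans dr ra) (le_trans dr rb) _ (M + M) HG pG) => // p' /andP[h1 h2].
have hp : 0 < snorm p' <= dl by rewrite h1 (le_trans (ltW h2)).
have sr : snorm (mirror sg p') = snorm p' by rewrite /snorm /= !normrM normrN sgn !mul1r.
have hr : 0 < snorm (mirror sg p') <= dl by rewrite sr.
have Er : N%:C / zc p' ^+ 2 = conjc (N%:C / zc (mirror sg p') ^+ 2).
  have -> : zc (mirror sg p') = sg%:C * conjc (zc p').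
    by apply: complex_ext; rewrite /zc /mirror /=; ring.
  have z0 : zc p' != 0 := zc_neq0 h1.
  have s1 : sg%:C * sg%:C = 1 :> C by apply: complex_ext; rewrite /= ?mulr0 ?mul0r ?subr0 ?addr0 ?sg2.
  rewrite exprMn (expr2 sg%:C) s1 mul1r.
  have cX (x y : C) : conjc (x / conjc y ^+ 2) = conjc x / y ^+ 2.
    by rewrite rmorphM fmorphV rmorphXn /= conjcK.
  by rewrite cX conjc_real.
have -> : q p' - conjc (q (mirror sg p')) = (q p' - N%:C / zc p' ^+ 2) -
    conjc (q (mirror sg p') - N%:C / zc (mirror sg p') ^+ 2).
  have cB (x y : C) : conjc (x - y) = conjc x - conjc y by rewrite rmorphB.
  by rewrite cB -Er; move: (conjc _) (_ / _) (q p') => x y z; ring.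
apply: (le_trans (ncB _ _)); apply: lerD; first exact: HM.
have ncC (x : C) : nc (conjc x) = nc x by rewrite !ncE; case: x => x y /=; rewrite sqrrN.
by rewrite ncC; exact: HM.
Qed.

Let beta_half : beta = b + b. Proof. by field. Qed.

(** q is real on the line y = b *)
Lemma real_top x : im (q (x, b)) = 0.
Proof.
have [k Hk] := reflect_const (mulr1 1).
have line t : im (q (t, b)) = im k / 2.
  have := Hk _ (Omega_top beta0 t).
  have -> : q (mirror 1 (t, b)) = q (t, b).
    rewrite -[RHS](periodic_int pq 0 (-1)); congr q.
    apply/pair_equal_spec; split; rewrite /= ?mul1r ?addr0 // mulrN1z.
    by rewrite mulN1r; move: beta_half => h; lra.
  move/(congr1 im); case: (q (t, b)) => u v /= <-; lra.
have Sy := smooth_dy Sw.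
have [s _ E] := @MVT_closed R (fun t => dy w (t, b)) (fun t => dx (dy w) (t, b)) 0 1 ltr01
  (fun s _ => is_derive_slice_x Sy (Omega_top beta0 s)).
have per : dy w (1, b) = dy w (0, b).
  have [h _] := periodic_dy (periodic_comp (fun x => expR (- 2^-1 * x)) pU).
  rewrite -(h (0, b)); congr (dy w _); by apply/pair_equal_spec; split=> /=; rewrite ?add0r ?addr0.
move: E; rewrite per subrr subr0 mulr1 (dxdyC oO Sw (Omega_top beta0 s)).
rewrite (schw_halfexp_im oO SU (Omega_top beta0 s)) => /esym/eqP.
rewrite mulf_eq0 (gt_eqF (halfexp_gt0 U _)) orbF mulf_eq0 oppr_eq0 pnatr_eq0 /= => /eqP E0.
exact: (etrans (line _) (etrans (esym (line s)) E0)).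
Qed.

Lemma real_right y : im (q (a, y)) = 0.
Proof.
have m1 : (-1) * (-1) = 1 :> R by rewrite mulrNN mulr1.
have [k Hk] := reflect_const m1.
have line t : im (q (a, t)) = im k / 2.
  have := Hk _ (Omega_right beta t).
  have -> : q (mirror (-1) (a, t)) = q (a, t).
    rewrite -[RHS](periodic_int pq (-1) 0); congr q.
    apply/pair_equal_spec; split; rewrite /= ?opprK ?mul1r ?mul0r ?addr0 // mulrN1z.
    by lra.
  move/(congr1 im); case: (q (a, t)) => u v /= <-; lra.
have Sx := smooth_dx Sw.
have [s _ E] := @MVT_closed R (fun t => dx w (a, t)) (fun t => dy (dx w) (a, t)) 0 beta beta0
  (fun s _ => is_derive_slice_y Sx (Omega_right beta s)).
have per : dx w (a, beta) = dx w (a, 0).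
  have [_ h] := periodic_dx (periodic_comp (fun x => expR (- 2^-1 * x)) pU).
  rewrite -(h (a, 0)); congr (dx w _); by apply/pair_equal_spec; split=> /=; rewrite ?add0r ?addr0.
move: E; rewrite per subrr subr0 => /esym/eqP; rewrite mulf_eq0 (gt_eqF beta0) orbF.
rewrite (schw_halfexp_im oO SU (Omega_right beta s)).
rewrite mulf_eq0 (gt_eqF (halfexp_gt0 U _)) orbF mulf_eq0 oppr_eq0 pnatr_eq0 /= => /eqP E0.
exact: (etrans (line _) (etrans (esym (line s)) E0)).
Qed.

Section lines.
Variables (s c d : C).
Hypotheses (ode : forall p, Om p -> dz (dz q) p = 6 / N%:C * q p ^+ 2 + s * q p + c)
  (ode1 : forall p, Om p -> dz q p ^+ 2 = 4 / N%:C * q p ^+ 3 + s * q p ^+ 2 + 2 * c * q p + d).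
Local Notation cub := (cubic N (re s) (re c) (re d)).
Local Notation cub1 := (cubic1 N (re s) (re c)).
Variables (F G : {poly R}).
Hypotheses (F0 : F != 0) (LF : lame N (re s) (re c) (re d) F = 0)
  (LG : lame N (re s) (re c) (re d) G = 8 * F^`()).
Let om := (pairing N (re s) (re c) (re d) F)`_0.

Lemma realC_div (x m : R) : m != 0 -> x%:C / m%:C = (x / m)%:C.
Proof. by move=> m0; apply: complex_ext; rewrite !(reM, imM, reV, imV) /=; field. Qed.

Lemma realC (z : C) : im z = 0 -> z = (re z)%:C.
Proof. by case: z => u v /= ->. Qed.

Lemma ode_real p : Om p -> im (q p) = 0 ->
  re (dz (dz q) p) = 2^-1 * cub1.[re (q p)] /\ re (dz q p ^+ 2) = cub.[re (q p)].
Proof.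
move=> Op /realC E; rewrite ode // ode1 // E; move: (re (q p)) => x; rewrite reR.
Transparent cubic cubic1.
rewrite /cubic /cubic1 !(hornerD, hornerZ, hornerXn, hornerX, hornerC).
have k0 (k : nat) : k%:R = (k%:R : R)%:C by rewrite rmorph_nat.
have kN (y : R) : y%:C / N%:C = (y / N)%:C := realC_div y N0.
rewrite !k0 !kN !(exprS, expr0) !(reD, reM, imD, imM) /=.
by move: (N^-1) => iN; split; field.
Qed.
Opaque cubic cubic1.

Let Hq2 : hol Om (dz (dz q)) := hol_dz oO Hq1.
Let Sq : smooth_on Om (re \o q) := proj1 (proj1 Hq).
Let Sqi : smooth_on Om (im \o q) := proj2 (proj1 Hq).
Let S1 : smooth_on Om (re \o dz q) := proj1 (proj1 Hq1).
Let S1i : smooth_on Om (im \o dz q) := proj2 (proj1 Hq1).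

Let pw : biperiodic beta w.
Proof. exact: (periodic_comp (fun x => expR (- 2^-1 * x)) pU). Qed.

Lemma zero_deriv (g : R -> R) (x k : R) : (forall x, g x = 0) -> is_derive x 1 g k -> k = 0.
Proof.
move=> g0 [_ E1]; have [_ E0] := @is_derive_cst R R R 0 x 1.
by rewrite -E1 -E0; congr ('D_1 _ x); apply/funext => t; rewrite g0.
Qed.

Lemma im_q1_top x : im (dz q (x, b)) = 0.
Proof.
have Op := Omega_top beta0 x; have [_ E _ _] := derivs_of_hol Hq Op.
rewrite -E; apply: (@zero_deriv (fun t => im (q (t, b))) x); first exact: real_top.
exact: (is_derive_slice_x Sqi Op).
Qed.

Lemma re_q1_right y : re (dz q (a, y)) = 0.
Proof.
have Op := Omega_right beta y; have [_ _ _ E] := derivs_of_hol Hq Op.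
rewrite -E; apply: (@zero_deriv (fun t => im (q (a, t))) y); first exact: real_right.
exact: (is_derive_slice_y Sqi Op).
Qed.

Let wre p : Om p -> dx (dx w) p = dy (dy w) p + 4 * (re (q p) * w p).
Proof.
move=> Op; have := schw_halfexp_re oO SU Op; rewrite -/q -/w.
by move: (dx (dx w) p) (dy (dy w) p) (re (q p)) (w p) => x y z t h; rewrite mulrA -h; ring.
Qed.

Let wim p : Om p -> dy (dx w) p = - 2 * (im (q p) * w p).
Proof. by move=> Op; rewrite (schw_halfexp_im oO SU Op) -mulrA. Qed.

Let shift_x p : p + (1, 0) = (p.1 + 1, p.2) :> R * R.
Proof. by apply/pair_equal_spec; split; rewrite /= ?addr0. Qed.
Let shift_y p : p + (0, beta) = (p.1, p.2 + beta) :> R * R.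
Proof. by apply/pair_equal_spec; split; rewrite /= ?addr0. Qed.

Let perx (T : Type) (f : R * R -> T) x y : biperiodic beta f -> f (x + 1, y) = f (x, y).
Proof. by move=> [h _]; rewrite -[RHS]h shift_x. Qed.
Let pery (T : Type) (f : R * R -> T) x y : biperiodic beta f -> f (x, y + beta) = f (x, y).
Proof. by move=> [_ h]; rewrite -[RHS]h shift_y. Qed.

Let lap_w p : Om p -> w p * (dx (dx w) p + dy (dy w) p) = dx w p ^+ 2 + dy w p ^+ 2 + 2^-1.
Proof. by move=> Op; exact: (lap_halfexp oO SU Op (EU Op)). Qed.

Lemma top_const : 0 <= om -> forall x, dz q (x, b) = 0 /\ dz (dz q) (x, b) = 0.
Proof.
move=> om0.
have O := Omega_top beta0.
have Df (x : R) : is_derive x 1 (fun x => re (q (x, b))) (re (dz q (x, b))).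
  by have [<- _ _ _] := derivs_of_hol Hq (O x); exact: (is_derive_slice_x Sq (O x)).
have Df1 (x : R) : is_derive x 1 (fun x => re (dz q (x, b))) (re (dz (dz q) (x, b))).
  by have [<- _ _ _] := derivs_of_hol Hq1 (O x); exact: (is_derive_slice_x S1 (O x)).
have Df1' (x : R) : is_derive x 1 (fun x => re (dz q (x, b))) (2^-1 * 1 * cub1.[re (q (x, b))]).
  by have [E _] := ode_real (O x) (real_top x); rewrite mulr1 -E.
have sq x : re (dz q (x, b)) ^+ 2 = 1 * cub.[re (q (x, b))].
  have [_ <-] := ode_real (O x) (real_top x).
  by rewrite mul1r expr2 [in RHS]expr2 reM im_q1_top mulr0 subr0.
have Dw (x : R) : is_derive x 1 (fun x => w (x, b)) (dx w (x, b)) := is_derive_slice_x Sw (O x).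
have Dw1 (x : R) : is_derive x 1 (fun x => dx w (x, b)) (dx (dx w) (x, b)) := is_derive_slice_x (smooth_dx Sw) (O x).
have Dw2 (x : R) : is_derive x 1 (fun x => dx (dx w) (x, b))
    (4 * (1 * re (q (x, b))) * dx w (x, b) + 2 * (1 * re (dz q (x, b))) * w (x, b)).
  have D := is_derive_slice_x (smooth_dx (smooth_dx Sw)) (O x).
  have Swy := smooth_dy Sw.
  have Srw : smooth_on Om (fun p => 4 * (re (q p) * w p)) := smoothZ 4 oO (smoothM oO Sq Sw).
  have E1 : dx (dx (dx w)) (x, b) = dx (dy (dy w)) (x, b) + 4 * (re (dz q (x, b)) * w (x, b) + re (q (x, b)) * dx w (x, b)).
    apply: etrans (dx_near oO (O x) wre) _; apply: etrans (dxD (smooth_dy Swy) Srw (O x)) _.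
    congr (_ + _); apply: etrans (dxZ (smoothM oO Sq Sw) (O x) 4) _; congr (4 * _).
    apply: etrans (dxM Sq Sw (O x)) _.
    by have [-> _ _ _] := derivs_of_hol Hq (O x).
  have E2 : dx (dy (dy w)) (x, b) = - 2 * (re (dz q (x, b)) * w (x, b)).
    have C1 p : Om p -> dx (dy w) p = - 2 * (im (q p) * w p).
      by move=> Op; rewrite (dxdyC oO Sw Op) wim.
    apply: etrans (dxdyC oO Swy (O x)) _; apply: etrans (dy_near oO (O x) C1) _.
    apply: etrans (dyZ (smoothM oO Sqi Sw) (O x) (- 2)) _; congr (- 2 * _).
    apply: etrans (dyM Sqi Sw (O x)) _.
    have [_ _ _ ->] := derivs_of_hol Hq (O x).
    by rewrite [(im \o q) _]real_top mul0r addr0.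
  move: D; rewrite E1 E2; congr (is_derive _ _ _ _).
  by move: (re (dz q _)) (re (q _)) (w _) (dx w _) => X Y Z W; ring.
have wneg x : dx w (x, b) ^+ 2 - 2 * w (x, b) * dx (dx w) (x, b) + 4 * (1 * re (q (x, b))) * w (x, b) ^+ 2 < 0.
  have := lap_w (O x); have := wre (O x).
  move: (dx (dx w) _) (dy (dy w) _) (dx w _) (dy w _) (re (q _)) (w _) => A B X Y Q W h1 h2.
  have -> : X ^+ 2 - 2 * W * A + 4 * (1 * Q) * W ^+ 2 = X ^+ 2 - W * (A + B) - W * (A - (B + 4 * (Q * W))) by ring.
  rewrite h2 {1}h1 subrr mulr0 subr0; have := sqr_ge0 Y; move: (X ^+ 2) (Y ^+ 2) => X2 Y2; lra.
have key : forall x, re (dz q (x, b)) = 0.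
  have p1 x : re (q (x + 1, b)) = re (q (x, b)) by rewrite (perx _ _ pq).
  have p2 x : re (dz q (x + 1, b)) = re (dz q (x, b)) by rewrite (perx _ _ (periodic_dz pq)).
  have p3 x : w (x + 1, b) = w (x, b) by rewrite (perx _ _ pw).
  have p4 x : dx w (x + 1, b) = dx w (x, b) by rewrite (perx _ _ (periodic_dx pw)).
  have p5 x : dx (dx w) (x + 1, b) = dx (dx w) (x, b) by rewrite (perx _ _ (periodic_dx (periodic_dx pw))).
  have p6 x : 0 < w (x, b) := halfexp_gt0 U (x, b).
  have p7 : 0 <= 1 * om by rewrite mul1r.
  exact: (@potential_constant R N (re s) (re c) (re d) 1 1 (fun x => re (q (x, b))) (fun x => re (dz q (x, b)))
    (fun x => w (x, b)) (fun x => dx w (x, b)) (fun x => dx (dx w) (x, b)) F G ltr01 (mulr1 1) Df Df1' sq Dw Dw1 Dw2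
    p1 p2 p3 p4 p5 p6 wneg F0 LF LG p7).
move=> x; split; first by apply: complex_ext; [exact: key|exact: im_q1_top].
apply: complex_ext; first exact: (zero_deriv key (Df1 x)).
have [_ <- _ _] := derivs_of_hol Hq1 (O x).
by apply: (@zero_deriv (fun t => im (dz q (t, b))) x _ im_q1_top); exact: (is_derive_slice_x S1i (O x)).
Qed.

Lemma right_const : om <= 0 -> forall y, dz q (a, y) = 0 /\ dz (dz q) (a, y) = 0.
Proof.
move=> om0.
have O := Omega_right beta.
have Df (y : R) : is_derive y 1 (fun y => re (q (a, y))) (- im (dz q (a, y))).
  by have [_ _ <- _] := derivs_of_hol Hq (O y); exact: (is_derive_slice_y Sq (O y)).
have Di (y : R) : is_derive y 1 (fun y => im (dz q (a, y))) (re (dz (dz q) (a, y))).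
  by have [_ _ _ <-] := derivs_of_hol Hq1 (O y); exact: (is_derive_slice_y S1i (O y)).
have Df1 (y : R) : is_derive y 1 (fun y => - im (dz q (a, y))) (2^-1 * -1 * cub1.[re (q (a, y))]).
  have [E _] := ode_real (O y) (real_right y).
  by have := is_deriveN (Di y); congr (is_derive _ _ _ _); rewrite E; ring.
have sq y : (- im (dz q (a, y))) ^+ 2 = -1 * cub.[re (q (a, y))].
  have [_ <-] := ode_real (O y) (real_right y).
  by rewrite [in RHS]expr2 reM re_q1_right mulr0; ring.
have Dw (y : R) : is_derive y 1 (fun y => w (a, y)) (dy w (a, y)) := is_derive_slice_y Sw (O y).
have Dw1 (y : R) : is_derive y 1 (fun y => dy w (a, y)) (dy (dy w) (a, y)) := is_derive_slice_y (smooth_dy Sw) (O y).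
have Dw2 (y : R) : is_derive y 1 (fun y => dy (dy w) (a, y))
    (4 * (-1 * re (q (a, y))) * dy w (a, y) + 2 * (-1 * - im (dz q (a, y))) * w (a, y)).
  have D := is_derive_slice_y (smooth_dy (smooth_dy Sw)) (O y).
  have Swx := smooth_dx Sw.
  have Srw : smooth_on Om (fun p => 4 * (re (q p) * w p)) := smoothZ 4 oO (smoothM oO Sq Sw).
  have wre' p : Om p -> dy (dy w) p = dx (dx w) p - 4 * (re (q p) * w p).
    by move=> Op; rewrite wre // addrK.
  have E1 : dy (dy (dy w)) (a, y) = dy (dx (dx w)) (a, y) - 4 * (- im (dz q (a, y)) * w (a, y) + re (q (a, y)) * dy w (a, y)).
    apply: etrans (dy_near oO (O y) wre') _; apply: etrans (dyB (smooth_dx Swx) Srw (O y)) _.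
    congr (_ - _); apply: etrans (dyZ (smoothM oO Sq Sw) (O y) 4) _; congr (4 * _).
    apply: etrans (dyM Sq Sw (O y)) _.
    by have [_ _ -> _] := derivs_of_hol Hq (O y).
  have E2 : dy (dx (dx w)) (a, y) = - 2 * (im (dz q (a, y)) * w (a, y)).
    apply: etrans (esym (dxdyC oO Swx (O y))) _; apply: etrans (dx_near oO (O y) wim) _.
    apply: etrans (dxZ (smoothM oO Sqi Sw) (O y) (- 2)) _; congr (- 2 * _).
    apply: etrans (dxM Sqi Sw (O y)) _.
    have [_ -> _ _] := derivs_of_hol Hq (O y).
    by rewrite [(im \o q) _]real_right mul0r addr0.
  move: D; rewrite E1 E2; congr (is_derive _ _ _ _).
  by move: (im (dz q _)) (re (q _)) (w _) (dy w _) => X Y Z W; ring.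
have wneg y : dy w (a, y) ^+ 2 - 2 * w (a, y) * dy (dy w) (a, y) + 4 * (-1 * re (q (a, y))) * w (a, y) ^+ 2 < 0.
  have := lap_w (O y); have := wre (O y).
  move: (dx (dx w) _) (dy (dy w) _) (dx w _) (dy w _) (re (q _)) (w _) => A B X Y Q W h1 h2.
  have -> : Y ^+ 2 - 2 * W * B + 4 * (-1 * Q) * W ^+ 2 = Y ^+ 2 - W * (A + B) + W * (A - (B + 4 * (Q * W))) by ring.
  rewrite h2 {1}h1 subrr mulr0 addr0; have := sqr_ge0 X; move: (X ^+ 2) (Y ^+ 2) => X2 Y2; lra.
have key : forall y, - im (dz q (a, y)) = 0.
  have m1 : (-1) * (-1) = 1 :> R by rewrite mulrNN mulr1.
  have p1 y : re (q (a, y + beta)) = re (q (a, y)) by rewrite (pery _ _ pq).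
  have p2 y : - im (dz q (a, y + beta)) = - im (dz q (a, y)) by rewrite (pery _ _ (periodic_dz pq)).
  have p3 y : w (a, y + beta) = w (a, y) by rewrite (pery _ _ pw).
  have p4 y : dy w (a, y + beta) = dy w (a, y) by rewrite (pery _ _ (periodic_dy pw)).
  have p5 y : dy (dy w) (a, y + beta) = dy (dy w) (a, y) by rewrite (pery _ _ (periodic_dy (periodic_dy pw))).
  have p6 y : 0 < w (a, y) := halfexp_gt0 U (a, y).
  have p7 : 0 <= -1 * om by rewrite mulN1r oppr_ge0.
  exact: (@potential_constant R N (re s) (re c) (re d) beta (-1) (fun y => re (q (a, y))) (fun y => - im (dz q (a, y)))
    (fun y => w (a, y)) (fun y => dy w (a, y)) (fun y => dy (dy w) (a, y)) F G beta0 m1 Df Df1 sq Dw Dw1 Dw2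
    p1 p2 p3 p4 p5 p6 wneg F0 LF LG p7).
have key' y : im (dz q (a, y)) = 0 by rewrite -[im _]opprK key oppr0.
move=> y; split; first by apply: complex_ext; [exact: re_q1_right|exact: key'].
apply: complex_ext; first exact: (zero_deriv key' (Di y)).
have [_ _ E _] := derivs_of_hol Hq1 (O y).
have D := is_derive_slice_y S1 (O y).
have D0 := @zero_deriv (fun t => re (dz q (a, t))) y _ re_q1_right D.
by rewrite -[im _]opprK -E [dy _ _]D0 oppr0.
Qed.

End lines.

Section corner.
Variables (s c : C).
Hypotheses (ode : forall p, Om p -> dz (dz q) p = 6 / N%:C * q p ^+ 2 + s * q p + c)
  (q1c : dz q (a, b) = 0) (q2c : dz (dz q) (a, b) = 0).

Lemma const_from_corner y0 : 0 < y0 -> y0 < beta -> q (0, y0) = q (a, b).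
Proof.
move=> y00 y0b; pose Q0 := q (a, b); pose dl p := q p - Q0.
pose A p := 6 / N%:C * (q p + Q0) + s.
have HA : hol Om A := holD oO (holZ oO _ (holD oO Hq (hol_cst oO Q0))) (hol_cst oO s).
have E2 p : Om p -> dz (dz q) p = A p * dl p.
  move=> Op; have := ode (Omega_right beta b); rewrite q2c ode // /A /dl -/Q0 => E.
  rewrite -[LHS]subr0 {1}E; move: (6 / N%:C) (q p) => k z; ring.
have Hdl : hol Om dl := holB oO Hq (hol_cst oO Q0).
have Hq2 : hol Om (dz (dz q)) := hol_dz oO Hq1.
have bound t0 t1 k0 k1 : rect t0 t1 k0 k1 `<=` Om ->
    exists2 B, 0 <= B & forall p, rect t0 t1 k0 k1 p -> `|re (A p)| <= B /\ `|im (A p)| <= B.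
  move=> sub; have [[S1 S2] _] := HA.
  have [B1 H1] := rect_bounded (fun p (h : rect t0 t1 k0 k1 p) => smooth_continuous S1 (sub p h)).
  have [B2 H2] := rect_bounded (fun p (h : rect t0 t1 k0 k1 p) => smooth_continuous S2 (sub p h)).
  exists (`|B1| + `|B2|); first by rewrite addr_ge0.
  move=> p hp; split.
    by apply: (le_trans (H1 p hp)); apply: (le_trans (ler_norm _)); rewrite lerDl.
  by apply: (le_trans (H2 p hp)); apply: (le_trans (ler_norm _)); rewrite lerDr.
have ddl p : Om p -> dz dl p = dz q p.
  move=> Op; have := dzB oO Op (proj1 Hq) (csm_cst Q0 oO); rewrite dz_cst subr0; exact.
have slx (F : R * R -> C) x y : hol Om F -> Om (x, y) ->
    is_derive x 1 (fun t => re (F (t, y))) (re (dz F (x, y))) /\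
    is_derive x 1 (fun t => im (F (t, y))) (im (dz F (x, y))).
  move=> HF Op; have [[S1 S2] _] := HF; have [<- <- _ _] := derivs_of_hol HF Op.
  by split; [exact: (is_derive_slice_x S1 Op)|exact: (is_derive_slice_x S2 Op)].
have sly (F : R * R -> C) x y : hol Om F -> Om (x, y) ->
    is_derive y 1 (fun t => re (F (x, t))) (- im (dz F (x, y))) /\
    is_derive y 1 (fun t => im (F (x, t))) (re (dz F (x, y))).
  move=> HF Op; have [[S1 S2] _] := HF; have [_ _ <- <-] := derivs_of_hol HF Op.
  by split; [exact: (is_derive_slice_y S1 Op)|exact: (is_derive_slice_y S2 Op)].
pose y1 := y0 + beta.
have by1 : b < y1 by rewrite /y1 (lt_le_trans (y := beta)) // ?lerDr ?ltW // ltr_pdivrMr // ltr_pMr // ltr1n.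
(* upwards along the line through the corner *)
have Ov := Omega_right beta.
have [B B0 HB] : exists2 B, 0 <= B & forall t, b <= t <= y1 -> `|- re (A (a, t))| <= B /\ `|- im (A (a, t))| <= B.
  have sub : rect a a b y1 `<=` Om.
    move=> [x y] [/=]; rewrite !in_itv /= => /le_anti <- _; exact: Ov.
  have [B B0 HB] := bound _ _ _ _ sub; exists B => // t ht.
  by rewrite !normrN; apply: HB; split; rewrite /= in_itv /= ?lexx.
have re0 (z : C) : z = 0 -> re z = 0 /\ im z = 0 by move=> ->.
have [i1 i2] := re0 _ q1c.
have d0 : dl (a, b) = 0 by rewrite /dl subrr.
have [j1 j2] := re0 _ d0.
have [|||||e1 e2 e3 e4] := @ode_unique R (fun t => re (dl (a, t))) (fun t => im (dl (a, t)))
   (fun t => - im (dz q (a, t))) (fun t => re (dz q (a, t)))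
   (fun t => - re (A (a, t))) (fun t => - im (A (a, t))) B b y1 by1 B0 _ _ _ _ HB j1 j2 _ i1.
- by move=> t _; have [h _] := sly _ _ _ Hdl (Ov t); rewrite ddl in h.
- by move=> t _; have [_ h] := sly _ _ _ Hdl (Ov t); rewrite ddl in h.
- move=> t _; have [_ h] := sly _ _ _ Hq1 (Ov t).
  have := is_deriveN h; congr (is_derive _ _ _ _).
  by rewrite E2 ?reM //; ring.
- move=> t _; have [h _] := sly _ _ _ Hq1 (Ov t).
  move: h; congr (is_derive _ _ _ _).
  by rewrite E2 ?imM //; ring.
- by rewrite i2 oppr0.
(* then to the right *)
have Oh t : Om (t, y1).
  rewrite /Omega /= negb_and; apply/orP; right; rewrite /y1 mulrDl divff ?gt_eqF //.
  apply/negP => h; have : y0 / beta \is a Num.int.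
    have o1 : (1 : R) \is a Num.int by rewrite rpred1.
    by have := rpredB h o1; rewrite addrK.
  move=> /small_int E; have yb : 0 < y0 / beta by rewrite divr_gt0.
  have lt1 : `|y0 / beta| < 1 by rewrite gtr0_norm // ltr_pdivrMr // mul1r.
  by move: yb; rewrite (E lt1) ltxx.
have [B' B'0 HB'] : exists2 B, 0 <= B & forall t, a <= t <= 1 -> `|re (A (t, y1))| <= B /\ `|im (A (t, y1))| <= B.
  have sub : rect a 1 y1 y1 `<=` Om.
    move=> [x y] [/=]; rewrite !in_itv /= => _ /le_anti <-; exact: Oh.
  have [B' B'0 HB'] := bound _ _ _ _ sub; exists B' => // t ht.
  by apply: HB'; split; rewrite /= in_itv /= ?lexx.
have a1 : a < 1 by rewrite invf_lt1 // ltr1n.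
have e3' : im (dz q (a, y1)) = 0 by rewrite -[im _]opprK e3 oppr0.
have [||||g1 g2 _ _] := @ode_unique R (fun t => re (dl (t, y1))) (fun t => im (dl (t, y1)))
   (fun t => re (dz q (t, y1))) (fun t => im (dz q (t, y1)))
   (fun t => re (A (t, y1))) (fun t => im (A (t, y1))) B' a 1 a1 B'0 _ _ _ _ HB' e1 e2 e4 e3'.
- by move=> t _; have [h _] := slx _ _ _ Hdl (Oh t); rewrite ddl in h.
- by move=> t _; have [_ h] := slx _ _ _ Hdl (Oh t); rewrite ddl in h.
- by move=> t _; have [h _] := slx _ _ _ Hq1 (Oh t); rewrite E2 ?reM in h.
- by move=> t _; have [_ h] := slx _ _ _ Hq1 (Oh t); rewrite E2 ?imM in h.
have g : dl (1, y1) = 0 by apply: complex_ext.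
have <- : q (1, y1) = q (0, y0).
  rewrite -[RHS](periodic_int pq 1 1); congr q.
  by apply/pair_equal_spec; split; rewrite /= ?add0r ?mul1r.
by apply/eqP; rewrite -subr_eq0 -/Q0 -/(dl _) g.
Qed.
End corner.

Theorem no_solution : False.
Proof.
have [dl dl0 [M HM]] := potential_pole.
have [s [c ode]] := elliptic_ode beta0 r0 ra rb Hq pq NC0 dl0 HM.
have [d ode1] := elliptic_ode1 beta0 Hq NC0 ode.
have eign : lame_eig N n = 0 by rewrite /lame_eig /N divff // subrr mulr0.
have eigk k : (k < n)%N -> lame_eig N k != 0.
  move=> kn; have N1 : 0 < N by rewrite ltr0n muln_gt0 n1.
  apply: mulf_neq0.
    apply: mulf_neq0; first by rewrite pnatr_eq0.
    by rewrite -natrM natr1 pnatr_eq0.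
  rewrite subr_eq0 lt_eqF // ltr_pdivrMr // mul1r ltr_nat.
  by apply: ltn_mul => //; rewrite ltnS.
have [F [G [F0 LF LG]]] := lame_kernel (re s) (re c) (re d) N0 eign eigk.
have [q1c q2c] : dz q (a, b) = 0 /\ dz (dz q) (a, b) = 0.
  have [h|/ltW h] := leP 0 (pairing N (re s) (re c) (re d) F)`_0.
    exact: (top_const ode ode1 F0 LF LG h a).
  exact: (right_const ode ode1 F0 LF LG h b).
have K := const_from_corner ode q1c q2c.
pose M' := `|M| + nc (q (a, b)) + 1.
have M'0 : 0 < M' by rewrite ltr_wpDl // addr_ge0 ?nc_ge0.
have N1 : 0 < N by rewrite ltr0n muln_gt0 n1.
pose y := Num.min (Num.min dl 1) (Num.min (beta / 2) (N / M')).
have y0 : 0 < y by rewrite !lt_min dl0 ltr01 !divr_gt0.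
have [ydl yy1 yb yN] : [/\ y <= dl, y <= 1, y <= beta / 2 & y <= N / M'].
  by split; rewrite /y !ge_min lexx ?orbT.
have yb' : y < beta by apply: (le_lt_trans yb); rewrite ltr_pdivrMr // ltr_pMr // ltr1n.
have sy : snorm (0, y) = y by rewrite /snorm /= normr0 gtr0_norm // max_r // ltW.
have := HM (0, y); rewrite sy y0 ydl => /(_ isT); rewrite (K y y0 yb') => H.
have nN : nc (N%:C / zc (0, y) ^+ 2) = N / y ^+ 2.
  have -> : zc (0, y) = 'i * y%:C by apply: complex_ext => /=; ring.
  by rewrite expr2 !(ncM, ncV, nci, ncR) !gtr0_norm // !mul1r expr2.
have H2 : N / y ^+ 2 <= M + nc (q (a, b)).
  rewrite -nN; have -> : N%:C / zc (0, y) ^+ 2 = q (a, b) - (q (a, b) - N%:C / zc (0, y) ^+ 2).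
    by rewrite opprB addrC subrK.
  by apply: (le_trans (ncB _ _)); rewrite addrC lerD2r.
have H3 : M' <= N / y ^+ 2.
  rewrite ler_pdivlMr ?exprn_gt0 //; apply: (le_trans (y := M' * y)).
    by rewrite ler_pM2l // expr2 -[leRHS]mulr1 ler_pM2l.
  by move: yN; rewrite ler_pdivlMr // mulrC.
have := le_trans H3 H2; rewrite /M' => H4.
have := ler_norm M; move: H4; move: (nc _) (`|M|) => x z; lra.
Qed.

End NoSolution.

(*@@@ 22*)
Local Open Scope complex_scope.

Lemma solution_bound (R : realType) (tau : R[i]) (n : nat) (u : R[i] -> R) : solution tau n u ->
  exists2 r : R, 0 < r & exists V, forall p, pb r p -> `|in_plane u p - 2 * n%:R * lg p| <= V.
Proof.
move=> [_ _ HO _].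
have /eqO_exP [k k0 H] := HO.
move: H; rewrite /= => /nbhs_ballP[e /= e0 He].
exists e => //; exists k => p hp; have /andP[p0 pe] := hp.
have pne : p != 0 by move: p0; rewrite snorm_gt0.
have := He p _ pne; rewrite normr1 mulr1.
have -> : in_plane u p - 4 * n%:R * ln (Normc.normc (to_complex p)) = in_plane u p - 2 * n%:R * lg p.
  have s0 := sqm_gt0 hp; congr (_ - _); rewrite /lg -[sqm p]sqr_sqrtr ?ltW // lnXn ?sqrtr_gt0 //.
  by rewrite -mulr_natl /Normc.normc /to_complex /= -/(sqm p); move: (ln _) => l; ring.
apply; rewrite -ball_normE /= sub0r normrN.
by rewrite -snormE.
Qed.

Theorem theorem1p1 (R : realType) (tau : R[i])
    (tau_Re : complex.Re tau = 0) (tau_Im : 0 < complex.Im tau)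
    (n : nat) (n_ge1 : (1 <= n)%N) :
  ~ exists u : R[i] -> R, solution tau n u.
Proof.
move=> [u Hu]; have [ut Su _ Eu] := Hu.
have [r0 r00 [V HV]] := solution_bound Hu.
have SU : smooth_on (Omega (complex.Im tau)) (in_plane u) by rewrite -(lattice_Omega tau_Re tau_Im).
have EU := pointwise_equation tau_Re tau_Im ut SU Eu.
have pU := torus_biperiodic tau_Re ut.
pose r := Num.min r0 (Num.min 2^-1 (complex.Im tau / 2)).
have rr : 0 < r by rewrite !lt_min r00 invr_gt0 divr_gt0 ?ltr0n.
have [h1 h2 h3] : [/\ r <= r0, r <= 2^-1 & r <= complex.Im tau / 2].
  by split; rewrite /r !ge_min lexx ?orbT.
apply: (@no_solution R (complex.Im tau) n (in_plane u) V r tau_Im n_ge1 rr h2 h3 SU pU EU).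
by move=> p /(pb_sub h1); exact: HV.
Qed.
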